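(* Let $\gamma\in\mathbb{R}$, $\gamma\neq 0$, and let $\mathbb{T}=\mathbb{R}/2\pi\mathbb{Z}$. Let $\{u_{0,n}\}_{n}$ be a sequence in $L^2(\mathbb{T})$ (complex-valued functions) converging weakly, but not strongly, to $u_0$ in $L^2(\mathbb{T})$. For each $n$ let $u_n\in C(\mathbb{R};L^2(\mathbb{T}))$ be the solution of the cubic Schrödinger equation $$ i u_t+u_{xx}+\gamma |u|^2u=0 \quad\text{on } \mathbb{R}\times\mathbb{T} $$ with initial datum $u_n(0)=u_{0,n}$, and let $u\in C(\mathbb{R};L^2(\mathbb{T}))$ be the solution of the same equation with $u(0)=u_0$. Then at least one adherence value (i.e. limit of a subsequence) of the real sequence $\int_{\mathbb{T}}|u_{0,n}|^2\,dx$ is different from $\int_{\mathbb{T}}|u_0|^2\,dx$. Moreover, for any adherence value $\alpha^2\in[0,\infty)$ of $\int_{\mathbb{T}}|u_{0,n}|^2\,dx$ and any increasing sequence of integers $\{n_k\}$ such that $\int_{\mathbb{T}}|u_{0,n_k}|^2\,dx\to\alpha^2$ as $k\to\infty$, for every $t\in\mathbb{R}$ the sequence $u_{n_k}(t)$ converges weakly in $L^2(\mathbb{T})$, as $k\to\infty$, to $$ v_\alpha(t)=\exp\Bigl(\frac{i\gamma}{\pi}\Bigl(\alpha^2-\int_{\mathbb{T}}|u_0|^2\,dx\Bigr)t\Bigr)\,u(t). $$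
   Context: Integrals over $\mathbb{T}=\mathbb{R}/2\pi\mathbb{Z}$ are with respect to Lebesgue measure of total mass $2\pi$. Solutions are understood as follows (known theorem of Bourgain): for every $\varphi\in L^2(\mathbb{T})$ and every $T>0$ there is a unique solution $u\in L^4(]-T,T[\times\mathbb{T})$ of $iu_t+u_{xx}+\gamma|u|^2u=0$ with $u(0)=\varphi$, in the sense of the integral (Duhamel) formulation; it belongs to $C([-T,T];L^2(\mathbb{T}))$. Since $T$ is arbitrary this defines a unique global solution $u\in C(\mathbb{R};L^2(\mathbb{T}))$, called the solution emanating from (associated with) $\varphi$. *)

(* Defs.v *)
From HB Require Import structures.
From mathcomp Require Import all_boot all_order all_algebra.
From mathcomp Require Import all_classical all_reals all_analysis.
From mathcomp Require Import complex.

Set Implicit Arguments.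
Unset Strict Implicit.
Unset Printing Implicit Defensive.

Import Order.TTheory GRing.Theory Num.Theory numFieldNormedType.Exports.
Local Open Scope classical_set_scope.
Local Open Scope ring_scope.
Local Open Scope complex_scope.

(* R[i] carries an R[i]-valued norm; cmod is the modulus as a real number. *)
Definition cmod (R : realType) (z : R[i]) : R := ComplexField.Normc.normc z.

Definition cis (R : realType) (theta : R) : R[i] := cos theta +i* sin theta.

Definition cmeasurable d (T : measurableType d) (R : realType)
    (f : T -> R[i]) : Prop :=
  measurable_fun setT (fun x => complex.Re (f x)) /\
  measurable_fun setT (fun x => complex.Im (f x)).

Definition Cintegral d (T : measurableType d) (R : realType)
    (mu : {measure set T -> \bar R}) (D : set T) (f : T -> R[i]) : R[i] :=
  (\int[mu]_(x in D) complex.Re (f x)) +i* (\int[mu]_(x in D) complex.Im (f x)).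

(* Functions on the torus R/2piZ are 2pi-periodic functions on R, integrated
   over the fundamental domain [0, 2pi] (total mass 2pi). *)
Definition torus (R : realType) : set R := `[0, 2 * pi]%classic.
Arguments torus : clear implicits.

Definition periodic2pi (R : realType) (f : R -> R[i]) : Prop :=
  forall x, f (x + 2 * pi) = f x.

(* Elements of L^2(T) are given by representatives; every notion below only
   depends on their almost-everywhere classes. *)
Definition L2torus (R : realType) (f : R -> R[i]) : Prop :=
  [/\ periodic2pi f, cmeasurable f &
      (\int[lebesgue_measure]_(x in torus R) ((cmod (f x) ^+ 2)%:E) < +oo)%E].

Definition mass (R : realType) (f : R -> R[i]) : R :=
  \int[lebesgue_measure]_(x in torus R) (cmod (f x) ^+ 2).

Definition L2inner (R : realType) (f g : R -> R[i]) : R[i] :=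
  Cintegral lebesgue_measure (torus R) (fun x : R => f x * (g x)^*%C).

Definition weak_cvg_L2 (R : realType) (f_ : nat -> R -> R[i])
    (f : R -> R[i]) : Prop :=
  [/\ forall n, L2torus (f_ n), L2torus f &
      forall g, L2torus g ->
        (fun n => L2inner (f_ n) g : R[i]^o) @ \oo --> (L2inner f g : R[i]^o)].

Definition strong_cvg_L2 (R : realType) (f_ : nat -> R -> R[i])
    (f : R -> R[i]) : Prop :=
  [/\ forall n, L2torus (f_ n), L2torus f &
      (fun n => mass (fun x => f_ n x - f x)) @ \oo --> (0 : R)].

Definition adherence_value (R : realType) (a : nat -> R) (l : R) : Prop :=
  exists nk : nat -> nat, increasing_seq nk /\ (fun k => a (nk k)) @ \oo --> l.

Definition fourier_coef (R : realType) (f : R -> R[i]) (k : int) : R[i] :=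
  ((2 * pi)^-1)%:C *
  Cintegral lebesgue_measure (torus R) (fun x : R => f x * cis (- (k%:~R * x))).

(* The free group S(t) = exp(i t d^2/dx^2), acting on distributions on the
   torus identified with their sequences of Fourier coefficients. *)
Definition free_group (R : realType) (t : R) (c : int -> R[i]) (k : int) : R[i] :=
  cis (- (k%:~R ^+ 2 * t)) * c k.

(* Integral over [0, t], counted negatively when t < 0. *)
Definition oriented_integral (R : realType) (t : R) (g : R -> R[i]) : R[i] :=
  if 0 <= t then Cintegral lebesgue_measure `[0, t]%classic g
  else - Cintegral lebesgue_measure `[t, 0]%classic g.

Definition cubic (R : realType) (f : R -> R[i]) (x : R) : R[i] :=
  (cmod (f x) ^+ 2)%:C * f x.

(* u(t) = S(t) phi + i gamma int_0^t S(t - s) (|u|^2 u)(s) ds, an identity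
   between distributions on the torus, i.e. between Fourier coefficients. *)
Definition duhamel (R : realType) (gamma : R) (phi : R -> R[i])
    (u : R -> R -> R[i]) : Prop :=
  forall (t : R) (k : int),
    fourier_coef (u t) k =
      free_group t (fourier_coef phi) k
      + 'i%C * gamma%:C *
        oriented_integral t
          (fun s => free_group (t - s) (fourier_coef (cubic (u s))) k).

Definition slab (R : realType) (T : R) : set (R * R) :=
  `]- T, T[%classic `*` torus R.

Definition L4_spacetime (R : realType) (T : R) (u : R -> R -> R[i]) : Prop :=
  (\int[lebesgue_measure \x lebesgue_measure]_(p in slab T)
     ((cmod (u p.1 p.2) ^+ 4)%:E) < +oo)%E.

Definition continuous_L2 (R : realType) (u : R -> R -> R[i]) : Prop :=
  (forall t, L2torus (u t)) /\
  forall t0 : R, mass (fun x => u t x - u t0 x) @[t --> t0] --> (0 : R).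

(* The global solution emanating from phi, through a representative that is
   jointly measurable in (t, x) (one exists for every class in C(R; L^2)). *)
Definition nls_solution (R : realType) (gamma : R) (phi : R -> R[i])
    (u : R -> R -> R[i]) : Prop :=
  [/\ cmeasurable (fun p : R * R => u p.1 p.2),
      continuous_L2 u,
      forall T : R, 0 < T -> L4_spacetime T u,
      mass (fun x => u 0 x - phi x) = 0 &
      duhamel gamma phi u].

Definition v_limit (R : realType) (gamma alpha : R) (u0 : R -> R[i])
    (u : R -> R -> R[i]) (t x : R) : R[i] :=
  cis (gamma / pi * (alpha ^+ 2 - mass u0) * t) * u t x.

(* Main.v *)
(** Pass to the interaction picture, a_k(s) = e^(i k^2 s) FT_k(u(s)), and remove from the nonlinearity the resonant
    interactions, which only rotate all the modes of a solution of mass m at the common speed gamma m / pi.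
    What remains is a sum over nondegenerate parallelograms of frequencies p, p+l, p+m, p+l+m, with phase 2 l m s
    and l, m <> 0.  Integrating these oscillations by parts in time gains 1/(|l| |m|), and
      sum A_p B_(p+l) C_(p+m) / (|l| |m|)  over  max(|l|, |m|) >= N   is  O(N^(-1/4)) |A|_2 |B|_2 |C|_2,
    so interactions with a far frequency gap are negligible uniformly on bounded sets of L^2.  This single estimate
    gives the conservation of mass, a bound of the L^4 space-time norm by the mass, and the fact that, after the
    rotation, the flow is continuous for the convergence of each Fourier coefficient: the difference of two solutions,
    measured with a slowly varying weight on frequencies, satisfies a Gronwall inequality, in which the remaining
    near interactions commute with the weight up to a small error.  For data converging weakly with masses converging
    to alpha^2, the rotation speeds differ in the limit by gamma (alpha^2 - |u_0|^2) / pi, which is the phase in the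
    statement.  Weakly convergent sequences are bounded (gliding hump), hence their masses have adherence values, and
    these cannot all be the mass of the limit unless the convergence is strong. *)

Require Import Defs.
From mathcomp Require Import all_boot all_order all_algebra.
From mathcomp Require Import all_classical all_reals all_analysis.
From mathcomp Require Import complex measurable_realfun.
From mathcomp Require Import ring lra zify.

Set Implicit Arguments.
Unset Strict Implicit.
Unset Printing Implicit Defensive.

Import Order.TTheory GRing.Theory Num.Theory numFieldNormedType.Exports.
Local Open Scope classical_set_scope.
Local Open Scope ring_scope.
Local Open Scope complex_scope.

(** The coefficients of the cubic term are bounded uniformly in the frequency, through the L^4 norm,
    but are not known to be square summable. This is why the sum in the estimate leaves one vertex
    of the parallelogram free: after integration by parts the time derivative sits there, taken in
    l^inf, and the others are taken in l^2. It also shapes the Gronwall argument. Discarding the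
    gaps beyond N leaves an error without the difference as a factor, so N must be large; but
    bounding the rest by counting puts a coefficient of order N^2 in the Gronwall inequality, whose
    exponential would destroy the gain. Hence a fixed L is inserted: gaps up to L are counted; gaps
    from L to N are integrated by parts once more, with the difference as one of the four factors,
    and its derivative is replaced by its equation, whose far terms are cut at a third scale N'. The
    exponent then depends on L only, and L, N, N' and the width Q of the weight are chosen in this
    order. The exponent also contains the time integral of h^2, where h is controlled by L^4 norms:
    this is the use of the space-time bound. *)

Notation Re := complex.Re.
Notation Im := complex.Im.

(** * Complex-valued integrals *)

Section Modulus.
Context {R : realType}.
Implicit Types (z w : R[i]) (r t : R).

Lemma cmod_ge0 z : 0 <= cmod z.
Proof. by case: z => a b; exact: sqrtr_ge0. Qed.

Lemma cmodM z w : cmod (z * w) = cmod z * cmod w.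
Proof. exact: ComplexField.Normc.normcM. Qed.

Lemma cmodD z w : cmod (z + w) <= cmod z + cmod w.
Proof. exact: le_normcD. Qed.

Lemma cmodN z : cmod (- z) = cmod z.
Proof. exact: normcN. Qed.

Lemma cmodB z w : cmod (z - w) <= cmod z + cmod w.
Proof. by rewrite -(cmodN w); exact: cmodD. Qed.

Lemma cmod0 : cmod (0 : R[i]) = 0.
Proof. exact: ComplexField.Normc.normc0. Qed.

Lemma cmod0_eq0 z : cmod z = 0 -> z = 0.
Proof. exact: ComplexField.Normc.eq0_normc. Qed.

Lemma cmod_conj z : cmod (conjc z) = cmod z.
Proof. by case: z => a b; rewrite /cmod/= sqrrN. Qed.

Lemma cmod_sqr z : cmod z ^+ 2 = Re z ^+ 2 + Im z ^+ 2.
Proof. by case: z => a b; rewrite /cmod/= sqr_sqrtr// addr_ge0// sqr_ge0. Qed.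

Lemma cmod_real r : cmod r%:C = `|r|.
Proof. by rewrite /cmod/= expr0n addr0 sqrtr_sqr. Qed.

Lemma cmod_i : cmod ('i%C : R[i]) = 1.
Proof. by rewrite /cmod/= expr0n add0r expr1n sqrtr1. Qed.

Lemma Re_le_cmod z : `|Re z| <= cmod z.
Proof.
rewrite -(@ler_pXn2r _ 2)// ?nnegrE ?cmod_ge0// cmod_sqr real_normK ?num_real//.
by rewrite lerDl sqr_ge0.
Qed.

Lemma Im_le_cmod z : `|Im z| <= cmod z.
Proof.
rewrite -(@ler_pXn2r _ 2)// ?nnegrE ?cmod_ge0// cmod_sqr real_normK ?num_real//.
by rewrite lerDr sqr_ge0.
Qed.

Lemma cmod_le_ReIm z : cmod z <= `|Re z| + `|Im z|.
Proof.
rewrite {1}(complexE z).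
by apply: (le_trans (cmodD _ _)); rewrite cmodM cmod_i mul1r !cmod_real.
Qed.

Lemma mul_conj z : z * conjc z = (cmod z ^+ 2)%:C.
Proof.
rewrite cmod_sqr; case: z => a b; apply/eqP; rewrite eq_complex/=; apply/andP; split.
  by apply/eqP; ring.
by apply/eqP; ring.
Qed.

Lemma cmod_cis t : cmod (cis t : R[i]) = 1.
Proof. by rewrite /cmod/= cos2Dsin2 sqrtr1. Qed.

Lemma cisD t r : cis (t + r) = cis t * cis r :> R[i].
Proof.
rewrite /cis cosD sinD; apply/eqP; rewrite eq_complex/=; apply/andP; split => //.
by rewrite addrC [X in _ + X]mulrC; apply/eqP; ring.
Qed.

Lemma cis0 : cis 0 = 1 :> R[i].
Proof. by rewrite /cis cos0 sin0. Qed.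

Lemma cisN t : cis (- t) = conjc (cis t) :> R[i].
Proof. by rewrite /cis cosN sinN. Qed.

Lemma cis_conjK t : cis t * conjc (cis t) = 1 :> R[i].
Proof. by rewrite -cisN -cisD subrr cis0. Qed.

Lemma cmod_sum (I : Type) (s : seq I) (P : pred I) (F : I -> R[i]) :
  cmod (\sum_(i <- s | P i) F i) <= \sum_(i <- s | P i) cmod (F i).
Proof.
elim/big_ind2 : _ => //; first by rewrite cmod0.
by move=> a b c d ab cd; apply: (le_trans (cmodD _ _)); exact: lerD.
Qed.

Lemma cReD z w : Re (z + w) = Re z + Re w. Proof. by case: z; case: w. Qed.
Lemma cImD z w : Im (z + w) = Im z + Im w. Proof. by case: z; case: w. Qed.
Lemma cReN z : Re (- z) = - Re z. Proof. by case: z. Qed.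
Lemma cImN z : Im (- z) = - Im z. Proof. by case: z. Qed.
Lemma cReM z w : Re (z * w) = Re z * Re w - Im z * Im w.
Proof. by case: z; case: w. Qed.
Lemma cImM z w : Im (z * w) = Re z * Im w + Im z * Re w.
Proof. by case: z => a b; case: w. Qed.
Lemma cReJ z : Re (conjc z) = Re z. Proof. by case: z. Qed.
Lemma cImJ z : Im (conjc z) = - Im z. Proof. by case: z. Qed.
Lemma eq_ReIm z w : Re z = Re w -> Im z = Im w -> z = w.
Proof. by case: z => a b; case: w => c d /= -> ->. Qed.

Lemma cJD z w : conjc (z + w) = conjc z + conjc w. Proof. exact: rmorphD. Qed.
Lemma cJB z w : conjc (z - w) = conjc z - conjc w. Proof. exact: rmorphB. Qed.
Lemma cJM z w : conjc (z * w) = conjc z * conjc w. Proof. exact: rmorphM. Qed.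
Lemma cJ_sum (I : Type) (s : seq I) (P : pred I) (F : I -> R[i]) :
  conjc (\sum_(i <- s | P i) F i) = \sum_(i <- s | P i) conjc (F i).
Proof. exact: rmorph_sum. Qed.
Lemma RtoCD r t : (r + t)%:C = r%:C + t%:C. Proof. exact: rmorphD. Qed.
Lemma RtoCB r t : (r - t)%:C = r%:C - t%:C. Proof. exact: rmorphB. Qed.
Lemma RtoCM r t : (r * t)%:C = r%:C * t%:C. Proof. exact: rmorphM. Qed.
Lemma RtoC_sum (I : Type) (s : seq I) (P : pred I) (F : I -> R) :
  (\sum_(i <- s | P i) F i)%:C = \sum_(i <- s | P i) (F i)%:C.
Proof. exact: rmorph_sum. Qed.

End Modulus.

Section ComplexIntegral.
Context d (T : measurableType d) {R : realType}.
Variables (mu : {measure set T -> \bar R}) (D : set T) (mD : measurable D).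
Implicit Types (f g : T -> R[i]) (h : T -> R).

Definition cmeas_on (D : set T) f :=
  measurable_fun D (fun x => Re (f x)) /\ measurable_fun D (fun x => Im (f x)).

Definition cintegrable (D : set T) f :=
  mu.-integrable D (EFin \o (fun x => Re (f x))) /\
  mu.-integrable D (EFin \o (fun x => Im (f x))).

Definition rintegrable (D : set T) h := mu.-integrable D (EFin \o h).

Lemma cmeas_onS D' f : cmeasurable f -> cmeas_on D' f.
Proof. by move=> [a b]; split; exact: measurable_funTS. Qed.

Lemma cmeas_cst (z : R[i]) : cmeas_on D (fun=> z).
Proof. by split; exact: measurable_cst. Qed.

Lemma cmeasD f g : cmeas_on D f -> cmeas_on D g -> cmeas_on D (fun x => f x + g x).
Proof.
move=> [a b] [a' b']; split.
  by under eq_fun do rewrite cReD; exact: measurable_funD.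
by under eq_fun do rewrite cImD; exact: measurable_funD.
Qed.

Lemma cmeasN f : cmeas_on D f -> cmeas_on D (fun x => - f x).
Proof.
move=> [a b]; split.
  by under eq_fun do rewrite cReN; exact: measurableT_comp.
by under eq_fun do rewrite cImN; exact: measurableT_comp.
Qed.

Lemma cmeasB f g : cmeas_on D f -> cmeas_on D g -> cmeas_on D (fun x => f x - g x).
Proof. by move=> mf mg; apply: cmeasD => //; exact: cmeasN. Qed.

Lemma cmeasM f g : cmeas_on D f -> cmeas_on D g -> cmeas_on D (fun x => f x * g x).
Proof.
move=> [a b] [a' b']; split.
  under eq_fun do rewrite cReM.
  by apply: measurable_funB; exact: measurable_funM.
under eq_fun do rewrite cImM.
by apply: measurable_funD; exact: measurable_funM.
Qed.

Lemma cmeasJ f : cmeas_on D f -> cmeas_on D (fun x => conjc (f x)).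
Proof.
move=> [a b]; split; first by under eq_fun do rewrite cReJ.
by under eq_fun do rewrite cImJ; exact: measurableT_comp.
Qed.

Lemma cmeas_real h : measurable_fun D h -> cmeas_on D (fun x => (h x)%:C).
Proof. by move=> mh; split => //=; exact: measurable_cst. Qed.

Lemma cmeas_sum (I : Type) (s : seq I) (P : pred I) (F : I -> T -> R[i]) :
  (forall i, cmeas_on D (F i)) -> cmeas_on D (fun x => \sum_(i <- s | P i) F i x).
Proof.
move=> mF; elim: s => [|i s IH].
  by under eq_fun do rewrite big_nil; exact: cmeas_cst.
under eq_fun do rewrite big_cons.
by case: (P i) => //; exact: cmeasD.
Qed.

Lemma cmeas_cis h : measurable_fun D h -> cmeas_on D (fun x => cis (h x)).
Proof.
move=> mh; split => /=.
  apply: (measurableT_comp (f := cos)) => //.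
  by apply: continuous_measurable_fun; exact: continuous_cos.
apply: (measurableT_comp (f := sin)) => //.
by apply: continuous_measurable_fun; exact: continuous_sin.
Qed.

Lemma meas_cmod f : cmeas_on D f -> measurable_fun D (fun x => cmod (f x)).
Proof.
move=> [a b].
have -> : (fun x => cmod (f x)) = (fun x => Num.sqrt (Re (f x) ^+ 2 + Im (f x) ^+ 2)).
  by apply/funext => x; case: (f x).
apply: measurableT_comp.
  by apply: continuous_measurable_fun; exact: sqrt_continuous.
by apply: measurable_funD; exact: measurable_funX.
Qed.

Lemma meas_cmodX f n : cmeas_on D f -> measurable_fun D (fun x => cmod (f x) ^+ n).
Proof. by move=> mf; apply: measurable_funX; exact: meas_cmod. Qed.

Lemma rint_le h1 h : measurable_fun D h1 -> (forall x, D x -> `|h1 x| <= h x) ->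
  rintegrable D h -> rintegrable D h1.
Proof.
move=> m1 le1; apply: le_integrable => //.
  exact/measurable_EFinP.
move=> x Dx /=; rewrite lee_fin; apply: (le_trans (le1 x Dx)); exact: ler_norm.
Qed.

Lemma cint_le f h : cmeas_on D f -> (forall x, D x -> cmod (f x) <= h x) ->
  rintegrable D h -> cintegrable D f.
Proof.
move=> [a b] le1 ih; split; apply: rint_le ih => // x Dx.
  by apply: le_trans (le1 x Dx); exact: Re_le_cmod.
by apply: le_trans (le1 x Dx); exact: Im_le_cmod.
Qed.

Lemma cint_meas f : cintegrable D f -> cmeas_on D f.
Proof. by move=> [a b]; split; apply/measurable_EFinP; exact: (measurable_int mu). Qed.

Lemma rintD h1 h2 : rintegrable D h1 -> rintegrable D h2 ->
  rintegrable D (fun x => h1 x + h2 x).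
Proof. by move=> a b; have := integrableD mD a b. Qed.

Lemma rintZ c h : rintegrable D h -> rintegrable D (fun x => c * h x).
Proof. by move=> a; have := integrableZl mD c a. Qed.

Lemma rintB h1 h2 : rintegrable D h1 -> rintegrable D h2 ->
  rintegrable D (fun x => h1 x - h2 x).
Proof. by move=> a b; have := integrableB mD a b. Qed.

Lemma rint_meas h : rintegrable D h -> measurable_fun D h.
Proof. by move=> a; apply/measurable_EFinP; exact: (measurable_int mu). Qed.

Lemma rint_sum (I : Type) (s : seq I) (F : I -> T -> R) :
  (forall i, rintegrable D (F i)) -> rintegrable D (fun x => \sum_(i <- s) F i x).
Proof.
move=> mF; have := @integrable_sum _ _ _ mu D mD I s xpredT (fun i => EFin \o F i) (fun i _ => mF i).
by rewrite /rintegrable; under eq_fun do rewrite sumEFin.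
Qed.

Lemma cint_cmod f : cintegrable D f -> rintegrable D (fun x => cmod (f x)).
Proof.
move=> if_; have [a b] := if_; apply: (@rint_le _ (fun x => `|Re (f x)| + `|Im (f x)|)).
- exact/meas_cmod/cint_meas.
- by move=> x Dx; rewrite ger0_norm ?cmod_ge0//; exact: cmod_le_ReIm.
- by apply: rintD; exact: integrable_norm.
Qed.

Lemma cintD f g : cintegrable D f -> cintegrable D g -> cintegrable D (fun x => f x + g x).
Proof.
move=> [a b] [a' b']; split; rewrite /comp.
  by under eq_fun do rewrite cReD; exact: rintD.
by under eq_fun do rewrite cImD; exact: rintD.
Qed.

Lemma cintZ z f : cintegrable D f -> cintegrable D (fun x => z * f x).
Proof.
move=> if_; apply: (@cint_le _ (fun x => cmod z * cmod (f x))).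
- by apply: cmeasM; [exact: cmeas_cst|exact: cint_meas].
- by move=> x _; rewrite cmodM.
- by apply: rintZ; exact: cint_cmod.
Qed.

Lemma cintN f : cintegrable D f -> cintegrable D (fun x => - f x).
Proof. by move/(cintZ (-1)); under eq_fun do rewrite mulN1r. Qed.

Lemma cintB f g : cintegrable D f -> cintegrable D g -> cintegrable D (fun x => f x - g x).
Proof. by move=> a b; apply: cintD => //; exact: cintN. Qed.

Lemma cintJ f : cintegrable D f -> cintegrable D (fun x => conjc (f x)).
Proof.
move=> if_; apply: (@cint_le _ (fun x => cmod (f x))).
- exact/cmeasJ/cint_meas.
- by move=> x _; rewrite cmod_conj.
- exact: cint_cmod.
Qed.

Lemma cint0 : cintegrable D (fun=> 0).
Proof. by split; exact: integrable0. Qed.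

Lemma cint_sum (I : Type) (s : seq I) (F : I -> T -> R[i]) :
  (forall i, cintegrable D (F i)) -> cintegrable D (fun x => \sum_(i <- s) F i x).
Proof.
move=> mF; elim: s => [|i s IH]; first by under eq_fun do rewrite big_nil; exact: cint0.
by under eq_fun do rewrite big_cons; exact: cintD.
Qed.

Lemma cintM_bdd f g c : cmeas_on D f -> (forall x, D x -> cmod (f x) <= c) ->
  cintegrable D g -> cintegrable D (fun x => f x * g x).
Proof.
move=> mf bf ig; apply: (@cint_le _ (fun x => c * cmod (g x))).
- by apply: cmeasM => //; exact: cint_meas.
- by move=> x Dx; rewrite cmodM ler_wpM2r ?cmod_ge0// bf.
- by apply: rintZ; exact: cint_cmod.
Qed.

Lemma CintD f g : cintegrable D f -> cintegrable D g ->
  Cintegral mu D (fun x => f x + g x) = Cintegral mu D f + Cintegral mu D g.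
Proof.
move=> [a b] [a' b']; apply: eq_ReIm; rewrite ?cReD ?cImD/=.
  by under eq_Rintegral do rewrite cReD; exact: RintegralD.
by under eq_Rintegral do rewrite cImD; exact: RintegralD.
Qed.

Lemma CintZ z f : cintegrable D f ->
  Cintegral mu D (fun x => z * f x) = z * Cintegral mu D f.
Proof.
move=> [a b]; apply: eq_ReIm; rewrite ?cReM ?cImM/=.
  under eq_Rintegral do rewrite cReM.
  by rewrite RintegralB ?RintegralZl//; exact: rintZ.
under eq_Rintegral do rewrite cImM.
by rewrite RintegralD ?RintegralZl//; exact: rintZ.
Qed.

Lemma CintN f : cintegrable D f ->
  Cintegral mu D (fun x => - f x) = - Cintegral mu D f.
Proof. by move=> if_; rewrite -mulN1r -CintZ//; under [in RHS]eq_fun do rewrite mulN1r. Qed.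

Lemma CintB f g : cintegrable D f -> cintegrable D g ->
  Cintegral mu D (fun x => f x - g x) = Cintegral mu D f - Cintegral mu D g.
Proof. by move=> a b; rewrite CintD ?CintN//; exact: cintN. Qed.

Lemma CintJ f : cintegrable D f ->
  Cintegral mu D (fun x => conjc (f x)) = conjc (Cintegral mu D f).
Proof.
move=> [a b]; apply: eq_ReIm; rewrite ?cReJ ?cImJ/=.
  by under eq_Rintegral do rewrite cReJ.
under eq_Rintegral do rewrite cImJ -mulN1r.
by rewrite RintegralZl// mulN1r.
Qed.

Lemma Cint0 : Cintegral mu D (fun=> 0) = 0 :> R[i].
Proof. by apply: eq_ReIm => /=; rewrite Rintegral_cst// mul0r. Qed.

Lemma Cint_sum (I : Type) (s : seq I) (F : I -> T -> R[i]) :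
  (forall i, cintegrable D (F i)) ->
  Cintegral mu D (fun x => \sum_(i <- s) F i x) = \sum_(i <- s) Cintegral mu D (F i).
Proof.
move=> mF; elim: s => [|i s IH].
  by under eq_fun do rewrite big_nil; rewrite big_nil Cint0.
by under eq_fun do rewrite big_cons; rewrite big_cons CintD ?IH//; exact: cint_sum.
Qed.

Lemma eq_Cint f g : (forall x, D x -> f x = g x) -> Cintegral mu D f = Cintegral mu D g.
Proof.
by move=> fg; apply: eq_ReIm => /=; apply: eq_Rintegral => x; rewrite inE => Dx; rewrite fg.
Qed.

(* Rotate the integral onto the positive real axis. *)
Lemma cmod_Cint_le f : cintegrable D f ->
  cmod (Cintegral mu D f) <= \int[mu]_(x in D) cmod (f x).
Proof.
move=> if_; set c := Cintegral mu D f.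
have [c0|c0] := eqVneq (cmod c) 0; first by rewrite c0 Rintegral_ge0// => x _; exact: cmod_ge0.
have cp : 0 < cmod c by rewrite lt_neqAle eq_sym c0 cmod_ge0.
rewrite -(ler_pM2l cp) -expr2.
have -> : cmod c ^+ 2 = Re (Cintegral mu D (fun x => conjc c * f x)).
  by rewrite CintZ// -/c mulrC mul_conj.
rewrite -RintegralZl//; last exact: cint_cmod.
apply: le_Rintegral => //; first by have [] := cintZ (conjc c) if_.
  by apply: rintZ; exact: cint_cmod.
move=> x _; apply: (le_trans (ler_norm _)); apply: (le_trans (Re_le_cmod _)).
by rewrite cmodM cmod_conj.
Qed.

Lemma cmod_Cint_le_bound f h : cintegrable D f -> rintegrable D h ->
  (forall x, D x -> cmod (f x) <= h x) ->
  cmod (Cintegral mu D f) <= \int[mu]_(x in D) h x.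
Proof.
move=> if_ ih fh; apply: (le_trans (cmod_Cint_le if_)).
by apply: le_Rintegral => //; exact: cint_cmod.
Qed.

(* Cauchy-Schwarz, obtained by optimizing 2ab <= eta a^2 + b^2/eta. *)
Lemma Rint_CS (g h : T -> R) : measurable_fun D g -> measurable_fun D h ->
  (forall x, 0 <= g x) -> (forall x, 0 <= h x) ->
  rintegrable D (fun x => g x ^+ 2) -> rintegrable D (fun x => h x ^+ 2) ->
  rintegrable D (fun x => g x * h x) /\
  (\int[mu]_(x in D) (g x * h x)) ^+ 2 <=
  (\int[mu]_(x in D) (g x ^+ 2)) * (\int[mu]_(x in D) (h x ^+ 2)).
Proof.
move=> mg mh g0 h0 ig ih.
have igh : rintegrable D (fun x => g x * h x).
  apply: (@rint_le _ (fun x => g x ^+ 2 + h x ^+ 2)); last exact: rintD.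
    exact: measurable_funM.
  move=> x _; rewrite ger0_norm ?mulr_ge0//; have := g0 x; have := h0 x; nra.
split => //.
set A := \int[mu]_(x in D) (g x ^+ 2); set B := \int[mu]_(x in D) (h x ^+ 2).
set C := \int[mu]_(x in D) (g x * h x).
have A0 : 0 <= A by apply: Rintegral_ge0 => x _; exact: sqr_ge0.
have B0 : 0 <= B by apply: Rintegral_ge0 => x _; exact: sqr_ge0.
have C0 : 0 <= C by apply: Rintegral_ge0 => x _; exact: mulr_ge0.
have key s t : 0 <= s -> 0 <= t -> 2 * (s * t) * C <= s ^+ 2 * A + t ^+ 2 * B.
  move=> s0 t0; rewrite /A /B /C -!RintegralZl// -RintegralD//; [|exact: rintZ..].
  apply: le_Rintegral => //; [exact: rintZ|by apply: rintD; exact: rintZ|].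
  move=> x _; have := sqr_ge0 (s * g x - t * h x); nra.
have [AZ|An0] := eqVneq A 0.
  rewrite AZ mul0r; suff -> : C = 0 by rewrite expr0n.
  apply/eqP; rewrite eq_le C0 andbT leNgt; apply/negP => Cp.
  (* With A = 0, [key] at s = (B + 1) / C and t = 1 reads 2 (B + 1) <= B. *)
  have /= := key ((B + 1) / C) 1 _ ler01.
  rewrite AZ mulr0 expr1n mul1r mulr1 add0r => /(_ _).
  have -> : 2 * ((B + 1) / C) * C = 2 * (B + 1) by field; rewrite gt_eqF.
  have h1 : 0 <= (B + 1) / C by rewrite divr_ge0// addr_ge0.
  by move=> /(_ h1); lra.
have Ap : 0 < A by rewrite lt_neqAle eq_sym An0.
(* The optimal choice s = C, t = A; both sides then carry the factor A. *)
have := key C A C0 A0.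
have -> : 2 * (C * A) * C = A * (C ^+ 2 + C ^+ 2) by ring.
have -> : C ^+ 2 * A + A ^+ 2 * B = A * (C ^+ 2 + A * B) by ring.
by rewrite (ler_pM2l Ap); lra.
Qed.

End ComplexIntegral.

(** * Sums over parallelograms of frequencies *)

Section Summation.
Context {R : realType}.

Lemma ler_sum_sub (I : eqType) (s t : seq I) (F : I -> R) : uniq s ->
  {subset s <= t} -> (forall i, 0 <= F i) -> \sum_(i <- s) F i <= \sum_(i <- t) F i.
Proof.
move=> us st F0.
(* [t] may have repetitions, so the comparison goes through [undup t]. *)
have -> : \sum_(i <- s) F i = \sum_(i <- undup t | i \in s) F i.
  suff ps : perm_eq s [seq i <- undup t | i \in s] by rewrite (perm_big _ ps) big_filter.
  apply: uniq_perm => //; first by rewrite filter_uniq// undup_uniq.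
  by move=> i; rewrite mem_filter mem_undup; case: (boolP (i \in s)) => //= /st ->.
apply: (@le_trans _ _ (\sum_(i <- undup t) F i)).
  by rewrite big_mkcond; apply: ler_sum => i _; case: ifP.
elim: t {st} => [|a t IH]/=; first by rewrite !big_nil.
by case: ifP => _; rewrite ?big_cons; [apply: (le_trans IH); rewrite lerDr|rewrite lerD2l].
Qed.

(** The bound M on the l^2 norm, stated on finite families of distinct frequencies: the form in
    which Bessel's inequality delivers it. *)
Definition l2b (a : int -> R) (M : R) :=
  forall s : seq int, uniq s -> \sum_(k <- s) a k ^+ 2 <= M ^+ 2.

Lemma l2b_inj a M (s : seq int) (f : int -> int) : l2b a M -> injective f -> uniq s ->
  \sum_(k <- s) a (f k) ^+ 2 <= M ^+ 2.
Proof.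
move=> aM fi us; have := aM [seq f k | k <- s].
by rewrite map_inj_uniq// big_map; exact.
Qed.

Lemma l2b_le a M k : l2b a M -> 0 <= M -> `|a k| <= M.
Proof.
move=> /(_ [:: k] isT); rewrite big_seq1 => h M0.
by rewrite -(@ler_pXn2r _ 2)// ?nnegrE// real_normK ?num_real.
Qed.

(** Each term is at most 2 (sqrt (k + 1) - sqrt k), and these telescope. *)
Lemma sum_sqrtV (n : nat) :
  \sum_(0 <= k < n) (Num.sqrt (k.+1%:R : R))^-1 <= 2 * Num.sqrt n%:R.
Proof.
elim: n => [|n IH]; first by rewrite big_geq// sqrtr0 mulr0.
rewrite big_nat_recr//=; apply: (le_trans (lerD IH (lexx _))).
set a := Num.sqrt n%:R; set b := Num.sqrt n.+1%:R.
have b0 : 0 < b by rewrite sqrtr_gt0 ltr0n.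
have a0 : 0 <= a by exact: sqrtr_ge0.
have a2 : a ^+ 2 = n%:R by rewrite sqr_sqrtr.
have b2 : b ^+ 2 = a ^+ 2 + 1 by rewrite a2 sqr_sqrtr// -natr1.
rewrite -(ler_pM2r b0) mulrDl mulVf ?gt_eqF//; nra.
Qed.

(** Telescoping again: k^(-3/2) <= 4 (k^(-1/2) - (k + 1)^(-1/2)), where the constant 4 absorbs sqrt
    (k + 1) <= sqrt 2 sqrt k for k >= 1. *)
Lemma sum_pow32V (N B : nat) : (0 < N)%N -> (N <= B)%N ->
  \sum_(N <= k < B) ((k%:R : R) * Num.sqrt k%:R)^-1 <=
  4 * (Num.sqrt N%:R)^-1 - 4 * (Num.sqrt B%:R)^-1.
Proof.
move=> N0; elim: B => [|B IH]; first by rewrite leqn0 => /eqP E; rewrite E in N0.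
rewrite leq_eqVlt => /predU1P[->|]; first by rewrite big_geq// subrr.
rewrite ltnS => NB; rewrite big_nat_recr//=; apply: (le_trans (lerD (IH NB) (lexx _))).
set a := Num.sqrt B%:R; set b := Num.sqrt B.+1%:R.
have B0 : (0 < B)%N by exact: leq_trans NB.
have a0 : 0 < a by rewrite sqrtr_gt0 ltr0n.
have b0 : 0 < b by rewrite sqrtr_gt0 ltr0n.
have a2 : a ^+ 2 = B%:R by rewrite sqr_sqrtr.
have b2 : b ^+ 2 = a ^+ 2 + 1 by rewrite a2 sqr_sqrtr// -natr1.
have a1 : 1 <= a ^+ 2 by rewrite a2 ler1n.
have ab : a <= b by nra.
suff : (B%:R * a)^-1 <= 4 * a^-1 - 4 * b^-1 by lra.
rewrite -a2 -exprSr.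
have -> : 4 * a^-1 - 4 * b^-1 = 4 * (b ^+ 2 - a ^+ 2) / (a * b * (a + b)).
  by field; rewrite !gt_eqF// addr_gt0.
have -> : b ^+ 2 - a ^+ 2 = 1 by rewrite b2; ring.
rewrite mulr1 -[leLHS]mul1r ler_pdivrMr ?exprn_gt0//.
rewrite mulrAC ler_pdivlMr ?mulr_gt0// ?addr_gt0// mul1r.
have -> : 4 * a ^+ 3 = a * (4 * a ^+ 2) by ring.
rewrite -mulrA ler_pM2l//.
have : 2 * (a * b) <= a ^+ 2 + b ^+ 2 by have := sqr_ge0 (a - b); nra.
nra.
Qed.

Lemma sum_absz_le (s : seq int) (g : nat -> R) (B : nat) : uniq s ->
  (forall n, 0 <= g n) -> (forall l, l \in s -> (l != 0) && (`|l| <= B)%N) ->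
  \sum_(l <- s) g `|l|%N <= 2 * \sum_(0 <= k < B) g k.+1.
Proof.
move=> us g0 sB.
(* Each positive integer is the absolute value of two integers; [Negz n] is -(n + 1), hence the
   shift in [g k.+1]. *)
apply: (@le_trans _ _ (\sum_(l <- [seq Posz n.+1 | n <- iota 0 B] ++ [seq Negz n | n <- iota 0 B]) g `|l|%N)).
  apply: ler_sum_sub => // l /sB /andP[l0 lB]; rewrite mem_cat; apply/orP.
  case: l l0 lB => [[//|n]|n] _ lB; [left|right]; apply/mapP; exists n => //;
   by rewrite mem_iota.
by rewrite big_cat !big_map/= /index_iota subn0 mulr2n mulrDl !mul1r.
Qed.

Lemma sum_absz_sqrtV (s : seq int) (n : nat) : uniq s ->
  (forall l, l \in s -> (l != 0) && (`|l| <= n)%N) ->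
  \sum_(l <- s) (Num.sqrt (`|l|%N%:R : R))^-1 <= 4 * Num.sqrt n%:R.
Proof.
move=> us sn.
apply: (le_trans (sum_absz_le (g := fun n => (Num.sqrt n%:R)^-1) us _ sn)).
  by move=> k; rewrite invr_ge0 sqrtr_ge0.
by have := sum_sqrtV n; lra.
Qed.

Lemma sum_absz_pow32V (s : seq int) (N : nat) : uniq s -> (0 < N)%N ->
  (forall l, l \in s -> (N <= `|l|)%N) ->
  \sum_(l <- s) ((`|l|%N%:R : R) * Num.sqrt `|l|%N%:R)^-1 <= 8 * (Num.sqrt N%:R)^-1.
Proof.
move=> us N0 sN.
pose B := \max_(l <- s) `|l|%N.
pose g n : R := if (N <= n)%N then (n%:R * Num.sqrt n%:R)^-1 else 0.
have -> : \sum_(l <- s) ((`|l|%N%:R : R) * Num.sqrt `|l|%N%:R)^-1 = \sum_(l <- s) g `|l|%N.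
  by rewrite big_seq [RHS]big_seq; apply: eq_bigr => l /sN; rewrite /g => ->.
have sB l : l \in s -> (l != 0) && (`|l| <= B)%N.
  move=> ls; apply/andP; split.
    by apply/eqP => l0; have := sN _ ls; rewrite l0/= leqNgt N0.
  by rewrite /B (big_rem l)//= leq_maxl.
have g0 n : 0 <= g n.
  by rewrite /g; case: ifP => // _; rewrite invr_ge0 mulr_ge0// sqrtr_ge0.
apply: (le_trans (sum_absz_le us g0 sB)).
suff : \sum_(0 <= k < B) g k.+1 <= 4 * (Num.sqrt N%:R)^-1 by lra.
have -> : \sum_(0 <= k < B) g k.+1 = \sum_(1 <= k < B.+1) g k by rewrite big_add1.
have [BN|NB] := ltnP B N.
  rewrite big_nat_cond big1 ?mulr_ge0 ?invr_ge0 ?sqrtr_ge0// => k /andP[/andP[_ kB] _].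
  by rewrite /g leqNgt (leq_trans kB BN).
rewrite (big_cat_nat (n := N))//=; last by rewrite ltnW.
rewrite big_nat_cond big1 ?add0r; last first.
  by move=> k /andP[/andP[_ kB] _]; rewrite /g leqNgt kB.
rewrite big_nat_cond (eq_bigr (fun k => ((k%:R : R) * Num.sqrt k%:R)^-1)); last first.
  by move=> k /andP[/andP[Nk _] _]; rewrite /g Nk.
rewrite -big_nat_cond; apply: (le_trans (@sum_pow32V N B.+1 N0 (leqW NB))).
by rewrite gerBl mulr_ge0// invr_ge0 sqrtr_ge0.
Qed.

(** Turns a Young inequality with a free parameter into Cauchy-Schwarz: the optimal value is t = S /
    X, and for X = 0 the large value t = (Y + 1) / S forces S = 0. *)
Lemma sqr_le_of_param (S X Y : R) : 0 <= S -> 0 <= X -> 0 <= Y ->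
  (forall t, 0 < t -> 2 * S <= t * X + t^-1 * Y) -> S ^+ 2 <= X * Y.
Proof.
move=> S0 X0 Y0 h.
have [->|Sn0] := eqVneq S 0; first by rewrite expr0n mulr_ge0.
have Sp : 0 < S by rewrite lt_neqAle eq_sym Sn0.
have [XZ|Xn0] := eqVneq X 0.
  have Yp : 0 < Y + 1 by rewrite ltr_pwDr.
  have := h ((Y + 1) / S); rewrite divr_gt0// => /(_ isT).
  rewrite XZ mulr0 add0r invf_div mulrAC ler_pdivlMr//; nra.
have Xp : 0 < X by rewrite lt_neqAle eq_sym Xn0.
have := h (S / X); rewrite divr_gt0// => /(_ isT).
rewrite divfK ?gt_eqF// invf_div mulrAC.
have -> : 2 * S = S + S by ring.
by rewrite lerD2l ler_pdivlMr// -expr2.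
Qed.

(** A finite family of triples lies in the product of its three projections, which makes iterated
    summation available. *)
Lemma sum3_le (r : seq (int * int * int)) (P : int -> int -> int -> bool)
    (F : int -> int -> int -> R) (I := undup [seq x.1.1 | x <- r])
    (L := undup [seq x.1.2 | x <- r]) (M := undup [seq x.2 | x <- r]) : uniq r ->
  (forall p l m, 0 <= F p l m) ->
  \sum_(x <- r | P x.1.1 x.1.2 x.2) F x.1.1 x.1.2 x.2 <=
  \sum_(p <- I) \sum_(l <- L) \sum_(m <- M | P p l m) F p l m.
Proof.
move=> ur F0.
pose G (x : int * int * int) := if P x.1.1 x.1.2 x.2 then F x.1.1 x.1.2 x.2 else 0.
rewrite big_mkcond/=.
have -> : \sum_(p <- I) \sum_(l <- L) \sum_(m <- M | P p l m) F p l m =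
    \sum_(x <- [seq (y, m) | y <- [seq (p, l) | p <- I, l <- L], m <- M]) G x.
  rewrite big_allpairs big_allpairs/=; apply: eq_bigr => p _; apply: eq_bigr => l _.
  by rewrite big_mkcond.
apply: (ler_sum_sub (F := G)) => //; last by move=> x; rewrite /G; case: ifP.
move=> [[p l] m] xr; apply/allpairsP; exists ((p, l), m); split => //=.
  apply/allpairsP; exists (p, l); split => //=; rewrite mem_undup; apply/mapP;
  by exists (p, l, m).
by rewrite mem_undup; apply/mapP; exists (p, l, m).
Qed.

(* The triple (p, l, m) stands for the parallelogram p, p + l, p + m, p + l + m. *)
Definition offaxis (N : nat) (x : int * int * int) :=
  [&& x.1.2 != 0, x.2 != 0 & (N <= `|x.1.2|)%N || (N <= `|x.2|)%N].

(** 32 N^(-1/4), where 32 = 2 sqrt (4 * 64): the halves |l| <= |m| and |m| < |l| contribute 16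
    N^(-1/4) each, and 4 and 64 are the constants of the two weighted sums in
    [parallelogram_half]. *)
Definition kap (N : nat) : R := 32 * Num.sqrt ((Num.sqrt N%:R)^-1).

Definition inv_lm (x : int * int * int) : R := ((`|x.1.2|%N%:R : R) * `|x.2|%N%:R)^-1.

(* The weights (|l||m|)^(-1/2) and (|l||m|)^(-3/2) are summable over |l| <= |m| in l,
   resp. over all l and m. *)
Lemma parallelogram_half (r : seq (int * int * int)) (N : nat) (A B C : int -> R) (a b c : R) :
  uniq r -> (0 < N)%N -> (forall p, 0 <= A p) -> (forall p, 0 <= B p) -> (forall p, 0 <= C p) ->
  0 <= a -> 0 <= b -> 0 <= c -> l2b A a -> l2b B b -> l2b C c ->
  (forall x, x \in r -> [&& x.1.2 != 0, x.2 != 0, (`|x.1.2| <= `|x.2|)%N & (N <= `|x.2|)%N]) ->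
  \sum_(x <- r) A x.1.1 * B (x.1.1 + x.1.2) * C (x.1.1 + x.2) * inv_lm x <=
  2^-1 * kap N * (a * b * c).
Proof.
move=> ur N0 A0 B0 C0 a0 b0 c0 lA lB lC rP.
set S := \sum_(x <- r) _.
set I := undup [seq x.1.1 | x <- r]; set L := undup [seq x.1.2 | x <- r].
set M := undup [seq x.2 | x <- r].
have S0 : 0 <= S.
  by apply: sumr_ge0 => x _; rewrite !mulr_ge0// invr_ge0 mulr_ge0.
pose P (p l m : int) := (`|l| <= `|m|)%N.
pose sq (n : int) : R := Num.sqrt `|n|%N%:R.
have sq0 n : 0 <= sq n by exact: sqrtr_ge0.
(* The square of a summand is [F1] times [F2]. The sums of [F1] and [F2] are bounded separately and
   recombined by the parametrized Young inequality. *)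
pose F1 p l m := (A p * C (p + m)) ^+ 2 * ((sq l)^-1 * (sq m)^-1).
pose F2 p l m := B (p + l) ^+ 2 * ((`|l|%N%:R * sq l)^-1 * (`|m|%N%:R * sq m)^-1).
have F10 p l m : 0 <= F1 p l m.
  by rewrite /F1 mulr_ge0 ?sqr_ge0// mulr_ge0// invr_ge0.
have F20 p l m : 0 <= F2 p l m.
  by rewrite /F2 mulr_ge0 ?sqr_ge0// mulr_ge0// invr_ge0 mulr_ge0.
have LP l : l \in L -> l != 0.
  by rewrite mem_undup => /mapP[x /rP /and4P[? _ _ _] ->].
have MP m : m \in M -> (m != 0) && (N <= `|m|)%N.
  by rewrite mem_undup => /mapP[x /rP /and4P[_ ? _ ?] ->]; apply/andP.
have sqp n : n != 0 -> 0 < sq n by move=> n0; rewrite sqrtr_gt0 ltr0n absz_gt0.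
have X1 : \sum_(x <- r) F1 x.1.1 x.1.2 x.2 <= 4 * (a * c) ^+ 2.
  have -> : \sum_(x <- r) F1 x.1.1 x.1.2 x.2 =
      \sum_(x <- r | P x.1.1 x.1.2 x.2) F1 x.1.1 x.1.2 x.2.
    rewrite big_seq [RHS]big_seq_cond; apply: eq_bigl => x.
    by case: (boolP (x \in r)) => //= /rP /and4P[_ _ ? _].
  apply: (le_trans (sum3_le P ur F10)); rewrite -/I -/L -/M.
  apply: (@le_trans _ _ (\sum_(p <- I) \sum_(m <- M) A p ^+ 2 * (C (p + m) ^+ 2) * 4)).
    apply: ler_sum => p _; under eq_bigr do rewrite big_mkcond.
    rewrite exchange_big/= big_seq [leRHS]big_seq; apply: ler_sum => m mM.
    rewrite -big_mkcond/=.
    have /andP[m0 _] := MP _ mM.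
    have -> : \sum_(l <- L | P p l m) F1 p l m =
        (A p * C (p + m)) ^+ 2 * (sq m)^-1 * \sum_(l <- L | P p l m) (sq l)^-1.
      by rewrite mulr_sumr; apply: eq_bigr => l _; rewrite /F1; ring.
    rewrite -exprMn -mulrA; apply: ler_wpM2l; first exact: sqr_ge0.
    (* The sum of |l|^(-1/2) over |l| <= |m| is at most 4 |m|^(1/2), which cancels the weight of m
       exactly: this is the reason for splitting according to |l| <= |m|. *)
    rewrite mulrC ler_pdivrMr ?sqp//.
    rewrite -big_filter; apply: sum_absz_sqrtV; first by rewrite filter_uniq// undup_uniq.
    by move=> l; rewrite mem_filter => /andP[Pl /LP ->].
  apply: (@le_trans _ _ (\sum_(p <- I) A p ^+ 2 * (c ^+ 2 * 4))).
    apply: ler_sum => p _; rewrite -mulr_suml -mulr_sumr -mulrA.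
    apply: ler_wpM2l; first exact: sqr_ge0.
    apply: ler_wpM2r => //; apply: (l2b_inj lC); last exact: undup_uniq.
    exact: addrI.
  rewrite -mulr_suml exprMn.
  have := lA I (undup_uniq _); have := sqr_ge0 c; nra.
have X2 : \sum_(x <- r) F2 x.1.1 x.1.2 x.2 <= b ^+ 2 * (64 * (Num.sqrt N%:R)^-1).
  apply: (le_trans (sum3_le (fun _ _ _ => true) ur F20)); rewrite -/I -/L -/M.
  rewrite exchange_big/=.
  have M1 : \sum_(m <- M) (`|m|%N%:R * sq m)^-1 <= 8 * (Num.sqrt N%:R)^-1.
    by apply: sum_absz_pow32V; rewrite ?undup_uniq// => m /MP /andP[].
  have L1 : \sum_(l <- L) (`|l|%N%:R * sq l)^-1 <= 8 * (Num.sqrt 1%:R)^-1.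
    by apply: sum_absz_pow32V; rewrite ?undup_uniq// => l /LP; rewrite -absz_gt0.
  rewrite sqrtr1 invr1 mulr1 in L1.
  apply: (@le_trans _ _ (\sum_(l <- L) b ^+ 2 * (`|l|%N%:R * sq l)^-1 * (8 * (Num.sqrt N%:R)^-1))).
    apply: ler_sum => l _.
    have -> : \sum_(i <- I) \sum_(m <- M) F2 i l m =
       (\sum_(i <- I) B (i + l) ^+ 2) * (`|l|%N%:R * sq l)^-1 * \sum_(m <- M) (`|m|%N%:R * sq m)^-1.
      rewrite -mulrA mulr_suml; apply: eq_bigr => i _; rewrite !mulr_sumr.
      by apply: eq_bigr => m _; rewrite /F2.
    apply: ler_pM => //.
    - by rewrite mulr_ge0 ?invr_ge0 ?mulr_ge0// sumr_ge0// => i _; exact: sqr_ge0.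
    - by apply: sumr_ge0 => m _; rewrite invr_ge0 mulr_ge0.
    apply: ler_wpM2r; first by rewrite invr_ge0 mulr_ge0.
    by apply: (l2b_inj lB); [exact: addIr|exact: undup_uniq].
  rewrite -mulr_suml -mulr_sumr.
  have N1 : 0 <= (Num.sqrt N%:R)^-1 :> R by rewrite invr_ge0 sqrtr_ge0.
  rewrite -mulrA; apply: ler_wpM2l; first exact: sqr_ge0.
  by have := ler_wpM2r N1 L1; lra.
have key t : 0 < t -> 2 * S <= t * (4 * (a * c) ^+ 2) + t^-1 * (b ^+ 2 * (64 * (Num.sqrt N%:R)^-1)).
  move=> t0.
  apply: (@le_trans _ _ (t * (\sum_(x <- r) F1 x.1.1 x.1.2 x.2) + t^-1 * (\sum_(x <- r) F2 x.1.1 x.1.2 x.2))); last first.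
    by apply: lerD; apply: ler_wpM2l => //; rewrite ?invr_ge0 ltW.
  rewrite /S !mulr_sumr -big_split/= big_seq [leRHS]big_seq; apply: ler_sum => -[[p l] m] /rP/=.
  move=> /and4P[l0 m0 _ _]; rewrite /F1 /F2 /inv_lm/=.
  have := sqp _ l0; have := sqp _ m0; set u := sq l; set v := sq m => v0 u0.
  have -> : `|l|%N%:R = u ^+ 2 :> R by rewrite sqr_sqrtr.
  have -> : `|m|%N%:R = v ^+ 2 :> R by rewrite sqr_sqrtr.
  set X := A p * C (p + m); set Y := B (p + l).
  have -> : A p * Y * C (p + m) = X * Y by rewrite /X; ring.
  have -> : t * (X ^+ 2 * (u^-1 * v^-1)) + t^-1 * (Y ^+ 2 * ((u ^+ 2 * u)^-1 * (v ^+ 2 * v)^-1)) =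
    (t * X ^+ 2 * (u * v) ^+ 2 + t^-1 * Y ^+ 2) / (u * v) ^+ 3 by field; rewrite !gt_eqF.
  have -> : 2 * (X * Y * (u ^+ 2 * v ^+ 2)^-1) = (2 * X * Y * (u * v)) / (u * v) ^+ 3.
    by field; rewrite !gt_eqF.
  rewrite ler_pM2r ?invr_gt0 ?exprn_gt0 ?mulr_gt0//.
  rewrite -(ler_pM2l t0) [leRHS]mulrDr [X in _ <= _ + X]mulrA mulfV ?gt_eqF// mul1r.
  have := sqr_ge0 (t * X * (u * v) - Y); nra.
have := sqr_le_of_param S0 _ _ key.
have N1 : 0 <= (Num.sqrt N%:R)^-1 :> R by rewrite invr_ge0 sqrtr_ge0.
rewrite !mulr_ge0 ?sqr_ge0// => /(_ isT isT) SS.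
rewrite -(@ler_pXn2r _ 2)// ?nnegrE//; last first.
  by rewrite !mulr_ge0// sqrtr_ge0.
apply: (le_trans SS); rewrite /kap !exprMn sqr_sqrtr// le_eqVlt; apply/orP; left; apply/eqP.
by field; rewrite gt_eqF// sqrtr_gt0 ltr0n.
Qed.

Lemma parallelogram (r : seq (int * int * int)) (N : nat) (A B C : int -> R) (a b c : R) :
  uniq r -> (0 < N)%N -> (forall p, 0 <= A p) -> (forall p, 0 <= B p) -> (forall p, 0 <= C p) ->
  0 <= a -> 0 <= b -> 0 <= c -> l2b A a -> l2b B b -> l2b C c ->
  (forall x, x \in r -> offaxis N x) ->
  \sum_(x <- r) A x.1.1 * B (x.1.1 + x.1.2) * C (x.1.1 + x.2) * inv_lm x <= kap N * (a * b * c).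
Proof.
move=> ur N0 A0 B0 C0 a0 b0 c0 lA lB lC rP.
pose P (x : int * int * int) := (`|x.1.2| <= `|x.2|)%N.
rewrite (bigID P)/= -big_filter -[X in _ + X]big_filter.
have -> : kap N * (a * b * c) = 2^-1 * kap N * (a * b * c) + 2^-1 * kap N * (a * c * b) by field.
apply: lerD.
  apply: parallelogram_half => //; first by rewrite filter_uniq.
  move=> x; rewrite mem_filter => /andP[Px /rP /and3P[-> -> /=]]; move: Px; rewrite /P => Px; rewrite Px/=.
  by case/orP => // h; exact: leq_trans Px.
(* Exchanging l and m exchanges the roles of [B] and [C] and reduces the other half to the same
   lemma. *)
pose sw (x : int * int * int) := (x.1.1, x.2, x.1.2).
have swi : injective sw by move=> [[? ?] ?] [[? ?] ?] [-> -> ->].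
have -> : \sum_(x <- [seq i <- r | ~~ P i]) A x.1.1 * B (x.1.1 + x.1.2) * C (x.1.1 + x.2) * inv_lm x
  = \sum_(x <- [seq sw i | i <- [seq i <- r | ~~ P i]])
     A x.1.1 * C (x.1.1 + x.1.2) * B (x.1.1 + x.2) * inv_lm x.
  rewrite big_map; apply: eq_bigr => x _; rewrite /inv_lm/= [(_ * `|x.2|%N%:R)]mulrC.
  by rewrite -!mulrA; congr (_ * _); rewrite !mulrA; congr (_ * _); rewrite mulrC.
apply: parallelogram_half => //; first by rewrite map_inj_uniq// filter_uniq.
move=> x /mapP[y]; rewrite mem_filter => /andP[Py /rP /and3P[y1 y2 /= yN]] ->/=.
move: Py; rewrite /P -ltnNge => Py; rewrite y1 y2 (ltnW Py)/=.
by case/orP : yN => // h; apply: leq_trans (ltnW Py).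
Qed.

Section OtherVertices.
Variables (r : seq (int * int * int)) (N : nat) (X F G W : int -> R) (x f g w : R).
Hypotheses (ur : uniq r) (N0 : (0 < N)%N).
Hypotheses (X0 : forall p, 0 <= X p) (F0 : forall p, 0 <= F p)
  (G0 : forall p, 0 <= G p) (W0 : forall p, 0 <= W p).
Hypotheses (x0 : 0 <= x) (f0 : 0 <= f) (g0 : 0 <= g) (w0 : 0 <= w).
Hypotheses (lX : l2b X x) (lF : l2b F f) (lG : l2b G g) (lW : l2b W w).
Hypothesis rP : forall y, y \in r -> offaxis N y.

(** The digit in [parallelogram_no0] to [parallelogram_no3] tells which vertex is left out: 0 for p,
    1 for p + l, 2 for p + m, 3 for p + l + m. All reduce to [parallelogram] by choosing another
    vertex as the base point, which only changes signs of l and m. *)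
Lemma parallelogram_no0 :
  \sum_(y <- r) X (y.1.1 + y.1.2 + y.2) * F (y.1.1 + y.1.2) * G (y.1.1 + y.2) * inv_lm y
  <= kap N * (x * f * g).
Proof.
pose sw (y : int * int * int) := (y.1.1 + y.1.2 + y.2, - y.1.2, - y.2).
have swi : injective sw.
  by move=> [[a b] c] [[a' b'] c'] [] e /oppr_inj eb /oppr_inj ec; move: e; rewrite eb ec => /addIr /addIr ->.
have -> : x * f * g = x * g * f by ring.
have -> : \sum_(y <- r) X (y.1.1 + y.1.2 + y.2) * F (y.1.1 + y.1.2) * G (y.1.1 + y.2) * inv_lm y
  = \sum_(y <- [seq sw i | i <- r]) X y.1.1 * G (y.1.1 + y.1.2) * F (y.1.1 + y.2) * inv_lm y.
  rewrite big_map; apply: eq_bigr => -[[a b] c] _; rewrite /inv_lm/= !abszN addrK.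
  by rewrite -[a + b + c - b]addrA [c - b]addrC addrA addrK; congr (_ * _); ring.
apply: parallelogram => //; first by rewrite map_inj_uniq.
by move=> y /mapP[z /rP + ->]; rewrite /offaxis/= !oppr_eq0 !abszN.
Qed.

Lemma parallelogram_no1 :
  \sum_(y <- r) X (y.1.1 + y.1.2 + y.2) * G (y.1.1 + y.2) * W y.1.1 * inv_lm y
  <= kap N * (x * g * w).
Proof.
pose sw (y : int * int * int) := (y.1.1 + y.2, y.1.2, - y.2).
have swi : injective sw.
  by move=> [[a b] c] [[a' b'] c'] [] e eb /oppr_inj ec; move: e; rewrite eb ec => /addIr ->.
have -> : x * g * w = g * x * w by ring.
have -> : \sum_(y <- r) X (y.1.1 + y.1.2 + y.2) * G (y.1.1 + y.2) * W y.1.1 * inv_lm y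
  = \sum_(y <- [seq sw i | i <- r]) G y.1.1 * X (y.1.1 + y.1.2) * W (y.1.1 + y.2) * inv_lm y.
  rewrite big_map; apply: eq_bigr => -[[a b] c] _; rewrite /inv_lm/= !abszN addrK.
  by rewrite [a + c + b]addrAC; congr (_ * _); ring.
apply: parallelogram => //; first by rewrite map_inj_uniq.
by move=> y /mapP[z /rP + ->]; rewrite /offaxis/= !oppr_eq0 !abszN.
Qed.

Lemma parallelogram_no2 :
  \sum_(y <- r) X (y.1.1 + y.1.2 + y.2) * F (y.1.1 + y.1.2) * W y.1.1 * inv_lm y
  <= kap N * (x * f * w).
Proof.
pose sw (y : int * int * int) := (y.1.1 + y.1.2, - y.1.2, y.2).
have swi : injective sw.
  by move=> [[a b] c] [[a' b'] c'] [] e /oppr_inj eb ec; move: e; rewrite eb ec => /addIr ->.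
have -> : x * f * w = f * w * x by ring.
have -> : \sum_(y <- r) X (y.1.1 + y.1.2 + y.2) * F (y.1.1 + y.1.2) * W y.1.1 * inv_lm y
  = \sum_(y <- [seq sw i | i <- r]) F y.1.1 * W (y.1.1 + y.1.2) * X (y.1.1 + y.2) * inv_lm y.
  rewrite big_map; apply: eq_bigr => -[[a b] c] _; rewrite /inv_lm/= !abszN addrK.
  by congr (_ * _); ring.
apply: parallelogram => //; first by rewrite map_inj_uniq.
by move=> y /mapP[z /rP + ->]; rewrite /offaxis/= !oppr_eq0 !abszN.
Qed.

Lemma parallelogram_no3 :
  \sum_(y <- r) F (y.1.1 + y.1.2) * G (y.1.1 + y.2) * W y.1.1 * inv_lm y
  <= kap N * (f * g * w).
Proof.
have -> : f * g * w = w * f * g by ring.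
rewrite (eq_bigr (fun y => W y.1.1 * F (y.1.1 + y.1.2) * G (y.1.1 + y.2) * inv_lm y)).
  exact: parallelogram.
by move=> y _; congr (_ * _); ring.
Qed.

Lemma parallelogram_all :
  \sum_(y <- r) X (y.1.1 + y.1.2 + y.2) * F (y.1.1 + y.1.2) * G (y.1.1 + y.2) * W y.1.1 * inv_lm y
  <= kap N * (x * f * g * w).
Proof.
apply: (@le_trans _ _ (\sum_(y <- r) x * (F (y.1.1 + y.1.2) * G (y.1.1 + y.2) * W y.1.1 * inv_lm y))).
  apply: ler_sum => y _; rewrite -!mulrA; apply: ler_wpM2r.
    by rewrite !mulr_ge0// invr_ge0 mulr_ge0.
  by apply: (le_trans (ler_norm _)); exact: l2b_le.
rewrite -mulr_sumr; have := ler_wpM2l x0 parallelogram_no3.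
by congr (_ <= _); ring.
Qed.

End OtherVertices.

Lemma kap_ge0 N : 0 <= kap N.
Proof. by rewrite mulr_ge0// sqrtr_ge0. Qed.

Lemma kap_small (e : R) : 0 < e -> exists2 N, (0 < N)%N & forall n, (N <= n)%N -> kap n <= e.
Proof.
move=> e0.
pose M : R := (32 / e) ^+ 4.
have M0 : 0 < M by rewrite exprn_gt0// divr_gt0.
exists (Num.truncn M).+1 => // n Nn.
have nM : M <= n%:R.
  apply: (@le_trans _ _ (Num.truncn M).+1%:R); last by rewrite ler_nat.
  by rewrite ltW// truncnS_gt.
have n0 : 0 < (n%:R : R) by exact: lt_le_trans nM.
set v := Num.sqrt (n%:R : R); have v0 : 0 < v by rewrite sqrtr_gt0.
have vE : (32 / e) ^+ 2 <= v.
  rewrite -(@ler_pXn2r _ 2)// ?nnegrE ?sqr_ge0 ?(ltW v0)//.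
  by rewrite sqr_sqrtr ?(ltW n0)// -exprM.
rewrite /kap -/v.
have -> : Num.sqrt v^-1 = (Num.sqrt v)^-1 by rewrite sqrtrV// ltW.
rewrite ler_pdivrMr ?sqrtr_gt0// -ler_pdivrMl// mulrC.
rewrite -(@ler_pXn2r _ 2)// ?nnegrE ?sqrtr_ge0//; last by rewrite divr_ge0// ltW.
by rewrite sqr_sqrtr// (ltW v0).
Qed.

End Summation.
Arguments l2b {R}.

(** * Absolutely continuous functions of time *)

Section AbsolutelyContinuous.
Context {R : realType}.
Notation mu := (@lebesgue_measure R).
Implicit Types (A B a b : R -> R).

Lemma mseg (a b : R) : measurable (`[a, b]%classic : set (measurableTypeR R)).
Proof. exact: measurable_itv. Qed.

#[local] Hint Resolve mseg : core.

(** Fubini for a(s) b(r) on the half-plane s < r; passing from the open to the closed half-line only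
    adds a point. *)
Lemma Rint_tail a b : rintegrable mu setT a -> rintegrable mu setT b ->
  rintegrable mu setT (fun s => a s * \int[mu]_(r in `]s, +oo[) b r) /\
  \int[mu]_r (b r * \int[mu]_(s in `]-oo, r]) a s) =
    \int[mu]_s (a s * \int[mu]_(r in `]s, +oo[) b r).
Proof.
move=> ia ib.
have ma := rint_meas ia; have mb := rint_meas ib.
pose lt2 := [set p : R * R | p.1 < p.2].
have mlt : measurable lt2.
  rewrite -[lt2]setTI; apply: (@measurable_fun_ltr _ _ R setT fst snd) => //.
have ltE s r : \1_lt2 (s, r) = (s < r)%R%:R :> R.
  by rewrite indicE; congr (_%:R); congr nat_of_bool; apply/idP/idP; rewrite inE.
pose g (p : R * R) : \bar R := (a p.1 * b p.2 * \1_lt2 p)%:E.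
have mg : measurable_fun setT g.
  apply/measurable_EFinP; apply: measurable_funM; last exact: measurable_indic.
  by apply: measurable_funM; apply: measurableT_comp.
pose gauged_profile (p : R * R) : \bar R := (`|a p.1| * `|b p.2|)%:E.
have mga : measurable_fun setT gauged_profile.
  apply/measurable_EFinP; apply: measurable_funM; apply: measurableT_comp => //;
  by apply: measurableT_comp.
have iga : (mu \x mu)%E.-integrable setT gauged_profile.
  apply/integrable12ltyP => //.
  have E x : (\int[mu]_y `|gauged_profile (x, y)| = (`|a x| * \int[mu]_y `|b y|)%:E)%E.
    rewrite -RintegralZl//; last exact: integrable_norm.
    rewrite /Rintegral fineK; last first.
      by apply: integrable_fin_num => //; apply: rintZ => //; exact: integrable_norm.
    by apply: eq_integral => y _; rewrite /gauged_profile/= normrM !normr_id.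
  under eq_integral do rewrite E.
  have : rintegrable mu setT (fun x => (\int[mu]_y `|b y|) * `|a x|).
    by apply: rintZ => //; exact: integrable_norm.
  by move/integrable_lty => /(_ measurableT); under eq_integral do rewrite /= mulrC.
have ig : (mu \x mu)%E.-integrable setT g.
  apply: le_integrable iga => // -[x y] _; rewrite /g /gauged_profile/= lee_fin !normrM !normr_id.
  by rewrite indicE; case: (_ \in _); rewrite ?normr1 ?normr0 ?mulr1// mulr0 mulr_ge0.
have gF s : (\int[mu]_r g (s, r) = (a s * \int[mu]_(r in `]s, +oo[) b r)%:E)%E.
  have ib' : rintegrable mu `]s, +oo[ b by apply: integrableS ib.
  rewrite -RintegralZl// /Rintegral fineK; last by apply: integrable_fin_num => //; exact: rintZ.
  rewrite [RHS]integral_mkcond; apply: eq_integral => r _; rewrite /g/= ltE patchE.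
  by rewrite mem_setE in_itv/= andbT; case: ifP => _; rewrite ?mulr1 ?mulr0.
have gG r : (\int[mu]_s g (s, r) = (b r * \int[mu]_(s in `]-oo, r]) a s)%:E)%E.
  have ia' : rintegrable mu `]-oo, r[ a by apply: integrableS ia.
  rewrite -Rintegral_itv_bndo_bndc//.
  rewrite -RintegralZl// /Rintegral fineK; last by apply: integrable_fin_num => //; exact: rintZ.
  rewrite [RHS]integral_mkcond; apply: eq_integral => s _; rewrite /g/= ltE patchE.
  by rewrite mem_setE in_itv/=; case: ifP => _; rewrite ?mulr1 ?mulr0// mulrC.
have iF : rintegrable mu setT (fun s => a s * \int[mu]_(r in `]s, +oo[) b r).
  have := integrable_fubini_F ig; rewrite /fubini_F /rintegrable.
  by under eq_fun do rewrite gF.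
split; first exact: iF.
have e1 : (\int[mu]_s \int[mu]_r g (s, r) =
    \int[mu]_s (a s * \int[mu]_(r in `]s, +oo[) b r)%:E)%E.
  by apply: eq_integral => s _; exact: gF.
have e2 : (\int[mu]_r \int[mu]_s g (s, r) =
    \int[mu]_r (b r * \int[mu]_(s in `]-oo, r]) a s)%:E)%E.
  by apply: eq_integral => r _; exact: gG.
by apply: (congr1 (@fine R)); exact: (etrans (esym e2) (etrans (esym (Fubini ig)) e1)).
Qed.

Lemma Rint_head a b : rintegrable mu setT a -> rintegrable mu setT b ->
  rintegrable mu setT (fun s => a s * \int[mu]_(r in `]-oo, s]) b r) /\
  forall s, a s * \int[mu]_(r in `]-oo, s]) b r =
    (\int[mu]_r b r) * a s - a s * \int[mu]_(r in `]s, +oo[) b r.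
Proof.
move=> ia ib; have [iF _] := Rint_tail ia ib.
have split s : \int[mu]_r b r = \int[mu]_(r in `]-oo, s]) b r + \int[mu]_(r in `]s, +oo[) b r.
  rewrite -Rintegral_setU//.
  - congr Rintegral; apply/seteqP; split => // x _ /=; rewrite !in_itv/= andbT.
    by case: (leP x s) => _; [left|right].
  - by apply: integrableS ib => //; exact: measurableU.
  - apply/disj_setPS => x [/=]; rewrite !in_itv/= andbT => xs sx.
    by have := le_lt_trans xs sx; rewrite ltxx.
have E1 s : a s * \int[mu]_(r in `]-oo, s]) b r =
    (\int[mu]_r b r) * a s - a s * \int[mu]_(r in `]s, +oo[) b r.
  by rewrite (split s); ring.
split => //; rewrite (funext E1).
by apply: (@rintB _ _ R mu) => //; exact: rintZ.
Qed.

(** The two iterated integrals are those of a(s) b(r) over two half-planes that cover the plane and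
    overlap in a null set. *)
Lemma Rint_triangle a b : rintegrable mu setT a -> rintegrable mu setT b ->
  [/\ rintegrable mu setT (fun s => a s * \int[mu]_(r in `]-oo, s]) b r),
      rintegrable mu setT (fun r => b r * \int[mu]_(s in `]-oo, r]) a s) &
      \int[mu]_s (a s * \int[mu]_(r in `]-oo, s]) b r) +
      \int[mu]_r (b r * \int[mu]_(s in `]-oo, r]) a s) =
      (\int[mu]_s a s) * (\int[mu]_s b s)].
Proof.
move=> ia ib; have [i1 E1] := Rint_head ia ib; have [i2 _] := Rint_head ib ia.
have [iF ->] := Rint_tail ia ib; split => //.
rewrite -RintegralD//; under eq_Rintegral do rewrite E1 subrK.
by rewrite RintegralZl// mulrC.
Qed.

Lemma itv0S (s t : R) : s <= t -> `[0, s]%classic `<=` `[0, t]%classic.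
Proof. by move=> st; apply: subset_itvl; rewrite bnd_simp. Qed.

Lemma Rint_parts (t : R) a b : rintegrable mu `[0, t] a -> rintegrable mu `[0, t] b ->
  [/\ rintegrable mu `[0, t] (fun s => a s * \int[mu]_(r in `[0, s]) b r),
      rintegrable mu `[0, t] (fun s => b s * \int[mu]_(r in `[0, s]) a r) &
      \int[mu]_(s in `[0, t]) (a s * \int[mu]_(r in `[0, s]) b r) +
      \int[mu]_(s in `[0, t]) (b s * \int[mu]_(r in `[0, s]) a r) =
      (\int[mu]_(s in `[0, t]) a s) * (\int[mu]_(s in `[0, t]) b s)].
Proof.
move=> ia ib.
have mid_phase : measurable `[0, t]%classic by [].
have res (c : R -> R) : rintegrable mu `[0, t] c -> rintegrable mu setT (c \_ `[0, t]).
  by move=> ic; have := (@integrable_mkcond _ _ R mu _ (EFin \o c) mid_phase).1 ic; rewrite restrict_EFin.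
have inner (c : R -> R) s : `[0, t]%classic s ->
    \int[mu]_(r in `]-oo, s]) (c \_ `[0, t]) r = \int[mu]_(r in `[0, s]) c r.
  rewrite /= in_itv/= => /andP[s0 st]; rewrite -Rintegral_mkcondr; congr Rintegral.
  apply/seteqP; split => x /=; rewrite !in_itv/=; first by move=> [xs /andP[-> _]].
  by move=> /andP[x0 xs]; rewrite x0 xs (le_trans xs st).
have outer (c e : R -> R) :
   (fun s => (c \_ `[0, t]) s * (\int[mu]_(r in `]-oo, s]) (e \_ `[0, t]) r)) =
   ((fun s => c s * \int[mu]_(r in `[0, s]) e r) \_ `[0, t]).
  apply/funext => s; rewrite !patchE; case: ifPn => [|_]; last by rewrite mul0r.
  by rewrite inE => ts; rewrite inner.
have [] := Rint_triangle (res _ ia) (res _ ib).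
rewrite !outer.
rewrite -!Rintegral_mkcond => h1 h2 h3; split => //.
- by apply/(@integrable_mkcond _ _ R mu _ _ mid_phase); rewrite restrict_EFin.
- by apply/(@integrable_mkcond _ _ R mu _ _ mid_phase); rewrite restrict_EFin.
Qed.

(** Absolute continuity in integrated form, with the density as part of the data: the modes of a
    solution come with an integrable density from Duhamel's formula, and calculus on them is
    calculus of integrals. *)
Definition rAC (T : R) A a := rintegrable mu `[0, T] a /\
  forall t, 0 <= t <= T -> A t = A 0 + \int[mu]_(s in `[0, t]) a s.

Lemma rint_itvS (t T : R) a : 0 <= t <= T -> rintegrable mu `[0, T] a -> rintegrable mu `[0, t] a.
Proof. by move=> /andP[_ tT]; apply: integrableS => //; exact: itv0S. Qed.

Lemma rAC_meas T A a : 0 <= T -> rAC T A a -> measurable_fun `[0, T] A.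
Proof.
move=> T0 [ia Aa].
have := parameterized_integral_continuous T0 ia.
move=> /(subspace_continuous_measurable_fun (measurable_itv _)) => mI.
have : measurable_fun `[0, T] (fun t => A 0 + parameterized_integral mu 0 t a).
  by apply: measurable_funD.
apply: eq_measurable_fun => t; rewrite inE/= in_itv/= => t0T.
by rewrite (Aa t t0T).
Qed.

Lemma rAC_bdd T A a : 0 <= T -> rAC T A a -> exists M : R, forall t, 0 <= t <= T -> `|A t| <= M.
Proof.
move=> T0 [ia Aa]; exists (`|A 0| + \int[mu]_(s in `[0, T]) `|a s|) => t tT.
rewrite (Aa t tT); apply: (le_trans (ler_normD _ _)); rewrite lerD2l.
have iat := rint_itvS tT ia.
apply: (le_trans (le_normr_Rintegral _ iat)) => //.
rewrite /Rintegral fine_le//.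
- by apply: integrable_fin_num => //; exact: integrable_norm.
- by apply: integrable_fin_num => //; exact: integrable_norm.
apply: ge0_subset_integral => //; last by apply: itv0S; case/andP: tT.
by apply/measurable_EFinP; apply: measurableT_comp => //; exact: rint_meas ia.
Qed.

Lemma rAC_integrableM T A a b : 0 <= T -> rAC T A a -> rintegrable mu `[0, T] b ->
  rintegrable mu `[0, T] (fun s => A s * b s).
Proof.
move=> T0 AA ib; have [M AM] := rAC_bdd T0 AA.
apply: (@rint_le _ _ R mu _ _ _ (fun s => M * `|b s|)) => //.
- by apply: measurable_funM; [exact: rAC_meas AA|exact: rint_meas ib].
- by move=> s; rewrite /= in_itv/= => sT; rewrite normrM ler_wpM2r// AM.
- by apply: rintZ => //; exact: integrable_norm.
Qed.

Lemma rAC_mul T A a B b : 0 <= T -> rAC T A a -> rAC T B b ->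
  rAC T (fun t => A t * B t) (fun t => a t * B t + A t * b t).
Proof.
move=> T0 AA BB; have [ia Aa] := AA; have [ib Bb] := BB.
have i1 : rintegrable mu `[0, T] (fun t => a t * B t).
  have -> : (fun t => a t * B t) = (fun t => B t * a t) by apply/funext => t; rewrite mulrC.
  exact: (rAC_integrableM T0 BB ia).
have i2 : rintegrable mu `[0, T] (fun t => A t * b t) by exact: (rAC_integrableM T0 AA ib).
split; first exact: rintD.
move=> t tT.
have iat := rint_itvS tT ia; have ibt := rint_itvS tT ib.
rewrite RintegralD//; [|exact: rint_itvS i1|exact: rint_itvS i2].
have [p1 p2 E] := Rint_parts iat ibt.
have sT s : s \in `[0, t]%classic -> 0 <= s <= T.
  by rewrite inE/= in_itv/= => /andP[-> st]; case/andP: tT => _; exact: le_trans.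
have -> : \int[mu]_(s in `[0, t]) (a s * B s) =
   B 0 * \int[mu]_(s in `[0, t]) a s + \int[mu]_(s in `[0, t]) (a s * \int[mu]_(r in `[0, s]) b r).
  rewrite -RintegralZl// -RintegralD//; last exact: rintZ.
  by apply: eq_Rintegral => s st; rewrite (Bb s (sT s st)); ring.
have -> : \int[mu]_(s in `[0, t]) (A s * b s) =
   A 0 * \int[mu]_(s in `[0, t]) b s + \int[mu]_(s in `[0, t]) (b s * \int[mu]_(r in `[0, s]) a r).
  rewrite -RintegralZl// -RintegralD//; last exact: rintZ.
  by apply: eq_Rintegral => s st; rewrite (Aa s (sT s st)); ring.
rewrite (Aa t tT) (Bb t tT).
set IA := \int[mu]_(s in `[0, t]) a s in E *; set IB := \int[mu]_(s in `[0, t]) b s in E *.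
rewrite addrACA E; ring.
Qed.

Lemma rAC_add T A a B b : rAC T A a -> rAC T B b ->
  rAC T (fun t => A t + B t) (fun t => a t + b t).
Proof.
move=> [ia Aa] [ib Bb]; split; first exact: rintD.
move=> t tT; rewrite RintegralD//; [|exact: rint_itvS ia|exact: rint_itvS ib].
by rewrite (Aa t tT) (Bb t tT); ring.
Qed.

Lemma rAC_scale T c A a : rAC T A a -> rAC T (fun t => c * A t) (fun t => c * a t).
Proof.
move=> [ia Aa]; split; first exact: rintZ.
by move=> t tT; rewrite RintegralZl//; [rewrite (Aa t tT) mulrDr|exact: rint_itvS ia].
Qed.

Lemma rAC_opp T A a : rAC T A a -> rAC T (fun t => - A t) (fun t => - a t).
Proof.
move=> /(rAC_scale (-1)); have E (f : R -> R) : (fun t => -1 * f t) = (fun t => - f t).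
  by apply/funext => t; rewrite mulN1r.
by rewrite !E.
Qed.

Lemma rAC_cst T c : rAC T (fun=> c) (fun=> 0).
Proof.
split; first exact: integrable0.
by move=> t _; rewrite Rintegral_cst// mul0r addr0.
Qed.

Lemma rAC_C1 T (A a : R -> R) : 0 <= T -> (forall t : R, is_derive t 1 A (a t)) -> continuous a -> rAC T A a.
Proof.
move=> T0 dA ca.
have ia (t : R) : rintegrable mu `[0, t] a.
  apply: continuous_compact_integrable; first exact: segment_compact.
  exact: continuous_subspaceT.
split => // t /andP[t0 tT].
move: t0; rewrite le_eqVlt => /predU1P[<-|t0].
  by rewrite set_itv1 Rintegral_set1 addr0.
have cA : continuous A.
  by move=> x; apply: differentiable_continuous; apply/derivable1_diffP.
have := @continuous_FTC2 R a A 0 t t0 (continuous_subspaceT ca).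
rewrite /Rintegral => ->.
- by rewrite -EFinB /= addrC subrK.
- split => //.
  + by apply: cvg_at_right_filter; exact: cA.
  + by apply: cvg_at_left_filter; exact: cA.
- by move=> x _; rewrite derive1E derive_val.
Qed.

Lemma is_derive_mulr (w t : R) : is_derive t 1 (fun t => w * t) w.
Proof.
have := is_deriveZ w (is_derive_id t (1 : R)).
by rewrite /GRing.scale/= mulr1.
Qed.

Lemma rAC_cos T w : 0 <= T -> rAC T (fun t => cos (w * t)) (fun t => - (w * sin (w * t))).
Proof.
move=> T0; apply: rAC_C1 => // [t|].
  have := is_derive1_comp (is_derive_cos (w * t)) (is_derive_mulr w t).
  by rewrite mulNr mulrC.
move=> t; apply: cvgN; apply: cvgMr; apply: continuous_comp; last exact: continuous_sin.
exact: mulrl_continuous.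
Qed.

Lemma rAC_sin T w : 0 <= T -> rAC T (fun t => sin (w * t)) (fun t => w * cos (w * t)).
Proof.
move=> T0; apply: rAC_C1 => // [t|].
  have := is_derive1_comp (is_derive_sin (w * t)) (is_derive_mulr w t).
  by rewrite mulrC.
move=> t; apply: cvgMr; apply: continuous_comp; last exact: continuous_cos.
exact: mulrl_continuous.
Qed.

Implicit Types (f g df dg : R -> R[i]).

Definition cAC (T : R) f df :=
  rAC T (fun t => Re (f t)) (fun t => Re (df t)) /\
  rAC T (fun t => Im (f t)) (fun t => Im (df t)).

Definition tint (t : R) f : R[i] := Cintegral mu `[0, t]%classic f.

Lemma eq_cAC T f df g dg : f =1 g -> df =1 dg -> cAC T f df -> cAC T g dg.
Proof. by move=> /funext -> /funext ->. Qed.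

Lemma cAC_add T f df g dg : cAC T f df -> cAC T g dg ->
  cAC T (fun t => f t + g t) (fun t => df t + dg t).
Proof.
move=> [a b] [a' b']; split; rewrite /=.
  by have := rAC_add a a'; congr rAC; apply/funext => t; rewrite cReD.
by have := rAC_add b b'; congr rAC; apply/funext => t; rewrite cImD.
Qed.

Lemma cAC_mul T f df g dg : 0 <= T -> cAC T f df -> cAC T g dg ->
  cAC T (fun t => f t * g t) (fun t => df t * g t + f t * dg t).
Proof.
move=> T0 [a b] [a' b']; split; rewrite /=.
  have := rAC_add (rAC_mul T0 a a') (rAC_opp (rAC_mul T0 b b')).
  by congr rAC; apply/funext => t; rewrite ?cReD !cReM//; ring.
have := rAC_add (rAC_mul T0 a b') (rAC_mul T0 b a').
by congr rAC; apply/funext => t; rewrite ?cImD !cImM//; ring.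
Qed.

Lemma cAC_conj T f df : cAC T f df -> cAC T (fun t => conjc (f t)) (fun t => conjc (df t)).
Proof.
move=> [a b]; split.
  by have := a; congr rAC; apply/funext => t; rewrite cReJ.
by have := rAC_opp b; congr rAC; apply/funext => t; rewrite cImJ.
Qed.

Lemma cAC_cst T z : cAC T (fun=> z) (fun=> 0).
Proof. by split; exact: rAC_cst. Qed.

Lemma cAC_scale T z f df : 0 <= T -> cAC T f df -> cAC T (fun t => z * f t) (fun t => z * df t).
Proof.
move=> T0 /(cAC_mul T0 (cAC_cst T z)); apply: eq_cAC => // t.
by rewrite mul0r add0r.
Qed.

Lemma cAC_opp T f df : cAC T f df -> cAC T (fun t => - f t) (fun t => - df t).
Proof.
move=> [a b]; split.
  by have := rAC_opp a; congr rAC; apply/funext => t; rewrite cReN.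
by have := rAC_opp b; congr rAC; apply/funext => t; rewrite cImN.
Qed.

Lemma cAC_sub T f df g dg : cAC T f df -> cAC T g dg ->
  cAC T (fun t => f t - g t) (fun t => df t - dg t).
Proof. by move=> a b; apply: cAC_add => //; exact: cAC_opp. Qed.

Lemma cAC_sum T (I : Type) (s : seq I) (F dF : I -> R -> R[i]) :
  (forall i, cAC T (F i) (dF i)) ->
  cAC T (fun t => \sum_(i <- s) F i t) (fun t => \sum_(i <- s) dF i t).
Proof.
move=> h; elim: s => [|i s IH].
  by apply: eq_cAC (cAC_cst T 0) => t; rewrite big_nil.
by apply: eq_cAC (cAC_add (h i) IH) => t; rewrite big_cons.
Qed.

Lemma cAC_cis T w : 0 <= T -> cAC T (fun t => cis (w * t)) (fun t => ('i%C * w%:C) * cis (w * t)).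
Proof.
move=> T0; split.
  have := rAC_cos w T0; congr rAC; apply/funext => t /=; simpc => /=; ring.
have := rAC_sin w T0; congr rAC; apply/funext => t /=; simpc => /=; ring.
Qed.

Lemma cAC_cint T f df : cAC T f df -> cintegrable mu `[0, T] df.
Proof. by move=> [[a _] [b _]]. Qed.

Lemma cAC_eq T f df t : cAC T f df -> 0 <= t <= T -> f t = f 0 + tint t df.
Proof.
move=> [[_ a] [_ b]] tT; apply: eq_ReIm; rewrite ?cReD ?cImD/=; [exact: a|exact: b].
Qed.

Lemma cAC_of T f df : cintegrable mu `[0, T] df ->
  (forall t, 0 <= t <= T -> f t = f 0 + tint t df) -> cAC T f df.
Proof.
move=> [ia ib] h; split; split => // t tT.
  by rewrite {1}(h t tT) cReD.
by rewrite {1}(h t tT) cImD.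
Qed.

Lemma cAC_meas T f df : 0 <= T -> cAC T f df -> cmeas_on `[0, T] f.
Proof. by move=> T0 [a b]; split; [exact: rAC_meas a|exact: rAC_meas b]. Qed.

Lemma cint_itvS (t T : R) f : 0 <= t <= T -> cintegrable mu `[0, T] f -> cintegrable mu `[0, t] f.
Proof. by move=> tT [a b]; split; apply: rint_itvS tT _. Qed.

Lemma cAC_intM T f df g : 0 <= T -> cAC T f df -> cintegrable mu `[0, T] g ->
  cintegrable mu `[0, T] (fun s => f s * g s).
Proof.
move=> T0 [a b] [c d]; split.
  have := rintB (mseg 0 T) (rAC_integrableM T0 a c) (rAC_integrableM T0 b d).
  by congr rintegrable; apply/funext => s; rewrite cReM.
have := rintD (mseg 0 T) (rAC_integrableM T0 a d) (rAC_integrableM T0 b c).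
by congr rintegrable; apply/funext => s; rewrite cImM.
Qed.

Lemma cAC_int T f df : 0 <= T -> cAC T f df -> cintegrable mu `[0, T] f.
Proof.
move=> T0 a; have := cAC_intM T0 a (g := fun=> 1).
have -> : (fun s => f s * 1) = f by apply/funext => s; rewrite mulr1.
apply; split; apply: continuous_compact_integrable; try exact: segment_compact;
by apply: continuous_subspaceT => x; exact: cvg_cst.
Qed.

(** The increment of f(s) e^(i w s) is i w times the integral sought plus the integral of f'(s) e^(i
    w s); dividing by |w| is the gain. *)
Lemma nonresonant_int T f df w t : 0 <= T -> cAC T f df -> w != 0 -> 0 <= t <= T ->
  cmod (tint t (fun s => f s * cis (w * s))) <=
  (cmod (f t) + cmod (f 0) + \int[mu]_(s in `[0, t]) cmod (df s)) / `|w|.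
Proof.
move=> T0 a w0 tT.
have ac := cAC_cis w T0.
have := cAC_eq (cAC_mul T0 a ac) tT.
have i1 : cintegrable mu `[0, t] (fun s => df s * cis (w * s)).
  apply: (cint_itvS tT).
  have := cAC_intM T0 ac (cAC_cint a).
  by congr cintegrable; apply/funext => s; rewrite mulrC.
have i2 : cintegrable mu `[0, t] (fun s => f s * cis (w * s)).
  apply: (cint_itvS tT).
  exact: cAC_intM T0 a (cAC_int T0 ac).
rewrite /tint CintD//; last first.
  have := cintZ (mseg 0 t) ('i%C * w%:C) i2; congr cintegrable.
  by apply/funext => s; ring.
have -> : (fun s => f s * ('i%C * w%:C * cis (w * s))) =
   (fun s => ('i%C * w%:C) * (f s * cis (w * s))) by apply/funext => s; ring.
rewrite CintZ// mulr0 cis0 mulr1.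
set I := Cintegral mu _ _; set J := Cintegral mu _ _ => E.
have {}E : 'i%C * w%:C * J = f t * cis (w * t) - f 0 - I by rewrite E; ring.
have : cmod ('i%C * w%:C * J) = `|w| * cmod J by rewrite !cmodM cmod_i mul1r cmod_real.
rewrite E => E2.
rewrite ler_pdivlMr ?normr_gt0// mulrC -E2.
apply: (le_trans (cmodB _ _)); apply: lerD.
  by apply: (le_trans (cmodB _ _)); rewrite cmodM cmod_cis mulr1.
apply: (le_trans (cmod_Cint_le _ i1)) => //.
by under eq_Rintegral do rewrite cmodM cmod_cis mulr1.
Qed.

End AbsolutelyContinuous.

(** * Nonresonant sums integrated by parts in time *)

Section NormalForm.
Context {R : realType}.
Notation mu := (@lebesgue_measure R).

(** [x] is a test sequence at the output frequency j = p + l + m; the other factors are those of the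
    cubic term f g conj(w). *)
Definition quartic (x f g w : int -> R -> R[i]) (y : int * int * int) (s : R) : R[i] :=
  x (y.1.1 + y.1.2 + y.2) s * f (y.1.1 + y.1.2) s * g (y.1.1 + y.2) s * conjc (w y.1.1 s).

Definition dquartic (x dx f df g dg w dw : int -> R -> R[i]) (y : int * int * int) (s : R) : R[i] :=
  quartic dx f g w y s + quartic x df g w y s + quartic x f dg w y s + quartic x f g dw y s.

(* j^2 - (p+l)^2 - (p+m)^2 + p^2 = 2 l m for j = p + l + m. *)
Definition freq (sg : R) (y : int * int * int) : R := 2 * sg * (y.1.2%:~R * y.2%:~R).

Lemma cmod_quartic x f g w y s : cmod (quartic x f g w y s) =
  cmod (x (y.1.1 + y.1.2 + y.2) s) * cmod (f (y.1.1 + y.1.2) s) *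
  cmod (g (y.1.1 + y.2) s) * cmod (w y.1.1 s).
Proof. by rewrite /quartic !cmodM cmod_conj. Qed.

Lemma quartic_AC (T : R) x dx f df g dg w dw y : 0 <= T ->
  (forall k, cAC T (x k) (dx k)) -> (forall k, cAC T (f k) (df k)) ->
  (forall k, cAC T (g k) (dg k)) -> (forall k, cAC T (w k) (dw k)) ->
  cAC T (quartic x f g w y) (dquartic x dx f df g dg w dw y).
Proof.
move=> T0 ax af ag aw.
have := cAC_mul T0 (cAC_mul T0 (cAC_mul T0 (ax (y.1.1 + y.1.2 + y.2)) (af (y.1.1 + y.1.2)))
  (ag (y.1.1 + y.2))) (cAC_conj (aw y.1.1)).
by apply: eq_cAC => s //; rewrite /dquartic /quartic; ring.
Qed.

Lemma normr_freq sg y : `|sg| = 1 -> (`|freq sg y|)^-1 = 2^-1 * inv_lm y.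
Proof.
move=> sg1; rewrite /freq /inv_lm !normrM sg1 mulr1 ger0_norm// -!intr_norm.
by rewrite -!abszE invfM.
Qed.

Lemma freq_neq0 sg y N : `|sg| = 1 -> offaxis N y -> freq sg y != 0.
Proof.
move=> sg1 /and3P[l0 m0 _]; rewrite /freq !mulf_neq0 ?intr_eq0//.
by rewrite -normr_eq0 sg1 oner_eq0.
Qed.

Lemma inv_lm_ge0 y : 0 <= inv_lm y :> R.
Proof. by rewrite invr_ge0 mulr_ge0. Qed.

Lemma nonresonant_sum (T sg : R) (r : seq (int * int * int)) (N : nat)
    (P dP : int * int * int -> R -> R[i]) (b0 : R) (b : R -> R) t :
  0 <= T -> `|sg| = 1 -> (forall y, y \in r -> offaxis N y) ->
  (forall y, cAC T (P y) (dP y)) -> 0 <= t <= T ->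
  \sum_(y <- r) (cmod (P y t) + cmod (P y 0)) * inv_lm y <= b0 ->
  rintegrable mu `[0, T] b ->
  (forall s, 0 <= s <= T -> \sum_(y <- r) cmod (dP y s) * inv_lm y <= b s) ->
  cmod (tint t (fun s => \sum_(y <- r) P y s * cis (freq sg y * s))) <=
  b0 + \int[mu]_(s in `[0, t]) b s.
Proof.
move=> T0 sg1 rP aP tT h0 ib hb.
have icis y : cAC T (fun s => cis (freq sg y * s)) (fun s => 'i%C * (freq sg y)%:C * cis (freq sg y * s)).
  exact: cAC_cis.
have iP y : cintegrable mu `[0, t] (fun s => P y s * cis (freq sg y * s)).
  by apply: (cint_itvS tT); exact: cAC_intM T0 (aP y) (cAC_int T0 (icis y)).
have idP y : rintegrable mu `[0, t] (fun s => cmod (dP y s)).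
  by apply: (rint_itvS tT); apply: cint_cmod => //; exact: cAC_cint (aP y).
rewrite /tint Cint_sum//; apply: (le_trans (cmod_sum _ _ _)).
apply: (@le_trans _ _ (\sum_(y <- r) (cmod (P y t) + cmod (P y 0) +
    \int[mu]_(s in `[0, t]) cmod (dP y s)) * inv_lm y)).
  rewrite big_seq [leRHS]big_seq; apply: ler_sum => y yr.
  apply: (le_trans (nonresonant_int T0 (aP y) (freq_neq0 sg1 (rP y yr)) tT)).
  rewrite normr_freq// mulrA; apply: ler_wpM2r; first exact: inv_lm_ge0.
  (* The factor 1/2 of 1 / |2 l m| is dropped. *)
  rewrite ler_piMr//; last by rewrite invf_le1// ler1n.
  by rewrite !addr_ge0 ?cmod_ge0// Rintegral_ge0// => s _; exact: cmod_ge0.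
under eq_bigr do rewrite mulrDl.
rewrite big_split/=; apply: lerD => //.
have -> : \sum_(y <- r) (\int[mu]_(s in `[0, t]) cmod (dP y s)) * inv_lm y =
    \int[mu]_(s in `[0, t]) \sum_(y <- r) inv_lm y * cmod (dP y s).
  have -> : \int[mu]_(s in `[0, t]) \sum_(y <- r) inv_lm y * cmod (dP y s) =
     \sum_(y <- r) \int[mu]_(s in `[0, t]) (inv_lm y * cmod (dP y s)).
    elim: r {rP h0 hb} => [|y r IH].
      by under eq_Rintegral do rewrite big_nil; rewrite big_nil Rintegral_cst// mul0r.
    under eq_Rintegral do rewrite big_cons.
    rewrite RintegralD//; [by rewrite big_cons IH|exact: (rintZ (mseg 0 t))|].
    by apply: (rint_sum (mseg 0 t)) => z; exact: (rintZ (mseg 0 t)).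
  by apply: eq_bigr => y _; rewrite (RintegralZl _ (mseg 0 t) (idP y)) mulrC.
apply: le_Rintegral => //.
- by apply: (rint_sum (mseg 0 t)) => z; exact: (rintZ (mseg 0 t)).
- exact: rint_itvS tT ib.
move=> s /=; rewrite in_itv/= => /andP[s0 st].
under eq_bigr do rewrite mulrC.
by apply: hb; rewrite s0 (le_trans st)//; case/andP: tT.
Qed.

Section Quartic.
Variables (T sg X M : R) (N : nat) (gx h : R -> R).
Variables (x dx f df g dg w dw : int -> R -> R[i]) (r : seq (int * int * int)).
Hypotheses (T0 : 0 <= T) (sg1 : `|sg| = 1) (X0 : 0 <= X) (M0 : 0 <= M) (N0 : (0 < N)%N).
Hypotheses (ax : forall k, cAC T (x k) (dx k)) (af : forall k, cAC T (f k) (df k))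
  (ag : forall k, cAC T (g k) (dg k)) (aw : forall k, cAC T (w k) (dw k)).
Hypotheses (lx : forall s, 0 <= s <= T -> l2b (fun k => cmod (x k s)) X)
  (lf : forall s, 0 <= s <= T -> l2b (fun k => cmod (f k s)) M)
  (lg : forall s, 0 <= s <= T -> l2b (fun k => cmod (g k s)) M)
  (lw : forall s, 0 <= s <= T -> l2b (fun k => cmod (w k s)) M).
Hypotheses (bx : forall k s, 0 <= s <= T -> cmod (dx k s) <= gx s)
  (bf : forall k s, 0 <= s <= T -> cmod (df k s) <= h s)
  (bg : forall k s, 0 <= s <= T -> cmod (dg k s) <= h s)
  (bw : forall k s, 0 <= s <= T -> cmod (dw k s) <= h s).
Hypotheses (igx : rintegrable mu `[0, T] gx) (ih : rintegrable mu `[0, T] h).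
Hypotheses (ur : uniq r) (rP : forall y, y \in r -> offaxis N y).

Lemma quartic_bound s : 0 <= s <= T ->
  \sum_(y <- r) cmod (quartic x f g w y s) * inv_lm y <= kap N * (X * M ^+ 3).
Proof.
move=> sT.
have -> : X * M ^+ 3 = X * M * M * M by ring.
under eq_bigr do rewrite cmod_quartic.
apply: (parallelogram_all (X := fun k => cmod (x k s)) (F := fun k => cmod (f k s))
  (G := fun k => cmod (g k s)) (W := fun k => cmod (w k s))) => //;
  try (by move=> ?; exact: cmod_ge0); auto.
Qed.

(** Leibniz's rule differentiates one vertex at a time; the derivative is bounded by [gx] or [h]
    uniformly in the frequency, and the version of the parallelogram estimate without this vertex
    handles the three others. *)
Lemma dquartic_bound s : 0 <= s <= T ->
  \sum_(y <- r) cmod (dquartic x dx f df g dg w dw y s) * inv_lm y <=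
  kap N * (gx s * M ^+ 3 + 3 * h s * X * M ^+ 2).
Proof.
move=> sT.
have h0 : 0 <= h s by apply: le_trans (bf 0 sT); exact: cmod_ge0.
have g0 : 0 <= gx s by apply: le_trans (bx 0 sT); exact: cmod_ge0.
have c0 (a : int -> R -> R[i]) k : 0 <= cmod (a k s) by exact: cmod_ge0.
apply: (@le_trans _ _ (\sum_(y <- r) (
   gx s * (cmod (f (y.1.1 + y.1.2) s) * cmod (g (y.1.1 + y.2) s) * cmod (w y.1.1 s) * inv_lm y) +
   h s * (cmod (x (y.1.1 + y.1.2 + y.2) s) * cmod (g (y.1.1 + y.2) s) * cmod (w y.1.1 s) * inv_lm y) +
   h s * (cmod (x (y.1.1 + y.1.2 + y.2) s) * cmod (f (y.1.1 + y.1.2) s) * cmod (w y.1.1 s) * inv_lm y) +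
   h s * (cmod (x (y.1.1 + y.1.2 + y.2) s) * cmod (f (y.1.1 + y.1.2) s) * cmod (g (y.1.1 + y.2) s) * inv_lm y)))).
  apply: ler_sum => y _.
  pose cx := cmod (x (y.1.1 + y.1.2 + y.2) s); pose cf := cmod (f (y.1.1 + y.1.2) s).
  pose cg := cmod (g (y.1.1 + y.2) s); pose cw := cmod (w y.1.1 s).
  suff e : cmod (dquartic x dx f df g dg w dw y s) <=
      gx s * (cf * cg * cw) + h s * (cx * cg * cw) + h s * (cx * cf * cw) + h s * (cx * cf * cg).
    by have := ler_wpM2r (inv_lm_ge0 y) e; congr (_ <= _); rewrite /cx /cf /cg /cw; ring.
  have step (u v c : R) : 0 <= c -> u <= v -> u * c <= v * c by move=> c0' uv; exact: ler_wpM2r.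
  rewrite /dquartic; apply: (le_trans (cmodD _ _)); apply: lerD;
    [apply: (le_trans (cmodD _ _)); apply: lerD;
      [apply: (le_trans (cmodD _ _)); apply: lerD|]|];
    rewrite cmod_quartic -/cx -/cf -/cg -/cw.
  - have := step _ _ (cf * cg * cw) _ (bx (y.1.1 + y.1.2 + y.2) sT).
    by rewrite !mulrA; apply; rewrite !mulr_ge0// c0.
  - have := step _ _ (cx * cg * cw) _ (bf (y.1.1 + y.1.2) sT).
    by rewrite !mulr_ge0 ?c0// => /(_ isT); congr (_ <= _); ring.
  - have := step _ _ (cx * cf * cw) _ (bg (y.1.1 + y.2) sT).
    by rewrite !mulr_ge0 ?c0// => /(_ isT); congr (_ <= _); ring.
  - have := step _ _ (cx * cf * cg) _ (bw y.1.1 sT).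
    by rewrite !mulr_ge0 ?c0// => /(_ isT); congr (_ <= _); ring.
rewrite !big_split/= -!mulr_sumr.
have b0 := @parallelogram_no3 _ r N _ _ _ _ _ _ ur N0 (c0 f) (c0 g) (c0 w) M0 M0 M0 (lf sT) (lg sT) (lw sT) rP.
have b1 := @parallelogram_no1 _ r N _ _ _ _ _ _ ur N0 (c0 x) (c0 g) (c0 w) X0 M0 M0 (lx sT) (lg sT) (lw sT) rP.
have b2 := @parallelogram_no2 _ r N _ _ _ _ _ _ ur N0 (c0 x) (c0 f) (c0 w) X0 M0 M0 (lx sT) (lf sT) (lw sT) rP.
have b3 := @parallelogram_no0 _ r N _ _ _ _ _ _ ur N0 (c0 x) (c0 f) (c0 g) X0 M0 M0 (lx sT) (lf sT) (lg sT) rP.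
have -> : kap N * (gx s * M ^+ 3 + 3 * h s * X * M ^+ 2) =
  gx s * (kap N * (M * M * M)) + h s * (kap N * (X * M * M)) +
  h s * (kap N * (X * M * M)) + h s * (kap N * (X * M * M)) by ring.
by repeat apply: lerD; apply: ler_wpM2l.
Qed.

Lemma normal_form t : 0 <= t <= T ->
  cmod (tint t (fun s => \sum_(y <- r) quartic x f g w y s * cis (freq sg y * s))) <=
  kap N * (2 * (X * M ^+ 3)) +
  \int[mu]_(s in `[0, t]) (kap N * (gx s * M ^+ 3 + 3 * h s * X * M ^+ 2)).
Proof.
move=> tT.
apply: (nonresonant_sum (T := T) (N := N) (dP := dquartic x dx f df g dg w dw)) => //.
- by move=> y; exact: quartic_AC.
- under eq_bigr do rewrite mulrDl.
  rewrite big_split/= mulr2n mulrDl mul1r mulrDr; apply: lerD; apply: quartic_bound => //.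
  by rewrite lexx.
- apply: (rintZ (mseg 0 T)); apply: (rintD (mseg 0 T)).
    have -> : (fun s => gx s * M ^+ 3) = (fun s => M ^+ 3 * gx s).
      by apply/funext => s; rewrite mulrC.
    exact: (rintZ (mseg 0 T)).
  have -> : (fun s => 3 * h s * X * M ^+ 2) = (fun s => (3 * X * M ^+ 2) * h s).
    by apply/funext => s; ring.
  exact: (rintZ (mseg 0 T)).
- exact: dquartic_bound.
Qed.

End Quartic.
End NormalForm.

(** * Fourier series in L^2 of the torus *)

Section TorusL2.
Context {R : realType}.
Notation mu := (@lebesgue_measure R).
Notation D := (torus R).
Implicit Types (f g p : R -> R[i]).

Lemma twopi_gt0 : 0 < 2 * pi :> R.
Proof. by rewrite mulr_gt0// pi_gt0. Qed.

(** L^2 of the fundamental domain, without periodicity: cutoffs, averages and difference quotients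
    stay in this class. *)
Definition sqi f := cmeas_on D f /\ rintegrable mu D (fun x => cmod (f x) ^+ 2).

Lemma mtorus : measurable (D : set (measurableTypeR R)).
Proof. exact: mseg. Qed.

#[local] Hint Resolve mtorus : core.

Lemma rint_cst (c : R) : rintegrable mu D (fun=> c).
Proof.
apply: continuous_compact_integrable; first exact: segment_compact.
by apply: continuous_subspaceT => x; exact: cvg_cst.
Qed.

Lemma sqi_bdd f (c : R) : cmeas_on D f -> (forall x, D x -> cmod (f x) <= c) -> sqi f.
Proof.
move=> mf bf; split => //; apply: (@rint_le _ _ R mu _ mtorus _ (fun=> c ^+ 2)).
- exact: meas_cmodX.
- by move=> x Dx; rewrite ger0_norm ?sqr_ge0// lerXn2r ?nnegrE ?cmod_ge0 ?bf// (le_trans (cmod_ge0 _) (bf x Dx)).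
- exact: rint_cst.
Qed.

Lemma meas_mulr (w : R) E : measurable_fun E (fun x : R => w * x).
Proof. by apply: measurable_funTS; exact: mulrl_measurable. Qed.

Lemma sqi_cis (w : R) : sqi (fun x => cis (w * x)).
Proof.
apply: (@sqi_bdd _ 1); last by move=> x _; rewrite cmod_cis.
by apply: cmeas_cis; exact: meas_mulr.
Qed.

Lemma sqiZ z f : sqi f -> sqi (fun x => z * f x).
Proof.
move=> [mf i2]; split; first by apply: cmeasM => //; exact: cmeas_cst.
under eq_fun do rewrite cmodM exprMn.
exact: (rintZ mtorus).
Qed.

Lemma sqi_conj f : sqi f -> sqi (fun x => conjc (f x)).
Proof.
move=> [mf i2]; split; first exact: cmeasJ.
by under eq_fun do rewrite cmod_conj.
Qed.

Lemma sqiM_bdd h f (c : R) : cmeas_on D h -> (forall x, D x -> cmod (h x) <= c) -> sqi f ->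
  sqi (fun x => h x * f x).
Proof.
move=> mh bh [mf i2]; split; first exact: cmeasM.
apply: (@rint_le _ _ R mu _ mtorus _ (fun x => c ^+ 2 * cmod (f x) ^+ 2)); last exact: (rintZ mtorus).
  by apply: meas_cmodX; exact: cmeasM.
move=> x Dx; rewrite ger0_norm ?sqr_ge0// cmodM exprMn ler_wpM2r ?sqr_ge0//.
by rewrite lerXn2r ?nnegrE ?cmod_ge0 ?bh// (le_trans (cmod_ge0 _) (bh x Dx)).
Qed.

Lemma sqi_CS f g : sqi f -> sqi g -> cintegrable mu D (fun x => f x * g x) /\
  \int[mu]_(x in D) (cmod (f x) * cmod (g x)) <= Num.sqrt (mass f) * Num.sqrt (mass g).
Proof.
move=> [mf if2] [mg ig2].
have [||ifg le] := Rint_CS mtorus (meas_cmod mf) (meas_cmod mg) _ _ if2 ig2; try by move=> x; exact: cmod_ge0.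
split.
  apply: (@cint_le _ _ R mu _ mtorus _ (fun x => cmod (f x) * cmod (g x))) => //.
    exact: cmeasM.
  by move=> x _; rewrite cmodM.
rewrite -sqrtrM; last by apply: Rintegral_ge0 => x _; exact: sqr_ge0.
rewrite -[leLHS]ger0_norm; last by apply: Rintegral_ge0 => x _; rewrite mulr_ge0 ?cmod_ge0.
by rewrite -sqrtr_sqr ler_sqrt// mulr_ge0// Rintegral_ge0// => x _; exact: sqr_ge0.
Qed.

Lemma mass_ge0 f : 0 <= mass f.
Proof. by apply: Rintegral_ge0 => x _; exact: sqr_ge0. Qed.

Definition nrm f : R := Num.sqrt (mass f).

Lemma nrm_ge0 f : 0 <= nrm f. Proof. exact: sqrtr_ge0. Qed.

Lemma nrm_sqr f : nrm f ^+ 2 = mass f.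
Proof. by rewrite sqr_sqrtr// mass_ge0. Qed.

Lemma cmod_int_CS f g : sqi f -> sqi g ->
  cmod (Cintegral mu D (fun x => f x * g x)) <= nrm f * nrm g.
Proof.
move=> sf sg; have [ifg le] := sqi_CS sf sg.
apply: le_trans le; apply: (le_trans (cmod_Cint_le mtorus ifg)).
by under eq_Rintegral do rewrite cmodM.
Qed.

Lemma sqiD f g : sqi f -> sqi g -> sqi (fun x => f x + g x).
Proof.
move=> [mf if2] [mg ig2]; split; first exact: cmeasD.
apply: (@rint_le _ _ R mu _ mtorus _ (fun x => 2 * (cmod (f x) ^+ 2 + cmod (g x) ^+ 2))).
- by apply: meas_cmodX; exact: cmeasD.
- move=> x _; rewrite ger0_norm ?sqr_ge0//.
  have := cmodD (f x) (g x); have := cmod_ge0 (f x + g x).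
  have := sqr_ge0 (cmod (f x) - cmod (g x)); nra.
- by apply: (rintZ mtorus); exact: (rintD mtorus).
Qed.

Lemma sqi_sum (I : Type) (s : seq I) (F : I -> R -> R[i]) :
  (forall i, sqi (F i)) -> sqi (fun x => \sum_(i <- s) F i x).
Proof.
move=> h; elim: s => [|i s IH].
  under eq_fun do rewrite big_nil.
  by apply: (@sqi_bdd _ 0) => [|x _]; [exact: cmeas_cst|rewrite cmod0].
by under eq_fun do rewrite big_cons; exact: sqiD.
Qed.

Lemma sqiN f : sqi f -> sqi (fun x => - f x).
Proof. by move/(sqiZ (-1)); under eq_fun do rewrite mulN1r. Qed.

Lemma sqiB f g : sqi f -> sqi g -> sqi (fun x => f x - g x).
Proof. by move=> sf sg; apply: sqiD => //; exact: sqiN. Qed.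

Lemma nrmD f g : sqi f -> sqi g -> nrm (fun x => f x + g x) <= nrm f + nrm g.
Proof.
move=> sf sg; have [[mf if2] [mg ig2]] := (sf, sg).
rewrite -(@ler_pXn2r _ 2)// ?nnegrE ?addr_ge0 ?nrm_ge0// sqrrD !nrm_sqr.
have [_ cs] := sqi_CS sf sg; rewrite -/(nrm f) -/(nrm g) in cs.
have ifg : rintegrable mu D (fun x => cmod (f x) * cmod (g x)).
  by have [||->] := Rint_CS mtorus (meas_cmod mf) (meas_cmod mg) _ _ if2 ig2; try by move=> x; exact: cmod_ge0.
apply: (@le_trans _ _ (\int[mu]_(x in D) (cmod (f x) ^+ 2 + 2 * (cmod (f x) * cmod (g x)) + cmod (g x) ^+ 2))).
  apply: le_Rintegral => //; first by case: (sqiD sf sg).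
    by apply: (rintD mtorus) => //; apply: (rintD mtorus) => //; exact: (rintZ mtorus).
  move=> x _; have := cmodD (f x) (g x); have := cmod_ge0 (f x + g x); nra.
rewrite RintegralD//; last by apply: (rintD mtorus) => //; exact: (rintZ mtorus).
rewrite RintegralD//; last exact: (rintZ mtorus).
rewrite RintegralZl// -/(mass f) -/(mass g) mulr2n; lra.
Qed.

Lemma nrmZ z f : sqi f -> nrm (fun x => z * f x) = cmod z * nrm f.
Proof.
move=> [mf if2]; rewrite /nrm /mass.
under eq_Rintegral do rewrite cmodM exprMn.
by rewrite (RintegralZl _ mtorus if2) sqrtrM ?sqr_ge0// sqrtr_sqr ger0_norm ?cmod_ge0.
Qed.

Lemma nrm_conj f : nrm (fun x => conjc (f x)) = nrm f.
Proof. by rewrite /nrm /mass; under eq_Rintegral do rewrite cmod_conj. Qed.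

Lemma nrmB f g : sqi f -> sqi g -> nrm (fun x => f x - g x) <= nrm f + nrm g.
Proof.
move=> sf sg; apply: (le_trans (nrmD sf (sqiN sg))); rewrite lerD2l.
rewrite /nrm /mass; under eq_Rintegral do rewrite cmodN; exact: lexx.
Qed.

Lemma mass_le_nrm f g : sqi f -> sqi g -> mass (fun x => f x + g x) <= 2 * mass f + 2 * mass g.
Proof.
move=> sf sg; have := nrmD sf sg; have := nrm_ge0 (fun x => f x + g x).
rewrite -!nrm_sqr; have := sqr_ge0 (nrm f - nrm g); nra.
Qed.

Lemma cis_nat2pi (n : nat) : cis (n%:R * (2 * pi)) = 1 :> R[i].
Proof.
elim: n => [|n IH]; first by rewrite mul0r cis0.
rewrite -natr1 mulrDl mul1r cisD IH mul1r /cis.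
by rewrite mulrC mulr_natr cos2pi sin2pi.
Qed.

Lemma cis_int2pi (k : int) : cis (k%:~R * (2 * pi)) = 1 :> R[i].
Proof.
case: k => n; first exact: cis_nat2pi.
by rewrite NegzE mulrNz mulNr cisN cis_nat2pi conjc1.
Qed.

Lemma cint_cis (w : R) : cintegrable mu D (fun x => cis (w * x)).
Proof. by have := cAC_int (ltW twopi_gt0) (cAC_cis w (ltW twopi_gt0)). Qed.

(** For k <> 0, i k times the integral is the increment of e^(i k x) over a period, which
    vanishes. *)
Lemma Cint_cis (k : int) :
  Cintegral mu D (fun x => cis (k%:~R * x)) = if k == 0 then (2 * pi)%:C else 0 :> R[i].
Proof.
have [->|k0] := eqVneq k 0.
  under eq_Cint do rewrite mul0r cis0.
  apply: eq_ReIm => /=; rewrite (Rintegral_cst mu mtorus)/= ?mul0r//.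
  rewrite mul1r /torus lebesgue_measure_itv/= lte_fin twopi_gt0.
  by rewrite -EFinD/= subr0.
have := cAC_eq (cAC_cis (k%:~R) (ltW twopi_gt0)) (t := 2 * pi).
rewrite lexx ltW ?twopi_gt0// => /(_ isT).
rewrite cis_int2pi mulr0 cis0 /tint CintZ//; last exact: cint_cis.
rewrite -/D => /eqP; rewrite addrC -subr_eq subrr eq_sym !mulf_eq0.
have -> : ('i%C : R[i]) == 0 = false by apply/negP => /eqP [/eqP]; rewrite oner_eq0.
have -> : ((k%:~R : R)%:C : R[i]) == 0 = false.
  by apply/negP => /eqP [/eqP]; rewrite intr_eq0 (negbTE k0).
by move=> /eqP.
Qed.

Notation fc := (@fourier_coef R).
Notation tpi := ((2 * pi)%:C : R[i]).

Lemma fcE f k : sqi f -> Cintegral mu D (fun x => f x * cis (- (k%:~R * x))) = tpi * fc f k.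
Proof.
move=> _; rewrite /fourier_coef mulrA -rmorphM/= mulfV ?mul1r//.
by rewrite gt_eqF// twopi_gt0.
Qed.

Lemma sqi_e (k : int) : sqi (fun x => cis (- (k%:~R * x))).
Proof. by under eq_fun do rewrite -mulNr; exact: sqi_cis. Qed.

Lemma sqi_eint f k : sqi f -> cintegrable mu D (fun x => f x * cis (- (k%:~R * x))).
Proof. by move=> sf; have [] := sqi_CS sf (sqi_e k). Qed.

Lemma sqi_int f g : sqi f -> sqi g -> cintegrable mu D (fun x => f x * g x).
Proof. by move=> sf sg; have [] := sqi_CS sf sg. Qed.

Definition trigp (s : seq int) (c : int -> R[i]) (x : R) : R[i] :=
  \sum_(k <- s) c k * cis (k%:~R * x).

Lemma sqi_trigp s c : sqi (trigp s c).
Proof. by apply: sqi_sum => k; apply: sqiZ; exact: sqi_cis. Qed.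

Lemma int_trigp f s c : sqi f ->
  Cintegral mu D (fun x => f x * conjc (trigp s c x)) =
  tpi * \sum_(k <- s) conjc (c k) * fc f k.
Proof.
move=> sf.
have -> : (fun x => f x * conjc (trigp s c x)) =
    (fun x => \sum_(k <- s) conjc (c k) * (f x * cis (- (k%:~R * x)))).
  apply/funext => x; rewrite /trigp cJ_sum mulr_sumr; apply: eq_bigr => k _.
  by rewrite cJM cisN; ring.
rewrite Cint_sum//; last by move=> k; apply: (cintZ mtorus); exact: sqi_eint.
rewrite mulr_sumr; apply: eq_bigr => k _.
by rewrite CintZ ?fcE//; [ring|exact: sqi_eint].
Qed.

Lemma fc_cis (k l : int) : fc (fun x => cis (k%:~R * x)) l = (k == l)%:R.
Proof.
rewrite /fourier_coef.
have -> : (fun x : R => cis (k%:~R * x) * cis (- (l%:~R * x))) = (fun x => cis ((k - l)%:~R * x) : R[i]).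
  by apply/funext => x; rewrite -cisD; congr cis; rewrite intrB; ring.
rewrite Cint_cis subr_eq0; case: eqP => _; last by rewrite mulr0.
by rewrite -rmorphM/= mulVf// gt_eqF// twopi_gt0.
Qed.

Lemma fcD f g k : sqi f -> sqi g -> fc (fun x => f x + g x) k = fc f k + fc g k.
Proof.
move=> sf sg; rewrite /fourier_coef -mulrDr -CintD//; try exact: sqi_eint.
by congr (_ * _); apply: eq_Cint => x _; ring.
Qed.

Lemma fcZ z f k : sqi f -> fc (fun x => z * f x) k = z * fc f k.
Proof.
move=> sf; rewrite /fourier_coef [RHS]mulrCA; congr (_ * _).
by rewrite -(CintZ mtorus z (sqi_eint k sf)); apply: eq_Cint => x _; ring.
Qed.

Lemma fcB f g k : sqi f -> sqi g -> fc (fun x => f x - g x) k = fc f k - fc g k.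
Proof.
move=> sf sg; rewrite fcD//; last exact: sqiN.
have -> : (fun x => - g x) = (fun x => -1 * g x) by apply/funext => x; rewrite mulN1r.
by rewrite fcZ// mulN1r.
Qed.

Lemma fc_trigp s c l : uniq s -> fc (trigp s c) l = if l \in s then c l else 0.
Proof.
move=> us.
have -> : fc (trigp s c) l = \sum_(k <- s) c k * (k == l)%:R.
  rewrite /trigp; elim: s {us} => [|k s IH].
    under eq_fun do rewrite big_nil.
    rewrite big_nil /fourier_coef; under eq_Cint do rewrite mul0r.
    by rewrite (Cint0 mu mtorus) mulr0.
  under eq_fun do rewrite big_cons.
  rewrite big_cons fcD ?IH ?fcZ ?fc_cis//.
  - exact: sqi_cis.
  - by apply: sqiZ; exact: sqi_cis.
  - exact: sqi_trigp.
case: ifPn => ls.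
  rewrite (big_rem l)//= eqxx mulr1 big_seq big1 ?addr0// => k.
  by rewrite mem_rem_uniq// inE => /andP[/negbTE -> _]; rewrite mulr0.
rewrite big_seq big1// => k ks; case: eqP => [kl|]; last by rewrite mulr0.
by rewrite -kl ks in ls.
Qed.

Lemma mass_Cint f : sqi f -> Cintegral mu D (fun x => f x * conjc (f x)) = (mass f)%:C.
Proof.
move=> _; under eq_Cint do rewrite mul_conj.
by apply: eq_ReIm => //=; rewrite (Rintegral_cst mu mtorus) mul0r.
Qed.

(** Completing the square in each frequency. It contains Bessel's inequality, for [c] equal to the
    coefficients of f, and the optimality of the Fourier partial sum among polynomials with
    frequencies in [s]. *)
Lemma mass_sub_trigp f s c : sqi f -> uniq s ->
  mass (fun x => f x - trigp s c x) =
  mass f + 2 * pi * (\sum_(k <- s) cmod (fc f k - c k) ^+ 2 - \sum_(k <- s) cmod (fc f k) ^+ 2).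
Proof.
move=> sf us; have sp := sqi_trigp s c.
apply: (@complexI R); rewrite -mass_Cint; last exact: sqiB.
have -> : (fun x => (f x - trigp s c x) * conjc (f x - trigp s c x)) =
   (fun x => f x * conjc (f x) - f x * conjc (trigp s c x)
     - (conjc (f x * conjc (trigp s c x)) - trigp s c x * conjc (trigp s c x))).
  by apply/funext => x; rewrite cJB cJM conjcK; ring.
have i1 : cintegrable mu D (fun x => f x * conjc (f x)) by apply: sqi_int => //; exact: sqi_conj.
have i2 : cintegrable mu D (fun x => f x * conjc (trigp s c x)).
  by apply: sqi_int => //; exact: sqi_conj.
have i3 : cintegrable mu D (fun x => trigp s c x * conjc (trigp s c x)).
  by apply: sqi_int => //; exact: sqi_conj.
have i4 := cintJ mtorus i2.
have i12 := cintB mtorus i1 i2; have i43 := cintB mtorus i4 i3.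
rewrite (CintB mtorus i12 i43) (CintB mtorus i1 i2) (CintB mtorus i4 i3).
rewrite (CintJ mtorus i2) mass_Cint// !int_trigp//.
have -> : \sum_(k <- s) conjc (c k) * fc (trigp s c) k = \sum_(k <- s) conjc (c k) * c k.
  by rewrite big_seq [RHS]big_seq; apply: eq_bigr => k ks; rewrite fc_trigp// ks.
rewrite RtoCD [X in _ = _ + X]RtoCM RtoCB !RtoC_sum cJM cJ_sum conjc_real.
rewrite -addrA; congr (_ + _).
rewrite -mulrBr -opprD -mulrDr -mulrN; congr (_ * _).
rewrite -!sumrB -big_split -sumrN; apply: eq_bigr => k _.
move: (fc f k) (c k) => F C /=.
rewrite -!mul_conj cJB cJM conjcK; ring.
Qed.

Lemma bessel f s : sqi f -> uniq s -> 2 * pi * \sum_(k <- s) cmod (fc f k) ^+ 2 <= mass f.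
Proof.
move=> sf us; have := mass_ge0 (fun x => f x - trigp s (fc f) x).
rewrite mass_sub_trigp// big1 ?add0r; first by lra.
by move=> k _; rewrite subrr cmod0 expr0n.
Qed.

Lemma l2b_fc f M : sqi f -> mass f <= 2 * pi * M ^+ 2 -> l2b (fun k => cmod (fc f k)) M.
Proof.
move=> sf fM s us; have := le_trans (bessel sf us) fM.
by rewrite (ler_pM2l twopi_gt0).
Qed.

End TorusL2.
Notation fc := (fourier_coef (R := _)).

(** * Fourier series of Lipschitz functions *)

Section Density.
Context {R : realType}.
Notation mu := (@lebesgue_measure R).
Notation D := (torus R).
Notation fc := (@fourier_coef R).
Implicit Types (f g p : R -> R[i]).
#[local] Hint Resolve mseg mtorus : core.

Lemma Rint_dct (a b : R) (h : nat -> R -> R) (H : R -> R) :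
  (forall n, measurable_fun `[a, b] (h n)) -> rintegrable mu `[a, b] H ->
  (forall n x, a <= x <= b -> `|h n x| <= H x) ->
  {ae mu, forall x, a <= x <= b -> h n x @[n --> \oo] --> (0 : R)} ->
  (fun n => \int[mu]_(x in `[a, b]) h n x) @ \oo --> (0 : R).
Proof.
move=> mh iH hH cvg.
have [] := @dominated_convergence _ _ _ mu `[a, b]%classic (mseg a b)
  (fun n x => (h n x)%:E) (cst 0%E) (EFin \o H).
- by move=> n; apply/measurable_EFinP; exact: mh.
- exact: measurable_cst.
- move: cvg; apply: filterS; first exact: (ae_filter_ringOfSetsType mu).
  move=> x cx Dx /=; apply: cvg_EFin; first by apply: nearW.
  by apply: cx; move: Dx; rewrite /= in_itv.
- by [].
- by apply: aeW => x n /=; rewrite in_itv/= => Dx; rewrite lee_fin hH.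
move=> _ _; rewrite integral0 => c0.
by apply: (fine_cvg (a := 0)).
Qed.

Lemma cvg0_le (u v : nat -> R) : (forall n, 0 <= u n <= v n) ->
  v @ \oo --> (0 : R) -> u @ \oo --> (0 : R).
Proof.
move=> uv cv; apply: (squeeze_cvgr _ (cvg_cst (0 : R)) cv); exact: nearW.
Qed.

Lemma cvg0D (u v : nat -> R) : u @ \oo --> (0 : R) -> v @ \oo --> (0 : R) ->
  (fun n => u n + v n) @ \oo --> (0 : R).
Proof. by move=> cu cv; rewrite -(addr0 (0 : R)); exact: cvgD. Qed.

Lemma cvg0Z (c : R) (u : nat -> R) : u @ \oo --> (0 : R) -> (fun n => c * u n) @ \oo --> (0 : R).
Proof. by move=> cu; rewrite -(mulr0 c); exact: cvgMr. Qed.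

Lemma cvg_sqr0 (u : nat -> R) : u @ \oo --> (0 : R) -> (fun n => u n ^+ 2) @ \oo --> (0 : R).
Proof.
move=> h; apply/cvgrPdist_lt => e e0.
move/cvgrPdist_lt : h => /(_ (Num.min 1 e)); rewrite lt_min ltr01 e0 => /(_ isT).
apply: filterS => n; rewrite !sub0r !normrN lt_min => /andP[u1 ue]; rewrite normrX.
have := normr_ge0 (u n); nra.
Qed.

Lemma cmod_cis_sub1_even (t : R) : cmod (cis (- t) - 1 : R[i]) = cmod (cis t - 1 : R[i]).
Proof. by rewrite cisN -(cmod_conj (cis t - 1)) cJB conjc1. Qed.

(** For t <= 1 the imaginary part is used, sin t being t times a cosine of a smaller angle; for t >
    1 the real part gives 1 - cos t >= 1 - cos 1, and pi <= 4 converts this into a multiple of t. *)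
Lemma cmod_cis_sub1_ge : exists2 c : R, 0 < c &
  forall t, 0 <= t <= pi -> c * t <= cmod (cis t - 1 : R[i]).
Proof.
have c1 : cos 1 < 1 :> R.
  rewrite -[ltRHS]cos0 ltr_cos// in_itv/= ?lexx ?pi_ge0// ler01/=.
  by rewrite (le_trans _ (pi_ge2 R))// ler1n.
have c0 := @cos1_gt0 R.
exists (Num.min (cos 1) ((1 - cos 1) / 4)).
  by rewrite lt_min c0/= divr_gt0// subr_gt0.
move=> t /andP[t0 tpi].
have p4 : pi <= 4 :> R by have := pihalf_lt2 R; lra.
have [t1|t1] := leP t 1.
  apply: (@le_trans _ _ (cos 1 * t)); first by rewrite ler_wpM2r// ge_min lexx.
  have [] := @MVT_segment R sin cos 0 t t0.
    by apply: continuous_subspaceT; exact: continuous_sin.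
  move=> c; rewrite in_itv/= => /andP[c_0 ct]; rewrite sin0 !subr0 => E.
  apply: (@le_trans _ _ (sin t)).
    rewrite E ler_wpM2r// leNgt ltr_cos ?in_itv/= ?ler01//=.
    - by rewrite -leNgt (le_trans ct).
    - by rewrite (le_trans _ (pi_ge2 R))// ler1n.
    - by rewrite c_0 (le_trans ct).
  have := Im_le_cmod (cis t - 1 : R[i]).
  rewrite cImD /= oppr0 addr0; apply: le_trans; exact: ler_norm.
apply: (@le_trans _ _ (1 - cos 1)).
  have : Num.min (cos 1 : R) ((1 - cos 1) / 4) <= (1 - cos 1) / 4 by rewrite ge_min lexx orbT.
  have : 0 <= Num.min (cos 1 : R) ((1 - cos 1) / 4) by rewrite le_min (ltW c0)/= divr_ge0// subr_ge0 ltW.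
  nra.
have ct : cos t <= cos 1.
  rewrite leNgt ltr_cos ?in_itv/= ?t0 ?ler01//= -?leNgt ?ltW//.
  by rewrite (lt_le_trans _ (pi_ge2 R))// ltr1n.
have := Re_le_cmod (cis t - 1 : R[i]); rewrite cReD /=.
by have := ler_norm (- (cos t - 1)); rewrite normrN; lra.
Qed.

Definition zwin (N : nat) : seq int := [seq (i%:Z - N%:Z) | i <- iota 0 (N.*2.+1)].

Lemma mem_zwin N k : (k \in zwin N) = (`|k| <= N)%N.
Proof.
apply/mapP/idP => [[n]|kN]; first by rewrite mem_iota => /andP[_ iN] ->; lia.
exists (`|(k + N%:Z)%R|%N); last by lia.
by rewrite mem_iota; lia.
Qed.

Lemma uniq_zwin N : uniq (zwin N).
Proof. by rewrite map_inj_uniq ?iota_uniq// => i j /addIr []. Qed.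

Lemma sum_zwin (V : zmodType) (F : int -> V) N :
  \sum_(k <- zwin N) F k = \sum_(0 <= i < N.*2.+1) F (i%:Z - N%:Z).
Proof. by rewrite big_map /index_iota subn0. Qed.

(** Riemann-Lebesgue from Bessel: along distinct frequencies the squared coefficients are the terms
    of a convergent series. *)
Lemma fc_cvg0 f (phi : nat -> int) : sqi f -> injective phi ->
  (fun n => cmod (fc f (phi n))) @ \oo --> (0 : R).
Proof.
move=> sf iphi.
have : cvgn (series (fun n => cmod (fc f (phi n)) ^+ 2)).
  apply: nondecreasing_is_cvgn.
    apply/nondecreasing_seqP => n; rewrite /series/= big_nat_recr//= lerDl; exact: sqr_ge0.
  exists (mass f / (2 * pi)) => _ [n _ <-]; rewrite /series/=.
  rewrite ler_pdivlMr ?twopi_gt0// mulrC.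
  have := bessel sf (s := [seq phi i | i <- iota 0 n]).
  by rewrite map_inj_uniq// iota_uniq big_map /index_iota subn0 => /(_ isT).
move=> /cvg_series_cvg_0 c0; apply/cvgrPdist_lt => e e0.
move/cvgrPdist_lt : c0 => /(_ (e ^+ 2)); rewrite exprn_gt0// => /(_ isT).
apply: filterS => n; rewrite !sub0r !normrN ger0_norm ?sqr_ge0// ger0_norm ?cmod_ge0//.
by rewrite ltr_pXn2r ?nnegrE ?cmod_ge0// ltW.
Qed.

Section Lipschitz.
Variables (f : R -> R[i]) (L : R).
Hypotheses (mf : cmeas_on D f) (L0 : 0 <= L) (fper : f 0 = f (2 * pi)).
Hypothesis fL : forall x y, 0 <= x <= 2 * pi -> 0 <= y <= 2 * pi -> cmod (f x - f y) <= L * `|x - y|.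

Lemma lip_sqi : sqi f.
Proof.
apply: (@sqi_bdd _ _ (cmod (f 0) + L * (2 * pi))) => // x; rewrite /torus/= in_itv/= => xD.
have -> : f x = f 0 + (f x - f 0) by rewrite addrC subrK.
apply: (le_trans (cmodD _ _)); rewrite lerD2l.
have D0 : 0 <= (0 : R) <= 2 * pi by rewrite lexx ltW ?twopi_gt0.
apply: (le_trans (fL xD D0)).
by case/andP: xD => x0 x2; rewrite subr0 ler_wpM2l// ger0_norm.
Qed.

(** The chord |e^(i(x - x0)) - 1| measures the distance on the circle. When x and x0 are more than
    pi apart the short arc passes through the endpoints, and f 0 = f (2 pi) glues the two pieces. *)
Lemma lip_quotient : exists2 B : R, 0 <= B & forall x0 x, 0 <= x0 <= 2 * pi -> 0 <= x <= 2 * pi ->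
  cmod (f x - f x0) <= B * cmod (cis (x - x0) - 1 : R[i]).
Proof.
have [c c0 hc] := cmod_cis_sub1_ge.
exists (L / c); first by rewrite divr_ge0// ltW.
have main x y : 0 <= x <= 2 * pi -> 0 <= y <= 2 * pi -> y <= x ->
    cmod (f x - f y) <= L / c * cmod (cis (x - y) - 1 : R[i]).
  move=> xD yD yx.
  have [d_pi|d_pi] := leP (x - y) pi.
    have := hc (x - y); rewrite subr_ge0 yx d_pi => /(_ isT) h.
    apply: (le_trans (fL xD yD)); rewrite ger0_norm ?subr_ge0//.
    rewrite -mulrA ler_wpM2l// mulrC ler_pdivlMr// mulrC; exact: h.
  have hd : 0 <= 2 * pi - (x - y) <= pi by case/andP: xD => ? ?; case/andP: yD => ? ?; lra.
  have := hc _ hd.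
  have -> : cmod (cis (2 * pi - (x - y)) - 1 : R[i]) = cmod (cis (x - y) - 1 : R[i]).
    rewrite cisD (_ : cis (2 * pi) = 1) ?mul1r ?cmod_cis_sub1_even//.
    by have := @cis_nat2pi R 1; rewrite mul1r.
  move=> h.
  have D0 : 0 <= (0 : R) <= 2 * pi by rewrite lexx ltW ?twopi_gt0.
  have D2 : 0 <= (2 * pi : R) <= 2 * pi by rewrite lexx ltW ?twopi_gt0.
  have -> : f x - f y = (f x - f (2 * pi)) + (f 0 - f y) by rewrite fper; ring.
  apply: (le_trans (cmodD _ _)).
  apply: (le_trans (lerD (fL xD D2) (fL D0 yD))).
  have -> : `|x - 2 * pi| = 2 * pi - x by rewrite distrC ger0_norm// subr_ge0; case/andP: xD.
  have -> : `|0 - y| = y by rewrite sub0r normrN ger0_norm//; case/andP: yD.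
  have -> : L * (2 * pi - x) + L * y = L * (2 * pi - (x - y)) by ring.
  by rewrite -mulrA ler_wpM2l// [leRHS]mulrC ler_pdivlMr// mulrC.
move=> x0 x x0D xD; have [le|/ltW le] := leP x0 x; first exact: main.
by rewrite -cmodN opprB -cmod_cis_sub1_even opprB; exact: main.
Qed.

(* Write f - f x0 = g (e^{i(x-x0)} - 1) with g bounded: the partial Fourier sums of f at x0
   telescope, and the boundary terms tend to 0 by Bessel's inequality. *)
Lemma lip_fourier : exists B : R, forall x0, 0 <= x0 <= 2 * pi ->
  (forall N, cmod (f x0 - trigp (zwin N) (fc f) x0) <= B) /\
  (fun N => cmod (f x0 - trigp (zwin N) (fc f) x0)) @ \oo --> (0 : R).
Proof.
have [B B0 hB] := lip_quotient.
exists (2 * B) => x0 x0D.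
pose e x : R[i] := cis (x - x0) - 1.
(* Multiplication by conj(e) / |e|^2 divides by [e], with value 0 where [e] vanishes; at such points
   f x = f x0 by the quotient bound, so the factorization still holds. *)
pose g x := (f x - f x0) * (conjc (e x) * ((cmod (e x) ^+ 2)^-1)%:C).
have ge x : 0 <= x <= 2 * pi -> f x - f x0 = g x * e x.
  move=> xD; have [e0|e0] := eqVneq (cmod (e x)) 0.
    have := hB x0 x x0D xD; rewrite -/(e x) e0 mulr0 => h.
    have -> : f x - f x0 = 0 by apply: cmod0_eq0; apply/eqP; rewrite eq_le h cmod_ge0.
    by rewrite /g (cmod0_eq0 e0) mulr0.
  have -> : g x * e x = (f x - f x0) * ((e x * conjc (e x)) * ((cmod (e x) ^+ 2)^-1)%:C).
    by rewrite /g; ring.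
  by rewrite mul_conj -RtoCM mulfV ?mulr1// expf_neq0.
have gB x : 0 <= x <= 2 * pi -> cmod (g x) <= B.
  move=> xD; rewrite /g !cmodM cmod_conj cmod_real ger0_norm ?invr_ge0 ?sqr_ge0//.
  have [e0|e0] := eqVneq (cmod (e x)) 0; first by rewrite e0 mul0r mulr0.
  have ep : 0 < cmod (e x) by rewrite lt_neqAle eq_sym e0 cmod_ge0.
  have -> : cmod (e x) * (cmod (e x) ^+ 2)^-1 = (cmod (e x))^-1.
    by rewrite expr2 invfM mulrA mulfV// mul1r.
  by rewrite ler_pdivrMr//; exact: hB.
have me : cmeas_on D e.
  apply: cmeasB; last exact: cmeas_cst.
  by apply: cmeas_cis; apply: measurable_funB => //; exact: measurable_cst.
have sg : sqi g.
  apply: (@sqi_bdd _ _ B); last by move=> x; rewrite /torus/= in_itv/= => xD; exact: gB.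
  apply: cmeasM; first by apply: cmeasB => //; exact: cmeas_cst.
  apply: cmeasM; first exact: cmeasJ.
  apply: cmeas_real.
  have -> : (fun x => (cmod (e x) ^+ 2)^-1) = (fun x => (cmod (e x) ^+ 2) `^ (-1)).
    by apply/funext => x; rewrite powR_inv1// sqr_ge0.
  by apply: (measurableT_comp (f := fun x : R => x `^ (-1))) => //; apply: meas_cmodX.
have sf := lip_sqi.
have scst : sqi (fun _ : R => f x0) by apply: (@sqi_bdd _ _ (cmod (f x0))) => //; exact: cmeas_cst.
pose G (k : int) := fc g k * cis (k%:~R * x0).
have tele (k : int) : (fc f k * cis (k%:~R * x0)) - (if k == 0 then f x0 else 0) = G (k - 1) - G k.
  have E1 : fc (fun x => f x - f x0) k = fc f k - (if k == 0 then f x0 else 0).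
    rewrite fcB//; congr (_ - _).
    have -> : (fun _ : R => f x0) = (fun x => f x0 * cis ((0 : int)%:~R * x)).
      by apply/funext => x; rewrite mul0r cis0 mulr1.
    rewrite fcZ; last exact: sqi_cis.
    by rewrite fc_cis eq_sym; case: eqP => _; rewrite ?mulr1 ?mulr0.
  have E2 : fc (fun x => f x - f x0) k = cis (- x0) * fc g (k - 1) - fc g k.
    have -> : cis (- x0) * fc g (k - 1) = fc (fun x => cis (- x0) * (cis (1 * x) * g x)) k.
      rewrite fcZ; last first.
        by apply: (@sqiM_bdd _ _ _ 1) => //; [apply: cmeas_cis; exact: meas_mulr|move=> x _; rewrite cmod_cis].
      congr (_ * _); rewrite /fourier_coef; congr (_ * _); apply: eq_Cint => x _.
      rewrite intrB mulrBl opprB cisD; ring.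
    rewrite -fcB//; last first.
      apply: sqiZ; apply: (@sqiM_bdd _ _ _ 1) => //; last by move=> x _; rewrite cmod_cis.
      by apply: cmeas_cis; exact: meas_mulr.
    rewrite /fourier_coef; congr (_ * _); apply: eq_Cint => x; rewrite /torus/= in_itv/= => xD.
    congr (_ * _); rewrite ge// /e mul1r cisD; ring.
  have -> : fc f k * cis (k%:~R * x0) - (if k == 0 then f x0 else 0) =
     (fc f k - (if k == 0 then f x0 else 0)) * cis (k%:~R * x0).
    by rewrite mulrBl; congr (_ - _); case: eqP => [->|_]; rewrite ?mul0r ?cis0 ?mulr1.
  rewrite -E1 E2 mulrBl /G; congr (_ - _).
  have -> : cis ((k - 1)%:~R * x0) = cis (- x0) * cis (k%:~R * x0) :> R[i].
    by rewrite -cisD; congr cis; rewrite intrB; ring.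
  ring.
have S N : f x0 - trigp (zwin N) (fc f) x0 = G N%:Z - G (- N%:Z - 1).
  have : \sum_(k <- zwin N) ((fc f k * cis (k%:~R * x0)) - (if k == 0 then f x0 else 0)) =
      G (- N%:Z - 1) - G N%:Z.
    rewrite (eq_bigr (fun k => G (k - 1) - G k)); last by move=> k _; exact: tele.
    rewrite sum_zwin.
    have H n : \sum_(0 <= i < n) (G (i%:Z - N%:Z - 1) - G (i%:Z - N%:Z)) = G (- N%:Z - 1) - G (n%:Z - N%:Z - 1).
      elim: n => [|n IH]; first by rewrite big_geq// sub0r subrr.
      rewrite big_nat_recr//= IH.
      have -> : n.+1%:Z - N%:Z - 1 = n%:Z - N%:Z by lia.
      by rewrite addrA subrK.
    by rewrite H; congr (_ - G _); lia.
  rewrite sumrB => E; have := E.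
  have -> : \sum_(k <- zwin N) (if k == 0 then f x0 else 0) = f x0.
    have z0 : 0 \in zwin N by rewrite mem_zwin.
    have uz := uniq_zwin N; move: z0 uz; move: (zwin N) => z z0 uz.
    rewrite (big_rem 0)//= big_seq big1 ?addr0// => k.
    by rewrite mem_rem_uniq// inE => /andP[/negbTE ->].
  rewrite -/(trigp (zwin N) (fc f) x0) => {}E.
  by rewrite -opprB E opprB.
have cG k : cmod (G k) = cmod (fc g k) by rewrite /G cmodM cmod_cis mulr1.
have bB N : cmod (f x0 - trigp (zwin N) (fc f) x0) <= cmod (fc g N%:Z) + cmod (fc g (- N%:Z - 1)).
  by rewrite S; apply: (le_trans (cmodB _ _)); rewrite !cG.
split.
  have gk k : cmod (fc g k) <= B.
    rewrite /fourier_coef cmodM cmod_real ger0_norm ?invr_ge0 ?(ltW (@twopi_gt0 R))//.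
    rewrite mulrC ler_pdivrMr ?twopi_gt0//.
    apply: (le_trans (cmod_Cint_le_bound mtorus (h := fun=> B) _ _ _)).
    - exact: sqi_eint.
    - exact: rint_cst.
    - by move=> x; rewrite /torus/= in_itv/= => xD; rewrite cmodM cmod_cis mulr1 gB.
    rewrite (Rintegral_cst mu mtorus)/= /torus lebesgue_measure_itv/= lte_fin twopi_gt0.
    by rewrite -EFinD/= subr0.
  by move=> N; apply: (le_trans (bB N)); have := gk N%:Z; have := gk (- N%:Z - 1); lra.
have c1 := fc_cvg0 sg (phi := fun n => n%:Z) (fun i j => @congr1 _ _ absz i%:Z j%:Z).
have c2 : (fun n => cmod (fc g (- n%:Z - 1))) @ \oo --> (0 : R).
  by apply: (fc_cvg0 sg) => i j; lia.
apply: cvg0_le (cvg0D c1 c2) => N.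
by rewrite cmod_ge0 bB.
Qed.

Lemma lip_dense : (fun N => mass (fun x => f x - trigp (zwin N) (fc f) x)) @ \oo --> (0 : R).
Proof.
have [B hB] := lip_fourier; have sf := lip_sqi.
apply: (@Rint_dct 0 (2 * pi) _ (fun=> B ^+ 2)).
- by move=> N; have [m _] := sqiB sf (sqi_trigp (zwin N) (fc f)); exact: meas_cmodX.
- exact: rint_cst.
- move=> N x xD; have [h _] := hB x xD; rewrite ger0_norm ?sqr_ge0//.
  by rewrite lerXn2r ?nnegrE ?cmod_ge0// (le_trans (cmod_ge0 _) (h N)).
apply: aeW => x xD; have [_ h] := hB x xD.
exact: cvg_sqr0.
Qed.

End Lipschitz.

End Density.

(** * Completeness of the exponentials and products of Fourier series *)

Section Parseval.
Context {R : realType}.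
Notation mu := (@lebesgue_measure R).
Notation D := (torus R).
Notation fc := (@fourier_coef R).
Implicit Types (f g p : R -> R[i]).
#[local] Hint Resolve mseg mtorus : core.

Lemma cint_e f k : cintegrable mu D f -> cintegrable mu D (fun x => f x * cis (- (k%:~R * x))).
Proof.
move=> cf; rewrite (_ : (fun x => _) = (fun x => cis (- (k%:~R * x)) * f x)); last by apply/funext => x; rewrite mulrC.
apply: (@cintM_bdd _ _ _ mu D mtorus _ _ 1) => //; first exact: (proj1 (sqi_e k)).
by move=> x _; rewrite cmod_cis.
Qed.

Lemma fcD_int f g k : cintegrable mu D f -> cintegrable mu D g ->
  fc (fun x => f x + g x) k = fc f k + fc g k.
Proof.
move=> cf cg; rewrite /fourier_coef -mulrDr; congr (_ * _).
rewrite -CintD//; [|exact: cint_e..].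
by apply: eq_Cint => x _; rewrite mulrDl.
Qed.

Lemma fcZ_int z f k : cintegrable mu D f -> fc (fun x => z * f x) k = z * fc f k.
Proof.
move=> cf; rewrite /fourier_coef mulrCA; congr (_ * _).
rewrite -CintZ//; last exact: cint_e.
by apply: eq_Cint => x _; rewrite mulrA.
Qed.

Lemma fcB_int f g k : cintegrable mu D f -> cintegrable mu D g ->
  fc (fun x => f x - g x) k = fc f k - fc g k.
Proof.
move=> cf cg; rewrite (_ : (fun x => f x - g x) = (fun x => f x + (-1) * g x)); last first.
  by apply/funext => x; rewrite mulN1r.
rewrite fcD_int//; last exact: cintZ.
by rewrite fcZ_int// mulN1r.
Qed.

Lemma fc_conj f k : cintegrable mu D f -> fc (fun x => conjc (f x)) k = conjc (fc f (- k)).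
Proof.
move=> cf; rewrite /fourier_coef cJM conjc_real; congr (_ * _).
rewrite -CintJ //; last exact: cint_e.
apply: eq_Cint => x _; rewrite cJM -cisN; congr (_ * cis _).
by rewrite mulrNz mulNr opprK.
Qed.

Section Average.
Variables (phi : R -> R) (B eta : R).
Hypotheses (eta0 : 0 < eta) (mphi : measurable_fun setT phi) (phiB : forall x, `|phi x| <= B).
Hypotheses (phi_eta : forall x, x < eta -> phi x = 0) (phi_2pi : forall x, 2 * pi < x -> phi x = 0).

Let B0 : 0 <= B. Proof. exact: le_trans (normr_ge0 _) (phiB 0). Qed.

Lemma support_int : rintegrable mu setT phi.
Proof.
apply: (@rint_le _ _ R mu setT _ _ (fun x => B * \1_(`[0, 2 * pi]%classic) x)) => //.
- move=> x _; rewrite indicE; case: (boolP (x \in _)) => [_|]; first by rewrite mulr1.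
  rewrite notin_setE/= in_itv/= mulr0 => /negP; rewrite negb_and -!ltNge => /orP[x0|x2].
    by rewrite phi_eta ?normr0// (lt_trans x0).
  by rewrite phi_2pi ?normr0.
- apply: (@rintZ _ _ R mu setT _) => //; exact: integrable_indic_itv.
Qed.

Let F x := \int[mu]_(t in `]-oo, x]) phi t.
Let h n : R := eta / n.+2%:R.

Let h0 n : 0 < h n. Proof. by rewrite divr_gt0. Qed.
Let heta n : h n < eta.
Proof. by rewrite ltr_pdivrMr// ltr_pMr// ltr1n. Qed.

Let FB x y : x <= y -> F y - F x = \int[mu]_(t in `]x, y]) phi t.
Proof.
move=> xy; apply: Rintegral_itvB.
- by apply: integrableS support_int.
- by rewrite bnd_simp.
- by rewrite bnd_simp.
Qed.

Let FL x y : `|F x - F y| <= B * `|x - y|.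
Proof.
have main a b : a <= b -> `|F b - F a| <= B * (b - a).
  move=> ab; rewrite FB//.
  have ii : rintegrable mu `]a, b] phi by apply: integrableS support_int.
  apply: (le_trans (le_normr_Rintegral _ ii)) => //.
  apply: (@le_trans _ _ (\int[mu]_(t in `]a, b]) B)).
    apply: le_Rintegral => //; first exact: integrable_norm.
    apply/measurable_bounded_integrable => //.
      by rewrite /= lebesgue_measure_itv/=; case: ifP => _ //; rewrite -EFinD ltry.
    by exists B; split; [exact: num_real|]; move=> r Br t _ /=; rewrite ger0_norm// ltW.
  rewrite Rintegral_cst//= lebesgue_measure_itv/= lte_fin.
  by case: ifP => ab'; rewrite ?mulr0 ?mulr_ge0// ?subr_ge0.
have [yx|/ltW xy] := leP y x.
  by rewrite [X in _ <= _ * X]ger0_norm ?subr_ge0//; exact: main.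
by rewrite distrC [X in _ <= _ * X]distrC [X in _ <= _ * X]ger0_norm ?subr_ge0//; exact: main.
Qed.

Let Fconst x y : x <= y -> (y < eta \/ 2 * pi <= x) -> F y - F x = 0.
Proof.
move=> xy H; rewrite FB//; transitivity (\int[mu]_(t in `]x, y]) (0 : R)).
  apply: eq_Rintegral => t; rewrite inE/= in_itv/= => /andP[xt ty].
  by case: H => H; [rewrite phi_eta// (le_lt_trans ty)|rewrite phi_2pi// (le_lt_trans H)].
by rewrite Rintegral_cst// mul0r.
Qed.

(** Moving averages of [phi]. They are Lipschitz; since the step is below [eta] and [phi] vanishes
    below [eta] and beyond 2 pi, they vanish at both endpoints, hence satisfy the periodicity
    condition imposed on Lipschitz functions. *)
Definition avg n x := (F (x + h n) - F x) / h n.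

Lemma avg_lip n x y : `|avg n x - avg n y| <= 2 * B / h n * `|x - y|.
Proof.
rewrite /avg -mulrBl normrM [`|(h n)^-1|]ger0_norm ?invr_ge0 ?(ltW (h0 n))//.
rewrite [leRHS]mulrAC ler_wpM2r ?invr_ge0 ?(ltW (h0 n))//.
have -> : F (x + h n) - F x - (F (y + h n) - F y) = (F (x + h n) - F (y + h n)) - (F x - F y) by ring.
apply: (le_trans (ler_normB _ _)).
have := FL (x + h n) (y + h n); have := FL x y.
have -> : x + h n - (y + h n) = x - y by ring.
lra.
Qed.

Lemma avg0 n : avg n 0 = 0.
Proof. by rewrite /avg add0r Fconst ?mul0r// ?(ltW (h0 n))//; left; exact: heta. Qed.

Lemma avg2pi n : avg n (2 * pi) = 0.
Proof. by rewrite /avg Fconst ?mul0r//; [rewrite lerDl ltW|right]. Qed.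

Lemma avg_bdd n x : `|avg n x| <= B.
Proof.
rewrite /avg normrM [`|(h n)^-1|]ger0_norm ?invr_ge0 ?(ltW (h0 n))// ler_pdivrMr//.
have := FL (x + h n) x; have -> : x + h n - x = h n by ring.
by rewrite [`|h n|]ger0_norm ?(ltW (h0 n)).
Qed.

Lemma avg_meas n E : measurable_fun E (avg n).
Proof.
have cF : continuous F.
  move=> x; apply/cvgrPdist_lt => e e0.
  have Bp : 0 < B + 1 by rewrite ltr_pwDr.
  have eB : 0 < e / (B + 1) by rewrite divr_gt0.
  apply: filterS (nbhsx_ballx x _ eB) => y; rewrite -ball_normE/= => xy.
  apply: (le_lt_trans (FL x y)).
  apply: (@le_lt_trans _ _ ((B + 1) * `|x - y|)); first by rewrite ler_wpM2r// lerDl.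
  by rewrite mulrC -ltr_pdivlMr.
apply: measurable_funTS; apply: continuous_measurable_fun => x.
apply: cvgMl; apply: cvgB; last exact: cF.
by apply: (@continuous_comp _ _ _ (fun x => x + h n) F x); [apply: cvgD; [exact: cvg_id|exact: cvg_cst]|exact: cF].
Unshelve. all: by end_near. Qed.

Lemma avg_ae : {ae mu, forall x, avg n x @[n --> \oo] --> phi x}.
Proof.
have li : locally_integrable [set: R] phi.
  by apply: open_integrable_locally; [exact: openT|exact: support_int].
have ii y : rintegrable mu `]-oo, y] phi by apply: integrableS support_int.
have := FTC1Ny ii li.
rewrite /=; apply: filterS; first exact: (ae_filter_ringOfSetsType mu).
move=> x [dF Fx].
have {}dF : k^-1 *: (F (k *: (1 : R) + x) - F x) @[k --> 0^'] --> phi x.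
  by rewrite -Fx derive1E; exact: dF.
move/cvgr_dnbhsP : dF => dF.
have hn0 : h n @[n --> \oo] --> (0 : R).
  rewrite -[X in _ --> X](mulr0 eta); apply: cvgMr.
  have := @cvg_harmonic R; rewrite -(cvg_shiftS (@harmonic R) (nbhs (0 : R))); exact.
have H := dF h (conj (fun n => lt0r_neq0 (h0 n)) hn0).
apply: cvg_trans H; apply: near_eq_cvg; near=> n.
by rewrite /avg /= scaler1 [RHS]mulrC [h n + x]addrC.
Unshelve. all: by end_near. Qed.

End Average.

(** The truncations in [trig_approx_sqi] vanish near 0, so 0 is the one point where they may fail to
    converge. *)
Lemma ae_neq0 : {ae mu, forall x : R, x != 0}.
Proof.
exists [set 0]; split => //; first exact: lebesgue_measure_set1.
by move=> x /= /negP; rewrite negbK => /eqP.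
Qed.

Definition trig_approx f := forall e, 0 < e ->
  exists N c, mass (fun x => f x - trigp (zwin N) c x) <= e.

Lemma trig_approx_lim f (F : nat -> R -> R[i]) : sqi f -> (forall n, sqi (F n)) ->
  (forall n, trig_approx (F n)) ->
  (fun n => mass (fun x => f x - F n x)) @ \oo --> (0 : R) -> trig_approx f.
Proof.
move=> sf sF aF cF e e0.
have e4 : 0 < e / 4 by rewrite divr_gt0.
have [n /ltW Hn] : exists n, mass (fun x => f x - F n x) < e / 4.
  have [n _ Hn] : \forall n \near \oo, `|0 - mass (fun x => f x - F n x)| < e / 4.
    by move/cvgrPdist_lt : cF => /(_ _ e4).
  by exists n; have := Hn n (leqnn n); rewrite sub0r normrN ger0_norm ?mass_ge0.
have [N [c Hc]] := aF n _ e4; exists N, c.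
have -> : (fun x => f x - trigp (zwin N) c x) = (fun x => (f x - F n x) + (F n x - trigp (zwin N) c x)).
  by apply/funext => x; ring.
apply: (le_trans (mass_le_nrm _ _)); [exact: sqiB|by apply: sqiB => //; exact: sqi_trigp|].
lra.
Qed.

Lemma mass_sub_partial f N : sqi f ->
  mass (fun x => f x - trigp (zwin N) (fc f) x) =
  mass f - 2 * pi * \sum_(k <- zwin N) cmod (fc f k) ^+ 2.
Proof.
move=> sf; rewrite mass_sub_trigp ?uniq_zwin// big1 ?sub0r ?mulrN// => k _.
by rewrite subrr cmod0 expr0n.
Qed.

Lemma sum_zwin_le (F : int -> R) N N' : (forall k, 0 <= F k) -> (N <= N')%N ->
  \sum_(k <- zwin N) F k <= \sum_(k <- zwin N') F k.
Proof.
move=> F0 NN'; apply: ler_sum_sub => //; first exact: uniq_zwin.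
by move=> k; rewrite !mem_zwin => kN; exact: leq_trans NN'.
Qed.

(** Optimality of the partial sums: on any larger window they do at least as well as the given
    polynomial. *)
Lemma trig_approx_partial f : sqi f -> trig_approx f ->
  (fun N => mass (fun x => f x - trigp (zwin N) (fc f) x)) @ \oo --> (0 : R).
Proof.
move=> sf af; apply/cvgrPdist_le => e e0; have [N [c Hc]] := af e e0.
near=> n; rewrite sub0r normrN ger0_norm ?mass_ge0//.
apply: le_trans Hc; rewrite mass_sub_partial// mass_sub_trigp ?uniq_zwin//.
have Nn : (N <= n)%N by near: n; exact: nbhs_infty_ge.
rewrite lerD2l -mulrN ler_wpM2l ?(ltW twopi_gt0)//.
apply: (@le_trans _ _ (- \sum_(k <- zwin N) cmod (fc f k) ^+ 2)).
  by rewrite lerN2 sum_zwin_le// => k; rewrite sqr_ge0.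
by rewrite lerDr sumr_ge0// => k _; rewrite sqr_ge0.
Unshelve. all: by end_near. Qed.

(** The averages of the real and imaginary parts are Lipschitz, stay bounded, and converge almost
    everywhere by Lebesgue's differentiation theorem, hence in mean square. *)
Lemma trig_approx_bounded f (B eta : R) : 0 < eta -> cmeasurable f -> (forall x, cmod (f x) <= B) ->
  (forall x, x < eta \/ 2 * pi < x -> f x = 0) -> trig_approx f.
Proof.
move=> eta0 [mr mi] fB f0.
have rB x : `|Re (f x)| <= B := le_trans (Re_le_cmod _) (fB x).
have iB x : `|Im (f x)| <= B := le_trans (Im_le_cmod _) (fB x).
have B0 : 0 <= B := le_trans (cmod_ge0 _) (fB 0).
have r1 x : x < eta -> Re (f x) = 0 by move=> h; rewrite f0//; left.
have r2 x : 2 * pi < x -> Re (f x) = 0 by move=> h; rewrite f0//; right.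
have i1 x : x < eta -> Im (f x) = 0 by move=> h; rewrite f0//; left.
have i2 x : 2 * pi < x -> Im (f x) = 0 by move=> h; rewrite f0//; right.
pose F n x := avg (fun x => Re (f x)) eta n x +i* avg (fun x => Im (f x)) eta n x.
have mF n : cmeas_on D (F n).
  by split; rewrite /F /=; [exact: (avg_meas eta0 mr rB r1 r2)|exact: (avg_meas eta0 mi iB i1 i2)].
have FB n x : cmod (F n x) <= 2 * B.
  apply: (le_trans (cmod_le_ReIm _)); rewrite /F /=.
  have := avg_bdd eta0 mr rB r1 r2 n x; have := avg_bdd eta0 mi iB i1 i2 n x; lra.
have sF n : sqi (F n) by apply: (@sqi_bdd _ _ (2 * B)) => // x _; exact: FB.
have sf : sqi f by apply: (@sqi_bdd _ _ B) => //; exact: cmeas_onS.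
apply: (@trig_approx_lim f F) => //.
- move=> n e e0.
  have hn0 : 0 < eta / n.+2%:R by rewrite divr_gt0.
  suff : (fun N => mass (fun x => F n x - trigp (zwin N) (fc (F n)) x)) @ \oo --> (0 : R).
    move=> /cvgrPdist_le /(_ _ e0) [N _ HN].
    by exists N, (fc (F n)); have := HN N (leqnn N); rewrite sub0r normrN ger0_norm ?mass_ge0.
  apply: (@lip_dense _ (F n) (2 * (2 * B / (eta / n.+2%:R))) (mF n)).
  + by rewrite !mulr_ge0// invr_ge0 ltW.
  + by rewrite /F (avg0 eta0 mr rB r1 r2) (avg0 eta0 mi iB i1 i2) (avg2pi eta0 mr rB r1 r2) (avg2pi eta0 mi iB i1 i2).
  + move=> x y _ _; apply: (le_trans (cmod_le_ReIm _)); rewrite cReD cImD cReN cImN /F /=.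
    have := avg_lip eta0 mr rB r1 r2 n x y; have := avg_lip eta0 mi iB i1 i2 n x y; lra.
- apply: (@Rint_dct _ 0 (2 * pi) _ (fun=> (3 * B) ^+ 2)).
  + by move=> n; apply: meas_cmodX => //; apply: cmeasB => //; exact: cmeas_onS.
  + exact: rint_cst.
  + move=> n x _; rewrite ger0_norm ?sqr_ge0// lerXn2r ?nnegrE ?cmod_ge0// ?mulr_ge0//.
    by apply: (le_trans (cmodB _ _)); have := FB n x; have := fB x; lra.
  + have A1 := avg_ae eta0 mr rB r1 r2; have A2 := avg_ae eta0 mi iB i1 i2.
    move: A1 A2; apply: filterS2; first exact: (ae_filter_ringOfSetsType mu).
    move=> x c1 c2 _; apply: cvg_sqr0.
    apply: (@cvg0_le _ _ (fun n => `|Re (f x) - avg (fun x => Re (f x)) eta n x| + `|Im (f x) - avg (fun x => Im (f x)) eta n x|)).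
      by move=> n; rewrite cmod_ge0/=; apply: (le_trans (cmod_le_ReIm _)); rewrite cReD cImD cReN cImN.
    have H (a : nat -> R) l : a @ \oo --> l -> (fun n => `|l - a n|) @ \oo --> (0 : R).
      move=> h; rewrite -(@normr0 _ R) -(subrr l); apply: cvg_norm; apply: cvgB => //; exact: cvg_cst.
    by apply: cvg0D; exact: H.
Qed.

Lemma trig_approx_sqi f : sqi f -> trig_approx f.
Proof.
move=> [mf intf].
(* Truncation in size by n and in space to [1 / (n + 1), 2 pi]: it makes f bounded and zero near 0,
   as the averaging argument wants. *)
pose A n : set R := (D `&` (fun x => cmod (f x)) @^-1` `]-oo, n%:R]) `&` `[n.+1%:R^-1, 2 * pi].
have mA n : measurable (A n).
  apply: measurableI => //; have := meas_cmod mf; move/(_ mtorus _ (measurable_itv `]-oo, n%:R])); exact.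
have AD n : A n `<=` D by move=> x [[]].
pose F n x := if x \in A n then f x else 0.
have mF n : cmeasurable (F n).
  split.
    rewrite (_ : (fun x => Re (F n x)) = (fun x => Re (f x)) \_ (A n)); last first.
      by apply/funext => x; rewrite /F patchE; case: ifP.
    by apply: (measurable_restrictT _ (mA n)).1; apply: (measurable_funS mtorus (AD n)); exact: (proj1 mf).
  rewrite (_ : (fun x => Im (F n x)) = (fun x => Im (f x)) \_ (A n)); last first.
    by apply/funext => x; rewrite /F patchE; case: ifP.
  by apply: (measurable_restrictT _ (mA n)).1; apply: (measurable_funS mtorus (AD n)); exact: (proj2 mf).
have FB n x : cmod (F n x) <= n%:R.
  by rewrite /F; case: ifP; rewrite ?cmod0// inE => -[[_ /=]]; rewrite in_itv/=.
apply: (@trig_approx_lim f F) => //.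
- by move=> n; apply: (@sqi_bdd _ _ n%:R) => [|x _]; [exact: cmeas_onS|exact: FB].
- move=> n; apply: (@trig_approx_bounded _ n%:R n.+1%:R^-1) => //.
  move=> x xx; rewrite /F; case: ifPn => //; rewrite inE => -[_] /=; rewrite in_itv/= => /andP[x1 x2].
  by case: xx => xx; [move: (lt_le_trans xx x1)|move: (lt_le_trans xx x2)]; rewrite ltxx.
apply: (@Rint_dct _ 0 (2 * pi) _ (fun x => cmod (f x) ^+ 2)) => //.
- by move=> n; apply: meas_cmodX => //; apply: cmeasB => //; exact: cmeas_onS.
- move=> n x _; rewrite ger0_norm ?sqr_ge0// lerXn2r ?nnegrE ?cmod_ge0//.
  by rewrite /F; case: ifP; rewrite ?subr0// subrr cmod0 cmod_ge0.
move: ae_neq0; apply: filterS; first exact: (ae_filter_ringOfSetsType mu).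
move=> x xn0 /andP[x0 x2].
have xp : 0 < x by rewrite lt_neqAle eq_sym xn0.
apply: cvg_near_cst; near=> n.
have -> : F n x = f x; last by rewrite subrr cmod0 expr0n.
rewrite /F; case: ifPn => // /negP; rewrite inE; case; split; [split|] => /=; rewrite ?in_itv/= ?x0 ?x2//.
  by rewrite /torus/= in_itv/= x0 x2.
  near: n; exact: nbhs_infty_ger.
rewrite andbT invf_ple ?posrE// ; apply: (@le_trans _ _ n%:R); last by rewrite ler_nat.
near: n; exact: nbhs_infty_ger.
Unshelve. all: by end_near. Qed.

Lemma partial_cvg f : sqi f ->
  (fun N => mass (fun x => f x - trigp (zwin N) (fc f) x)) @ \oo --> (0 : R).
Proof. by move=> sf; apply: trig_approx_partial => //; exact: trig_approx_sqi. Qed.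

Lemma parseval f : sqi f ->
  (fun N => 2 * pi * \sum_(k <- zwin N) cmod (fc f k) ^+ 2) @ \oo --> mass f.
Proof.
move=> sf; have := partial_cvg sf => /cvgrPdist_le H; apply/cvgrPdist_le => e e0.
move: (H e e0); by apply: filterS => N; rewrite mass_sub_partial// sub0r normrN.
Qed.

Lemma cmod_fc_le f g k : sqi f -> sqi g ->
  cmod (fc (fun x => f x * g x) k) <= (2 * pi)^-1 * (nrm f * nrm g).
Proof.
move=> sf sg; rewrite /fourier_coef cmodM cmod_real ger0_norm ?invr_ge0 ?(ltW twopi_gt0)//.
rewrite ler_wpM2l ?invr_ge0 ?(ltW twopi_gt0)//.
rewrite (@eq_Cint _ _ _ mu D _ (fun x => f x * (g x * cis (- (k%:~R * x))))); last by move=> x _; rewrite mulrA.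
have sg' : sqi (fun x => g x * cis (- (k%:~R * x))).
  rewrite (_ : (fun x => _) = (fun x => cis (- (k%:~R * x)) * g x)); last by apply/funext => x; rewrite mulrC.
  by apply: (@sqiM_bdd _ _ _ 1) => //; [exact: (proj1 (sqi_e k))|move=> x _; rewrite cmod_cis].
apply: (le_trans (cmod_int_CS sf sg')).
rewrite (_ : nrm (fun x => g x * _) = nrm g)// /nrm /mass; congr Num.sqrt; apply: eq_Rintegral => x _.
by rewrite cmodM cmod_cis mulr1.
Qed.

Lemma fc_mul_cis f k j : fc (fun x => f x * cis (k%:~R * x)) j = fc f (j - k).
Proof.
rewrite /fourier_coef; congr (_ * _); apply: eq_Cint => x _.
by rewrite -mulrA -cisD; congr (_ * cis _); rewrite intrB; ring.
Qed.

Lemma sqi_mul_cis f k : sqi f -> sqi (fun x => f x * cis (k%:~R * x)).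
Proof.
move=> sf.
rewrite (_ : (fun x => _) = (fun x => cis (k%:~R * x) * f x)); last by apply/funext => x; rewrite mulrC.
by apply: (@sqiM_bdd _ _ _ 1) => //; [exact: (proj1 (sqi_cis _))|move=> x _; rewrite cmod_cis].
Qed.

Lemma fc_sum (I : Type) (s : seq I) (F : I -> R -> R[i]) j : (forall i, sqi (F i)) ->
  fc (fun x => \sum_(i <- s) F i x) j = \sum_(i <- s) fc (F i) j.
Proof.
move=> sF; elim: s => [|i s IH].
  rewrite big_nil (_ : (fun x => _) = (fun x => 0 * (0 : R[i]))); last by apply/funext => x; rewrite big_nil mul0r.
  rewrite fcZ ?mul0r//; apply: (@sqi_bdd _ _ 0); first exact: cmeas_cst.
  by move=> x _; rewrite cmod0.
rewrite big_cons -IH -fcD//; last exact: sqi_sum.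
by congr (fourier_coef _ j); apply/funext => x; rewrite big_cons.
Qed.

Lemma fc_mul_trigp f s c j : sqi f ->
  fc (fun x => f x * trigp s c x) j = \sum_(m <- s) fc f (j - m) * c m.
Proof.
move=> sf.
rewrite (_ : (fun x => _) = (fun x => \sum_(m <- s) c m * (f x * cis (m%:~R * x)))); last first.
  by apply/funext => x; rewrite /trigp mulr_sumr; apply: eq_bigr => m _; ring.
rewrite fc_sum; last by move=> m; apply: sqiZ; exact: sqi_mul_cis.
by apply: eq_bigr => m _; rewrite fcZ ?fc_mul_cis 1?mulrC//; exact: sqi_mul_cis.
Qed.

Lemma conj_trigp s c x : conjc (trigp s c x) = trigp (map -%R s) (fun k => conjc (c (- k))) x :> R[i].
Proof.
rewrite /trigp cJ_sum big_map; apply: eq_bigr => k _.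
by rewrite cJM opprK -cisN; congr (_ * cis _); rewrite mulrNz mulNr.
Qed.

Lemma fc_mul_conj_trigp f s c j : sqi f ->
  fc (fun x => f x * conjc (trigp s c x)) j = \sum_(p <- s) conjc (c p) * fc f (p + j).
Proof.
move=> sf.
rewrite (_ : (fun x => _) = (fun x => f x * trigp (map -%R s) (fun k => conjc (c (- k))) x)); last first.
  by apply/funext => x; rewrite conj_trigp.
rewrite fc_mul_trigp// big_map; apply: eq_bigr => k _.
by rewrite !opprK mulrC addrC.
Qed.

Definition nrm_tail g N := nrm (fun x => g x - trigp (zwin N) (fc g) x).

Lemma nrm_tail_cvg g : sqi g -> nrm_tail g @ \oo --> (0 : R).
Proof.
move=> sg; have H := partial_cvg sg; rewrite -(@sqrtr0 R).
exact: (cvg_comp _ _ H (@sqrt_continuous R 0)).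
Qed.

End Parseval.

Arguments conjc {R} x : simpl never.
Arguments fourier_coef : simpl never.
Arguments cmod : simpl never.
Arguments cis : simpl never.

(** * Nonresonant interactions *)

Section Statics.
Context {R : realType}.
Notation mu := (@lebesgue_measure R).
Notation D := (torus R).
Notation fc := (@fourier_coef R).
Implicit Types (f g w : R -> R[i]) (u v : nat -> R[i]).
#[local] Hint Resolve mseg mtorus : core.

(** Convergence expressed by the real modulus, since the norm of [R[i]] takes its values in
    [R[i]]. *)
Definition cvgC u (z : R[i]) := (fun n => cmod (u n - z)) @ \oo --> (0 : R).

Lemma cvgC_near u v z : (\forall n \near \oo, u n = v n) -> cvgC v z -> cvgC u z.
Proof.
move=> uv; apply: cvg_trans; apply: near_eq_cvg; apply: filterS uv => n ->; by [].
Qed.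

Lemma cvgC_cst z : cvgC (fun=> z) z.
Proof. by rewrite /cvgC subrr cmod0; exact: cvg_cst. Qed.

Lemma cvgC_le u z (e : nat -> R) : (forall n, cmod (u n - z) <= e n) -> e @ \oo --> (0 : R) -> cvgC u z.
Proof. by move=> ue; apply: cvg0_le => n; rewrite cmod_ge0 ue. Qed.

Lemma cvgCD u v z z' : cvgC u z -> cvgC v z' -> cvgC (fun n => u n + v n) (z + z').
Proof.
move=> cu cv; apply: cvgC_le (cvg0D cu cv) => n.
by rewrite opprD addrACA; exact: cmodD.
Qed.

Lemma cvgCZ c u z : cvgC u z -> cvgC (fun n => c * u n) (c * z).
Proof. by move=> cu; apply: cvgC_le (cvg0Z (cmod c) cu) => n; rewrite -mulrBr cmodM. Qed.

Lemma cvgCB u v z z' : cvgC u z -> cvgC v z' -> cvgC (fun n => u n - v n) (z - z').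
Proof.
move=> cu cv; rewrite -[- z']mulN1r.
rewrite (_ : (fun n => _) = (fun n => u n + (-1) * v n)); last by apply/funext => n; rewrite mulN1r.
by apply: cvgCD => //; exact: cvgCZ.
Qed.

Lemma cvgC_sum (I : Type) (s : seq I) (P : pred I) (F : I -> nat -> R[i]) (z : I -> R[i]) :
  (forall i, P i -> cvgC (F i) (z i)) -> cvgC (fun n => \sum_(i <- s | P i) F i n) (\sum_(i <- s | P i) z i).
Proof.
move=> H; elim: s => [|i s IH].
  rewrite big_nil (_ : (fun n => _) = (fun=> 0)); last by apply/funext => n; rewrite big_nil.
  exact: cvgC_cst.
rewrite big_cons (_ : (fun n => _) = (fun n => if P i then F i n + \sum_(i <- s | P i) F i n else \sum_(i <- s | P i) F i n)); last by apply/funext => n; rewrite big_cons.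
by case: ifP => // Pi; apply: cvgCD => //; exact: H.
Qed.

Lemma cvgC_bound u z (c : R) : cvgC u z -> (forall n, cmod (u n) <= c) -> cmod z <= c.
Proof.
move=> cu uc; apply/ler_addgt0Pr => e e0.
have [n _ /(_ n (leqnn n))] : \forall n \near \oo, `|0 - cmod (u n - z)| <= e.
  by move/cvgrPdist_le : cu; exact.
rewrite sub0r normrN ger0_norm ?cmod_ge0// => H.
have -> : z = u n - (u n - z) by ring.
by apply: (le_trans (cmodB _ _)); exact: lerD.
Qed.

Lemma l2_CS (a b : int -> R) (A B : R) (s : seq int) (si ta : int -> int) :
  (forall k, 0 <= a k) -> (forall k, 0 <= b k) -> 0 <= A -> 0 <= B -> l2b a A -> l2b b B ->
  injective si -> injective ta -> uniq s -> \sum_(k <- s) a (si k) * b (ta k) <= A * B.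
Proof.
move=> a0 b0 A0 B0 la lb isi ita us.
have S0 : 0 <= \sum_(k <- s) a (si k) * b (ta k) by apply: sumr_ge0 => k _; exact: mulr_ge0.
rewrite -(@ler_pXn2r _ 2)// ?nnegrE ?mulr_ge0// exprMn.
apply: sqr_le_of_param; rewrite ?sqr_ge0// => t t0.
apply: (@le_trans _ _ (\sum_(k <- s) (t * a (si k) ^+ 2 + t^-1 * b (ta k) ^+ 2))).
  rewrite mulr_sumr; apply: ler_sum => k _.
  rewrite -subr_ge0 (_ : _ - _ = t^-1 * (t * a (si k) - b (ta k)) ^+ 2); last by field; rewrite gt_eqF.
  by rewrite mulr_ge0 ?sqr_ge0// invr_ge0 ltW.
rewrite big_split/= -!mulr_sumr; apply: lerD; apply: ler_wpM2l; rewrite ?invr_ge0 ?(ltW t0)//.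
  exact: l2b_inj la isi us.
exact: l2b_inj lb ita us.
Qed.

Lemma l2_CS_cond (a b : int -> R) (A B : R) (s : seq int) (P : pred int) (si ta : int -> int) :
  (forall k, 0 <= a k) -> (forall k, 0 <= b k) -> 0 <= A -> 0 <= B -> l2b a A -> l2b b B ->
  injective si -> injective ta -> uniq s -> \sum_(k <- s | P k) a (si k) * b (ta k) <= A * B.
Proof.
by move=> *; rewrite -big_filter; apply: l2_CS => //; exact: filter_uniq.
Qed.

(** L^4 of the fundamental domain: f g and f conj(g) are then in L^2, so Bessel and Parseval apply
    to them. *)
Definition qi f := cmeas_on D f /\ rintegrable mu D (fun x => cmod (f x) ^+ 4).

Definition qmass f : R := \int[mu]_(x in D) (cmod (f x) ^+ 4).

Lemma qmass_ge0 f : 0 <= qmass f.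
Proof. by apply: Rintegral_ge0 => x _; rewrite exprn_ge0 ?cmod_ge0. Qed.

Lemma qi_sqi f : qi f -> sqi f.
Proof.
move=> [mf qf]; split => //.
apply: (@rint_le _ _ R mu _ mtorus _ (fun x => 1 + cmod (f x) ^+ 4)).
- exact: meas_cmodX.
- move=> x _; rewrite ger0_norm ?sqr_ge0//.
  have := sqr_ge0 (cmod (f x) ^+ 2 - 1); have := sqr_ge0 (cmod (f x) ^+ 2); nra.
- apply: (rintD mtorus) => //; exact: rint_cst.
Qed.

Lemma qi_conj f : qi f -> qi (fun x => conjc (f x)).
Proof.
move=> [mf qf]; split; first exact: cmeasJ.
by apply: eq_integrable qf => // x _; rewrite /= cmod_conj.
Qed.

Lemma qmass_conj f : qmass (fun x => conjc (f x)) = qmass f.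
Proof. by apply: eq_Rintegral => x _; rewrite cmod_conj. Qed.

Lemma qi_mul f g : qi f -> qi g -> sqi (fun x => f x * g x) /\
  mass (fun x => f x * g x) <= 2^-1 * (qmass f + qmass g).
Proof.
move=> [mf qf] [mg qg].
have ii : rintegrable mu D (fun x => 2^-1 * (cmod (f x) ^+ 4 + cmod (g x) ^+ 4)).
  by apply: (rintZ mtorus); exact: (rintD mtorus).
have le x : cmod (f x * g x) ^+ 2 <= 2^-1 * (cmod (f x) ^+ 4 + cmod (g x) ^+ 4).
  rewrite cmodM exprMn.
  have := sqr_ge0 (cmod (f x) ^+ 2 - cmod (g x) ^+ 2); nra.
have mm : cmeas_on D (fun x => f x * g x) by exact: cmeasM.
have im : rintegrable mu D (fun x => cmod (f x * g x) ^+ 2).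
  by apply: (@rint_le _ _ R mu _ mtorus _ _ _ _ ii); [exact: meas_cmodX|move=> x _; rewrite ger0_norm ?sqr_ge0].
split; first by split.
rewrite /qmass -RintegralD// -RintegralZl//; last exact: (rintD mtorus).
by apply: le_Rintegral.
Qed.

Lemma qi_scale c f : qi f -> qi (fun x => c * f x).
Proof.
move=> [mf qf]; split; first by apply: cmeasM => //; exact: cmeas_cst.
rewrite /rintegrable (_ : (fun x => _) = (fun x => cmod c ^+ 4 * cmod (f x) ^+ 4)).
  exact: (rintZ mtorus).
by apply/funext => x; rewrite cmodM exprMn.
Qed.

Lemma pow4_le (a b : R) : 0 <= a -> 0 <= b -> (a + b) ^+ 4 <= 8 * (a ^+ 4 + b ^+ 4).
Proof.
move=> a0 b0.
have h1 : (a + b) ^+ 2 <= 2 * (a ^+ 2 + b ^+ 2) by have := sqr_ge0 (a - b); nra.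
have h2 : (a ^+ 2 + b ^+ 2) ^+ 2 <= 2 * (a ^+ 4 + b ^+ 4) by have := sqr_ge0 (a ^+ 2 - b ^+ 2); nra.
have h3 : ((a + b) ^+ 2) ^+ 2 <= (2 * (a ^+ 2 + b ^+ 2)) ^+ 2.
  by rewrite lerXn2r ?nnegrE ?sqr_ge0// mulr_ge0// addr_ge0// sqr_ge0.
nra.
Qed.

Lemma qi_sub f g : qi f -> qi g -> qi (fun x => f x - g x) /\
  qmass (fun x => f x - g x) <= 8 * (qmass f + qmass g).
Proof.
move=> [mf qf] [mg qg].
have ii : rintegrable mu D (fun x => 8 * (cmod (f x) ^+ 4 + cmod (g x) ^+ 4)).
  by apply: (rintZ mtorus); exact: (rintD mtorus).
have le x : cmod (f x - g x) ^+ 4 <= 8 * (cmod (f x) ^+ 4 + cmod (g x) ^+ 4).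
  apply: le_trans (pow4_le (cmod_ge0 _) (cmod_ge0 _)).
  by rewrite lerXn2r ?nnegrE ?addr_ge0 ?cmod_ge0// cmodB.
have mm : cmeas_on D (fun x => f x - g x) by exact: cmeasB.
have im : rintegrable mu D (fun x => cmod (f x - g x) ^+ 4).
  apply: (@rint_le _ _ R mu _ mtorus _ _ _ _ ii); first exact: meas_cmodX.
  by move=> x _; rewrite ger0_norm ?exprn_ge0 ?cmod_ge0.
split; first by split.
rewrite /qmass -RintegralD// -RintegralZl//; last exact: (rintD mtorus).
by apply: le_Rintegral.
Qed.

Definition tailn g (s : seq int) := nrm (fun x => g x - trigp s (fc g) x).

Lemma tailn_sub g s t : sqi g -> uniq s -> uniq t -> {subset s <= t} -> tailn g t <= tailn g s.
Proof.
move=> sg us ut st; rewrite /tailn /nrm ler_wsqrtr// !mass_sub_trigp// lerD2l ler_wpM2l ?(ltW twopi_gt0)//.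
rewrite !(big1 _ _ _ (fun k _ => _ : cmod (fc g k - fc g k) ^+ 2 = 0)); first last.
- by move=> k _; rewrite subrr cmod0 expr0n.
- by move=> k _; rewrite subrr cmod0 expr0n.
by rewrite !sub0r lerN2; apply: ler_sum_sub => // k; rewrite sqr_ge0.
Qed.

(** The tail decreases as the set of frequencies grows, so any exhausting sequence of finite sets
    will do; besides the windows, the reflected windows j - m occur. *)
Lemma tailn_cvg g (S : nat -> seq int) : sqi g -> (forall n, uniq (S n)) ->
  (forall N, \forall n \near \oo, {subset zwin N <= S n}) -> (fun n => tailn g (S n)) @ \oo --> (0 : R).
Proof.
move=> sg us Ss; apply/cvgrPdist_le => e e0.
have /cvgrPdist_le/(_ e e0) [N _ /(_ N (leqnn N)) HN] := nrm_tail_cvg sg.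
have := Ss N; apply: filterS => n Hn.
rewrite sub0r normrN ger0_norm ?nrm_ge0//.
apply: (le_trans (tailn_sub _ _ _ Hn)) => //; first exact: uniq_zwin.
by move: HN; rewrite sub0r normrN ger0_norm ?nrm_ge0.
Qed.

(** The finite convolution is the exact coefficient of f times a partial sum of g; the error is a
    coefficient of f times the tail of g. *)
Lemma fc_mul_tailn f g j s : sqi f -> sqi g ->
  cmod (\sum_(m <- s) fc f (j - m) * fc g m - fc (fun x => f x * g x) j)
    <= (2 * pi)^-1 * (nrm f * tailn g s).
Proof.
move=> sf sg; rewrite -fc_mul_trigp// -cmodN opprB.
rewrite (_ : _ - _ = fc (fun x => f x * (g x - trigp s (fc g) x)) j); last first.
  rewrite -fcB_int; [|exact: sqi_int|by apply: sqi_int => //; exact: sqi_trigp].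
  by congr (fourier_coef _ j); apply/funext => x; rewrite mulrBr.
by apply: cmod_fc_le => //; apply: sqiB => //; exact: sqi_trigp.
Qed.

Lemma fc_mul_conj_tailn f g j s : sqi f -> sqi g ->
  cmod (\sum_(p <- s) conjc (fc g p) * fc f (p + j) - fc (fun x => f x * conjc (g x)) j)
    <= (2 * pi)^-1 * (nrm f * tailn g s).
Proof.
move=> sf sg; rewrite -fc_mul_conj_trigp// -cmodN opprB.
have sT := sqi_trigp s (fc g).
rewrite (_ : _ - _ = fc (fun x => f x * conjc (g x - trigp s (fc g) x)) j); last first.
  rewrite -fcB_int; [|by apply: sqi_int => //; exact: sqi_conj..].
  by congr (fourier_coef _ j); apply/funext => x; rewrite cJB mulrBr.
rewrite /tailn -(nrm_conj (fun x => g x - _)).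
by apply: cmod_fc_le => //; apply: sqi_conj; exact: sqiB.
Qed.

Lemma cvgC_tail u z g c (S : nat -> seq int) : sqi g -> (forall n, uniq (S n)) ->
  (forall N, \forall n \near \oo, {subset zwin N <= S n}) ->
  (forall n, cmod (u n - z) <= c * tailn g (S n)) -> cvgC u z.
Proof. by move=> sg us Ss H; apply: cvgC_le H _; apply: cvg0Z; exact: tailn_cvg. Qed.

Lemma zwin_incl N : \forall n \near \oo, {subset zwin N <= zwin n}.
Proof. by exists N => // n /= Nn k; rewrite !mem_zwin => kN; exact: leq_trans Nn. Qed.

Lemma refl_win_uniq (j : int) n : uniq [seq j - m | m <- zwin n].
Proof. by rewrite map_inj_uniq ?uniq_zwin// => a b; lia. Qed.

Lemma refl_win_incl (j : int) N : \forall n \near \oo, {subset zwin N <= [seq j - m | m <- zwin n]}.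
Proof.
exists (N + `|j|)%N; first by [].
move=> n Nn k; rewrite mem_zwin => kN; have {}Nn : (N + `|j| <= n)%N := Nn.
by apply/mapP; exists (j - k); rewrite ?mem_zwin; lia.
Qed.

Lemma cvgC_fc_mul f g j : sqi f -> sqi g ->
  cvgC (fun P => \sum_(m <- zwin P) fc f (j - m) * fc g m) (fc (fun x => f x * g x) j).
Proof.
move=> sf sg; apply: (@cvgC_tail _ _ g ((2 * pi)^-1 * nrm f) (fun P => zwin P)) => //.
- by move=> n; exact: uniq_zwin.
- exact: zwin_incl.
- by move=> n; rewrite -mulrA; exact: fc_mul_tailn.
Qed.

Lemma cvgC_fc_mul_conj f g j : sqi f -> sqi g ->
  cvgC (fun P => \sum_(p <- zwin P) conjc (fc g p) * fc f (p + j)) (fc (fun x => f x * conjc (g x)) j).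
Proof.
move=> sf sg; apply: (@cvgC_tail _ _ g ((2 * pi)^-1 * nrm f) (fun P => zwin P)) => //.
- by move=> n; exact: uniq_zwin.
- exact: zwin_incl.
- by move=> n; rewrite -mulrA; exact: fc_mul_conj_tailn.
Qed.

Lemma cvgC_fc_conj_refl f g j : sqi f -> sqi g ->
  cvgC (fun P => \sum_(m <- zwin P) fc f (j - m) * conjc (fc g (j - m))) (fc (fun x => f x * conjc (g x)) 0).
Proof.
move=> sf sg.
apply: (@cvgC_tail _ _ g ((2 * pi)^-1 * nrm f) (fun P => [seq j - m | m <- zwin P])) => //.
- by move=> n; exact: refl_win_uniq.
- exact: refl_win_incl.
- move=> n; rewrite -mulrA; have := fc_mul_conj_tailn 0 [seq j - m | m <- zwin n] sf sg.
  rewrite big_map; under eq_bigr do rewrite addr0 mulrC; exact.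
Qed.

Lemma sum_seq_pred1 (F : int -> R[i]) (j : int) (s : seq int) : uniq s -> j \in s ->
  \sum_(k <- s | k != j) F k = \sum_(k <- s) F k - F j.
Proof. by move=> us js; rewrite (bigD1_seq j)//= addrC addrK. Qed.

Lemma sum_zwin_pred1 (F : int -> R[i]) (j : int) N : (`|j| <= N)%N ->
  \sum_(k <- zwin N | k != j) F k = \sum_(k <- zwin N) F k - F j.
Proof.
move=> jN; by apply: sum_seq_pred1; rewrite ?uniq_zwin ?mem_zwin.
Qed.

Lemma sum_seq_diff (F : int -> R[i]) (P : pred int) (s t : seq int) : uniq s -> uniq t -> {subset s <= t} ->
  \sum_(k <- t | P k) F k - \sum_(k <- s | P k) F k = \sum_(k <- t | (k \notin s) && P k) F k.
Proof.
move=> us ut st; rewrite [X in X - _](bigID (mem s))/=.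
rewrite (_ : \sum_(k <- t | P k && (k \in s)) F k = \sum_(k <- s | P k) F k).
  by rewrite addrC addrK; apply: eq_bigl => k; rewrite andbC.
rewrite -big_filter -[RHS]big_filter; apply: perm_big.
apply: uniq_perm; rewrite ?filter_uniq// => k.
rewrite !mem_filter; case: (P k) => //=.
by case: (boolP (k \in s)) => //= ks; rewrite st.
Qed.

Definition crossfc g w (m : int) := fc (fun x => g x * conjc (w x)) m.

(* The nonresonant part of the cubic term: among the frequency quadruples
   (j-m-l, j-m, j-l, j) of [fc (f * g * conj w) j], those with l m <> 0. *)
Definition NR f g w j := fc (fun x => f x * (g x * conjc (w x))) j
  - fc f j * crossfc g w 0 - fc g j * crossfc f w 0 + fc f j * fc g j * conjc (fc w j).

(* [NRp] and [NR3p] keep only the indices of [NR] with j - (frequency of f), resp. the frequency of w, in s;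
   the suffix r stands for a further truncation of the inner sum to a finite one. *)
Definition NRp (s : seq int) f g w j :=
  \sum_(m <- s | m != 0) fc f (j - m) * (crossfc g w m - fc g j * conjc (fc w (j - m))).

Definition NRpr (s : seq int) S f g w j := \sum_(m <- s | m != 0) \sum_(p <- zwin S | p != j - m)
  fc f (j - m) * fc g (p + m) * conjc (fc w p).

Definition NR3p (s : seq int) f g w j := \sum_(p <- s) conjc (fc w p) *
  (fc (fun x => f x * g x) (j + p) - fc f p * fc g j - (if p == j then 0 else fc f j * fc g p)).

Definition NR3pr (s : seq int) S f g w j := \sum_(p <- s) \sum_(i <- zwin S | (i != j) && (i != p))
  conjc (fc w p) * (fc f (j + p - i) * fc g i).

Lemma sqi_mul_conj f g : qi f -> qi g -> sqi (fun x => f x * conjc (g x)).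
Proof. by move=> qf qg; case: (qi_mul qf (qi_conj qg)). Qed.

Lemma NRpr_cvg s f g w j : qi f -> qi g -> qi w -> cvgC (fun S => NRpr s S f g w j) (NRp s f g w j).
Proof.
move=> qf qg qw; apply: cvgC_sum => m m0.
rewrite mulrBr; apply: (@cvgC_near _ (fun S => fc f (j - m) * \sum_(p <- zwin S) conjc (fc w p) * fc g (p + m)
    - fc f (j - m) * (fc g j * conjc (fc w (j - m))))).
  exists `|(j - m)%R|%N; first by []. move=> n jn; have {}jn : (`|(j - m)%R| <= n)%N := jn.
  rewrite sum_zwin_pred1//; congr (_ - _).
    by rewrite mulr_sumr; apply: eq_bigr => p _; rewrite mulrAC -mulrA.
  by rewrite subrK mulrA.
apply: cvgCB; last exact: cvgC_cst.
by apply: cvgCZ; apply: cvgC_fc_mul_conj; exact: qi_sqi.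
Qed.

(** Inclusion-exclusion: m = 0 is excluded by the index, l = 0 by the subtracted product, and the
    quadruple (j, j, j, j), which belongs to both families, is restored by the last term of [NR]. *)
Lemma NRp_cvg f g w j : qi f -> qi g -> qi w -> cvgC (fun P => NRp (zwin P) f g w j) (NR f g w j).
Proof.
move=> qf qg qw.
have E P : NRp (zwin P) f g w j = \sum_(m <- zwin P) fc f (j - m) * crossfc g w m
   - fc g j * \sum_(m <- zwin P) fc f (j - m) * conjc (fc w (j - m))
   - fc f j * (crossfc g w 0 - fc g j * conjc (fc w j)).
  rewrite /NRp sum_zwin_pred1// subr0; congr (_ - _).
  by rewrite mulr_sumr -sumrB; apply: eq_bigr => m _; ring.
rewrite (_ : (fun P => _) = (fun P => \sum_(m <- zwin P) fc f (j - m) * crossfc g w m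
   - fc g j * \sum_(m <- zwin P) fc f (j - m) * conjc (fc w (j - m))
   - fc f j * (crossfc g w 0 - fc g j * conjc (fc w j)))); last exact/funext.
rewrite (_ : NR f g w j = fc (fun x => f x * (g x * conjc (w x))) j - fc g j * crossfc f w 0
   - fc f j * (crossfc g w 0 - fc g j * conjc (fc w j))); last by rewrite /NR; ring.
apply: cvgCB; last exact: cvgC_cst.
apply: cvgCB.
  by apply: cvgC_fc_mul; [exact: qi_sqi|exact: sqi_mul_conj].
by apply: cvgCZ; apply: cvgC_fc_conj_refl; exact: qi_sqi.
Qed.

Lemma NR3pr_cvg s f g w j : qi f -> qi g -> qi w -> cvgC (fun S => NR3pr s S f g w j) (NR3p s f g w j).
Proof.
move=> qf qg qw; apply: cvgC_sum => p _.
apply: (@cvgC_near _ (fun S => conjc (fc w p) * (\sum_(i <- zwin S) fc f (j + p - i) * fc g i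
    - fc f p * fc g j - (if p == j then 0 else fc f j * fc g p)))).
  exists (`|j| + `|p|)%N; first by []. move=> n jn; have {}jn : (`|j| + `|p| <= n)%N := jn.
  rewrite -mulr_sumr; congr (_ * _).
  have [->|pj] := eqVneq p j.
    under eq_bigl do rewrite andbb.
    by rewrite sum_zwin_pred1 ?addrK ?subr0//; lia.
  rewrite -big_filter_cond.
  rewrite sum_seq_pred1 ?filter_uniq ?uniq_zwin//; last by rewrite mem_filter pj mem_zwin; lia.
  by rewrite big_filter sum_zwin_pred1 ?addrK 1?[j + p]addrC ?addrK//; lia.
apply: cvgCZ; apply: cvgCB; last exact: cvgC_cst.
apply: cvgCB; last exact: cvgC_cst.
by apply: cvgC_fc_mul; exact: qi_sqi.
Qed.

(** The same sum with the conjugated factor outermost. It serves when the difference of two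
    solutions is in this factor, because the outer truncation is what keeps a frequency close to
    j. *)
Lemma NR3p_cvg f g w j : qi f -> qi g -> qi w -> cvgC (fun P => NR3p (zwin P) f g w j) (NR f g w j).
Proof.
move=> qf qg qw.
have sf := qi_sqi qf; have sg := qi_sqi qg; have sw := qi_sqi qw.
have [sfg _] := qi_mul qf qg.
apply: (@cvgC_near _ (fun P => \sum_(p <- zwin P) conjc (fc w p) * fc (fun x => f x * g x) (p + j)
   - fc g j * \sum_(p <- zwin P) conjc (fc w p) * fc f (p + 0)
   - fc f j * \sum_(p <- zwin P) conjc (fc w p) * fc g (p + 0) + fc f j * fc g j * conjc (fc w j))).
  exists `|j|%N; first by []. move=> n jn; have {}jn : (`|j| <= n)%N := jn.
  rewrite /NR3p.
  have -> : fc f j * fc g j * conjc (fc w j) = \sum_(p <- zwin n) (if p == j then fc f j * fc g p * conjc (fc w p) else 0).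
    by rewrite (bigD1_seq j) ?mem_zwin ?uniq_zwin//= eqxx big1 ?addr0// => p /negbTE->.
  rewrite !mulr_sumr -!sumrB -big_split/=; apply: eq_bigr => p _.
  by rewrite addr0 [j + p]addrC; case: eqP => [->|_]; ring.
rewrite (_ : NR f g w j = fc (fun x => (f x * g x) * conjc (w x)) j - fc g j * crossfc f w 0
   - fc f j * crossfc g w 0 + fc f j * fc g j * conjc (fc w j)); last first.
  rewrite /NR (_ : (fun x => _) = (fun x => f x * g x * conjc (w x))); first by ring.
  by apply/funext => x; rewrite mulrA.
apply: cvgCD; last exact: cvgC_cst.
apply: cvgCB; last by apply: cvgCZ; exact: cvgC_fc_mul_conj.
apply: cvgCB; last by apply: cvgCZ; exact: cvgC_fc_mul_conj.
exact: cvgC_fc_mul_conj.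
Qed.

(** The factor 2 pi of Bessel's inequality is discarded. *)
Lemma l2b_nrm f : sqi f -> l2b (fun k => cmod (fc f k)) (nrm f).
Proof.
move=> sf; apply: l2b_fc => //; rewrite nrm_sqr ler_peMl ?mass_ge0//.
have := pi_ge2 R; lra.
Qed.

Section Bounds.
Variables (f g w : R -> R[i]) (M : R).
Hypotheses (M0 : 0 <= M) (qf : qi f) (qg : qi g) (qw : qi w).
Hypotheses (lf : l2b (fun k => cmod (fc f k)) M) (lg : l2b (fun k => cmod (fc g k)) M)
  (lw : l2b (fun k => cmod (fc w k)) M).

Let cmodM3 (x y z : R[i]) : cmod (x * y * z) = cmod x * cmod y * cmod z.
Proof. by rewrite cmodM cmodM. Qed.

Let c0 (u : R -> R[i]) k : 0 <= cmod (fc u k). Proof. exact: cmod_ge0. Qed.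

Lemma cmod_fc_le_l2 (u : R -> R[i]) k : l2b (fun k => cmod (fc u k)) M -> cmod (fc u k) <= M.
Proof. by move=> /(l2b_le k) /(_ M0); rewrite ger0_norm. Qed.

(** The bound does not see the window, which makes it a dominating function of time when the window
    grows. *)
Lemma NRp_bound s j : uniq s -> cmod (NRp s f g w j) <= M * nrm (fun x => g x * conjc (w x)) + M ^+ 3.
Proof.
move=> us; apply: (le_trans (cmod_sum _ _ _)).
apply: (@le_trans _ _ (\sum_(m <- s | m != 0) (cmod (fc f (j - m)) * cmod (crossfc g w m)
    + M * (cmod (fc f (j - m)) * cmod (fc w (j - m)))))).
  apply: ler_sum => m _; rewrite cmodM mulrCA -mulrDr ler_wpM2l//.
  apply: (le_trans (cmodB _ _)); rewrite lerD2l cmodM cmod_conj ler_wpM2r//; exact: cmod_fc_le_l2.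
have inj : injective (fun m : int => j - m) by move=> a b; lia.
rewrite big_split/= -mulr_sumr exprS expr2; apply: lerD.
  apply: (@l2_CS_cond (fun k => cmod (fc f k)) (fun k => cmod (crossfc g w k)) _ _ _ _ (fun m => j - m) id) => //.
  - by move=> k; exact: cmod_ge0.
  - exact: nrm_ge0.
  - by apply: l2b_nrm; exact: sqi_mul_conj.
apply: ler_wpM2l => //.
by apply: (@l2_CS_cond (fun k => cmod (fc f k)) (fun k => cmod (fc w k)) _ _ _ _ (fun m => j - m) (fun m => j - m)) => //; (assumption || exact: uniq_zwin).
Qed.

(** Uniform in the inner window only; this suffices for the inner limit, taken with the outer window
    fixed. *)
Lemma trilinear_bound s S j (A : pred int) (C : int -> pred int) :
  cmod (\sum_(m <- s | A m) \sum_(p <- zwin S | C m p) fc f (j - m) * fc g (p + m) * conjc (fc w p)) <= (size s)%:R * M ^+ 3.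
Proof.
apply: (le_trans (cmod_sum _ _ _)).
apply: (@le_trans _ _ (\sum_(m <- s) M ^+ 3)); last first.
  by rewrite big_const_seq count_predT iter_addr_0 mulr_natl.
rewrite big_mkcond/=; apply: ler_sum => m _; case: ifP => _; last by rewrite exprn_ge0.
apply: (le_trans (cmod_sum _ _ _)).
apply: (@le_trans _ _ (\sum_(p <- zwin S | C m p) (M * (cmod (fc g (p + m)) * cmod (fc w p))))).
  apply: ler_sum => p _; rewrite cmodM3 cmod_conj -mulrA ler_wpM2r ?mulr_ge0//; exact: cmod_fc_le_l2.
rewrite -mulr_sumr exprS expr2; apply: ler_wpM2l => //.
apply: (@l2_CS_cond (fun k => cmod (fc g k)) (fun k => cmod (fc w k)) _ _ _ _ (fun p => p + m) id) => //.
  by move=> a b; lia.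
(assumption || exact: uniq_zwin).
Qed.

Lemma NR3p_bound s j : uniq s -> cmod (NR3p s f g w j) <= M * nrm (fun x => f x * g x) + 2 * M ^+ 3.
Proof.
move=> us; apply: (le_trans (cmod_sum _ _ _)).
apply: (@le_trans _ _ (\sum_(p <- s) (cmod (fc w p) * cmod (fc (fun x => f x * g x) (j + p))
    + M * (cmod (fc w p) * cmod (fc f p)) + M * (cmod (fc w p) * cmod (fc g p))))).
  apply: ler_sum => p _; rewrite cmodM cmod_conj.
  have -> : cmod (fc w p) * cmod (fc (fun x : R => f x * g x) (j + p)) + M * (cmod (fc w p) * cmod (fc f p)) + M * (cmod (fc w p) * cmod (fc g p)) = cmod (fc w p) * (cmod (fc (fun x : R => f x * g x) (j + p)) + cmod (fc f p) * M + M * cmod (fc g p)) by ring.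
  rewrite ler_wpM2l//.
  apply: (le_trans (cmodB _ _)); apply: lerD; last first.
    case: ifP => _; first by rewrite cmod0 mulr_ge0.
    by rewrite cmodM ler_wpM2r//; exact: cmod_fc_le_l2.
  apply: (le_trans (cmodB _ _)); rewrite lerD2l cmodM ler_wpM2l//; exact: cmod_fc_le_l2.
have inj : injective (fun p : int => j + p) by move=> a b; lia.
rewrite !big_split/= -!mulr_sumr.
have -> : M * nrm (fun x => f x * g x) + 2 * M ^+ 3 = M * nrm (fun x => f x * g x) + M * (M * M) + M * (M * M) by ring.
apply: lerD; first (apply: lerD).
- apply: (@l2_CS_cond (fun k => cmod (fc w k)) (fun k => cmod (fc (fun x => f x * g x) k)) _ _ _ _ id (fun p => j + p)) => //.
  + exact: nrm_ge0.
  + by apply: l2b_nrm; case: (qi_mul qf qg).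
- apply: ler_wpM2l => //.
  by apply: (@l2_CS_cond (fun k => cmod (fc w k)) (fun k => cmod (fc f k)) _ _ _ _ id id) => //; (assumption || exact: uniq_zwin).
- apply: ler_wpM2l => //.
  by apply: (@l2_CS_cond (fun k => cmod (fc w k)) (fun k => cmod (fc g k)) _ _ _ _ id id) => //; (assumption || exact: uniq_zwin).
Qed.

Lemma NR3pr_bound s S j : cmod (NR3pr s S f g w j) <= (size s)%:R * M ^+ 3.
Proof.
apply: (le_trans (cmod_sum _ _ _)).
apply: (@le_trans _ _ (\sum_(m <- s) M ^+ 3)); last first.
  by rewrite big_const_seq count_predT iter_addr_0 mulr_natl.
apply: ler_sum => p _.
apply: (le_trans (cmod_sum _ _ _)).
apply: (@le_trans _ _ (\sum_(i <- zwin S | (i != j) && (i != p)) (M * (cmod (fc f (j + p - i)) * cmod (fc g i))))).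
  apply: ler_sum => i _; rewrite mulrA cmodM3 cmod_conj -mulrA ler_wpM2r ?mulr_ge0//; exact: cmod_fc_le_l2.
rewrite -mulr_sumr exprS expr2; apply: ler_wpM2l => //.
apply: (@l2_CS_cond (fun k => cmod (fc f k)) (fun k => cmod (fc g k)) _ _ _ _ (fun i => j + p - i) id) => //.
  by move=> a b; lia.
(assumption || exact: uniq_zwin).
Qed.

End Bounds.

End Statics.

(** * Far interactions *)

Section Flows.
Context {R : realType}.
Notation mu := (@lebesgue_measure R).
Notation D := (torus R).
Notation fc := (@fourier_coef R).
#[local] Hint Resolve mseg mtorus : core.

Lemma rint_cst_seg (t c : R) : rintegrable mu `[0, t] (fun=> c).
Proof.
apply: continuous_compact_integrable; first exact: segment_compact.
by apply: continuous_subspaceT => x; exact: cvg_cst.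
Qed.

(** Tonelli for the positive and the negative part, whose integrals may be infinite for some values
    of the parameter. *)
Lemma meas_Rint_param (h : R * R -> R) : measurable_fun setT h ->
  measurable_fun setT (fun s => \int[mu]_(x in D) h (s, x)).
Proof.
move=> mh.
pose H (p : R * R) := (h p * \1_D p.2)%:E.
have mH : measurable_fun setT H.
  apply/measurable_EFinP; apply: measurable_funM => //.
  exact: (measurableT_comp (measurable_indic mtorus) measurable_snd).
have E s : \int[mu]_(x in D) h (s, x) = fine (\int[mu]_x H^\+ (s, x) - \int[mu]_x H^\- (s, x))%E.
  have e x : ((fun x => (h (s, x))%:E) \_ D) x = H (s, x).
    by rewrite /H /patch indicE /=; case: (x \in D); rewrite ?mulr1 ?mulr0.
  rewrite /Rintegral integral_mkcond integralE; congr (fine (_ - _)); apply: eq_integral => x _.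
    by rewrite !funeposE e.
  by rewrite !funenegE e.
rewrite (_ : (fun s => _) = (fun s => fine (\int[mu]_x H^\+ (s, x) - \int[mu]_x H^\- (s, x))%E)); last exact/funext.
apply: measurableT_comp => //.
by apply: emeasurable_funB; apply: measurable_fun_fubini_tonelli_F => //;
  [exact: measurable_funepos|exact: measurable_funeneg].
Qed.

Lemma meas_Cint_param (f : R * R -> R[i]) : cmeasurable f ->
  cmeasurable (fun s => Cintegral mu D (fun x => f (s, x))).
Proof. by move=> [m1 m2]; split; [exact: (meas_Rint_param m1)|exact: (meas_Rint_param m2)]. Qed.

Lemma meas_fc_param (f : R -> R -> R[i]) k : cmeasurable (fun p => f p.1 p.2) ->
  cmeasurable (fun s => fc (f s) k).
Proof.
move=> mf.
have mc : cmeas_on setT (fun p : R * R => f p.1 p.2 * cis (- (k%:~R * p.2))).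
  apply: cmeasM => //; apply: cmeas_cis.
  by apply: measurable_funN; apply: (measurable_funM (measurable_cst _) measurable_snd).
by apply: cmeasM; [exact: cmeas_cst|exact: (meas_Cint_param mc)].
Qed.

Lemma cvgC_Re (u : nat -> R[i]) z : cvgC u z -> (fun n => Re (u n)) @ \oo --> Re z.
Proof.
move=> H; apply/cvgrPdist_le => e e0; move/cvgrPdist_le : H => /(_ e e0).
apply: filterS => n; rewrite sub0r normrN ger0_norm ?cmod_ge0// distrC; apply: le_trans.
by rewrite -cReN -cReD; exact: Re_le_cmod.
Qed.

Lemma cvgC_Im (u : nat -> R[i]) z : cvgC u z -> (fun n => Im (u n)) @ \oo --> Im z.
Proof.
move=> H; apply/cvgrPdist_le => e e0; move/cvgrPdist_le : H => /(_ e e0).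
apply: filterS => n; rewrite sub0r normrN ger0_norm ?cmod_ge0// distrC; apply: le_trans.
by rewrite -cImN -cImD; exact: Im_le_cmod.
Qed.

Lemma cvgC_shift (u : nat -> R[i]) n z : cvgC u z -> cvgC (fun k => u (n + k)%N) z.
Proof.
move=> H; have := H; rewrite /cvgC -(cvg_shiftn n (fun n => cmod (u n - z))).
by under [X in X @ _ --> _ -> _]eq_fun do rewrite addnC.
Qed.

(** Dominated convergence in time, arranged so that a uniform bound on the integrals passes to the
    limit. *)
Lemma tint_limit (t : R) (F : nat -> R -> R[i]) (E : R -> R[i]) (H : R -> R) (B : R) :
  (forall n, cmeas_on `[0, t] (F n)) -> rintegrable mu `[0, t] H ->
  (forall n s, 0 <= s <= t -> cmod (F n s) <= H s) ->
  (forall s, 0 <= s <= t -> cvgC (F^~ s) (E s)) ->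
  (forall n, cmod (tint t (F n)) <= B) ->
  cintegrable mu `[0, t] E /\ cmod (tint t E) <= B.
Proof.
move=> mF iH FH FE FB.
have itv s : `[0, t]%classic s -> 0 <= s <= t by rewrite /= in_itv.
have mid_phase : cmeas_on `[0, t] E.
  split.
    apply: (measurable_fun_cvg (h := fun n s => Re (F n s))) => [n|s /itv st]; first exact: (proj1 (mF n)).
    exact: cvgC_Re (FE s st).
  apply: (measurable_fun_cvg (h := fun n s => Im (F n s))) => [n|s /itv st]; first exact: (proj2 (mF n)).
  exact: cvgC_Im (FE s st).
have EH s : 0 <= s <= t -> cmod (E s) <= H s.
  by move=> st; apply: (cvgC_bound (FE s st)) => n; exact: FH.
have iE : cintegrable mu `[0, t] E by apply: (cint_le (mseg 0 t) mid_phase _ iH) => s /itv; exact: EH.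
have iF n : cintegrable mu `[0, t] (F n) by apply: (cint_le (mseg 0 t) (mF n) _ iH) => s /itv; exact: FH.
split=> //; apply: (@cvgC_bound _ (fun n => tint t (F n))) FB.
apply: (@cvgC_le _ _ _ (fun n => \int[mu]_(s in `[0, t]) cmod (F n s - E s))).
  move=> n; rewrite /tint -(CintB (mseg 0 t)) //; apply: (cmod_Cint_le (mseg 0 t)).
  exact: (cintB (mseg 0 t)).
apply: (@Rint_dct _ 0 t _ (fun s => 2 * H s)).
- by move=> n; apply: meas_cmod; apply: cmeasB.
- exact: (rintZ (mseg 0 t)).
- move=> n s st; rewrite ger0_norm ?cmod_ge0//; apply: (le_trans (cmodB _ _)).
  by have := FH n s st; have := EH s st; lra.
- by apply: aeW => s st; exact: FE.
Qed.

Lemma eq_ae_tint (t : R) (F G : R -> R[i]) : cmeas_on `[0, t] F -> cmeas_on `[0, t] G ->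
  {ae mu, forall s, 0 <= s <= t -> F s = G s} -> tint t F = tint t G.
Proof.
move=> [mF1 mF2] [mG1 mG2] FG; rewrite /tint /Cintegral; congr (_ +i* _);
  rewrite /Rintegral; congr fine; apply: ae_eq_integral => //; try exact/measurable_EFinP;
  apply: filterS FG; try exact: (ae_filter_ringOfSetsType mu);
  move=> s Hs; rewrite /= in_itv/= => st; by rewrite Hs.
Qed.

(* [a k] is the k-th Fourier mode of [f] in the interaction picture, run forward (sg = 1) or backward (sg = -1) in
   time.  It is known only almost everywhere, because [f s] is set to 0 at the times when the L^4 norm is infinite. *)
Record flow (T sg M : R) (h : R -> R) (f : R -> R -> R[i]) (a da : int -> R -> R[i]) : Prop := Flow {
  flow_ac : forall k, cAC T (a k) (da k) ;
  flow_l2 : forall s, 0 <= s <= T -> l2b (fun k => cmod (a k s)) M ;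
  flow_da : forall k s, 0 <= s <= T -> cmod (da k s) <= h s ;
  flow_h : rintegrable mu `[0, T] h ;
  flow_qi : forall s, qi (f s) ;
  flow_fc : forall s, l2b (fun k => cmod (fc (f s) k)) M ;
  flow_meas : cmeasurable (fun p => f p.1 p.2) ;
  flow_q : rintegrable mu `[0, T] (fun s => qmass (f s)) ;
  flow_ae : {ae mu, forall s, 0 <= s <= T -> forall k, a k s = cis (sg * k%:~R ^+ 2 * s) * fc (f s) k}
}.

Section Far.
Variables (T sg X M : R) (N : nat) (gx h : R -> R) (x dx : int -> R -> R[i]).
Variables (f g w : R -> R -> R[i]) (a da b db c dc : int -> R -> R[i]).
Hypotheses (T0 : 0 <= T) (sg1 : `|sg| = 1) (X0 : 0 <= X) (M0 : 0 <= M) (N0 : (0 < N)%N).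
Hypotheses (Ff : flow T sg M h f a da) (Fg : flow T sg M h g b db) (Fw : flow T sg M h w c dc).
Hypothesis ax : forall k, cAC T (x k) (dx k).
Hypothesis lx : forall s, 0 <= s <= T -> l2b (fun k => cmod (x k s)) X.
Hypothesis bx : forall k s, 0 <= s <= T -> cmod (dx k s) <= gx s.
Hypothesis igx : rintegrable mu `[0, T] gx.
Variable J : seq int.
Hypothesis uJ : uniq J.

Definition far_err (t : R) : R := kap N * (2 * (X * M ^+ 3)) +
  \int[mu]_(s in `[0, t]) (kap N * (gx s * M ^+ 3 + 3 * h s * X * M ^+ 2)).

(** The outer index o and the inner index i parametrize through [yf] the parallelograms with vertex
    p + l + m = j; [cond] selects the far ones. The different ways of truncating [NR] are instances
    of this scheme. *)
Variables (cond : int -> int -> int -> bool) (yf : int -> int -> int -> int * int * int).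
Hypothesis cond_off : forall j o i, cond j o i -> offaxis N (yf j o i).
Hypothesis yf_sum : forall j o i, (yf j o i).1.1 + (yf j o i).1.2 + (yf j o i).2 = j.
Hypothesis yf_inj : forall j o i o' i', yf j o i = yf j o' i' -> o = o' /\ i = i'.

Let tri P S : seq (int * int * int) := [seq (q, i) | q <- [seq (j, o) | j <- J, o <- zwin P], i <- zwin S].
Let rr P S := [seq yf q.1.1 q.1.2 q.2 | q <- tri P S & cond q.1.1 q.1.2 q.2].

Let uniq_rr P S : uniq (rr P S).
Proof.
rewrite /rr map_inj_uniq.
  apply: filter_uniq; apply: allpairs_uniq => //; last by case=> [[? ?] ?] [[? ?] ?] _ _ /= [-> -> ->].
  - apply: allpairs_uniq => //; first exact: uniq_zwin.
    by case=> ? ? [? ?] _ _ /= [-> ->].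
  - exact: uniq_zwin.
move=> [[j o] i] [[j' o'] i'] /= e.
have jj : j = j' by rewrite -(yf_sum j o i) -(yf_sum j' o' i') e.
by subst j'; case: (yf_inj e) => -> ->.
Qed.

Let rr_off P S y : y \in rr P S -> offaxis N y.
Proof. by case/mapP => q; rewrite mem_filter => /andP[cq _] ->; exact: cond_off. Qed.

Let sum_rr P S (F : int * int * int -> R[i]) : \sum_(y <- rr P S) F y =
  \sum_(j <- J) \sum_(o <- zwin P) \sum_(i <- zwin S | cond j o i) F (yf j o i).
Proof.
rewrite /rr big_map big_filter big_mkcond /tri big_allpairs big_allpairs.
by apply: eq_bigr => j _; apply: eq_bigr => o _; rewrite [RHS]big_mkcond.
Qed.

Definition vert (s : R) (y : int * int * int) : R[i] :=
  fc (f s) (y.1.1 + y.1.2) * fc (g s) (y.1.1 + y.2) * conjc (fc (w s) y.1.1).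

Variable t : R.
Hypothesis tT : 0 <= t <= T.

Let stT s : 0 <= s <= t -> 0 <= s <= T.
Proof. by case/andP: tT => _ tT' /andP[-> st] /=; exact: le_trans tT'. Qed.

Lemma vert_phase y s :
  a (y.1.1 + y.1.2) s = cis (sg * (y.1.1 + y.1.2)%:~R ^+ 2 * s) * fc (f s) (y.1.1 + y.1.2) ->
  b (y.1.1 + y.2) s = cis (sg * (y.1.1 + y.2)%:~R ^+ 2 * s) * fc (g s) (y.1.1 + y.2) ->
  c y.1.1 s = cis (sg * y.1.1%:~R ^+ 2 * s) * fc (w s) y.1.1 ->
  quartic x a b c y s * cis (freq sg y * s) = x (y.1.1 + y.1.2 + y.2) s *
    cis (sg * (y.1.1 + y.1.2 + y.2)%:~R ^+ 2 * s) * vert s y.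
Proof.
case: y => [[p l] m] /=; rewrite /quartic /vert /= => -> -> ->.
have -> : cis (sg * (p + l + m)%:~R ^+ 2 * s) = cis (sg * (p + l)%:~R ^+ 2 * s) *
   cis (sg * (p + m)%:~R ^+ 2 * s) * conjc (cis (sg * p%:~R ^+ 2 * s)) * cis (freq sg (p, l, m) * s) :> R[i].
  rewrite -cisN -!cisD; congr cis; rewrite /freq /= !intrD; ring.
rewrite cJM; ring.
Qed.

Lemma cmeas_sub (E E' : set R) (u : R -> R[i]) : measurable E -> E' `<=` E -> cmeas_on E u -> cmeas_on E' u.
Proof. by move=> mid_phase EE [m1 m2]; split; apply: (measurable_funS mid_phase EE). Qed.

Let sub_tT : `[0, t]%classic `<=` `[0, T]%classic.
Proof. by apply: itv0S; case/andP: tT. Qed.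

Lemma meas_x j : cmeas_on `[0, t] (x j).
Proof. by apply: (cmeas_sub (mseg 0 T) sub_tT); exact: cAC_meas (ax j). Qed.

Lemma meas_phase j : cmeas_on `[0, t] (fun s => x j s * cis (sg * j%:~R ^+ 2 * s)).
Proof. by apply: cmeasM; [exact: meas_x|apply: cmeas_cis; exact: meas_mulr]. Qed.

Lemma meas_vert E y : cmeas_on E (fun s => vert s y).
Proof.
apply: cmeasM; last by apply: cmeasJ; apply: cmeas_onS; exact: meas_fc_param (flow_meas Fw).
by apply: cmeasM; apply: cmeas_onS; [exact: meas_fc_param (flow_meas Ff)|exact: meas_fc_param (flow_meas Fg)].
Qed.

Lemma far_finite P S : cmod (tint t (fun s => \sum_(j <- J) x j s * cis (sg * j%:~R ^+ 2 * s) *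
     \sum_(o <- zwin P) \sum_(i <- zwin S | cond j o i) vert s (yf j o i))) <= far_err t.
Proof.
have -> : tint t (fun s => \sum_(j <- J) x j s * cis (sg * j%:~R ^+ 2 * s) *
     \sum_(o <- zwin P) \sum_(i <- zwin S | cond j o i) vert s (yf j o i)) =
   tint t (fun s => \sum_(y <- rr P S) quartic x a b c y s * cis (freq sg y * s)).
  apply: eq_ae_tint.
  - apply: cmeas_sum => j; apply: cmeasM; first exact: meas_phase.
    by apply: cmeas_sum => o; apply: cmeas_sum => i; exact: meas_vert.
  - apply: cmeas_sum => y; apply: cmeasM; last by apply: cmeas_cis; exact: meas_mulr.
    apply: (cmeas_sub (mseg 0 T) sub_tT); apply: (cAC_meas T0).
    exact: (quartic_AC y T0 ax (flow_ac Ff) (flow_ac Fg) (flow_ac Fw)).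
  - move: (flow_ae Ff) (flow_ae Fg) (flow_ae Fw); apply: filterS3; first exact: (ae_filter_ringOfSetsType mu).
    move=> s ea eb ec st; rewrite sum_rr; apply: eq_bigr => j _; rewrite mulr_sumr; apply: eq_bigr => o _.
    rewrite mulr_sumr; apply: eq_bigr => i _.
    by rewrite vert_phase ?ea ?eb ?ec ?yf_sum//; exact: stT.
apply: (@normal_form R T sg X M N gx h x dx a da b db c dc (rr P S) T0 sg1 X0 M0 N0 ax (flow_ac Ff) (flow_ac Fg) (flow_ac Fw)) => //.
- exact: (flow_l2 Ff).
- exact: (flow_l2 Fg).
- exact: (flow_l2 Fw).
- exact: (flow_da Ff).
- exact: (flow_da Fg).
- exact: (flow_da Fw).
- exact: (flow_h Ff).
- exact: rr_off.
Qed.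

Variables (win : nat -> nat) (EPS : nat -> nat -> int -> R -> R[i]) (EP : nat -> int -> R -> R[i]) (E : int -> R -> R[i]).
Variables (KPS : nat -> R) (KP : R -> R).
Hypothesis EPSE : forall P S j s, j \in J ->
  EPS P S j s = \sum_(o <- zwin (win P)) \sum_(i <- zwin S | cond j o i) vert s (yf j o i).
Hypothesis EPS_cvg : forall P j s, j \in J -> cvgC (fun S => EPS P S j s) (EP P j s).
Hypothesis EPS_bound : forall P S j s, j \in J -> cmod (EPS P S j s) <= KPS P.
Hypothesis EP_cvg : forall j s, j \in J -> cvgC (fun P => EP P j s) (E j s).
Hypothesis EP_bound : forall P j s, j \in J -> cmod (EP P j s) <= KP s.
Hypothesis iKP : rintegrable mu `[0, T] KP.

Lemma cmod_x j s : 0 <= s <= T -> cmod (x j s) <= X.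
Proof. by move=> sT; have := l2b_le j (lx sT) X0; rewrite ger0_norm ?cmod_ge0. Qed.

Let dom (F : int -> R -> R[i]) (K : R) s : 0 <= s <= t -> (forall j, j \in J -> cmod (F j s) <= K) ->
  cmod (\sum_(j <- J) x j s * cis (sg * j%:~R ^+ 2 * s) * F j s) <= (size J)%:R * X * K.
Proof.
move=> st FK; rewrite (_ : _ * K = \sum_(j <- J) X * K); last first.
  by rewrite big_const_seq count_predT iter_addr_0 -mulrA mulr_natl.
apply: (le_trans (cmod_sum _ _ _)); rewrite big_seq [leRHS]big_seq; apply: ler_sum => j jJ.
by rewrite cmodM cmodM cmod_cis mulr1 ler_pM ?cmod_ge0// ?cmod_x ?FK//; exact: stT.
Qed.

Let cvg_test (F : nat -> int -> R -> R[i]) (G : int -> R -> R[i]) s :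
  (forall j, j \in J -> cvgC (fun n => F n j s) (G j s)) ->
  cvgC (fun n => \sum_(j <- J) x j s * cis (sg * j%:~R ^+ 2 * s) * F n j s)
    (\sum_(j <- J) x j s * cis (sg * j%:~R ^+ 2 * s) * G j s).
Proof.
move=> H; rewrite big_seq (_ : (fun n => _) = (fun n => \sum_(j <- J | j \in J) x j s * cis (sg * j%:~R ^+ 2 * s) * F n j s)).
  by apply: cvgC_sum => j jJ; apply: cvgCZ; exact: H.
by apply/funext => n; rewrite big_seq.
Qed.

(** The bound of [far_finite] does not see the truncations, so it survives two dominated limits: the
    inner one, where the dominating constant [KPS] may depend on the outer window, then the outer
    one, where [KP] is an integrable function of time independent of the window. *)
Lemma far_bound :
  cintegrable mu `[0, t] (fun s => \sum_(j <- J) x j s * cis (sg * j%:~R ^+ 2 * s) * E j s) /\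
  cmod (tint t (fun s => \sum_(j <- J) x j s * cis (sg * j%:~R ^+ 2 * s) * E j s)) <= far_err t.
Proof.
have inner P : cintegrable mu `[0, t] (fun s => \sum_(j <- J) x j s * cis (sg * j%:~R ^+ 2 * s) * EP P j s) /\
  cmod (tint t (fun s => \sum_(j <- J) x j s * cis (sg * j%:~R ^+ 2 * s) * EP P j s)) <= far_err t.
  apply: (@tint_limit t (fun S s => \sum_(j <- J) x j s * cis (sg * j%:~R ^+ 2 * s) * EPS P S j s) _ (fun=> (size J)%:R * X * KPS P)).
  - move=> S; rewrite (_ : (fun s => _) = (fun s => \sum_(j <- J) x j s * cis (sg * j%:~R ^+ 2 * s) *
       \sum_(o <- zwin (win P)) \sum_(i <- zwin S | cond j o i) vert s (yf j o i))).
      apply: cmeas_sum => j; apply: cmeasM; first exact: meas_phase.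
      by apply: cmeas_sum => o; apply: cmeas_sum => i; exact: meas_vert.
    by apply/funext => s; rewrite big_seq [RHS]big_seq; apply: eq_bigr => j jJ; rewrite EPSE.
  - exact: rint_cst_seg.
  - by move=> S s st; apply: dom => // j jJ; exact: EPS_bound.
  - by move=> s st; apply: cvg_test => j jJ; exact: EPS_cvg.
  - move=> S; have := far_finite (win P) S; congr (cmod (tint t _) <= _).
    by apply/funext => s; rewrite big_seq [RHS]big_seq; apply: eq_bigr => j jJ; rewrite EPSE.
apply: (@tint_limit t (fun P s => \sum_(j <- J) x j s * cis (sg * j%:~R ^+ 2 * s) * EP P j s) _ (fun s => (size J)%:R * X * KP s)).
- by move=> P; case: (inner P) => /cint_meas.
- apply: (rintZ (mseg 0 t)); exact: rint_itvS tT iKP.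
- by move=> P s st; apply: dom => // j jJ; exact: EP_bound.
- by move=> s st; apply: cvg_test => j jJ; exact: EP_cvg.
- by move=> P; case: (inner P).
Qed.

End Far.

(** * Three truncations of the nonresonant term *)

Section FarInstances.
Variables (T sg X M : R) (N : nat) (gx h : R -> R) (x dx : int -> R -> R[i]).
Variables (f g w : R -> R -> R[i]) (a da b db c dc : int -> R -> R[i]).
Hypotheses (T0 : 0 <= T) (sg1 : `|sg| = 1) (X0 : 0 <= X) (M0 : 0 <= M) (N0 : (0 < N)%N).
Hypotheses (Ff : flow T sg M h f a da) (Fg : flow T sg M h g b db) (Fw : flow T sg M h w c dc).
Hypothesis ax : forall k, cAC T (x k) (dx k).
Hypothesis lx : forall s, 0 <= s <= T -> l2b (fun k => cmod (x k s)) X.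
Hypothesis bx : forall k s, 0 <= s <= T -> cmod (dx k s) <= gx s.
Hypothesis igx : rintegrable mu `[0, T] gx.
Variable J : seq int.
Hypothesis uJ : uniq J.
Variable t : R.
Hypothesis tT : 0 <= t <= T.

Let qf s := flow_qi Ff s. Let qg s := flow_qi Fg s. Let qw s := flow_qi Fw s.
Let lf s := flow_fc Ff s. Let lg s := flow_fc Fg s. Let lw s := flow_fc Fw s.

Let K1 s := M * (1 + 2^-1 * (qmass (g s) + qmass (w s))) + M ^+ 3.
Let K3 s := M * (1 + 2^-1 * (qmass (f s) + qmass (g s))) + 2 * M ^+ 3.

Lemma nrm_le1 (u : R -> R[i]) : nrm u <= 1 + mass u.
Proof. have := nrm_sqr u; have := nrm_ge0 u; have := sqr_ge0 (nrm u - 1); nra. Qed.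

Let iK (u v : R -> R) (c1 c2 : R) : rintegrable mu `[0, T] u -> rintegrable mu `[0, T] v ->
  rintegrable mu `[0, T] (fun s => M * (c1 + 2^-1 * (u s + v s)) + c2).
Proof.
move=> iu iv; apply: (rintD (mseg 0 T)); last exact: rint_cst_seg.
apply: (rintZ (mseg 0 T)); apply: (rintD (mseg 0 T)); first exact: rint_cst_seg.
by apply: (rintZ (mseg 0 T)); exact: (rintD (mseg 0 T)).
Qed.

Let K1_bound s r j : uniq r -> cmod (NRp r (f s) (g s) (w s) j) <= K1 s.
Proof.
move=> ur; apply: (le_trans (NRp_bound M0 (qg s) (qw s) (lf s) (lg s) (lw s) j ur)).
rewrite lerD2r ler_wpM2l// (le_trans (nrm_le1 _))// lerD2l.
by have [_] := qi_mul (qg s) (qi_conj (qw s)); rewrite qmass_conj.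
Qed.

Let K3_bound s r j : uniq r -> cmod (NR3p r (f s) (g s) (w s) j) <= K3 s.
Proof.
move=> ur; apply: (le_trans (NR3p_bound M0 (qf s) (qg s) (lf s) (lg s) (lw s) j ur)).
rewrite lerD2r ler_wpM2l// (le_trans (nrm_le1 _))// lerD2l.
by have [_] := qi_mul (qf s) (qg s).
Qed.

Let bound2 (u v : R[i]) (c1 c2 : R) : cmod u <= c1 -> cmod v <= c2 -> cmod (u - v) <= c1 + c2.
Proof. by move=> h1 h2; apply: (le_trans (cmodB _ _)); exact: lerD. Qed.

(** Here the discarded interactions are those where the frequency j - m of the first factor is more
    than N away from j. *)
Lemma far1 : let E j s := NR (f s) (g s) (w s) j - NRp (zwin N) (f s) (g s) (w s) j in
  cintegrable mu `[0, t] (fun s => \sum_(j <- J) x j s * cis (sg * j%:~R ^+ 2 * s) * E j s) /\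
  cmod (tint t (fun s => \sum_(j <- J) x j s * cis (sg * j%:~R ^+ 2 * s) * E j s)) <= far_err X M N gx h t.
Proof.
move=> E.
apply: (@far_bound T sg X M N gx h x dx f g w a da b db c dc T0 sg1 X0 M0 N0 Ff Fg Fw ax lx bx igx J uJ
  (fun j m p => (m \notin zwin N) && (m != 0) && (p != j - m)) (fun j m p => (p, j - m - p, m)) _ _ _ t tT
  (fun P => (N + P)%N)
  (fun P S j s => NRpr (zwin (N + P)) S (f s) (g s) (w s) j - NRpr (zwin N) S (f s) (g s) (w s) j)
  (fun P j s => NRp (zwin (N + P)) (f s) (g s) (w s) j - NRp (zwin N) (f s) (g s) (w s) j) E
  (fun P => (size (zwin (N + P)))%:R * M ^+ 3 + (size (zwin N))%:R * M ^+ 3)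
  (fun s => K1 s + K1 s)).
- by move=> j m p; rewrite /offaxis mem_zwin /= => H; lia.
- by move=> j m p /=; lia.
- by move=> j m p m' p' [] *; lia.
- move=> P S j s _; rewrite /NRpr sum_seq_diff ?uniq_zwin//; last by move=> k; rewrite !mem_zwin; lia.
  rewrite big_mkcond; apply: eq_bigr => m _.
  case: (_ && _) => /=; last by rewrite big_pred0.
  apply: eq_big => // p _; rewrite /vert /=; congr (fc _ _ * _ * _); lia.
- move=> P j s _; apply: cvgCB; exact: NRpr_cvg.
- by move=> P S j s _; apply: bound2; exact: trilinear_bound.
- move=> j s _; apply: cvgCB; last exact: cvgC_cst.
  by apply: (@cvgC_shift (fun P => NRp (zwin P) (f s) (g s) (w s) j)); apply: NRp_cvg.
- by move=> P j s _; apply: bound2; apply: K1_bound; exact: uniq_zwin.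
- apply: (rintD (mseg 0 T)); apply: iK; [exact: flow_q Fg|exact: flow_q Fw|exact: flow_q Fg|exact: flow_q Fw].
Qed.

(** Both gaps are at most n, so all three input frequencies are within 2 n of j, and a slowly
    varying weight can be moved to any of them. *)
Definition NRsq (n : nat) (f g w : R -> R[i]) j := \sum_(m <- zwin n | m != 0) \sum_(l <- zwin n | l != 0)
  fc f (j - m) * fc g (j - l) * conjc (fc w (j - m - l)).

Lemma farsq : let E j s := NR (f s) (g s) (w s) j - NRsq N (f s) (g s) (w s) j in
  cintegrable mu `[0, t] (fun s => \sum_(j <- J) x j s * cis (sg * j%:~R ^+ 2 * s) * E j s) /\
  cmod (tint t (fun s => \sum_(j <- J) x j s * cis (sg * j%:~R ^+ 2 * s) * E j s)) <= far_err X M N gx h t.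
Proof.
move=> E.
(* The finite sum rewritten over the vertex p = j - m - l restricted to the window S, the format of
   [far_bound]; it is stationary once S contains all these vertices. *)
pose SQ S j s := \sum_(m <- zwin N | m != 0) \sum_(p <- zwin S | (p != j - m) && (`|(j - m - p)%R| <= N)%N)
   fc (f s) (j - m) * fc (g s) (p + m) * conjc (fc (w s) p).
have SQ_cvg j s : cvgC (fun S => SQ S j s) (NRsq N (f s) (g s) (w s) j).
  apply: cvgC_sum => m m0; apply: (@cvgC_near _ _ (fun=> \sum_(l <- zwin N | l != 0)
     fc (f s) (j - m) * fc (g s) (j - l) * conjc (fc (w s) (j - m - l)))); last exact: cvgC_cst.
  exists (`|(j - m)%R| + N)%N; first by [].
  move=> n Hn; have {}Hn : (`|(j - m)%R| + N <= n)%N := Hn.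
  rewrite -big_filter -[RHS]big_filter (_ : \sum_(l <- [seq l <- zwin N | l != 0]) _ =
    \sum_(p <- [seq j - m - l | l <- [seq l <- zwin N | l != 0]]) fc (f s) (j - m) * fc (g s) (p + m) * conjc (fc (w s) p)).
    apply: perm_big; apply: uniq_perm; first by rewrite filter_uniq ?uniq_zwin.
      by rewrite map_inj_uniq ?filter_uniq ?uniq_zwin// => u v; lia.
    move=> p; rewrite mem_filter mem_zwin; apply/idP/mapP => [H|[l]].
      by exists (j - m - p); rewrite ?mem_filter ?mem_zwin; lia.
    by rewrite mem_filter mem_zwin => H ->; lia.
  by rewrite big_map; apply: eq_bigr => l _; congr (_ * fc _ _ * _); lia.
apply: (@far_bound T sg X M N gx h x dx f g w a da b db c dc T0 sg1 X0 M0 N0 Ff Fg Fw ax lx bx igx J uJ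
  (fun j m p => [&& m != 0, p != j - m & ~~ ((m \in zwin N) && (`|(j - m - p)%R| <= N)%N)])
  (fun j m p => (p, j - m - p, m)) _ _ _ t tT
  (fun P => (N + P)%N)
  (fun P S j s => NRpr (zwin (N + P)) S (f s) (g s) (w s) j - SQ S j s)
  (fun P j s => NRp (zwin (N + P)) (f s) (g s) (w s) j - NRsq N (f s) (g s) (w s) j) E
  (fun P => (size (zwin (N + P)))%:R * M ^+ 3 + (size (zwin N))%:R * M ^+ 3)
  (fun s => K1 s + (size (zwin N))%:R * M ^+ 3)).
- by move=> j m p; rewrite /offaxis mem_zwin /= => H; lia.
- by move=> j m p /=; lia.
- by move=> j m p m' p' [] *; lia.
- move=> P S j s _; rewrite /NRpr /SQ.
  rewrite (_ : \sum_(m <- zwin N | m != 0) _ = \sum_(m <- zwin (N + P) | m != 0)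
     if m \in zwin N then \sum_(p <- zwin S | (p != j - m) && (`|(j - m - p)%R| <= N)%N)
        fc (f s) (j - m) * fc (g s) (p + m) * conjc (fc (w s) p) else 0); last first.
    rewrite -big_mkcondr/= -big_filter -[RHS]big_filter; apply: perm_big.
    apply: uniq_perm; rewrite ?filter_uniq ?uniq_zwin// => k.
    by rewrite !mem_filter !mem_zwin; lia.
  rewrite -sumrB big_mkcond; apply: eq_bigr => m _; case: (m != 0) => /=; last by rewrite big1.
  case: (m \in zwin N) => /=; last first.
    rewrite subr0; apply: eq_big => [p|p _]; first by rewrite andbT.
    by rewrite /vert /=; congr (fc _ _ * _ * _); lia.
  rewrite (bigID (fun p => `|(j - m - p)%R| <= N)%N)/= addrC addrK.
  by apply: eq_big => // p _; rewrite /vert /=; congr (fc _ _ * _ * _); lia.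
- move=> P j s _; apply: cvgCB; first exact: NRpr_cvg.
  exact: SQ_cvg.
- by move=> P S j s _; apply: bound2; exact: trilinear_bound.
- move=> j s _; apply: cvgCB; last exact: cvgC_cst.
  by apply: (@cvgC_shift (fun P => NRp (zwin P) (f s) (g s) (w s) j)); apply: NRp_cvg.
- move=> P j s _; apply: bound2; first by apply: K1_bound; exact: uniq_zwin.
  by apply: (cvgC_bound (SQ_cvg j s)) => n; exact: trilinear_bound.
- apply: (rintD (mseg 0 T)); last exact: rint_cst_seg.
  by apply: iK; [exact: flow_q Fg|exact: flow_q Fw].
Qed.

(** Why twice N: if p = j - l - m is more than 2 N away from j, then |l| or |m| exceeds N. *)
Definition win3 (j : int) := [seq j - n | n <- zwin (N.*2)].

Lemma far3 : let E j s := NR (f s) (g s) (w s) j - NR3p (win3 j) (f s) (g s) (w s) j in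
  cintegrable mu `[0, t] (fun s => \sum_(j <- J) x j s * cis (sg * j%:~R ^+ 2 * s) * E j s) /\
  cmod (tint t (fun s => \sum_(j <- J) x j s * cis (sg * j%:~R ^+ 2 * s) * E j s)) <= far_err X M N gx h t.
Proof.
(* Outer windows of radius at least K contain [win3 j] for every j in J, so the truncations differ
   by a sum over a complement. *)
move=> E; pose K := (N.*2 + \sum_(j <- J) `|j|%N)%N.
have jK j : j \in J -> (N.*2 + `|j| <= K)%N by move=> jJ; rewrite /K (bigD1_seq j)//= addnA leq_addr.
have sz j : size (win3 j) = size (zwin N.*2) by rewrite size_map.
apply: (@far_bound T sg X M N gx h x dx f g w a da b db c dc T0 sg1 X0 M0 N0 Ff Fg Fw ax lx bx igx J uJ
  (fun j p i => [&& p \notin win3 j, i != j & i != p]) (fun j p i => (p, j - i, i - p)) _ _ _ t tT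
  (fun P => (K + P)%N)
  (fun P S j s => NR3pr (zwin (K + P)) S (f s) (g s) (w s) j - NR3pr (win3 j) S (f s) (g s) (w s) j)
  (fun P j s => NR3p (zwin (K + P)) (f s) (g s) (w s) j - NR3p (win3 j) (f s) (g s) (w s) j) E
  (fun P => (size (zwin (K + P)))%:R * M ^+ 3 + (size (zwin N.*2))%:R * M ^+ 3)
  (fun s => K3 s + K3 s)).
- move=> j p i /and3P[/negP H ij ip]; rewrite /offaxis /=.
  have {}H : (N.*2 < `|(j - p)%R|)%N.
    rewrite ltnNge; apply/negP => H'; apply: H; apply/mapP; exists (j - p); first by rewrite mem_zwin.
    lia.
  by lia.
- by move=> j m p /=; lia.
- by move=> j m p m' p' [] *; lia.
- move=> P S j s jJ; rewrite /NR3pr sum_seq_diff ?uniq_zwin//; first last.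
  + by move=> k /mapP[n]; rewrite !mem_zwin => nN ->; have := jK j jJ; lia.
  + exact: refl_win_uniq.
  rewrite big_mkcond; apply: eq_bigr => p _; rewrite andbT.
  case: (_ \notin _) => /=; last by rewrite big_pred0.
  apply: eq_big => // i _; rewrite /vert /= mulrC; congr (fc _ _ * fc _ _ * _); lia.
- move=> P j s _; apply: cvgCB; exact: NR3pr_cvg.
- move=> P S j s _; rewrite -(sz j); apply: bound2; exact: NR3pr_bound.
- move=> j s _; apply: cvgCB; last exact: cvgC_cst.
  by apply: (@cvgC_shift (fun P => NR3p (zwin P) (f s) (g s) (w s) j)); apply: NR3p_cvg.
- by move=> P j s _; apply: bound2; apply: K3_bound; [exact: uniq_zwin|exact: refl_win_uniq].
- apply: (rintD (mseg 0 T)); apply: iK; [exact: flow_q Ff|exact: flow_q Fg|exact: flow_q Ff|exact: flow_q Fg].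
Qed.

End FarInstances.

End Flows.

#[global] Arguments conjc {R} x : simpl never.
#[global] Arguments fourier_coef : simpl never.

(** * Solutions in the interaction picture *)

Section SolutionFlow.
Context {R : realType}.
Notation mu := (@lebesgue_measure R).
Notation D := (torus R).
Notation fc := (@fourier_coef R).
#[local] Hint Resolve mseg mtorus : core.

Lemma ge0_integral_reflect (t : R) (g : R -> \bar R) : measurable_fun setT g -> (forall s, 0 <= g s)%E ->
  (\int[mu]_(s in `[0%R, t]) g (- s)%R = \int[mu]_(s in `[(- t)%R, 0%R]) g s)%E.
Proof.
move=> mg g0.
have mN : measurable_fun (setT : set (measurableTypeR R)) (-%R : R -> measurableTypeR R) by exact: oppr_measurable.
have := @ge0_integral_pushforward _ _ _ _ R _ mN mu `[(- t)%R, 0%R]%classic g (mseg _ _) (measurable_funTS mg) (fun s _ => g0 s).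
rewrite (_ : -%R @^-1` _ = `[0, t]%classic); last first.
  by apply/seteqP; split => s /=; rewrite !in_itv/=; lra.
move=> <-; apply: eq_measure_integral => A mA _; exact: lebesgue_measureN.
Qed.

Lemma Rint_reflect (t : R) (g : R -> R) : measurable_fun setT g ->
  \int[mu]_(s in `[0, t]) g (- s) = \int[mu]_(s in `[- t, 0]) g s.
Proof.
move=> mg; rewrite /Rintegral; congr fine; rewrite integralE [RHS]integralE; congr (_ - _)%E.
  rewrite -(@ge0_integral_reflect t (fun s => (EFin \o g)^\+ s)%E) //.
    by apply: eq_integral => s _; rewrite !funeposE.
  have /measurable_EFinP/measurable_funepos := mg; exact.
rewrite -(@ge0_integral_reflect t (fun s => (EFin \o g)^\- s)%E) //.
  by apply: eq_integral => s _; rewrite !funenegE.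
have /measurable_EFinP/measurable_funeneg := mg; exact.
Qed.

(** The sign [sg] encodes the direction of time: both directions become integrals over [0, t] with t
    >= 0. *)
Lemma oriented_reflect (sg t : R) (g : R -> R[i]) : cmeasurable g -> 0 <= t -> `|sg| = 1 ->
  oriented_integral (sg * t) g = sg%:C * tint t (fun s => g (sg * s)).
Proof.
move=> [m1 m2] t0 sg1.
have [->|->] : sg = 1 \/ sg = -1 by have [s0|s0] := lerP 0 sg; move: sg1; [rewrite ger0_norm//|rewrite ltr0_norm//]; lra.
  rewrite /oriented_integral mul1r t0 mul1r /tint; congr Cintegral; apply/funext => s; by rewrite mul1r.
rewrite /oriented_integral mulN1r oppr_ge0.
have -> : (fun s => g (-1 * s)) = (fun s => g (- s)) by apply/funext => s; rewrite mulN1r.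
rewrite (_ : (-1)%:C = -1); last by apply: eq_ReIm; rewrite /= ?oppr0.
have E : Cintegral mu `[- t, 0]%classic g = tint t (fun s => g (- s)).
  by rewrite /tint /Cintegral (@Rint_reflect t (fun s => Re (g s)))// (@Rint_reflect t (fun s => Im (g s))).
case: ifP => t0'; last by rewrite mulN1r E.
have -> : t = 0 by lra.
rewrite oppr0 /tint /Cintegral set_itv1 !Rintegral_set1 mulr0 //.
Qed.

Section Quartic.
Variable u : R -> R -> R[i].
Hypothesis mu_ : cmeasurable (fun p : R * R => u p.1 p.2).

(** Extended-real valued, since u(s) is in L^4 for almost every s only. *)
Definition qtime (s : R) : \bar R := (\int[mu]_(x in D) (cmod (u s x) ^+ 4)%:E)%E.

Let Q (p : R * R) : \bar R := ((cmod (u p.1 p.2) ^+ 4) * \1_D p.2)%:E.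

Let Q0 p : (0 <= Q p)%E.
Proof. by rewrite lee_fin mulr_ge0// exprn_ge0// cmod_ge0. Qed.

Let mQ : measurable_fun setT Q.
Proof.
apply/measurable_EFinP; apply: measurable_funM; last exact: (measurableT_comp (measurable_indic mtorus) measurable_snd).
exact: (meas_cmodX 4 mu_).
Qed.

Let qtimeE s : qtime s = (\int[mu]_x Q (s, x))%E.
Proof.
rewrite /qtime integral_mkcond; apply: eq_integral => x _.
by rewrite /Q /patch indicE /=; case: (x \in D); rewrite ?mulr1 ?mulr0.
Qed.

Lemma qtime_ge0 s : (0 <= qtime s)%E.
Proof. by rewrite qtimeE; apply: integral_ge0 => x _; exact: Q0. Qed.

Lemma meas_qtime : measurable_fun setT qtime.
Proof.
rewrite (_ : qtime = fun s => (\int[mu]_x Q (s, x))%E); last by apply/funext => s; exact: qtimeE.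
have := @measurable_fun_fubini_tonelli_F _ _ _ _ R mu Q mQ Q0; exact.
Qed.

Lemma qtime_int (T : R) : L4_spacetime T u -> (\int[mu]_(s in `](- T)%R, T[) qtime s < +oo)%E.
Proof.
rewrite /L4_spacetime => H; apply: le_lt_trans H.
rewrite integral_mkcond [leRHS]integral_mkcond.
rewrite [leRHS](_ : _ = (\int[(mu \x mu)%E]_p (Q p * (\1_(`]- T, T[%classic) p.1)%:E))%E); last first.
  apply: eq_integral => -[s x] _; rewrite /patch /Q /slab /= !indicE -EFinM -mulrA -natrM mulnb andbC.
  by rewrite in_setX; case: (_ && _); rewrite ?mulr1 ?mulr0.
rewrite (fubini_tonelli1 (m1 := mu) (m2 := mu)); last 2 first.
- apply: emeasurable_funM => //; apply/measurable_EFinP.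
  by apply: (measurableT_comp _ measurable_fst); exact: measurable_indic.
- by move=> p; rewrite mule_ge0// lee_fin.
rewrite le_eqVlt; apply/orP; left; apply/eqP; apply: eq_integral => s _.
rewrite /patch /fubini_F /=.
case: (boolP (s \in _)) => sT.
  by rewrite qtimeE; apply: eq_integral => x _; rewrite indicE sT mule1.
by rewrite integral0_eq// => x _; rewrite indicE (negbTE sT) mule0.
Qed.

End Quartic.

Lemma cubicE (f : R -> R[i]) : cubic f = (fun x => f x * (f x * conjc (f x))).
Proof. by apply/funext => x; rewrite /cubic mul_conj mulrC. Qed.

Lemma mass_sqmod (f : R -> R[i]) : mass (fun x => f x * conjc (f x)) = qmass f.
Proof. by apply: eq_Rintegral => x _; rewrite mul_conj cmod_real ger0_norm ?sqr_ge0// -exprM. Qed.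

Lemma cmod_fc_cubic (f : R -> R[i]) k : qi f ->
  cmod (fc (cubic f) k) <= (2 * pi)^-1 * (nrm f * Num.sqrt (qmass f)).
Proof.
move=> qf; rewrite cubicE -mass_sqmod.
by apply: cmod_fc_le; [exact: qi_sqi|exact: sqi_mul_conj].
Qed.

Lemma qi0 : qi (fun=> 0 : R[i]).
Proof.
split; first exact: cmeas_cst.
exact: rint_cst.
Qed.

Lemma mass0 : mass (fun=> 0 : R[i]) = 0.
Proof.
transitivity (\int[mu]_(x in D) (0 : R)); first by apply: eq_Rintegral => x _; rewrite cmod0 expr0n.
by rewrite Rintegral_cst// mul0r.
Qed.

Lemma qmass0 : qmass (fun=> 0 : R[i]) = 0.
Proof.
transitivity (\int[mu]_(x in D) (0 : R)); first by apply: eq_Rintegral => x _; rewrite cmod0 expr0n.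
by rewrite Rintegral_cst// mul0r.
Qed.

Lemma L2_sqi (f : R -> R[i]) : L2torus f -> sqi f.
Proof.
move=> [_ mf H]; split; first exact: cmeas_onS.
apply/integrableP; split.
  by apply/measurable_EFinP; apply: meas_cmodX; exact: cmeas_onS.
by under eq_integral do rewrite /= ger0_norm ?sqr_ge0//.
Qed.

Section Rep.
Variables (gamma T sg M : R) (phi : R -> R[i]) (u : R -> R -> R[i]).
Hypotheses (T0 : 0 <= T) (sg1 : `|sg| = 1) (M0 : 0 <= M).
Hypothesis sol : nls_solution gamma phi u.
Hypothesis uM : forall s, 0 <= s <= T -> mass (u (sg * s)) <= 2 * pi * M ^+ 2.

(* The L^4 norm of u(t) is finite for almost every t only; elsewhere the cubic term has no integrable meaning. *)
Definition rep (s : R) : R -> R[i] :=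
  if (0 <= s <= T) && (qtime u (sg * s) < +oo)%E then u (sg * s) else (fun=> 0).

Let um : cmeasurable (fun p : R * R => u p.1 p.2). Proof. by case: sol. Qed.
Let uL2 t : sqi (u t). Proof. by case: sol => _ [+ _] _ _ _ => /(_ t)/L2_sqi. Qed.

Lemma rep_qi s : qi (rep s).
Proof.
rewrite /rep; case: ifP => [/andP[_ H]|_]; last exact: qi0.
have [mf _] := uL2 (sg * s); split => //.
apply/integrableP; split; first by apply/measurable_EFinP; exact: meas_cmodX.
by under eq_integral do rewrite /= ger0_norm ?exprn_ge0 ?cmod_ge0//.
Qed.

Lemma rep_mass s : mass (rep s) <= 2 * pi * M ^+ 2.
Proof.
rewrite /rep; case: ifP => [/andP[sT _]|_]; first exact: uM.
by rewrite mass0 mulr_ge0 ?sqr_ge0 ?(ltW twopi_gt0).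
Qed.

Let mscale : measurable_fun setT (fun s : R => qtime u (sg * s)).
Proof. by apply: (measurableT_comp (@meas_qtime u um)); exact: mulrl_measurable. Qed.

Let A : set R := [set s | (0 <= s <= T) && (qtime u (sg * s) < +oo)%E].

Let mA : measurable A.
Proof.
have H := emeasurable_fun_infty_o measurableT mscale (+oo)%E.
have := measurableI _ _ (mseg 0 T) H; congr measurable; apply/seteqP; split => s /=.
  by rewrite in_itv/= /A /= => -[sT [_ h]]; rewrite sT h.
by move=> /andP[sT h]; rewrite in_itv/= sT.
Qed.

Let joint : cmeasurable (fun p : R * R => u (sg * p.1) p.2).
Proof.
have mp : measurable_fun setT (fun p : R * R => (sg * p.1, p.2)).
  apply: measurable_fun_pair; last exact: measurable_snd.
  exact: (measurable_funM (measurable_cst _) measurable_fst).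
by case: um => m1 m2; split; [exact: (measurableT_comp m1 mp)|exact: (measurableT_comp m2 mp)].
Qed.

Lemma rep_meas : cmeasurable (fun p : R * R => rep p.1 p.2).
Proof.
rewrite (_ : (fun p => _) = (fun p : R * R => (\1_A p.1)%:C * u (sg * p.1) p.2)).
  apply: cmeasM; last exact: joint.
  apply: (@cmeas_real _ _ R setT (fun p : R * R => \1_A p.1)).
  exact: (measurableT_comp (measurable_indic mA) measurable_fst).
apply/funext => p; rewrite /rep indicE.
case: ifP => h; first by rewrite mem_set ?mul1r.
by rewrite memNset ?mul0r// /A /= h.
Qed.

Let qfin : (\int[mu]_(s in `[0%R, T]) qtime u (sg * s)%R < +oo)%E.
Proof.
(* [L4_spacetime] bounds an open slab; T + 1 makes it contain the closed time interval, also when T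
   = 0. *)
have T1 : 0 < T + 1 by rewrite ltr_pwDr.
have [_ _ L4 _ _] := sol.
have H := @qtime_int u um _ (L4 _ T1).
have [->|->] : sg = 1 \/ sg = -1 by have [s0|s0] := lerP 0 sg; move: sg1; [rewrite ger0_norm//|rewrite ltr0_norm//]; lra.
  under eq_integral do rewrite mul1r.
  apply: le_lt_trans H; apply: ge0_subset_integral => //.
  - exact: measurable_funTS (@meas_qtime u um).
  - by move=> s _; exact: qtime_ge0.
  - by move=> s /=; rewrite !in_itv/=; lra.
under eq_integral do rewrite mulN1r.
rewrite (ge0_integral_reflect T (@meas_qtime u um) (qtime_ge0 u)).
apply: le_lt_trans H; apply: ge0_subset_integral => //.
- exact: measurable_funTS (@meas_qtime u um).
- by move=> s _; exact: qtime_ge0.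
- by move=> s /=; rewrite !in_itv/=; lra.
Qed.

Lemma rep_ae : {ae mu, forall s, 0 <= s <= T -> rep s = u (sg * s)}.
Proof.
have qi_ : mu.-integrable `[0, T] (fun s => qtime u (sg * s)).
  apply/integrableP; split; first exact: (measurable_funTS mscale).
  by under eq_integral do rewrite gee0_abs ?qtime_ge0//.
have [N [mN N0 sub]] := integrable_ae (mseg 0 T) qi_.
exists N; split => //; apply: subset_trans sub => s /= H Hs; apply: H => sT.
have := Hs; rewrite /= in_itv/= => /(_ sT); rewrite ge0_fin_numE ?qtime_ge0// => h.
by rewrite /rep sT h.
Qed.

Let qmass_rep s : (qmass (rep s))%:E = (qtime u (sg * s)%R * (\1_A s)%:E)%E.
Proof.
rewrite /rep indicE; case: ifPn => h.
  rewrite mem_set// mule1 /qmass /Rintegral fineK// ge0_fin_numE; last exact: qtime_ge0.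
  by case/andP: h.
by rewrite memNset ?qmass0 ?mule0//; exact/negP.
Qed.

Lemma rep_q : rintegrable mu `[0, T] (fun s => qmass (rep s)).
Proof.
have m : measurable_fun `[0, T] (EFin \o (fun s => qmass (rep s))).
  apply: measurable_funTS.
  rewrite (_ : _ \o _ = (fun s => qtime u (sg * s)%R * (\1_A s)%:E)%E); last by apply/funext => s; exact: qmass_rep.
  apply: emeasurable_funM; first exact: mscale.
  by apply: (measurableT_comp _ (measurable_indic mA)); exact: EFin_measurable.
apply/integrableP; split => //; apply: le_lt_trans qfin; apply: ge0_le_integral => //.
- exact: measurableT_comp.
- exact: (measurable_funTS mscale).
- move=> s _; rewrite gee0_abs ?lee_fin ?qmass_ge0// /= qmass_rep indicE; case: (s \in A); rewrite ?mule1// mule0; exact: qtime_ge0.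
Qed.

Definition profile k s : R[i] := cis (sg * k%:~R ^+ 2 * s) * fc (u (sg * s)) k.
Definition dprofile k s : R[i] := 'i%C * gamma%:C * sg%:C * (cis (sg * k%:~R ^+ 2 * s) * fc (cubic (rep s)) k).
(** A coefficient of f |f|^2 is at most |f|_2 times the L^2 norm of |f|^2, over 2 pi. Only the
    square root of [qmass] enters, so this function is square integrable in time as soon as [qmass]
    is integrable. *)
Definition rep_bound s : R := `|gamma| * ((2 * pi)^-1 * (Num.sqrt (2 * pi * M ^+ 2) * Num.sqrt (qmass (rep s)))).

Lemma cmod_dprofile k s : cmod (dprofile k s) <= rep_bound s.
Proof.
have -> : cmod (dprofile k s) = `|gamma| * cmod (fc (cubic (rep s)) k).
  rewrite /dprofile cmodM [cmod (cis _ * _)]cmodM cmod_cis mul1r; congr (_ * _).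
  by rewrite cmodM cmodM cmod_i !cmod_real sg1 mul1r mulr1.
rewrite ler_wpM2l//.
apply: (le_trans (cmod_fc_cubic k (rep_qi s))).
rewrite ler_wpM2l ?invr_ge0 ?(ltW twopi_gt0)// ler_wpM2r ?sqrtr_ge0//.
by rewrite ler_wsqrtr// rep_mass.
Qed.

(** [rep_bound] without |gamma|: it bounds the coefficients of the cubic term itself. *)
Let K s : R := (2 * pi)^-1 * (Num.sqrt (2 * pi * M ^+ 2) * Num.sqrt (qmass (rep s))).

Let iK : rintegrable mu `[0, T] K.
Proof.
do 2 apply: (rintZ (mseg 0 T)).
apply: (@rint_le _ _ R mu _ (mseg 0 T) _ (fun s => 1 + qmass (rep s))).
- apply: (measurableT_comp _ (rint_meas rep_q)).
  by apply: continuous_measurable_fun; exact: sqrt_continuous.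
- move=> s _; rewrite ger0_norm ?sqrtr_ge0//.
  have q0 := qmass_ge0 (rep s); have := sqr_sqrtr q0; have := sqrtr_ge0 (qmass (rep s)).
  have := sqr_ge0 (Num.sqrt (qmass (rep s)) - 1); nra.
- by apply: (rintD (mseg 0 T)); [exact: rint_cst_seg|exact: rep_q].
Qed.

Lemma rep_bound_int : rintegrable mu `[0, T] rep_bound.
Proof. exact: (rintZ (mseg 0 T)). Qed.

Let mcubic (v : R -> R -> R[i]) k : cmeasurable (fun p : R * R => v p.1 p.2) ->
  cmeasurable (fun s => fc (cubic (v s)) k).
Proof.
move=> mv; apply: (@meas_fc_param R (fun s => cubic (v s))).
rewrite (_ : (fun p => _) = (fun p : R * R => v p.1 p.2 * (v p.1 p.2 * conjc (v p.1 p.2)))).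
  by apply: cmeasM => //; apply: cmeasM => //; exact: cmeasJ.
by apply/funext => p; rewrite cubicE.
Qed.

Let mcis (w : R) E : cmeas_on E (fun s : R => cis (w * s)).
Proof. by apply: cmeas_cis; exact: meas_mulr. Qed.

Lemma meas_dprofile k E : cmeas_on E (dprofile k).
Proof.
apply: cmeasM; first exact: cmeas_cst.
by apply: cmeasM => //; apply: cmeas_onS; exact: (@mcubic rep k rep_meas).
Qed.

Lemma dprofile_int k : cintegrable mu `[0, T] (dprofile k).
Proof. by apply: (cint_le (mseg 0 T) (meas_dprofile k _) _ rep_bound_int) => s _; exact: cmod_dprofile. Qed.

Lemma cubic_int k : cintegrable mu `[0, T] (fun r => cis (sg * k%:~R ^+ 2 * r) * fc (cubic (rep r)) k).
Proof.
have mG : cmeas_on `[0, T] (fun r : R => cis (sg * k%:~R ^+ 2 * r) * fc (cubic (rep r)) k).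
  by apply: cmeasM => //; apply: cmeas_onS; exact: (@mcubic rep k rep_meas).
apply: (cint_le (mseg 0 T) mG _ iK) => r _; rewrite cmodM cmod_cis mul1r.
apply: (le_trans (cmod_fc_cubic k (rep_qi r))).
rewrite ler_wpM2l ?invr_ge0 ?(ltW twopi_gt0)// ler_wpM2r ?sqrtr_ge0//.
by rewrite ler_wsqrtr// rep_mass.
Qed.

(** Multiplication by the phase removes the free group from Duhamel's formula: its dependence on the
    final time, the factor [c], cancels, and the phase at the integration time joins the cubic
    coefficient. *)
Lemma profileE k s : 0 <= s <= T -> profile k s = fc phi k + tint s (dprofile k).
Proof.
move=> sT; have [_ _ _ _ duh] := sol.
have s0 : 0 <= s by case/andP: sT.
rewrite /profile duh /free_group.
rewrite (@oriented_reflect sg s (fun r => cis (- (k%:~R ^+ 2 * (sg * s - r))) * fc (cubic (u r)) k)) //; last first.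
  apply: cmeasM; last exact: (@mcubic u k um).
  apply: cmeas_cis; apply: measurable_funN; apply: measurable_funM => //.
  by apply: measurable_funB.
pose c : R[i] := cis (- (sg * k%:~R ^+ 2 * s)).
have e1 : tint s (fun r => cis (- (k%:~R ^+ 2 * (sg * s - sg * r))) * fc (cubic (u (sg * r))) k) =
    tint s (fun r => c * (cis (sg * k%:~R ^+ 2 * r) * fc (cubic (rep r)) k)).
  apply: eq_ae_tint.
  - apply: cmeasM; last by apply: cmeas_onS; exact: (@mcubic (fun r => u (sg * r)) k joint).
    apply: cmeas_cis; apply: measurable_funN; apply: measurable_funM => //.
    by apply: measurable_funB => //; exact: meas_mulr.
  - apply: cmeasM; first exact: cmeas_cst.
    by apply: cmeasM => //; apply: cmeas_onS; exact: (@mcubic rep k rep_meas).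
  - move: rep_ae; apply: filterS; first exact: (ae_filter_ringOfSetsType mu).
    move=> r Hr rs; rewrite Hr; last by case/andP: rs => -> /le_trans; apply; case/andP: sT.
    by rewrite /c mulrA -cisD; congr (cis _ * _); ring.
have iG := cint_itvS sT (cubic_int k).
pose G := tint s (fun r => cis (sg * k%:~R ^+ 2 * r) * fc (cubic (rep r)) k).
have e2 : tint s (fun r => c * (cis (sg * k%:~R ^+ 2 * r) * fc (cubic (rep r)) k)) = c * G.
  exact: (CintZ (mseg 0 s) c iG).
have e3 : tint s (dprofile k) = 'i%C * gamma%:C * sg%:C * G by exact: (CintZ (mseg 0 s) _ iG).
rewrite e1 e2 e3.
have cc : cis (sg * k%:~R ^+ 2 * s) * c = 1 by rewrite /c cisN cis_conjK.
have ck : cis (sg * k%:~R ^+ 2 * s) * cis (- (k%:~R ^+ 2 * (sg * s))) = 1 :> R[i].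
  by rewrite -cisD (_ : _ + _ = 0) ?cis0//; ring.
rewrite mulrDr mulrA ck mul1r; congr (_ + _).
rewrite -[RHS]mul1r -cc; ring.
Qed.

Lemma profile_AC k : cAC T (profile k) (dprofile k).
Proof.
apply: cAC_of; first exact: dprofile_int.
move=> s sT; rewrite (profileE k sT) (profileE k (s := 0)) ?lexx ?T0//; congr (_ + _).
rewrite /tint /Cintegral set_itv1 !Rintegral_set1 addr0 //.
Qed.

Lemma solution_flow : flow T sg M rep_bound rep profile dprofile.
Proof.
split.
- exact: profile_AC.
- move=> s sT r ur; under eq_bigr do rewrite /profile cmodM cmod_cis mul1r.
  by apply: (l2b_fc (uL2 _) (uM sT)).
- by move=> k s _; exact: cmod_dprofile.
- exact: rep_bound_int.
- exact: rep_qi.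
- by move=> s; apply: l2b_fc; [exact: qi_sqi (rep_qi s)|exact: rep_mass].
- exact: rep_meas.
- exact: rep_q.
- move: rep_ae; apply: filterS; first exact: (ae_filter_ringOfSetsType mu).
  by move=> s Hs sT k; rewrite /profile Hs.
Qed.

End Rep.
End SolutionFlow.

Arguments zwin : simpl never.
Opaque fourier_coef.

(** * Conservation of mass *)

Section Weights.
Context {R : realType}.

(* A weight with Lipschitz constant 1/Q commutes with bounded shifts of the frequency up to O(1/Q), unlike a sharp
   cutoff. *)
Definition lam (Q : nat) (k : int) : R := Num.max 0 (1 - `|k|%N%:R / Q%:R).

Lemma lam_ge0 Q k : 0 <= lam Q k.
Proof. by rewrite /lam le_max lexx. Qed.

Lemma lam_le1 Q k : lam Q k <= 1.
Proof. by rewrite /lam ge_max ler01/= gerBl divr_ge0. Qed.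

Lemma lam_ge Q k : 1 - `|k|%N%:R / Q%:R <= lam Q k.
Proof. by rewrite /lam le_max lexx orbT. Qed.

Lemma lam_supp Q k : (0 < Q)%N -> (Q <= `|k|)%N -> lam Q k = 0.
Proof.
move=> Q0 Qk; apply/max_idPl; rewrite subr_le0 ler_pdivlMr ?ltr0n// mul1r ler_nat //.
Qed.

Lemma lam_lip Q k l : `|lam Q k - lam Q l| <= `|k - l|%N%:R / Q%:R.
Proof.
have main k1 l1 : lam Q k1 <= lam Q l1 + `|k1 - l1|%N%:R / Q%:R.
  have d0 : 0 <= `|k1 - l1|%N%:R / Q%:R :> R by rewrite divr_ge0.
  rewrite {1}/lam ge_max addr_ge0 ?lam_ge0//=.
  apply: (@le_trans _ _ (1 - `|l1|%N%:R / Q%:R + `|k1 - l1|%N%:R / Q%:R)); last by rewrite lerD2r lam_ge.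
  rewrite -addrA lerD2l -mulNr -mulNr -mulrDl ler_wpM2r ?invr_ge0//.
  have : (`|l1|%N%:R : R) <= `|k1|%N%:R + `|k1 - l1|%N%:R by rewrite -natrD ler_nat; lia.
  lra.
have := main k l; have := main l k; rewrite (_ : `|l - k|%N = `|k - l|%N); last by lia.
by rewrite ler_norml; lra.
Qed.

End Weights.

Section MassConservation.
Context {R : realType}.
Notation mu := (@lebesgue_measure R).
Notation D := (torus R).
Notation fc := (@fourier_coef R).
#[local] Hint Resolve mseg mtorus : core.

(** The window exceeds the support of the weight by the margin N, on which the weight vanishes; this
    is the room for shifting frequencies by at most N in [sum_zwin_shift]. *)
Lemma lam_parseval (f : R -> R[i]) (N : nat) : sqi f ->
  (fun n => 2 * pi * \sum_(k <- zwin (n.+1 + N)) lam n.+1 k * cmod (fc f k) ^+ 2) @ \oo --> mass f.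
Proof.
move=> sf; apply/cvgrPdist_le => e e0.
have e2 : 0 < e / 2 by rewrite divr_gt0.
have /cvgrPdist_le/(_ _ e2)[P _ /(_ P (leqnn P)) HP] := parseval sf.
have c0 k : 0 <= cmod (fc f k) ^+ 2 by exact: sqr_ge0.
have tp0 := @twopi_gt0 R.
have m0 := mass_ge0 f.
near=> n.
have nP : P%:R * (2 * mass f / e) <= n%:R by near: n; exact: nbhs_infty_ger.
have Pn : (P <= n)%N by near: n; exact: nbhs_infty_ge.
pose S1 := 2 * pi * \sum_(k <- zwin P) cmod (fc f k) ^+ 2.
have S1m : S1 <= mass f by apply: bessel => //; exact: uniq_zwin.
have up : 2 * pi * \sum_(k <- zwin (n.+1 + N)) lam n.+1 k * cmod (fc f k) ^+ 2 <= mass f.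
  apply: le_trans (bessel sf (uniq_zwin (n.+1 + N))).
  rewrite ler_wpM2l ?(ltW tp0)//; apply: ler_sum => k _.
  by rewrite ler_piMl ?lam_le1.
have lo : S1 - P%:R / n.+1%:R * mass f <= 2 * pi * \sum_(k <- zwin (n.+1 + N)) lam n.+1 k * cmod (fc f k) ^+ 2.
  apply: (@le_trans _ _ (2 * pi * \sum_(k <- zwin P) (1 - P%:R / n.+1%:R) * cmod (fc f k) ^+ 2)).
    rewrite -mulr_sumr mulrCA -/S1 mulrBl mul1r lerD2l lerN2 ler_wpM2l// divr_ge0//.
  rewrite ler_wpM2l ?(ltW tp0)//.
  apply: (@le_trans _ _ (\sum_(k <- zwin P) lam n.+1 k * cmod (fc f k) ^+ 2)).
    rewrite big_seq [leRHS]big_seq; apply: ler_sum => k; rewrite mem_zwin => kP.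
    rewrite ler_wpM2r//; apply: le_trans (lam_ge _ _).
    by rewrite lerD2l lerN2 ler_wpM2r ?invr_ge0// ler_nat.
  apply: ler_sum_sub; [exact: uniq_zwin| |by move=> k; rewrite mulr_ge0 ?lam_ge0].
  by move=> k; rewrite !mem_zwin => kP; lia.
have small : P%:R / n.+1%:R * mass f <= e / 2.
  rewrite mulrAC ler_pdivrMr ?ltr0n//.
  have : P%:R * (2 * mass f / e) * (e / 2) <= n%:R * (e / 2) by rewrite ler_wpM2r ?(ltW e2).
  have -> : P%:R * (2 * mass f / e) * (e / 2) = P%:R * mass f by field; rewrite gt_eqF.
  have -> : (n.+1%:R : R) = n%:R + 1 by rewrite natr1.
  lra.
move: HP; rewrite -/S1 ler_norml => /andP[_ HP].
move: (2 * pi * \sum_(k <- zwin (n.+1 + N)) _) up lo => V up lo.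
move: (P%:R / n.+1%:R * mass f) lo small => B lo small.
by clearbody S1; rewrite ler_norml; apply/andP; split; lra.
Unshelve. all: by end_near. Qed.

Lemma sum_zwin_shift (F : int -> R[i]) (Q N : nat) (m : int) : (`|m| <= N)%N ->
  (forall k, (Q <= `|k|)%N -> F k = 0) ->
  \sum_(k <- zwin (Q + N)) F (k + m) = \sum_(k <- zwin (Q + N)) F k.
Proof.
move=> mN F0.
have red (G : int -> int) : injective G -> (forall k, (`|G k| < Q)%N -> (`|k| <= Q + N)%N) ->
   (forall k, exists2 k', G k' = k & True) ->
   \sum_(k <- zwin (Q + N)) F (G k) = \sum_(k <- zwin Q) F k.
  move=> iG GN sG; move: (uniq_zwin (Q + N)) (mem_zwin (Q + N)) => uZ mZ.
  move: (zwin (Q + N)) uZ mZ => Z uZ mZ; rewrite (bigID (fun k => `|G k| <= Q)%N)/= [X in _ + X]big1 ?addr0; last first.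
    by move=> k; rewrite -ltnNge => /ltnW; exact: F0.
  rewrite -big_filter -(big_map G predT).
  rewrite (bigID (fun k => `|k| < Q)%N) [in RHS](bigID (fun k => `|k| < Q)%N)/=.
  rewrite [X in _ + X = _]big1 ?[X in _ = _ + X]big1 ?addr0; try by move=> k; rewrite -leqNgt; exact: F0.
  rewrite -big_filter -[RHS]big_filter; apply: perm_big; apply: uniq_perm.
  - by rewrite filter_uniq// map_inj_uniq// filter_uniq.
  - by rewrite filter_uniq// uniq_zwin.
  move=> k; rewrite !mem_filter mem_zwin; apply/andP/andP => -[kQ H]; split=> //; first exact: ltnW.
  have [k' e _] := sG k; apply/mapP; exists k' => //.
  by rewrite mem_filter e (ltnW kQ)/= mZ; apply: GN; rewrite e.
rewrite (red (fun k => k + m)); [|by move=> a b; lia|by move=> k; lia|by move=> k; exists (k - m) => //; rewrite subrK].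
by rewrite (red id)//; [move=> k; lia|move=> k; exists k].
Qed.

Lemma sum_zwin_opp (F : int -> R[i]) (P : pred int) N :
  \sum_(k <- zwin N | P (- k)) F (- k) = \sum_(k <- zwin N | P k) F k.
Proof.
rewrite -(big_map -%R P F); apply: perm_big; apply: uniq_perm.
- by rewrite map_inj_uniq ?uniq_zwin//; exact: oppr_inj.
- exact: uniq_zwin.
move=> k; rewrite mem_zwin; apply/mapP/idP => [[l]|kN]; first by rewrite mem_zwin => lN ->; lia.
by exists (- k); rewrite ?opprK// mem_zwin; lia.
Qed.

Section Static.
Variables (f : R -> R[i]) (M : R) (Q N : nat).
Hypotheses (M0 : 0 <= M) (qf : qi f) (lf : l2b (fun k => cmod (fc f k)) M) (Q0 : (0 < Q)%N).
Notation J := (zwin (Q + N)).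
Notation F := (fc f).

Lemma cmod_crossfc_le (g w : R -> R[i]) m : qi g -> qi w -> l2b (fun k => cmod (fc g k)) M ->
  l2b (fun k => cmod (fc w k)) M -> cmod (crossfc g w m) <= M ^+ 2.
Proof.
clear Q0.
move=> qg qw lg lw; apply: (cvgC_bound (cvgC_fc_mul_conj m (qi_sqi qg) (qi_sqi qw))) => n.
apply: (le_trans (cmod_sum _ _ _)).
apply: (@le_trans _ _ (\sum_(p <- zwin n) cmod (fc w p) * cmod (fc g (p + m)))).
  by apply: ler_sum => p _; rewrite cmodM cmod_conj.
rewrite expr2; apply: (@l2_CS R (fun k => cmod (fc w k)) (fun k => cmod (fc g k)) _ _ _ id (fun p => p + m)) => //;
  try (by move=> k; exact: cmod_ge0).
  by move=> a b; lia.
exact: uniq_zwin.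
Qed.

Lemma crossfc_conj (g w : R -> R[i]) m : qi g -> qi w -> conjc (crossfc g w m) = crossfc w g (- m).
Proof.
move=> qg qw; rewrite /crossfc -[m in LHS]opprK -fc_conj ?opprK; last by apply: sqi_int; [exact: qi_sqi|exact: sqi_conj (qi_sqi qw)].
rewrite (_ : (fun x => conjc (g x * _)) = (fun x => w x * conjc (g x)))//.
by apply/funext => x; rewrite cJM conjcK mulrC.
Qed.

Lemma crossfc0_real : conjc (crossfc f f 0) = crossfc f f 0.
Proof. by rewrite crossfc_conj// oppr0. Qed.

Let A m := \sum_(k <- J) (lam Q k)%:C * (conjc (F k) * F (k - m)).

Let A_conj m : (`|m| <= N)%N -> cmod (conjc (A m) - A (- m)) <= N%:R / Q%:R * M ^+ 2.
Proof.
move=> mN.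
have -> : conjc (A m) = \sum_(k <- J) (lam Q (k + m))%:C * (F (k + m) * conjc (F k)).
  transitivity (\sum_(k <- J) (lam Q k)%:C * (F k * conjc (F (k - m)))).
    by rewrite /A cJ_sum; apply: eq_bigr => k _; rewrite cJM cJM conjcK conjc_real.
  rewrite -(@sum_zwin_shift (fun k => (lam Q k)%:C * (F k * conjc (F (k - m)))) Q N m mN).
    by apply: eq_bigr => k _; rewrite addrK.
  by move=> k kQ; rewrite lam_supp// mul0r.
rewrite /A -sumrB.
apply: (le_trans (cmod_sum _ _ _)).
apply: (@le_trans _ _ (\sum_(k <- J) N%:R / Q%:R * (cmod (F (k + m)) * cmod (F k)))).
  apply: ler_sum => k _; rewrite opprK [conjc _ * F (k + m)]mulrC -mulrBl -RtoCB cmodM cmod_real.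
  rewrite [cmod (F _ * _)]cmodM cmod_conj ler_wpM2r ?mulr_ge0 ?cmod_ge0//.
  apply: (le_trans (lam_lip _ _ _)); rewrite ler_wpM2r ?invr_ge0// ler_nat.
  by rewrite (_ : k + m - k = m)//; lia.
rewrite -mulr_sumr expr2 ler_wpM2l ?divr_ge0//.
apply: (@l2_CS R (fun k => cmod (F k)) (fun k => cmod (F k)) _ _ _ (fun k => k + m) id) => //;
  try (by move=> k; exact: cmod_ge0).
  by move=> a b; lia.
exact: uniq_zwin.
Qed.

Let RtoC_aux (l r c s : R) : (l * (2 * r * c - r ^+ 2 - s))%:C = l%:C * (2 * r%:C * c%:C - r%:C ^+ 2 - s%:C).
Proof. by rewrite !(RtoCM, RtoCB) (_ : 2%:C = 2)// -[2%:R]/(1 + 1) RtoCD. Qed.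

(** Up to real terms the sum is that of G_m [A m] over 0 < |m| <= N, where G_m is the m-th
    coefficient of |f|^2. As G_(-m) = conj G_m, it would be real if A_(-m) = conj A_m; for the
    Lipschitz weight this holds up to M^2 N / Q. *)
Lemma mass_near_imag : `|Im (\sum_(k <- J) (lam Q k)%:C * conjc (F k) *
    (NRp (zwin N) f f f k + 2 * F k * crossfc f f 0 - F k * F k * conjc (F k)))|
  <= (size (zwin N))%:R * (M ^+ 2 * (N%:R / Q%:R * M ^+ 2)).
Proof.
pose S := \sum_(m <- zwin N | m != 0) crossfc f f m * A m.
have E : \sum_(k <- J) (lam Q k)%:C * conjc (F k) *
    (NRp (zwin N) f f f k + 2 * F k * crossfc f f 0 - F k * F k * conjc (F k)) =
  S + (\sum_(k <- J) lam Q k * (2 * cmod (F k) ^+ 2 * Re (crossfc f f 0) - (cmod (F k) ^+ 2) ^+ 2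
      - \sum_(m <- zwin N | m != 0) cmod (F k) ^+ 2 * cmod (F (k - m)) ^+ 2))%:C.
  rewrite (_ : S = \sum_(m <- zwin N | m != 0) \sum_(k <- J) crossfc f f m * ((lam Q k)%:C * (conjc (F k) * F (k - m)))); last first.
    by rewrite /S; apply: eq_bigr => m _; rewrite mulr_sumr.
  rewrite exchange_big/= RtoC_sum -big_split/=; apply: eq_bigr => k _.
  have c0 : crossfc f f 0 = (Re (crossfc f f 0))%:C.
    by apply: eq_ReIm => //=; have := congr1 (@complex.Im R) crossfc0_real; rewrite cImJ; lra.
  pose X1 := \sum_(m <- zwin N | m != 0) F (k - m) * crossfc f f m.
  pose X2 := \sum_(m <- zwin N | m != 0) F (k - m) * conjc (F (k - m)).
  have e1 : NRp (zwin N) f f f k = X1 - F k * X2.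
    by rewrite /NRp /X1 /X2 mulr_sumr -sumrB; apply: eq_bigr => m _; ring.
  have e2 : \sum_(m <- zwin N | m != 0) crossfc f f m * ((lam Q k)%:C * (conjc (F k) * F (k - m))) = (lam Q k)%:C * conjc (F k) * X1.
    by rewrite /X1 mulr_sumr; apply: eq_bigr => m _; ring.
  have e3 : (\sum_(m <- zwin N | m != 0) cmod (F k) ^+ 2 * cmod (F (k - m)) ^+ 2)%:C = F k * conjc (F k) * X2.
    by rewrite /X2 mulr_sumr RtoC_sum; apply: eq_bigr => m _; rewrite RtoCM -!mul_conj.
  rewrite RtoC_aux e1 e2 [in LHS]c0 e3 -mul_conj; ring.
rewrite E cImD [Im (_%:C)]/= addr0.
have cS : conjc S = \sum_(m <- zwin N | m != 0) crossfc f f m * conjc (A (- m)).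
  rewrite /S cJ_sum -[RHS]sum_zwin_opp; apply: eq_big => m; first by rewrite oppr_eq0.
  by move=> _; rewrite cJM (crossfc_conj _ qf qf) opprK.
apply: (@le_trans _ _ (cmod (S - conjc S))).
  apply: le_trans (Im_le_cmod _); rewrite cImD cImN cImJ opprK.
  by rewrite -mulr2n normrMn mulr2n lerDl.
rewrite cS /S -sumrB; apply: (le_trans (cmod_sum _ _ _)).
apply: (@le_trans _ _ (\sum_(m <- zwin N) M ^+ 2 * (N%:R / Q%:R * M ^+ 2))); last first.
  by rewrite big_const_seq count_predT iter_addr_0 [leRHS]mulr_natl.
rewrite big_seq_cond [leRHS]big_seq_cond big_mkcond [leRHS]big_mkcond; apply: ler_sum => m _.
rewrite mem_zwin andbT; case: ifP => [/andP[mN m0]|_]; last first.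
  by case: ifP => // _; rewrite !mulr_ge0 ?sqr_ge0// invr_ge0.
rewrite mN -mulrBr cmodM; apply: ler_pM; rewrite ?cmod_ge0//; first exact: cmod_crossfc_le.
rewrite -cmodN opprB; have := @A_conj (- m); rewrite opprK; apply; lia.
Qed.

End Static.

Section TimeMeasurability.
Variables (f g w : R -> R -> R[i]).
Hypotheses (mf : cmeasurable (fun p : R * R => f p.1 p.2)) (mg : cmeasurable (fun p : R * R => g p.1 p.2))
  (mw : cmeasurable (fun p : R * R => w p.1 p.2)).

Lemma meas_fc_on E k : cmeas_on E (fun s => fc (f s) k).
Proof. by apply: cmeas_onS; exact: meas_fc_param. Qed.

Lemma meas_crossfc E m : cmeas_on E (fun s => crossfc (g s) (w s) m).
Proof.
apply: cmeas_onS; apply: (@meas_fc_param R (fun s x => g s x * conjc (w s x))).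
by apply: cmeasM => //; exact: cmeasJ.
Qed.

Lemma meas_fc_trilinear E m : cmeas_on E (fun s => fc (fun x => f s x * (g s x * conjc (w s x))) m).
Proof.
apply: cmeas_onS; apply: (@meas_fc_param R (fun s x => f s x * (g s x * conjc (w s x)))).
by apply: cmeasM => //; apply: cmeasM => //; exact: cmeasJ.
Qed.
End TimeMeasurability.

Lemma meas_NRp E r f g w k : cmeasurable (fun p : R * R => f p.1 p.2) -> cmeasurable (fun p : R * R => g p.1 p.2) ->
  cmeasurable (fun p : R * R => w p.1 p.2) -> cmeas_on E (fun s => NRp r (f s) (g s) (w s) k).
Proof.
move=> mf mg mw; apply: cmeas_sum => m; apply: cmeasM; first exact: meas_fc_on.
apply: cmeasB; first exact: meas_crossfc.
by apply: cmeasM; [exact: meas_fc_on|apply: cmeasJ; exact: meas_fc_on].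
Qed.

Lemma meas_NR E f g w k : cmeasurable (fun p : R * R => f p.1 p.2) -> cmeasurable (fun p : R * R => g p.1 p.2) ->
  cmeasurable (fun p : R * R => w p.1 p.2) -> cmeas_on E (fun s => NR (f s) (g s) (w s) k).
Proof.
move=> mf mg mw; apply: cmeasD; last first.
  by apply: cmeasM; [apply: cmeasM; exact: meas_fc_on|apply: cmeasJ; exact: meas_fc_on].
apply: cmeasB; last by apply: cmeasM; [exact: meas_fc_on|exact: meas_crossfc].
apply: cmeasB; last by apply: cmeasM; [exact: meas_fc_on|exact: meas_crossfc].
exact: meas_fc_trilinear.
Qed.

Lemma fc_cubicE (f : R -> R[i]) k :
  fc (cubic f) k = NR f f f k + 2 * fc f k * crossfc f f 0 - fc f k * fc f k * conjc (fc f k).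
Proof. by rewrite cubicE /NR; ring. Qed.

Lemma Rint_bound (t B : R) (g : R -> R) : 0 <= t -> measurable_fun `[0, t] g ->
  (forall s, 0 <= s <= t -> `|g s| <= B) -> `|\int[mu]_(s in `[0, t]) g s| <= t * B.
Proof.
move=> t0 mg gB.
have itv s : `[0, t]%classic s -> 0 <= s <= t by rewrite /= in_itv.
have ig : rintegrable mu `[0, t] g.
  by apply: (@rint_le _ _ R mu _ (mseg 0 t) _ (fun=> B)) ; [exact: mg|move=> s /itv; exact: gB|exact: rint_cst_seg].
apply: (le_trans (le_normr_Rintegral (mseg 0 t) ig)).
apply: (@le_trans _ _ (\int[mu]_(s in `[0, t]) B)).
  apply: le_Rintegral; [exact: mseg|exact: integrable_norm|exact: rint_cst_seg|by move=> s /itv; exact: gB].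
rewrite Rintegral_cst//= lebesgue_measure_itv/= lte_fin.
case: ltP => [_|t0'] /=; first by rewrite oppr0 addr0 mulrC.
have -> : t = 0 by lra.
by rewrite mulr0 mul0r.
Qed.

Section Law.
Variables (gamma T sg M : R) (phi : R -> R[i]) (u : R -> R -> R[i]).
Hypotheses (T0 : 0 <= T) (sg1 : `|sg| = 1) (M0 : 0 <= M).
Hypothesis sol : nls_solution gamma phi u.
Hypothesis uM : forall s, 0 <= s <= T -> mass (u (sg * s)) <= 2 * pi * M ^+ 2.
Notation f := (rep T sg u).
Notation a := (profile sg u).
Notation da := (dprofile gamma T sg u).
Notation h := (rep_bound gamma T sg M u).
Let Ff : flow T sg M h f a da := solution_flow T0 sg1 sol uM.

(** The weighted mass varies by twice the real part of the equation tested against [lam] times the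
    conjugate modes. Its far part is [far1], with this time-dependent test sequence; its near part
    is almost conservative by [mass_near_imag]. *)
Lemma mass_step (N n : nat) t : (0 < N)%N -> 0 <= t <= T ->
  `|\sum_(k <- zwin (n.+1 + N)) lam n.+1 k * cmod (a k t) ^+ 2 -
    \sum_(k <- zwin (n.+1 + N)) lam n.+1 k * cmod (a k 0) ^+ 2| <=
  2 * `|gamma| * (far_err M M N h h t + t * ((size (zwin N))%:R * (M ^+ 2 * (N%:R / n.+1%:R * M ^+ 2)))).
Proof.
move=> N0 tT; have t0 : 0 <= t by case/andP: tT.
set Q := n.+1; set J := zwin (Q + N).
pose x k s := (lam Q k)%:C * conjc (a k s).
pose dx k s := (lam Q k)%:C * conjc (da k s).
have ax k : cAC T (x k) (dx k) by apply: cAC_scale => //; apply: cAC_conj; exact: flow_ac Ff k.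
have lcx k (z : R[i]) : cmod ((lam Q k)%:C * z) <= cmod z.
  by rewrite cmodM cmod_real ger0_norm ?lam_ge0// ler_piMl ?cmod_ge0// lam_le1.
have lx s : 0 <= s <= T -> l2b (fun k => cmod (x k s)) M.
  move=> sT r ur; apply: le_trans (flow_l2 Ff sT ur); apply: ler_sum => k _.
  by rewrite lerXn2r ?nnegrE ?cmod_ge0// -[leRHS]cmod_conj; exact: lcx.
have bx k s : 0 <= s <= T -> cmod (dx k s) <= h s.
  by move=> sT; apply: le_trans (flow_da Ff k sT); rewrite -[leRHS]cmod_conj; exact: lcx.
have [iZ1 bZ1] := far1 T0 sg1 M0 M0 N0 Ff Ff Ff ax lx bx (flow_h Ff) (uniq_zwin (Q + N)) tT.
set Z1 := (fun s => \sum_(j <- _) _) in iZ1 bZ1.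
pose W s := \sum_(k <- J) x k s * cis (sg * k%:~R ^+ 2 * s) * fc (cubic (f s)) k.
pose Y s := \sum_(k <- J) x k s * da k s.
have iY : cintegrable mu `[0, t] Y.
  apply: (cint_itvS tT); apply: (cint_sum (mseg 0 T)) => k.
  by apply: (cAC_intM T0 (ax k)); exact: cAC_cint (flow_ac Ff k).
pose c : R[i] := 'i%C * gamma%:C * sg%:C.
have YW s : Y s = c * W s.
  by rewrite /Y /W mulr_sumr; apply: eq_bigr => k _; rewrite /dprofile -/c; ring.
have iW : cintegrable mu `[0, t] W.
  apply: (cint_itvS tT); apply: (cint_sum (mseg 0 T)) => k.
  rewrite (_ : (fun s => _) = (fun s => x k s * (cis (sg * k%:~R ^+ 2 * s) * fc (cubic (f s)) k))).
    by apply: (cAC_intM T0 (ax k)); exact: (cubic_int T0 sg1 sol uM).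
  by apply/funext => s; rewrite mulrA.
pose Z2 s := W s - Z1 s.
have iZ2 : cintegrable mu `[0, t] Z2 by exact: (cintB (mseg 0 t)).
pose Z3 s := \sum_(k <- J) (lam Q k)%:C * conjc (fc (f s) k) *
    (NRp (zwin N) (f s) (f s) (f s) k + 2 * fc (f s) k * crossfc (f s) (f s) 0 - fc (f s) k * fc (f s) k * conjc (fc (f s) k)).
have mf := flow_meas Ff.
have mZ3 : cmeas_on `[0, t] Z3.
  apply: cmeas_sum => k; apply: cmeasM.
    by apply: cmeasM; [exact: cmeas_cst|apply: cmeasJ; exact: meas_fc_on].
  apply: cmeasB; last by apply: cmeasM; [apply: cmeasM; exact: meas_fc_on|apply: cmeasJ; exact: meas_fc_on].
  apply: cmeasD; first exact: meas_NRp.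
  by apply: cmeasM; [apply: cmeasM; [exact: cmeas_cst|exact: meas_fc_on]|exact: meas_crossfc].
have Z23 : tint t Z2 = tint t Z3.
  apply: eq_ae_tint; [exact: (cint_meas iZ2)|exact: mZ3|].
  move: (flow_ae Ff); apply: filterS; first exact: (ae_filter_ringOfSetsType mu).
  move=> s ea st; have sT : 0 <= s <= T by case/andP: st => -> /le_trans; apply; case/andP: tT.
  rewrite /Z2 /W /Z1 -sumrB; apply: eq_bigr => k _.
  have -> : x k s * cis (sg * k%:~R ^+ 2 * s) = (lam Q k)%:C * conjc (fc (f s) k).
    rewrite /x (ea sT k) cJM; have := cis_conjK (sg * k%:~R ^+ 2 * s).
    set C := cis _; move: (conjc C) (conjc (fc _ k)) => C' F' CC.
    by transitivity ((lam Q k)%:C * F' * (C * C')); [ring|rewrite CC mulr1].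
  by rewrite -mulrBr fc_cubicE; congr (_ * _); ring.
have bZ3 : `|Im (tint t Z3)| <= t * ((size (zwin N))%:R * (M ^+ 2 * (N%:R / Q%:R * M ^+ 2))).
  apply: (@Rint_bound t _ (fun s => Im (Z3 s))) => //; first exact: (proj2 mZ3).
  by move=> s _; apply: mass_near_imag => //; [exact: flow_qi Ff s|exact: flow_fc Ff s].
have P0 s : \sum_(k <- J) x k s * a k s = (\sum_(k <- J) lam Q k * cmod (a k s) ^+ 2)%:C.
  by rewrite RtoC_sum; apply: eq_bigr => k _; rewrite RtoCM -mul_conj /x -mulrA [conjc _ * _]mulrC.
have aP : cAC T (fun s => \sum_(k <- J) x k s * a k s) (fun s => \sum_(k <- J) (dx k s * a k s + x k s * da k s)).
  by apply: cAC_sum => k; apply: cAC_mul => //; exact: flow_ac Ff k.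
have := cAC_eq aP tT; rewrite !P0.
have -> : tint t (fun s => \sum_(k <- J) (dx k s * a k s + x k s * da k s)) = conjc (tint t Y) + tint t Y.
  rewrite /tint -(CintJ (mseg 0 t) iY) -(CintD (mseg 0 t)) //; last exact: (cintJ (mseg 0 t)).
  apply: eq_Cint => s _; rewrite big_split/=; congr (_ + _).
  by rewrite /Y cJ_sum; apply: eq_bigr => k _; rewrite cJM /x cJM conjcK conjc_real /dx mulrAC -mulrA mulrCA mulrA.
have -> : tint t Y = c * (tint t Z1 + tint t Z3).
  rewrite -Z23 /tint -(CintD (mseg 0 t) iZ1 iZ2) -(CintZ (mseg 0 t)); last by apply: (cintD (mseg 0 t)).
  by apply: eq_Cint => s _; rewrite YW /Z2 addrCA subrr addr0.
set e1 := \sum_(k <- J) _; set e0 := \sum_(k <- J) _; set tY := c * _.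
move=> /(congr1 (@complex.Re R)); rewrite !cReD cReJ => H.
have {}H : e1 = e0 + (Re tY + Re tY) := H.
have -> : e1 - e0 = 2 * Re tY by rewrite H; ring.
rewrite /tY.
have -> : Re (c * (tint t Z1 + tint t Z3)) = - (gamma * sg * Im (tint t Z1 + tint t Z3)).
  by rewrite /c; move: (tint t Z1 + tint t Z3) => [r1 r2] /=; ring.
rewrite mulrN normrN !normrM sg1 mulr1 [`|2|]ger0_norm// -!mulrA ler_wpM2l// ler_wpM2l//.
rewrite cImD; apply: (le_trans (ler_normD _ _)); apply: lerD => //.
  exact: le_trans (Im_le_cmod _) bZ1.
by move: bZ3; rewrite !mulrA.
Qed.

Definition far_const (X M0 : R) (gx h0 : R -> R) (t : R) : R :=
  2 * (X * M0 ^+ 3) + \int[mu]_(s in `[0, t]) (gx s * M0 ^+ 3 + 3 * h0 s * X * M0 ^+ 2).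

End Law.

(** Isolates the factor that tends to 0 as N grows with the other data fixed. *)
Lemma far_errE X M N gx h (T t : R) : 0 <= t <= T -> rintegrable mu `[0, T] gx -> rintegrable mu `[0, T] h ->
  far_err X M N gx h t = kap N * far_const X M gx h t.
Proof.
move=> tT ig ih; rewrite /far_err /far_const mulrDr; congr (_ + _).
rewrite RintegralZl//; apply: (rint_itvS tT); apply: (rintD (mseg 0 T)).
  rewrite (_ : (fun s => _) = (fun s => M ^+ 3 * gx s)); first exact: (rintZ (mseg 0 T)).
  by apply/funext => s; rewrite mulrC.
rewrite (_ : (fun s => _) = (fun s => 3 * X * M ^+ 2 * h s)); first exact: (rintZ (mseg 0 T)).
by apply/funext => s; ring.
Qed.

Lemma nrm_dist (f g : R -> R[i]) : sqi f -> sqi g -> `|nrm f - nrm g| <= nrm (fun x => f x - g x).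
Proof.
move=> sf sg.
have h1 : nrm f <= nrm (fun x => f x - g x) + nrm g.
  rewrite [nrm f](_ : _ = nrm (fun x => (f x - g x) + g x)); first by apply: nrmD => //; exact: sqiB.
  by congr nrm; apply/funext => x; rewrite subrK.
have h2 : nrm g <= nrm (fun x => f x - g x) + nrm f.
  rewrite [nrm g](_ : _ = nrm (fun x => f x - (f x - g x))).
    by rewrite addrC; apply: nrmB => //; exact: sqiB.
  by congr nrm; apply/funext => x; rewrite subKr.
by rewrite ler_norml; lra.
Qed.

Lemma continuous_L2_bdd (u : R -> R -> R[i]) (T : R) : continuous_L2 u -> 0 <= T ->
  exists2 M : R, 0 <= M & forall s, - T <= s <= T -> mass (u s) <= 2 * pi * M ^+ 2.
Proof.
move=> [uL cu] T0.
have cn : continuous (fun s => nrm (u s)).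
  move=> t0; apply/cvgrPdist_le => e e0.
  have e20 : 0 < e ^+ 2 by rewrite exprn_gt0.
  move/cvgrPdist_le : (cu t0) => /(_ _ e20); apply: filterS => t.
  rewrite sub0r normrN ger0_norm ?mass_ge0// => H.
  rewrite distrC; apply: (le_trans (nrm_dist (L2_sqi (uL t)) (L2_sqi (uL t0)))).
  by rewrite -(@ler_pXn2r _ 2)// ?nnegrE ?nrm_ge0 ?(ltW e0)// nrm_sqr.
have TT : - T <= T by lra.
have [c _ Hc] := EVT_max TT (continuous_subspaceT cn).
exists (nrm (u c)) => [|s sT]; first exact: nrm_ge0.
apply: (@le_trans _ _ (nrm (u c) ^+ 2)).
  by rewrite -nrm_sqr lerXn2r ?nnegrE ?nrm_ge0//; apply: Hc; rewrite in_itv.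
by rewrite ler_peMl ?sqr_ge0//; have := pi_ge2 R; lra.
Qed.

(** Continuity in time provides a provisional mass bound M on [-|t|, |t|]. For fixed N the width of
    the weight tends to infinity, which removes the error in N / Q and leaves a multiple of [kap N];
    then N tends to infinity. *)
Lemma mass_conserved (gamma : R) (phi : R -> R[i]) (u : R -> R -> R[i]) (t : R) : sqi phi -> nls_solution gamma phi u -> mass (u t) = mass phi.
Proof.
move=> sphi sol; have [_ cu _ u0 _] := sol.
have su s : sqi (u s) by case: cu => /(_ s)/L2_sqi.
have m0 : mass (u 0) = mass phi.
  rewrite -!nrm_sqr; congr (_ ^+ 2); apply/eqP; rewrite -subr_eq0 -normr_le0.
  by apply: (le_trans (nrm_dist (su 0) sphi)); rewrite /nrm u0 sqrtr0.
rewrite -m0.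
pose T := `|t|; have T0 : 0 <= T by exact: normr_ge0.
have [sg sg1 tE] : exists2 sg : R, `|sg| = 1 & t = sg * T.
  have [t0|t0] := lerP 0 t; [exists 1; rewrite ?normr1// mul1r /T ger0_norm//|].
  by exists (-1); rewrite ?normrN1// mulN1r /T ltr0_norm// opprK.
have [M M0 uM'] := continuous_L2_bdd cu T0.
have uM s : 0 <= s <= T -> mass (u (sg * s)) <= 2 * pi * M ^+ 2.
  move=> /andP[s0 sT]; apply: uM'; rewrite -ler_norml normrM sg1 mul1r ger0_norm//.
have TT : 0 <= T <= T by rewrite T0 lexx.
pose h := rep_bound gamma T sg M u.
have ih : rintegrable mu `[0, T] h by apply: rep_bound_int; [exact: T0|exact: sg1|exact: sol].
pose K := far_const M M h h T.
have step N : (0 < N)%N -> `|mass (u t) - mass (u 0)| <= 2 * pi * (2 * `|gamma|) * (kap N * K).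
  move=> N0; apply/ler_addgt0Pr => e e0.
  pose c : R := 2 * pi * (2 * `|gamma|).
  have c0 : 0 <= c by rewrite !mulr_ge0// pi_ge0.
  pose b : R := T * ((size (zwin N))%:R * (M ^+ 2 * (N%:R * M ^+ 2))).
  have b0 : 0 <= b by rewrite /b !mulr_ge0 ?sqr_ge0.
  have e3 : 0 < e / 3 by rewrite divr_gt0.
  have [n [n1 n2 n3]] : exists n, [/\ `|mass (u t) - 2 * pi * \sum_(k <- zwin (n.+1 + N)) lam n.+1 k * cmod (fc (u t) k) ^+ 2| <= e / 3,
      `|mass (u 0) - 2 * pi * \sum_(k <- zwin (n.+1 + N)) lam n.+1 k * cmod (fc (u 0) k) ^+ 2| <= e / 3 &
      c * b <= e / 3 * n.+1%:R].
    have := lam_parseval N (su t) => /cvgrPdist_le/(_ _ e3) A1.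
    have := lam_parseval N (su 0) => /cvgrPdist_le/(_ _ e3) A2.
    have A3 : \forall n \near \oo, c * b / (e / 3) <= n%:R by exact: nbhs_infty_ger.
    have [n _ /(_ n (leqnn n)) [[B1 B2] B3]] := filterI (filterI A1 A2) A3.
    exists n; split => //; move: B3; rewrite ler_pdivrMr// => B3; apply: (le_trans B3).
    by rewrite mulrC ler_wpM2l ?(ltW e3)// ler_nat.
  have := mass_step T0 sg1 M0 sol uM n N0 TT; rewrite (far_errE _ _ _ TT ih ih) -/h -/K.
  set S1 := \sum_(k <- _) _; set S0 := \sum_(k <- _) _ => H.
  have eS1 : S1 = \sum_(k <- zwin (n.+1 + N)) lam n.+1 k * cmod (fc (u t) k) ^+ 2.
    by apply: eq_bigr => k _; rewrite /profile cmodM cmod_cis mul1r -tE.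
  have eS0 : S0 = \sum_(k <- zwin (n.+1 + N)) lam n.+1 k * cmod (fc (u 0) k) ^+ 2.
    by apply: eq_bigr => k _; rewrite /profile cmodM cmod_cis mul1r mulr0.
  rewrite -eS1 in n1; rewrite -eS0 in n2.
  have -> : mass (u t) - mass (u 0) = (mass (u t) - 2 * pi * S1) - (mass (u 0) - 2 * pi * S0) + 2 * pi * (S1 - S0) by ring.
  apply: (le_trans (ler_normD _ _)).
  have h1 := ler_normB (mass (u t) - 2 * pi * S1) (mass (u 0) - 2 * pi * S0).
  have h2 : `|2 * pi * (S1 - S0)| <= 2 * pi * (2 * `|gamma|) * (kap N * K) + e / 3.
    rewrite normrM [`|2 * pi|]ger0_norm ?(ltW twopi_gt0)//.
    apply: (@le_trans _ _ (2 * pi * (2 * `|gamma| * (kap N * K + b / n.+1%:R)))).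
      rewrite ler_wpM2l ?(ltW twopi_gt0)//; apply: (le_trans H); rewrite le_eqVlt; apply/orP; left; apply/eqP.
      by rewrite /b; ring.
    have -> : 2 * pi * (2 * `|gamma| * (kap N * K + b / n.+1%:R)) = 2 * pi * (2 * `|gamma|) * (kap N * K) + c * b / n.+1%:R by rewrite /c; ring.
    by rewrite lerD2l ler_pdivrMr ?ltr0n.
  lra.
apply/eqP; rewrite -subr_eq0 -normr_le0; apply/ler_addgt0Pr => e e0; rewrite add0r.
have d0 : 0 < 2 * pi * (2 * `|gamma|) * `|K| + 1.
  by rewrite ltr_wpDl// !mulr_ge0// pi_ge0.
have [N N0 /(_ N (leqnn N)) HN] := @kap_small R (e / (2 * pi * (2 * `|gamma|) * `|K| + 1)) (divr_gt0 e0 d0).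
apply: (le_trans (step N N0)).
apply: (@le_trans _ _ (kap N * (2 * pi * (2 * `|gamma|) * `|K| + 1))).
  have := kap_ge0 (R := R) N; have := ler_norm K; have g0 := normr_ge0 gamma; have := pi_ge0 R => p0 KK k0.
  have : 2 * pi * (2 * `|gamma|) * K <= 2 * pi * (2 * `|gamma|) * `|K| by rewrite ler_wpM2l// !mulr_ge0.
  nra.
by rewrite -ler_pdivlMr.
Qed.

End MassConservation.

(** * The space-time L^4 bound *)

Section Apriori.
Context {R : realType}.
Notation mu := (@lebesgue_measure R).
Notation D := (torus R).
Notation fc := (@fourier_coef R).
#[local] Hint Resolve mseg mtorus : core.

Lemma cvgC_sqmod (u : nat -> R[i]) z (c : R) : cvgC u z -> (forall n, cmod (u n) <= c) ->
  cvgC (fun n => (cmod (u n) ^+ 2)%:C) (cmod z ^+ 2)%:C.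
Proof.
move=> cu uc; have zc := cvgC_bound cu uc.
apply: (cvgC_le _ (cvg0Z (c + c) cu)) => n.
rewrite -RtoCB cmod_real subr_sqr normrM mulrC ler_pM//.
  by rewrite ger0_norm ?addr_ge0 ?cmod_ge0//; apply: lerD.
rewrite ler_norml; have := cmodD (u n - z) z; have := cmodD (z - u n) (u n).
by rewrite !subrK -[cmod (z - u n)]cmodN opprB; lra.
Qed.

Lemma sum_zwin_pred1R (F : int -> R) N : \sum_(k <- zwin N | k != 0) F k = \sum_(k <- zwin N) F k - F 0.
Proof. by rewrite [in RHS](bigD1_seq 0) ?uniq_zwin ?mem_zwin//= [X in _ = X - _]addrC addrK. Qed.

Section Family.
Variables P S : nat.
Let quad : seq (int * int * int) :=
  [seq (q, p') | q <- [seq (p, m) | p <- zwin S, m <- zwin P], p' <- zwin S].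

(** Expanding the square of the modulus of a sum over p of conj(F_p) F_(p+m) produces pairs (p, p').
    Each pair with p' <> p is the parallelogram p, p', p + m, p' + m, that is l = p' - p. *)
Definition pairing_family : seq (int * int * int) :=
  [seq (q.1.1, q.2 - q.1.1, q.1.2) | q <- quad & (q.1.2 != 0) && (q.2 != q.1.1)].

Lemma pairing_family_uniq : uniq pairing_family.
Proof.
rewrite map_inj_uniq; last by move=> [[p m] p'] [[p1 m1] p1'] /= [-> e ->]; congr (_, _, _); lia.
apply: filter_uniq; apply: allpairs_uniq; [|exact: uniq_zwin|by case=> [[? ?] ?] [[? ?] ?] _ _ /= [-> -> ->]].
by apply: allpairs_uniq; [exact: uniq_zwin|exact: uniq_zwin|case=> ? ? [? ?] _ _ /= [-> ->]].
Qed.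

Lemma pairing_family_off y : y \in pairing_family -> offaxis 1 y.
Proof.
by case/mapP => -[[p m] p']; rewrite mem_filter /= => /andP[/andP[m0 pp] _] ->; rewrite /offaxis /=; lia.
Qed.

Lemma sum_pairing_family (V : int * int * int -> R[i]) : \sum_(y <- pairing_family) V y =
  \sum_(p <- zwin S) \sum_(m <- zwin P | m != 0) \sum_(p' <- zwin S | p' != p) V (p, p' - p, m).
Proof.
rewrite /pairing_family big_map big_filter big_mkcond /quad big_allpairs big_allpairs.
apply: eq_bigr => p _; rewrite [RHS]big_mkcond/=; apply: eq_bigr => m _.
by case: (m != 0) => /=; [rewrite [RHS]big_mkcond|rewrite big1].
Qed.
End Family.

Definition pairing_trunc P S (f : R -> R[i]) : R := \sum_(m <- zwin P | m != 0)
  cmod (\sum_(p <- zwin S) conjc (fc f p) * fc f (p + m)) ^+ 2.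

(** Off-diagonal pairs form nondegenerate parallelograms; the diagonal p' = p is the resonant
    remainder, bounded by the l^2 norms alone. *)
Lemma pairing_truncE P S (f : R -> R[i]) : (pairing_trunc P S f)%:C =
  \sum_(y <- pairing_family P S) conjc (fc f (y.1.1 + y.1.2 + y.2)) * vert (fun=> f) (fun=> f) (fun=> f) (0 : R) y +
  (\sum_(m <- zwin P | m != 0) \sum_(p <- zwin S) cmod (fc f p) ^+ 2 * cmod (fc f (p + m)) ^+ 2)%:C.
Proof.
rewrite sum_pairing_family exchange_big/= /pairing_trunc !RtoC_sum -big_split/=; apply: eq_bigr => m _.
rewrite -mul_conj cJ_sum mulr_suml RtoC_sum -big_split/= big_seq [RHS]big_seq; apply: eq_bigr => p pS.
rewrite mulr_sumr (bigD1_seq p) ?uniq_zwin//= addrC; congr (_ + _).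
  apply: eq_bigr => p' _; rewrite /vert /= [conjc (conjc _ * _)]cJM conjcK [p + (p' - p)]addrC subrK; ring.
by rewrite [conjc (conjc _ * _)]cJM conjcK RtoCM -!mul_conj; ring.
Qed.

Lemma Rint_cst_seg (t c : R) : 0 <= t -> \int[mu]_(s in `[0, t]) c = c * t.
Proof.
move=> t0; rewrite Rintegral_cst//= lebesgue_measure_itv/= lte_fin.
case: ltP => [_|t0'] /=; first by rewrite oppr0 addr0.
by rewrite (_ : t = 0) ?mulr0//; apply/eqP; rewrite eq_le t0' t0.
Qed.

Let young (p b r : R) : 0 < p -> b * r <= r ^+ 2 / (4 * p) + p * b ^+ 2.
Proof.
move=> p0; rewrite -subr_ge0 (_ : _ - _ = (4 * p)^-1 * (r - 2 * p * b) ^+ 2); last by field; rewrite gt_eqF.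
by rewrite mulr_ge0 ?sqr_ge0// invr_ge0 mulr_ge0// ltW.
Qed.

Let absorb_eq (p J A B C : R) : p != 0 ->
  2 * p * (A + J / (4 * p) + B + C + C) = J / 2 + 2 * p * (A + B + 2 * C).
Proof. by move=> p0; field. Qed.

Section Estimate.
Variables (gamma T sg M : R) (phi : R -> R[i]) (u : R -> R -> R[i]).
Hypotheses (T0 : 0 <= T) (sg1 : `|sg| = 1) (M0 : 0 <= M).
Hypothesis sol : nls_solution gamma phi u.
Hypothesis uM : forall s, 0 <= s <= T -> mass (u (sg * s)) <= 2 * pi * M ^+ 2.
Notation f := (rep T sg u).
Notation a := (profile sg u).
Notation da := (dprofile gamma T sg u).
Notation h := (rep_bound gamma T sg M u).
Let Ff : flow T sg M h f a da := solution_flow T0 sg1 sol uM.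
Let TT : 0 <= T <= T. Proof. by rewrite T0 lexx. Qed.
Let qf s : qi (f s) := flow_qi Ff s.
Let lf s : l2b (fun k => cmod (fc (f s) k)) M := flow_fc Ff s.

Lemma pairing_trunc_bound P S s : pairing_trunc P S (f s) <= (size (zwin P))%:R * M ^+ 4.
Proof.
apply: (@le_trans _ _ (\sum_(m <- zwin P) M ^+ 4)); last first.
  by rewrite big_const_seq count_predT iter_addr_0 [leRHS]mulr_natl.
rewrite /pairing_trunc big_mkcond; apply: ler_sum => m _; case: ifP => _; last by rewrite exprn_ge0.
rewrite (_ : M ^+ 4 = (M * M) ^+ 2); last by ring.
rewrite lerXn2r ?nnegrE ?cmod_ge0 ?mulr_ge0//.
apply: (le_trans (cmod_sum _ _ _)); under eq_bigr do rewrite cmodM cmod_conj.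
apply: (@l2_CS R (fun k => cmod (fc (f s) k)) (fun k => cmod (fc (f s) k)) _ _ _ id (fun p => p + m)) => //;
  try (by move=> k; exact: cmod_ge0).
  by move=> k l; lia.
exact: uniq_zwin.
Qed.

Lemma meas_pairing_trunc P S E : cmeas_on E (fun s => (pairing_trunc P S (f s))%:C).
Proof.
apply: cmeas_real; rewrite /pairing_trunc.
have H m : measurable_fun E (fun s => if m != 0 then cmod (\sum_(p <- zwin S) conjc (fc (f s) p) * fc (f s) (p + m)) ^+ 2 else 0).
  case: (m != 0) => //; apply: meas_cmodX; apply: cmeas_sum => p.
  by apply: cmeasM; [apply: cmeasJ|]; apply: meas_fc_on; exact: flow_meas Ff.
rewrite (_ : (fun s => _) = (fun s => \sum_(m <- zwin P) if m != 0 then cmod (\sum_(p <- zwin S) conjc (fc (f s) p) * fc (f s) (p + m)) ^+ 2 else 0)).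
  by apply: measurable_sum => m; exact: H.
by apply/funext => s; rewrite big_mkcond.
Qed.

Definition ap_bound := far_err M M 1 h h T + T * M ^+ 4.

(** Every nondegenerate parallelogram is off-axis for N = 1, so the whole off-diagonal part
    oscillates in time and falls under [normal_form]; here boundedness is wanted, not smallness. *)
Lemma pairing_trunc_int P S : cmod (tint T (fun s => (pairing_trunc P S (f s))%:C)) <= ap_bound.
Proof.
pose dg s := \sum_(m <- zwin P | m != 0) \sum_(p <- zwin S) cmod (fc (f s) p) ^+ 2 * cmod (fc (f s) (p + m)) ^+ 2.
pose V s := \sum_(y <- pairing_family P S) conjc (fc (f s) (y.1.1 + y.1.2 + y.2)) * vert f f f s y.
pose x k s := conjc (a k s).
pose dx k s := conjc (da k s).
have ax k : cAC T (x k) (dx k) by apply: cAC_conj; exact: flow_ac Ff k.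
have lx s : 0 <= s <= T -> l2b (fun k => cmod (x k s)) M.
  by move=> sT r ur; under eq_bigr do rewrite cmod_conj; exact: (flow_l2 Ff sT).
have bx k s : 0 <= s <= T -> cmod (dx k s) <= h s.
  by move=> sT; rewrite cmod_conj; exact: (flow_da Ff k sT).
have mV : cmeas_on `[0, T] V.
  apply: cmeas_sum => y; apply: cmeasM; first by apply: cmeasJ; apply: meas_fc_on; exact: flow_meas Ff.
  exact: (meas_vert Ff Ff Ff).
have mq y : cAC T (quartic x a a a y) (dquartic x dx a da a da a da y).
  exact: (quartic_AC y T0 ax (flow_ac Ff) (flow_ac Ff) (flow_ac Ff)).
have VE : tint T V = tint T (fun s => \sum_(y <- pairing_family P S) quartic x a a a y s * cis (freq sg y * s)).
  apply: eq_ae_tint.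
  - exact: mV.
  - apply: cmeas_sum => y; apply: cmeasM; last by apply: cmeas_cis; exact: meas_mulr.
    exact: (cAC_meas T0 (mq y)).
  - move: (flow_ae Ff); apply: filterS; first exact: (ae_filter_ringOfSetsType mu).
    move=> s ea sT; apply: eq_bigr => y _.
    rewrite (@vert_phase R sg x f f f a a a) ?(ea sT)//; congr (_ * _).
    rewrite /x (ea sT) [conjc (cis _ * _)]cJM; have := cis_conjK (sg * (y.1.1 + y.1.2 + y.2)%:~R ^+ 2 * s).
    set C := cis _; move: (conjc C) (conjc (fc _ _)) => C' F' CC.
    by transitivity (F' * (C * C')); [rewrite CC mulr1|ring].
have BV : cmod (tint T V) <= far_err M M 1 h h T.
  rewrite VE; apply: (@normal_form R T sg M M 1 h h x dx a da a da a da (pairing_family P S) T0 sg1 M0 M0 isT ax (flow_ac Ff) (flow_ac Ff) (flow_ac Ff)) => //.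
  - exact: (flow_l2 Ff).
  - exact: (flow_l2 Ff).
  - exact: (flow_l2 Ff).
  - exact: (flow_da Ff).
  - exact: (flow_da Ff).
  - exact: (flow_da Ff).
  - exact: (flow_h Ff).
  - exact: (flow_h Ff).
  - exact: pairing_family_uniq.
  - exact: pairing_family_off.
have dgB s : `|dg s| <= M ^+ 4.
  rewrite ger0_norm; last by apply: sumr_ge0 => m _; apply: sumr_ge0 => p _; rewrite mulr_ge0 ?sqr_ge0.
  rewrite /dg exchange_big/= (_ : M ^+ 4 = M ^+ 2 * M ^+ 2); last by ring.
  apply: (@le_trans _ _ (\sum_(p <- zwin S) cmod (fc (f s) p) ^+ 2 * M ^+ 2)).
    apply: ler_sum => p _; rewrite -mulr_sumr ler_wpM2l ?sqr_ge0// -big_filter.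
    apply: (@l2b_inj R (fun k => cmod (fc (f s) k)) M _ (fun m => p + m)); [exact: lf|by move=> k l; lia|].
    by apply: filter_uniq; exact: uniq_zwin.
  by rewrite -mulr_suml ler_wpM2r ?sqr_ge0// lf// uniq_zwin.
have mdg : measurable_fun `[0, T] dg.
  have E s : (dg s)%:C = (pairing_trunc P S (f s))%:C - V s by rewrite pairing_truncE [X in X - _]addrC addrK.
  have : cmeas_on `[0, T] (fun s => (dg s)%:C).
    by rewrite (_ : (fun s => _) = (fun s => (pairing_trunc P S (f s))%:C - V s)); [apply: cmeasB => //; exact: meas_pairing_trunc|exact/funext].
  by case.
have iV : cintegrable mu `[0, T] V.
  apply: (@cint_le _ _ R mu _ (mseg 0 T) V (fun=> (size (zwin P))%:R * M ^+ 4 + M ^+ 4)) => //.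
    move=> s _; have -> : V s = (pairing_trunc P S (f s))%:C - (dg s)%:C by rewrite pairing_truncE addrK.
    apply: (le_trans (cmodB _ _)); rewrite !cmod_real; apply: lerD => //.
    rewrite ger0_norm ?pairing_trunc_bound//; apply: sumr_ge0 => m _; exact: sqr_ge0.
  exact: rint_cst_seg.
have idg : cintegrable mu `[0, T] (fun s => (dg s)%:C).
  apply: (@cint_le _ _ R mu _ (mseg 0 T) _ (fun=> M ^+ 4)); first exact: cmeas_real.
    by move=> s _; rewrite cmod_real.
  exact: rint_cst_seg.
rewrite (_ : (fun s => (pairing_trunc P S (f s))%:C) = (fun s => V s + (dg s)%:C)); last by apply/funext => s; rewrite pairing_truncE.
rewrite /tint (CintD (mseg 0 T) iV idg); apply: (le_trans (cmodD _ _)); apply: lerD => //.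
rewrite /Cintegral /=; rewrite (_ : _ +i* _ = (\int[mu]_(s in `[0, T]) dg s)%:C).
  by rewrite cmod_real; apply: Rint_bound.
by congr (_ +i* _); rewrite Rintegral_cst// mul0r.
Qed.

Let G s m := crossfc (f s) (f s) m.
Let pairing P s : R := \sum_(m <- zwin P | m != 0) cmod (G s m) ^+ 2.

Let Gb s m : cmod (G s m) <= M ^+ 2.
Proof. exact: (cmod_crossfc_le M0 m (qf s) (qf s) (lf s) (lf s)). Qed.

Lemma pairing_int P : cintegrable mu `[0, T] (fun s => (pairing P s)%:C) /\
  cmod (tint T (fun s => (pairing P s)%:C)) <= ap_bound.
Proof.
apply: (@tint_limit R T (fun S s => (pairing_trunc P S (f s))%:C) _ (fun=> (size (zwin P))%:R * M ^+ 4)).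
- by move=> S; exact: meas_pairing_trunc.
- exact: rint_cst_seg.
- move=> S s _; rewrite cmod_real ger0_norm ?pairing_trunc_bound//; apply: sumr_ge0 => m _; exact: sqr_ge0.
- move=> s _; rewrite /pairing /pairing_trunc RtoC_sum (_ : (fun S => _) = (fun S => \sum_(m <- zwin P | m != 0) (cmod (\sum_(p <- zwin S) conjc (fc (f s) p) * fc (f s) (p + m)) ^+ 2)%:C)).
    apply: cvgC_sum => m _; apply: (@cvgC_sqmod _ _ (M * M)).
      by apply: cvgC_fc_mul_conj; exact: qi_sqi.
    move=> n; apply: (le_trans (cmod_sum _ _ _)); under eq_bigr do rewrite cmodM cmod_conj.
    apply: (@l2_CS R (fun k => cmod (fc (f s) k)) (fun k => cmod (fc (f s) k)) _ _ _ id (fun p => p + m)) => //;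
      try (by move=> k; exact: cmod_ge0).
      by move=> k l; lia.
    exact: uniq_zwin.
  by apply/funext => S; rewrite RtoC_sum.
- by move=> S; exact: pairing_trunc_int.
Qed.

(** Parseval for |f|^2: its coefficients with m <> 0 are controlled by [pairing_int], and the one
    with m = 0 by the mass. *)
Lemma qmass_int_le : \int[mu]_(s in `[0, T]) qmass (f s) <= 2 * pi * (ap_bound + T * M ^+ 4).
Proof.
have tp0 := @twopi_gt0 R.
have iq := flow_q Ff.
pose E s : R := (2 * pi)^-1 * qmass (f s) - cmod (G s 0) ^+ 2.
have sG s : sqi (fun x => f s x * conjc (f s x)) by exact: sqi_mul_conj.
have [iE bE] : cintegrable mu `[0, T] (fun s => (E s)%:C) /\ cmod (tint T (fun s => (E s)%:C)) <= ap_bound.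
  apply: (@tint_limit R T (fun P s => (pairing P s)%:C) _ (fun s => (2 * pi)^-1 * qmass (f s))).
  - by move=> P; have [/cint_meas H _] := pairing_int P.
  - exact: (rintZ (mseg 0 T)).
  - move=> P s _; rewrite cmod_real ger0_norm; last by apply: sumr_ge0 => m _; exact: sqr_ge0.
    rewrite mulrC ler_pdivlMr// mulrC -mass_sqmod.
    apply: le_trans (bessel (sG s) (uniq_zwin P)); rewrite ler_wpM2l ?(ltW tp0)//.
    by rewrite /pairing big_mkcond; apply: ler_sum => m _; case: ifP => // _; exact: sqr_ge0.
  - move=> s _; rewrite /cvgC.
    have H := parseval (sG s).
    have : (fun P => (2 * pi)^-1 * `|2 * pi * \sum_(k <- zwin P) cmod (fc (fun x => f s x * conjc (f s x)) k) ^+ 2 - qmass (f s)|) @ \oo --> (0 : R).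
      apply: cvg0Z; rewrite -mass_sqmod; apply/cvgrPdist_le => e e0.
      move/cvgrPdist_le : H => /(_ e e0); apply: filterS => n.
      by rewrite sub0r normrN normr_id distrC.
    apply: cvg0_le => P; rewrite cmod_ge0/= -RtoCB cmod_real.
    rewrite -{1}[(2 * pi)^-1]ger0_norm ?invr_ge0 ?(ltW tp0)// -normrM le_eqVlt; apply/orP; left; apply/eqP; congr `|_|.
    rewrite /pairing sum_zwin_pred1R// /E mulrBr mulrA mulVf ?gt_eqF// mul1r; ring.
  - by move=> P; case: (pairing_int P).
have mG0 : measurable_fun `[0, T] (fun s => cmod (G s 0) ^+ 2).
  by apply: meas_cmodX; apply: meas_crossfc; exact: flow_meas Ff.
have G0B s : `|cmod (G s 0) ^+ 2| <= M ^+ 4.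
  rewrite ger0_norm ?sqr_ge0// (_ : M ^+ 4 = (M ^+ 2) ^+ 2); last by ring.
  by rewrite lerXn2r ?nnegrE ?cmod_ge0 ?sqr_ge0//; exact: Gb.
have iG0 : rintegrable mu `[0, T] (fun s => cmod (G s 0) ^+ 2).
  by apply: (@rint_le _ _ R mu _ (mseg 0 T) _ (fun=> M ^+ 4)); [exact: mG0|move=> s _; exact: G0B|exact: rint_cst_seg].
have iq' : rintegrable mu `[0, T] (fun s => (2 * pi)^-1 * qmass (f s)) by exact: (rintZ (mseg 0 T)).
have e1 : \int[mu]_(s in `[0, T]) E s <= ap_bound.
  by apply: le_trans bE; apply: le_trans (Re_le_cmod _); exact: ler_norm.
have e2 : \int[mu]_(s in `[0, T]) E s = (2 * pi)^-1 * (\int[mu]_(s in `[0, T]) qmass (f s)) - \int[mu]_(s in `[0, T]) cmod (G s 0) ^+ 2.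
  by rewrite /E RintegralB//; congr (_ - _); rewrite RintegralZl.
have e3 := ler_norm (\int[mu]_(s in `[0, T]) cmod (G s 0) ^+ 2).
have e4 : `|\int[mu]_(s in `[0, T]) cmod (G s 0) ^+ 2| <= T * M ^+ 4 by apply: Rint_bound.
rewrite -ler_pdivrMl//.
have -> : (2 * pi)^-1 * \int[mu]_(s in `[0, T]) qmass (f s) = \int[mu]_(s in `[0, T]) E s + \int[mu]_(s in `[0, T]) cmod (G s 0) ^+ 2.
  by rewrite e2 subrK.
exact: lerD e1 (le_trans e3 e4).
Qed.

(** The error [far_err] contains the time integral of h, hence of sqrt(qmass). Young's inequality
    bounds it by I / (4 pi) plus constants; multiplied by 2 pi the first term is I / 2 and is
    absorbed, I being finite for a solution. The result depends on gamma, M and T only. *)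
Lemma apriori_bound (b := 4 * kap 1 * M ^+ 3 * (`|gamma| * ((2 * pi)^-1 * Num.sqrt (2 * pi * M ^+ 2)))) :
  \int[mu]_(s in `[0, T]) qmass (f s) <= 4 * pi * (2 * kap 1 * M ^+ 4 + pi * b ^+ 2 * T + 2 * T * M ^+ 4).
Proof.
have p0 := pi_gt0 R.
have := qmass_int_le; rewrite /ap_bound.
set I := \int[mu]_(s in `[0, T]) _.
suff : far_err M M 1 h h T <= kap 1 * (2 * M ^+ 4) + I / (4 * pi) + pi * b ^+ 2 * T.
  move=> H1 H2; have {H2} : I <= 2 * pi * (kap 1 * (2 * M ^+ 4) + I / (4 * pi) + pi * b ^+ 2 * T + T * M ^+ 4 + T * M ^+ 4).
    by apply: (le_trans H2); rewrite ler_wpM2l ?mulr_ge0 ?pi_ge0// !lerD2r.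
  have e (A B C : R) : 2 * pi * (A + I / (4 * pi) + B + C + C) = I / 2 + 2 * pi * (A + B + 2 * C).
    exact: (absorb_eq _ _ _ _ (lt0r_neq0 p0)).
  rewrite e; have -> : 2 * T * M ^+ 4 = 2 * (T * M ^+ 4) by rewrite mulrA.
  have -> : 2 * kap 1 * M ^+ 4 = kap 1 * (2 * M ^+ 4) by ring.
  lra.
have iq := flow_q Ff.
rewrite (far_errE _ _ _ TT (flow_h Ff) (flow_h Ff)) /far_const mulrDr -addrA; apply: lerD.
  by rewrite (_ : M * M ^+ 3 = M ^+ 4)//; ring.
have ir : rintegrable mu `[0, T] (fun s => qmass (f s) / (4 * pi) + pi * b ^+ 2).
  apply: (rintD (mseg 0 T)); last exact: rint_cst_seg.
  rewrite (_ : (fun s => _) = (fun s => (4 * pi)^-1 * qmass (f s))); first exact: (rintZ (mseg 0 T)).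
  by apply/funext => s; rewrite mulrC.
have il : rintegrable mu `[0, T] (fun s => h s * M ^+ 3 + 3 * h s * M * M ^+ 2).
  rewrite (_ : (fun s => _) = (fun s => 4 * M ^+ 3 * h s)); first by apply: (rintZ (mseg 0 T)); exact: flow_h Ff.
  by apply/funext => s; ring.
rewrite -RintegralZl//.
have -> : I / (4 * pi) + pi * b ^+ 2 * T = \int[mu]_(s in `[0, T]) (qmass (f s) / (4 * pi) + pi * b ^+ 2).
  rewrite RintegralD//; last 2 first.
  - rewrite (_ : (fun s => _) = (fun s => (4 * pi)^-1 * qmass (f s))); first exact: (rintZ (mseg 0 T)).
    by apply/funext => s; rewrite mulrC.
  - exact: rint_cst_seg.
  congr (_ + _).
    rewrite /I mulrC -RintegralZl//; apply: eq_Rintegral => s _; exact: mulrC.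
  by rewrite Rint_cst_seg.
apply: le_Rintegral => //; first exact: (rintZ (mseg 0 T)).
move=> s _; have -> : kap 1 * (h s * M ^+ 3 + 3 * h s * M * M ^+ 2) = b * Num.sqrt (qmass (f s)).
  by rewrite /b /rep_bound; ring.
have q0 := qmass_ge0 (f s); have := sqr_sqrtr q0; move: (Num.sqrt _) => r <-.
exact: young.
Qed.

End Estimate.
End Apriori.

(** * Differences of two solutions *)

Section DifferenceStatics.
Context {R : realType}.
Notation mu := (@lebesgue_measure R).
Notation D := (torus R).
Notation fc := (@fourier_coef R).
#[local] Hint Resolve mseg mtorus : core.
Implicit Types (f g w : R -> R[i]).

Lemma l2b_mono (a b : int -> R) (A B : R) : (forall k, 0 <= a k <= b k) -> 0 <= A -> A <= B -> l2b b A -> l2b a B.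
Proof.
move=> ab A0 AB lb s us; apply: (@le_trans _ _ (A ^+ 2)); last by rewrite lerXn2r ?nnegrE ?(le_trans A0).
apply: le_trans (lb s us); apply: ler_sum => k _; have /andP[a0 h] := ab k.
by rewrite lerXn2r ?nnegrE ?(le_trans a0).
Qed.

Lemma l2b_add (a b : int -> R) (A B : R) : (forall k, 0 <= a k) -> (forall k, 0 <= b k) ->
  0 <= A -> 0 <= B -> l2b a A -> l2b b B -> l2b (fun k => a k + b k) (A + B).
Proof.
move=> a0 b0 A0 B0 la lb s us.
have := l2_CS a0 b0 A0 B0 la lb (@inj_id _) (@inj_id _) us => H.
under eq_bigr do rewrite sqrrD -mulr_natl.
rewrite !big_split/= -mulr_sumr sqrrD -[in leRHS]mulr_natl.
by apply: lerD (lb s us); apply: lerD; [exact: la|rewrite ler_wpM2l].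
Qed.

Lemma l2b_scale (c : R) (a : int -> R) (A : R) : l2b a A -> l2b (fun k => c * a k) (c * A).
Proof.
move=> la s us; under eq_bigr do rewrite exprMn.
by rewrite -mulr_sumr exprMn ler_wpM2l ?sqr_ge0// la.
Qed.

Lemma fc_sub f g k : sqi f -> sqi g -> fc (fun x => f x - g x) k = fc f k - fc g k.
Proof. exact: fcB. Qed.

Lemma sqi_mul f g : qi f -> qi g -> sqi (fun x => f x * g x).
Proof. by move=> qf qg; case: (qi_mul qf qg). Qed.

Lemma crossfc_subl f g w m : qi f -> qi g -> qi w ->
  crossfc (fun x => f x - g x) w m = crossfc f w m - crossfc g w m.
Proof.
move=> qf qg qw; rewrite /crossfc -fc_sub; [|exact: sqi_mul_conj..].
by congr (fourier_coef _ m); apply/funext => x; rewrite mulrBl.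
Qed.

Lemma crossfc_subr f g w m : qi f -> qi g -> qi w ->
  crossfc f (fun x => g x - w x) m = crossfc f g m - crossfc f w m.
Proof.
move=> qf qg qw; rewrite /crossfc -fc_sub; [|exact: sqi_mul_conj..].
by congr (fourier_coef _ m); apply/funext => x; rewrite cJB mulrBr.
Qed.

Let tri_int f g w : qi f -> qi g -> qi w -> cintegrable mu D (fun x => f x * (g x * conjc (w x))).
Proof. by move=> qf qg qw; apply: sqi_int; [exact: qi_sqi|exact: sqi_mul_conj]. Qed.

Lemma NR_sub1 f f' g w k : qi f -> qi f' -> qi g -> qi w ->
  NR (fun x => f x - f' x) g w k = NR f g w k - NR f' g w k.
Proof.
move=> qf qf' qg qw; rewrite /NR crossfc_subl// fc_sub; [|exact: qi_sqi..].
rewrite (_ : (fun x => (f x - f' x) * _) = (fun x => f x * (g x * conjc (w x)) - f' x * (g x * conjc (w x)))); last first.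
  by apply/funext => x; rewrite mulrBl.
by rewrite fcB_int; [ring|exact: tri_int..].
Qed.

Lemma NR_sym f g w k : NR f g w k = NR g f w k.
Proof.
rewrite /NR (_ : (fun x => f x * (g x * _)) = (fun x => g x * (f x * conjc (w x)))); first by ring.
by apply/funext => x; rewrite mulrCA.
Qed.

Lemma NR_sub3 f g w w' k : qi f -> qi g -> qi w -> qi w' ->
  NR f g (fun x => w x - w' x) k = NR f g w k - NR f g w' k.
Proof.
move=> qf qg qw qw'; rewrite /NR !crossfc_subr// fc_sub; [|exact: qi_sqi..].
rewrite (_ : (fun x => f x * _) = (fun x => f x * (g x * conjc (w x)) - f x * (g x * conjc (w' x)))); last first.
  by apply/funext => x; rewrite cJB !mulrBr.
by rewrite fcB_int ?cJB; [ring|exact: tri_int..].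
Qed.

(** The symmetry of the first two slots brings the difference into the first or the third slot, the
    two cases covered by [NRp] and [NR3p]. *)
Lemma NR_diff f g k (z := fun x => f x - g x) : qi f -> qi g ->
  NR f f f k - NR g g g k = NR z f f k + NR z g f k + NR g g z k.
Proof.
by move=> qf qg; rewrite /z NR_sub1// NR_sub1// NR_sub3// [NR f g f k]NR_sym; ring.
Qed.

Section Weighted.
Variables (z g w : R -> R[i]) (M y : R) (Q N : nat).
Hypotheses (M0 : 0 <= M) (y0 : 0 <= y) (qz : qi z) (qg : qi g) (qw : qi w).
Hypotheses (lz : l2b (fun k => cmod (fc z k)) M) (lg : l2b (fun k => cmod (fc g k)) M)
  (lw : l2b (fun k => cmod (fc w k)) M).
Hypothesis ly : l2b (fun k => lam Q k * cmod (fc z k)) y.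
Notation d := (N%:R / Q%:R : R).

Let d0 : 0 <= d. Proof. by rewrite divr_ge0. Qed.
Let c0 (u : R -> R[i]) k : 0 <= cmod (fc u k). Proof. exact: cmod_ge0. Qed.
Let zz k := lam Q k * cmod (fc z k) + d * cmod (fc z k).
Let zz0 k : 0 <= zz k. Proof. by rewrite addr_ge0// mulr_ge0 ?lam_ge0. Qed.
Let B0 : 0 <= y + d * M. Proof. by rewrite addr_ge0// mulr_ge0. Qed.

Let lzz : l2b zz (y + d * M).
Proof.
apply: l2b_add => //; [by move=> k; rewrite mulr_ge0 ?lam_ge0|by move=> k; rewrite mulr_ge0|by rewrite mulr_ge0|].
exact: l2b_scale.
Qed.

(** Moves the weight from the output frequency to that of the difference, at the cost of N / Q times
    the unweighted coefficient. *)
Lemma lam_shift (k l : int) : (`|k - l| <= N)%N -> lam Q k * cmod (fc z l) <= zz l.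
Proof.
move=> kl; rewrite /zz -mulrDl ler_wpM2r//.
have := lam_lip (R := R) Q k l; rewrite ler_norml => /andP[_ H].
have : `|k - l|%N%:R / Q%:R <= d by rewrite ler_wpM2r ?invr_ge0// ler_nat.
lra.
Qed.

(** Cauchy-Schwarz in m, for each output frequency separately. The number of frequencies in the
    window does not enter: an L^2 norm of the product g conj(w) replaces it. *)
Lemma NRp_weighted k : lam Q k * cmod (NRp (zwin N) z g w k) <=
  (y + d * M) * (nrm (fun x => g x * conjc (w x)) + M ^+ 2).
Proof.
apply: (@le_trans _ _ (\sum_(m <- zwin N | m != 0) (zz (k - m) * cmod (crossfc g w m)
    + M * (zz (k - m) * cmod (fc w (k - m)))))).
  apply: (@le_trans _ _ (lam Q k * \sum_(m <- zwin N | m != 0) cmod (fc z (k - m) * (crossfc g w m - fc g k * conjc (fc w (k - m)))))).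
    by rewrite ler_wpM2l ?lam_ge0//; exact: cmod_sum.
  rewrite mulr_sumr big_seq_cond [leRHS]big_seq_cond; apply: ler_sum => m /andP[mN _].
  rewrite cmodM mulrA mulrCA -mulrDr; apply: ler_pM; rewrite ?cmod_ge0 ?mulr_ge0 ?lam_ge0//.
    by apply: lam_shift; rewrite mem_zwin in mN; rewrite (_ : k - (k - m) = m)//; lia.
  apply: (le_trans (cmodB _ _)); rewrite lerD2l cmodM cmod_conj ler_wpM2r//; exact: cmod_fc_le_l2.
have inj : injective (fun m : int => k - m) by move=> a b; lia.
rewrite big_split/= -mulr_sumr mulrDr; apply: lerD.
  apply: (@l2_CS_cond R zz (fun k => cmod (crossfc g w k)) _ _ _ _ (fun m => k - m) id) => //.
  - by move=> l; exact: cmod_ge0.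
  - exact: nrm_ge0.
  - by apply: l2b_nrm; exact: sqi_mul_conj.
  - exact: uniq_zwin.
rewrite (_ : (y + d * M) * M ^+ 2 = M * ((y + d * M) * M)); last by ring.
apply: ler_wpM2l => //.
by apply: (@l2_CS_cond R zz (fun k => cmod (fc w k)) _ _ _ _ (fun m => k - m) (fun m => k - m)) => //; exact: uniq_zwin.
Qed.

End Weighted.

Lemma NR3p_weighted f g z (M y : R) (Q N : nat) k (d := N.*2%:R / Q%:R : R) :
  0 <= M -> 0 <= y -> qi f -> qi g -> qi z ->
  l2b (fun k => cmod (fc f k)) M -> l2b (fun k => cmod (fc g k)) M -> l2b (fun k => cmod (fc z k)) M ->
  l2b (fun k => lam Q k * cmod (fc z k)) y ->
  lam Q k * cmod (NR3p (win3 N k) f g z k) <=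
  (y + d * M) * (nrm (fun x => f x * g x) + 2 * M ^+ 2).
Proof.
move=> M0 y0 qf qg qz lf lg lz ly.
have d0 : 0 <= d by rewrite divr_ge0.
pose zz k := lam Q k * cmod (fc z k) + d * cmod (fc z k).
have zz0 l : 0 <= zz l by rewrite addr_ge0// mulr_ge0 ?lam_ge0 ?cmod_ge0.
have lzz : l2b zz (y + d * M).
  apply: l2b_add => //; [by move=> l; rewrite mulr_ge0 ?lam_ge0 ?cmod_ge0|by move=> l; rewrite mulr_ge0 ?cmod_ge0|by rewrite mulr_ge0|].
  exact: l2b_scale.
have B0 : 0 <= y + d * M by rewrite addr_ge0// mulr_ge0.
have c0 (u : R -> R[i]) l : 0 <= cmod (fc u l) by exact: cmod_ge0.
have uw : uniq (win3 N k) by exact: refl_win_uniq.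
apply: (@le_trans _ _ (\sum_(p <- win3 N k) (zz p * cmod (fc (fun x => f x * g x) (k + p))
    + M * (zz p * cmod (fc f p)) + M * (zz p * cmod (fc g p))))).
  apply: (@le_trans _ _ (lam Q k * \sum_(p <- win3 N k) cmod (conjc (fc z p) *
     (fc (fun x => f x * g x) (k + p) - fc f p * fc g k - (if p == k then 0 else fc f k * fc g p))))).
    by rewrite ler_wpM2l ?lam_ge0//; exact: cmod_sum.
  rewrite mulr_sumr big_seq [leRHS]big_seq; apply: ler_sum => p /mapP[n]; rewrite mem_zwin => nN pE.
  have -> : zz p * cmod (fc (fun x => f x * g x) (k + p)) + M * (zz p * cmod (fc f p)) + M * (zz p * cmod (fc g p)) =
    zz p * (cmod (fc (fun x => f x * g x) (k + p)) + cmod (fc f p) * M + M * cmod (fc g p)) by ring.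
  rewrite cmodM cmod_conj mulrA; apply: ler_pM; rewrite ?cmod_ge0 ?mulr_ge0 ?lam_ge0//.
    by apply: (@lam_shift z Q N.*2); rewrite pE (_ : k - (k - n) = n)//; lia.
  apply: (le_trans (cmodB _ _)); apply: lerD; last first.
    case: ifP => _; first by rewrite cmod0 mulr_ge0.
    by rewrite cmodM ler_wpM2r//; exact: cmod_fc_le_l2.
  apply: (le_trans (cmodB _ _)); rewrite lerD2l cmodM ler_wpM2l//; exact: cmod_fc_le_l2.
have inj : injective (fun p : int => k + p) by move=> a b; lia.
rewrite !big_split/= -!mulr_sumr.
have -> : (y + d * M) * (nrm (fun x => f x * g x) + 2 * M ^+ 2) =
   (y + d * M) * nrm (fun x => f x * g x) + M * ((y + d * M) * M) + M * ((y + d * M) * M) by ring.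
apply: lerD; first (apply: lerD).
- apply: (@l2_CS R zz (fun k => cmod (fc (fun x => f x * g x) k)) _ _ _ id (fun p => k + p)) => //.
  + exact: nrm_ge0.
  + by apply: l2b_nrm; exact: sqi_mul.
- apply: ler_wpM2l => //.
  by apply: (@l2_CS R zz (fun k => cmod (fc f k)) _ _ _ id id).
- apply: ler_wpM2l => //.
  by apply: (@l2_CS R zz (fun k => cmod (fc g k)) _ _ _ id id).
Qed.

Lemma cub_diff (a b : R[i]) (M : R) : cmod a <= M -> cmod b <= M ->
  cmod (a * a * conjc a - b * b * conjc b) <= 3 * M ^+ 2 * cmod (a - b).
Proof.
move=> aM bM; have a0 := cmod_ge0 a; have b0 := cmod_ge0 b; have z0 := cmod_ge0 (a - b).
have M0 := le_trans a0 aM.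
have -> : a * a * conjc a - b * b * conjc b = (a - b) * a * conjc a + (a - b) * b * conjc a + b * b * conjc (a - b).
  by rewrite cJB; ring.
have step (u v x y : R) : 0 <= x -> 0 <= y -> x <= M -> y <= M -> u <= cmod (a - b) * x * y -> u <= cmod (a - b) * M * M.
  by move=> x0 y0 xM yM /le_trans; apply; rewrite -!mulrA ler_wpM2l// ler_pM.
rewrite (_ : 3 * M ^+ 2 * _ = cmod (a - b) * M * M + cmod (a - b) * M * M + cmod (a - b) * M * M); last by ring.
apply: (le_trans (cmodD _ _)); apply: lerD; first (apply: (le_trans (cmodD _ _)); apply: lerD).
- by rewrite cmodM cmodM cmod_conj -!mulrA ler_wpM2l// ler_pM.
- by rewrite cmodM cmodM cmod_conj -!mulrA ler_wpM2l// ler_pM.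
- by rewrite cmodM cmodM cmod_conj mulrC -!mulrA ler_wpM2l// ler_pM.
Qed.

End DifferenceStatics.

(** * Removal of the resonant rotation *)

Section Gauge.
Context {R : realType}.
Notation mu := (@lebesgue_measure R).
Notation D := (torus R).
Notation fc := (@fourier_coef R).
#[local] Hint Resolve mseg mtorus : core.

(** The density may be changed on a null set of times. The gauged equation needs this, being derived
    at the times where [rep] is the solution itself. *)
Lemma cAC_ae (T : R) (A d d' : R -> R[i]) (h : R -> R) : 0 <= T -> cAC T A d -> cmeas_on `[0, T] d' ->
  (forall s, 0 <= s <= T -> cmod (d' s) <= h s) -> rintegrable mu `[0, T] h ->
  {ae mu, forall s, 0 <= s <= T -> d s = d' s} -> cAC T A d'.
Proof.
move=> T0 ad md' bd ih ae.
have itv s : `[0, T]%classic s -> 0 <= s <= T by rewrite /= in_itv.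
have id' : cintegrable mu `[0, T] d' by apply: (cint_le (mseg 0 T) md' _ ih) => s /itv; exact: bd.
apply: cAC_of => // t tT; rewrite (cAC_eq ad tT); congr (_ + _).
apply: eq_ae_tint.
- exact: (cint_meas (cint_itvS tT (cAC_cint ad))).
- exact: (cint_meas (cint_itvS tT id')).
- move: ae; apply: filterS; first exact: (ae_filter_ringOfSetsType mu).
  move=> s H st; apply: H; case/andP: st => -> /le_trans; apply; by case/andP: tT.
Qed.

Lemma fc0E (f : R -> R[i]) : fc f 0 = ((2 * pi)^-1)%:C * Cintegral mu D f.
Proof.
Transparent fourier_coef.
rewrite /fourier_coef; congr (_ * _); apply: eq_Cint => x _.
by rewrite mul0r oppr0 cis0 mulr1.
Qed.

Lemma crossfc0E (f : R -> R[i]) : sqi f -> crossfc f f 0 = ((2 * pi)^-1 * mass f)%:C.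
Proof. by move=> sf; rewrite RtoCM -mass_Cint// /crossfc fc0E. Qed.

Lemma crossfcZ (c : R[i]) (f g : R -> R[i]) m : cmod c = 1 -> qi f -> qi g ->
  crossfc (fun x => c * f x) (fun x => c * g x) m = crossfc f g m.
Proof.
move=> c1 qf qg; rewrite /crossfc; congr (fourier_coef _ m); apply/funext => x.
by rewrite cJM mulrACA mul_conj c1 expr1n mul1r.
Qed.

Lemma NRZ (c : R[i]) (f g w : R -> R[i]) k : cmod c = 1 -> qi f -> qi g -> qi w ->
  NR (fun x => c * f x) (fun x => c * g x) (fun x => c * w x) k = c * NR f g w k.
Proof.
move=> c1 qf qg qw; rewrite /NR !crossfcZ// !fcZ; [|exact: qi_sqi..].
have cc : c * conjc c = 1 by rewrite mul_conj c1 expr1n.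
rewrite (_ : (fun x => c * f x * _) = (fun x => c * (f x * (g x * conjc (w x))))); last first.
  apply/funext => x; rewrite cJM.
  by transitivity ((c * conjc c) * (c * (f x * (g x * conjc (w x))))); [ring|rewrite cc mul1r].
rewrite fcZ_int; last by apply: sqi_int; [exact: qi_sqi|exact: sqi_mul_conj].
rewrite cJM; transitivity (c * (fc (fun x => f x * (g x * conjc (w x))) k - fc f k * crossfc g w 0 - fc g k * crossfc f w 0)
  + (c * conjc c) * (c * (fc f k * fc g k * conjc (fc w k)))); first by ring.
by rewrite cc; ring.
Qed.

Lemma qmassZ (c : R[i]) (f : R -> R[i]) : cmod c = 1 -> qmass (fun x => c * f x) = qmass f.
Proof. by move=> c1; apply: eq_Rintegral => x _; rewrite cmodM c1 mul1r. Qed.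

(** The left side differs from the cubic coefficient by two resonant terms of size at most M^3, so
    it inherits the L^4 bound of that coefficient. *)
Lemma cmod_NR_le (f : R -> R[i]) (M : R) k : 0 <= M -> qi f -> l2b (fun k => cmod (fc f k)) M ->
  cmod (NR f f f k - fc f k * fc f k * conjc (fc f k)) <= cmod (fc (cubic f) k) + 2 * M ^+ 3.
Proof.
move=> M0 qf lf.
have -> : NR f f f k - fc f k * fc f k * conjc (fc f k) = fc (cubic f) k - (fc f k * crossfc f f 0 + fc f k * crossfc f f 0).
  by rewrite fc_cubicE; ring.
apply: (le_trans (cmodB _ _)); rewrite lerD2l; apply: (le_trans (cmodD _ _)).
have : cmod (fc f k * crossfc f f 0) <= M * M ^+ 2.
  rewrite cmodM ler_pM ?cmod_ge0//; first exact: cmod_fc_le_l2.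
  exact: cmod_crossfc_le.
have -> : M * M ^+ 2 = M ^+ 3 by ring.
lra.
Qed.

Section GaugeFlow.
Variables (gamma T sg M m : R) (phi : R -> R[i]) (u : R -> R -> R[i]).
Hypotheses (T0 : 0 <= T) (sg1 : `|sg| = 1) (M0 : 0 <= M).
Hypothesis sol : nls_solution gamma phi u.
Hypothesis um : forall t, mass (u t) = m.
Hypothesis mM : m <= 2 * pi * M ^+ 2.
Notation f := (rep T sg u).
Notation a := (profile sg u).
Notation da := (dprofile gamma T sg u).
Notation h := (rep_bound gamma T sg M u).
Let uM s (_ : 0 <= s <= T) : mass (u (sg * s)) <= 2 * pi * M ^+ 2. Proof. by rewrite um. Qed.
Let Ff : flow T sg M h f a da := solution_flow T0 sg1 sol uM.
Let qf s : qi (f s) := flow_qi Ff s.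
Let lf s : l2b (fun k => cmod (fc (f s) k)) M := flow_fc Ff s.

(* The interactions with l m = 0 contribute twice the mean of |u|^2 as a potential, hence the speed 2 gamma (m / 2 pi). *)
Definition gauge_speed : R := - (gamma * m / pi * sg).
Definition gauged (s x : R) : R[i] := cis (gauge_speed * s) * f s x.
Definition gauged_profile (k : int) (s : R) : R[i] := cis (gauge_speed * s) * a k s.
Definition gauged_dprofile (k : int) (s : R) : R[i] := 'i%C * gamma%:C * sg%:C * (cis (sg * k%:~R ^+ 2 * s) *
  (NR (gauged s) (gauged s) (gauged s) k - fc (gauged s) k * fc (gauged s) k * conjc (fc (gauged s) k))).
Definition gauged_bound (s : R) : R :=
  `|gamma| * ((2 * pi)^-1 * (Num.sqrt (2 * pi * M ^+ 2) * Num.sqrt (qmass (gauged s))) + 2 * M ^+ 3).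

Let gauge_speedE : pi != 0 :> R -> gauge_speed = - (gamma * sg * (2 * ((2 * pi)^-1 * m))).
Proof. by move=> p0; rewrite /gauge_speed; move: (pi : R) p0 => p p0; field. Qed.

Lemma gauged_qi s : qi (gauged s). Proof. exact: qi_scale. Qed.

Lemma gauged_qmass s : qmass (gauged s) = qmass (f s). Proof. by apply: qmassZ; rewrite cmod_cis. Qed.

Lemma gauged_fc s k : fc (gauged s) k = cis (gauge_speed * s) * fc (f s) k.
Proof. by rewrite /gauged fcZ//; exact: qi_sqi. Qed.

Lemma gauged_l2 s : l2b (fun k => cmod (fc (gauged s) k)) M.
Proof. by move=> r ur; under eq_bigr do rewrite gauged_fc cmodM cmod_cis mul1r; exact: lf. Qed.

Lemma gauged_mass s : mass (gauged s) <= 2 * pi * M ^+ 2.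
Proof.
have -> : mass (gauged s) = mass (f s) by apply: eq_Rintegral => x _; rewrite cmodM cmod_cis mul1r.
by apply: rep_mass => //; exact: uM.
Qed.

Lemma gauged_meas : cmeasurable (fun p : R * R => gauged p.1 p.2).
Proof.
apply: cmeasM; last exact: flow_meas Ff.
by apply: cmeas_cis; exact: (measurable_funM (measurable_cst _) measurable_fst).
Qed.

Lemma cmod_gauged_dprofile k s : cmod (gauged_dprofile k s) <= gauged_bound s.
Proof.
have -> : cmod (gauged_dprofile k s) = `|gamma| * cmod (NR (gauged s) (gauged s) (gauged s) k - fc (gauged s) k * fc (gauged s) k * conjc (fc (gauged s) k)).
  rewrite /gauged_dprofile cmodM [cmod (cis _ * _)]cmodM cmod_cis mul1r; congr (_ * _).
  by rewrite cmodM cmodM cmod_i !cmod_real sg1 mul1r mulr1.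
rewrite ler_wpM2l//; apply: (le_trans (cmod_NR_le k M0 (gauged_qi s) (gauged_l2 s))).
rewrite lerD2r; apply: (le_trans (cmod_fc_cubic k (gauged_qi s))).
rewrite ler_wpM2l ?invr_ge0 ?(ltW twopi_gt0)// ler_wpM2r ?sqrtr_ge0//.
by rewrite ler_wsqrtr// gauged_mass.
Qed.

Lemma gauged_bound_int : rintegrable mu `[0, T] gauged_bound.
Proof.
rewrite (_ : gauged_bound = (fun s => rep_bound gamma T sg M u s + `|gamma| * (2 * M ^+ 3))).
  by apply: (rintD (mseg 0 T)); [exact: (flow_h Ff)|exact: rint_cst_seg].
by apply/funext => s; rewrite /gauged_bound /rep_bound gauged_qmass mulrDr.
Qed.

Lemma meas_gauged_dprofile k E : cmeas_on E (gauged_dprofile k).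
Proof.
apply: cmeasM; first exact: cmeas_cst.
apply: cmeasM; first by apply: cmeas_cis; exact: meas_mulr.
have mg := gauged_meas.
apply: cmeasB; first exact: meas_NR.
by apply: cmeasM; [apply: cmeasM; exact: meas_fc_on|apply: cmeasJ; exact: meas_fc_on].
Qed.

(** The derivative of the gauge phase cancels the term 2 F_k [crossfc f f 0] of the cubic
    nonlinearity. Conservation of mass enters here: this mean value is constant in time, so a linear
    phase does it. *)
Lemma gauged_profile_AC k : cAC T (gauged_profile k) (gauged_dprofile k).
Proof.
have A1 := cAC_mul T0 (cAC_cis gauge_speed T0) (flow_ac Ff k).
apply: (cAC_ae T0 A1 (meas_gauged_dprofile k _) _ gauged_bound_int); first by move=> s _; exact: cmod_gauged_dprofile.
have := rep_ae T0 sg1 sol; apply: filterS; first exact: (ae_filter_ringOfSetsType mu).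
move=> s Hs sT; have Es := Hs sT.
have c1 : cmod (cis (gauge_speed * s) : R[i]) = 1 by rewrite cmod_cis.
have ea : a k s = cis (sg * k%:~R ^+ 2 * s) * fc (f s) k by rewrite /profile Es.
rewrite ea /dprofile /gauged_dprofile gauged_fc /gauged NRZ//.
have E0 : crossfc (f s) (f s) 0 = ((2 * pi)^-1 * m)%:C.
  by rewrite crossfc0E; [rewrite Es um|exact: qi_sqi].
rewrite fc_cubicE E0.
have cc := cis_conjK (gauge_speed * s).
have kE : gauge_speed%:C = - (gamma%:C * sg%:C * (2 * ((2 * pi)^-1 * m)%:C)).
  rewrite (gauge_speedE (lt0r_neq0 (pi_gt0 R))).
  by rewrite rmorphN !rmorphM rmorph_nat.
rewrite kE [conjc (cis _ * _)]cJM; move: cc; set c := cis _; move: (conjc c) => c' cc.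
set e := cis _; set F := fc _ _; set N := NR _ _ _ _; move: (conjc F) => F'.
set q := (_)%:C in E0 *.
transitivity ('i%C * gamma%:C * sg%:C * (e * (c * N - c * (F * F * F')))); first by ring.
transitivity ('i%C * gamma%:C * sg%:C * (e * (c * N - (c * c') * (c * (F * F * F'))))); last by ring.
by rewrite cc mul1r.
Qed.

Lemma gauge_flow : flow T sg M gauged_bound gauged gauged_profile gauged_dprofile.
Proof.
split.
- exact: gauged_profile_AC.
- by move=> s sT r ur; under eq_bigr do rewrite cmodM cmod_cis mul1r; exact: (flow_l2 Ff sT).
- by move=> k s _; exact: cmod_gauged_dprofile.
- exact: gauged_bound_int.
- exact: gauged_qi.
- exact: gauged_l2.
- exact: gauged_meas.
- rewrite /rintegrable (_ : (fun s => qmass (gauged s)) = (fun s => qmass (f s))); first exact: flow_q Ff.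
  by apply/funext => s; exact: gauged_qmass.
- move: (flow_ae Ff); apply: filterS; first exact: (ae_filter_ringOfSetsType mu).
  by move=> s Hs sT k; rewrite /gauged_profile gauged_fc Hs// mulrCA.
Qed.

End GaugeFlow.

Lemma flow_weaken T sg M M' (h h' : R -> R) f a da : 0 <= M -> M <= M' -> (forall s, h s <= h' s) ->
  rintegrable mu `[0, T] h' -> flow T sg M h f a da -> flow T sg M' h' f a da.
Proof.
move=> M0 MM hh ih' F; split => //.
- exact: flow_ac F.
- move=> s sT; apply: (l2b_mono _ M0 MM (flow_l2 F sT)) => k; by rewrite cmod_ge0 /=.
- by move=> k s sT; apply: le_trans (hh s); exact: flow_da F k s sT.
- exact: flow_qi F.
- move=> s; apply: (l2b_mono _ M0 MM (flow_fc F s)) => k; by rewrite cmod_ge0 /=.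
- exact: flow_meas F.
- exact: flow_q F.
- exact: flow_ae F.
Qed.

(** [flow] asks for bounds but not for an equation, so it is stable under differences, and the far
    estimates apply with a difference in any slot. *)
Lemma flow_sub T sg M (h : R -> R) f a da g b db : 0 <= T -> 0 <= M -> flow T sg M h f a da -> flow T sg M h g b db ->
  flow T sg (M + M) (fun s => h s + h s) (fun s x => f s x - g s x) (fun k s => a k s - b k s) (fun k s => da k s - db k s).
Proof.
move=> T0 M0 F G.
have MM : 0 <= M + M by rewrite addr_ge0.
have sub (u v : int -> R[i]) : l2b (fun k => cmod (u k)) M -> l2b (fun k => cmod (v k)) M ->
    l2b (fun k => cmod (u k - v k)) (M + M).
  move=> lu lv; apply: (l2b_mono _ MM (lexx _) (l2b_add _ _ M0 M0 lu lv)) => k; rewrite ?cmod_ge0//=.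
  exact: cmodB.
split.
- by move=> k; apply: cAC_sub; [exact: flow_ac F k|exact: flow_ac G k].
- by move=> s sT; apply: sub; [exact: flow_l2 F s sT|exact: flow_l2 G s sT].
- move=> k s sT; apply: (le_trans (cmodB _ _)); apply: lerD; [exact: flow_da F k s sT|exact: flow_da G k s sT].
- by apply: (rintD (mseg 0 T)); exact: flow_h F.
- by move=> s; case: (qi_sub (flow_qi F s) (flow_qi G s)).
- move=> s r ur; under eq_bigr do rewrite (fc_sub _ (qi_sqi (flow_qi F s)) (qi_sqi (flow_qi G s))).
  apply: (sub _ _ (flow_fc F s) (flow_fc G s)) ur.
- by apply: cmeasB; [exact: flow_meas F|exact: flow_meas G].
- have mq : cmeasurable (fun p : R * R => f p.1 p.2 - g p.1 p.2) by apply: cmeasB; [exact: flow_meas F|exact: flow_meas G].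
  have m4 : measurable_fun setT (fun s => qmass (fun x => f s x - g s x)).
    apply: (@meas_Rint_param R (fun p => cmod (f p.1 p.2 - g p.1 p.2) ^+ 4)); exact: meas_cmodX.
  apply: (@rint_le _ _ R mu _ (mseg 0 T) _ (fun s => 8 * (qmass (f s) + qmass (g s)))).
  + exact: measurable_funTS.
  + by move=> s _; rewrite ger0_norm ?qmass_ge0//; case: (qi_sub (flow_qi F s) (flow_qi G s)).
  + by apply: (rintZ (mseg 0 T)); apply: (rintD (mseg 0 T)); [exact: flow_q F|exact: flow_q G].
- move: (flow_ae F) (flow_ae G); apply: filterS2; first exact: (ae_filter_ringOfSetsType mu).
  move=> s H1 H2 sT k; by rewrite H1// H2// fc_sub ?mulrBr//; [exact: qi_sqi (flow_qi F s)|exact: qi_sqi (flow_qi G s)].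
Qed.

End Gauge.

(** * Interactions of intermediate range *)

Section Mid.
Context {R : realType}.
Notation mu := (@lebesgue_measure R).
#[local] Hint Resolve mseg mtorus : core.
Variables (T sg : R) (L : nat) (h y : R -> R) (r : seq (int * int * int)).
Variables (A dA B dB C dC Z dZ : int -> R -> R[i]) (MA MB MC cA cB cC : R).
Hypotheses (T0 : 0 <= T) (sg1 : `|sg| = 1) (L0 : (0 < L)%N).
Hypotheses (MA0 : 0 <= MA) (MB0 : 0 <= MB) (MC0 : 0 <= MC) (cA0 : 0 <= cA) (cB0 : 0 <= cB) (cC0 : 0 <= cC).
Hypotheses (aA : forall k, cAC T (A k) (dA k)) (aB : forall k, cAC T (B k) (dB k))
  (aC : forall k, cAC T (C k) (dC k)) (aZ : forall k, cAC T (Z k) (dZ k)).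
Hypotheses (lA : forall s, 0 <= s <= T -> l2b (fun k => cmod (A k s)) MA)
  (lB : forall s, 0 <= s <= T -> l2b (fun k => cmod (B k s)) MB)
  (lC : forall s, 0 <= s <= T -> l2b (fun k => cmod (C k s)) MC)
  (lZ : forall s, 0 <= s <= T -> l2b (fun k => cmod (Z k s)) (y s)).
Hypotheses (y0 : forall s, 0 <= y s) (h0 : forall s, 0 <= h s).
Hypotheses (bA : forall k s, 0 <= s <= T -> cmod (dA k s) <= cA * h s)
  (bB : forall k s, 0 <= s <= T -> cmod (dB k s) <= cB * h s)
  (bC : forall k s, 0 <= s <= T -> cmod (dC k s) <= cC * h s).
Hypotheses (ihy : rintegrable mu `[0, T] (fun s => h s * y s)).
Hypotheses (ur : uniq r) (rP : forall x, x \in r -> offaxis L x).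

(** The vertex p + l is left free for the difference [Z]; the three others carry solutions or a test
    sequence. *)
Definition mid_coef (x : int * int * int) s := A x.1.1 s * B (x.1.1 + x.2) s * C (x.1.1 + x.1.2 + x.2) s.
Definition mid_dcoef (x : int * int * int) s :=
  (dA x.1.1 s * B (x.1.1 + x.2) s + A x.1.1 s * dB (x.1.1 + x.2) s) * C (x.1.1 + x.1.2 + x.2) s +
  A x.1.1 s * B (x.1.1 + x.2) s * dC (x.1.1 + x.1.2 + x.2) s.
(* A primitive in s of cis (freq sg x * s). *)
Definition mid_phase (x : int * int * int) (s : R) : R[i] := ('i%C * (freq sg x)%:C)^-1 * cis (freq sg x * s).
(** What multiplies the mode k of [Z] in the integrated expression: when the derivative falls on
    [Z], this becomes the test sequence for the equation of [Z]. *)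
Definition mid_test (k : int) (s : R) : R[i] := \sum_(x <- r | x.1.1 + x.1.2 == k) mid_coef x s * mid_phase x s.
Definition mid_dtest (k : int) (s : R) : R[i] :=
  \sum_(x <- r | x.1.1 + x.1.2 == k) (mid_dcoef x s * mid_phase x s + mid_coef x s * cis (freq sg x * s)).
Definition mid_freqs : seq int := undup [seq x.1.1 + x.1.2 | x <- r].
Notation P := (MA * MB * MC).
Notation Dd := (cA * MB * MC + cB * MA * MC + cC * MA * MB).

Lemma mid_phase_AC x : x \in r -> cAC T (mid_phase x) (fun s => cis (freq sg x * s)).
Proof.
move=> xr; have w0 := freq_neq0 sg1 (rP xr).
have iw : 'i%C * (freq sg x)%:C != 0 :> R[i].
  apply/eqP => /(congr1 (@cmod R)); rewrite cmodM cmod_i mul1r cmod_real cmod0 => /eqP.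
  by rewrite normr_eq0 (negbTE w0).
apply: eq_cAC (cAC_scale ('i%C * (freq sg x)%:C)^-1 T0 (cAC_cis (freq sg x) T0)) => // s.
by rewrite /= mulrA mulVf// mul1r.
Qed.

Lemma cmod_mid_phase x s : x \in r -> cmod (mid_phase x s) = 2^-1 * inv_lm x.
Proof.
move=> xr; rewrite -(normr_freq x sg1) /mid_phase cmodM cmod_cis mulr1.
have w0 := freq_neq0 sg1 (rP xr).
have c0 : cmod ('i%C * (freq sg x)%:C : R[i]) = `|freq sg x| by rewrite cmodM cmod_i mul1r cmod_real.
have iw : 'i%C * (freq sg x)%:C != 0 :> R[i].
  by apply/eqP => /(congr1 (@cmod R)); rewrite c0 cmod0 => /eqP; rewrite normr_eq0 (negbTE w0).
have : cmod (('i%C * (freq sg x)%:C)^-1 : R[i]) * `|freq sg x| = 1.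
  rewrite -c0 -cmodM mulVf// -[1]/(1%:C) cmod_real normr1 //.
by move=> /(canRL (mulfK _)) -> //; rewrite ?normr_eq0// mul1r.
Qed.

Lemma mid_coef_AC x : cAC T (mid_coef x) (mid_dcoef x).
Proof. by apply: cAC_mul => //; apply: cAC_mul. Qed.

Lemma inv_lm_le1 x : x \in r -> inv_lm x <= 1 :> R.
Proof.
move=> /rP /and3P[l0 m0 _]; rewrite /inv_lm -natrM invf_le1 ?ltr0n ?ler1n//; clear -l0 m0; lia.
Qed.

Lemma mid_test_AC k : cAC T (mid_test k) (mid_dtest k).
Proof.
have H x : cAC T (fun s => if (x.1.1 + x.1.2 == k) && (x \in r) then mid_coef x s * mid_phase x s else 0)
   (fun s => if (x.1.1 + x.1.2 == k) && (x \in r) then mid_dcoef x s * mid_phase x s + mid_coef x s * cis (freq sg x * s) else 0).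
  case: (boolP ((x.1.1 + x.1.2 == k) && (x \in r))) => [/andP[_ xr]|_]; last exact: cAC_cst.
  by apply: cAC_mul => //; [exact: mid_coef_AC|exact: mid_phase_AC].
apply: eq_cAC (cAC_sum r H) => s; rewrite /mid_test /mid_dtest -big_mkcond [LHS]big_seq_cond [RHS]big_seq_cond;
  by apply: eq_bigl => x /=; case: (x \in r); rewrite ?andbT.
Qed.

Let c0 (u : int -> R -> R[i]) s k : 0 <= cmod (u k s). Proof. exact: cmod_ge0. Qed.

Lemma sum_mid_coef s : 0 <= s <= T -> \sum_(x <- r) cmod (mid_coef x s * mid_phase x s) <= 2^-1 * (kap L * P).
Proof.
move=> sT.
have := @parallelogram_no1 R r L _ _ _ _ _ _ ur L0 (c0 C s) (c0 B s) (c0 A s) MC0 MB0 MA0 (lC sT) (lB sT) (lA sT) rP.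
rewrite (_ : MC * MB * MA = P); last by ring.
move=> H; apply: (@le_trans _ _ (2^-1 * \sum_(x <- r) cmod (C (x.1.1 + x.1.2 + x.2) s) * cmod (B (x.1.1 + x.2) s) * cmod (A x.1.1 s) * inv_lm x)).
  rewrite mulr_sumr big_seq [leRHS]big_seq; apply: ler_sum => x xr.
  by rewrite cmodM cmod_mid_phase// /mid_coef cmodM cmodM le_eqVlt; apply/orP; left; apply/eqP; ring.
by rewrite ler_wpM2l.
Qed.

Lemma sum_mid_coefZ s : 0 <= s <= T ->
  \sum_(x <- r) cmod (mid_coef x s * mid_phase x s * Z (x.1.1 + x.1.2) s) <= 2^-1 * (kap L * (P * y s)).
Proof.
move=> sT.
have := @parallelogram_all R r L _ _ _ _ _ _ _ _ ur L0 (c0 Z s) (c0 B s) (c0 A s) MC0 (y0 s) MB0 MA0 (lC sT) (lZ sT) (lB sT) (lA sT) rP.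
rewrite (_ : MC * y s * MB * MA = P * y s); last by ring.
move=> H; apply: (@le_trans _ _ (2^-1 * \sum_(x <- r) cmod (C (x.1.1 + x.1.2 + x.2) s) * cmod (Z (x.1.1 + x.1.2) s) * cmod (B (x.1.1 + x.2) s) * cmod (A x.1.1 s) * inv_lm x)).
  rewrite mulr_sumr big_seq [leRHS]big_seq; apply: ler_sum => x xr.
  by rewrite cmodM cmodM cmod_mid_phase// /mid_coef cmodM cmodM le_eqVlt; apply/orP; left; apply/eqP; ring.
by rewrite ler_wpM2l.
Qed.

Let cmod_mid_dcoef x s : 0 <= s <= T -> cmod (mid_dcoef x s) <=
  h s * (cA * (cmod (B (x.1.1 + x.2) s) * cmod (C (x.1.1 + x.1.2 + x.2) s)) +
         cB * (cmod (A x.1.1 s) * cmod (C (x.1.1 + x.1.2 + x.2) s)) +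
         cC * (cmod (A x.1.1 s) * cmod (B (x.1.1 + x.2) s))).
Proof.
move=> sT; rewrite /mid_dcoef; apply: (le_trans (cmodD _ _)); rewrite mulrDr; apply: lerD.
  rewrite cmodM; apply: (@le_trans _ _ ((cA * h s * cmod (B (x.1.1 + x.2) s) + cmod (A x.1.1 s) * (cB * h s)) * cmod (C (x.1.1 + x.1.2 + x.2) s))).
    rewrite ler_wpM2r ?cmod_ge0//; apply: (le_trans (cmodD _ _)); rewrite !cmodM; apply: lerD.
      by rewrite ler_wpM2r ?cmod_ge0// bA.
    by rewrite ler_wpM2l ?cmod_ge0// bB.
  by rewrite le_eqVlt; apply/orP; left; apply/eqP; ring.
rewrite cmodM cmodM; apply: (@le_trans _ _ (cmod (A x.1.1 s) * cmod (B (x.1.1 + x.2) s) * (cC * h s))).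
  by rewrite ler_wpM2l ?mulr_ge0 ?cmod_ge0// bC.
by rewrite le_eqVlt; apply/orP; left; apply/eqP; ring.
Qed.

Lemma sum_mid_dcoefZ s : 0 <= s <= T ->
  \sum_(x <- r) cmod (mid_dcoef x s * mid_phase x s * Z (x.1.1 + x.1.2) s) <= 2^-1 * (kap L * (Dd * (h s * y s))).
Proof.
move=> sT; have hs := h0 s.
have p0 := @parallelogram_no0 R r L _ _ _ _ _ _ ur L0 (c0 C s) (c0 Z s) (c0 B s) MC0 (y0 s) MB0 (lC sT) (lZ sT) (lB sT) rP.
have p2 := @parallelogram_no2 R r L _ _ _ _ _ _ ur L0 (c0 C s) (c0 Z s) (c0 A s) MC0 (y0 s) MA0 (lC sT) (lZ sT) (lA sT) rP.
have p3 := @parallelogram_no3 R r L _ _ _ _ _ _ ur L0 (c0 Z s) (c0 B s) (c0 A s) (y0 s) MB0 MA0 (lZ sT) (lB sT) (lA sT) rP.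
apply: (@le_trans _ _ (2^-1 * (h s * (cA * (kap L * (MC * y s * MB)) + cB * (kap L * (MC * y s * MA)) + cC * (kap L * (y s * MB * MA)))))); last first.
  by rewrite le_eqVlt; apply/orP; left; apply/eqP; ring.
apply: (@le_trans _ _ (2^-1 * (h s * (
  cA * (\sum_(x <- r) cmod (C (x.1.1 + x.1.2 + x.2) s) * cmod (Z (x.1.1 + x.1.2) s) * cmod (B (x.1.1 + x.2) s) * inv_lm x) +
  cB * (\sum_(x <- r) cmod (C (x.1.1 + x.1.2 + x.2) s) * cmod (Z (x.1.1 + x.1.2) s) * cmod (A x.1.1 s) * inv_lm x) +
  cC * (\sum_(x <- r) cmod (Z (x.1.1 + x.1.2) s) * cmod (B (x.1.1 + x.2) s) * cmod (A x.1.1 s) * inv_lm x))))); last first.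
  by rewrite ler_wpM2l// ler_wpM2l//; repeat apply: lerD; rewrite ler_wpM2l.
rewrite !mulr_sumr -!big_split/= !mulr_sumr big_seq [leRHS]big_seq; apply: ler_sum => x xr.
rewrite cmodM cmodM cmod_mid_phase//.
have w0 : 0 <= inv_lm x :> R by exact: inv_lm_ge0.
apply: (@le_trans _ _ (h s * (cA * (cmod (B (x.1.1 + x.2) s) * cmod (C (x.1.1 + x.1.2 + x.2) s)) +
         cB * (cmod (A x.1.1 s) * cmod (C (x.1.1 + x.1.2 + x.2) s)) +
         cC * (cmod (A x.1.1 s) * cmod (B (x.1.1 + x.2) s))) * (2^-1 * inv_lm x) * cmod (Z (x.1.1 + x.1.2) s))).
  by rewrite ler_wpM2r ?cmod_ge0// ler_wpM2r ?mulr_ge0// cmod_mid_dcoef.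
by rewrite le_eqVlt; apply/orP; left; apply/eqP; ring.
Qed.

(** The parallelogram estimate without the vertex of [Z] is an l^1 bound for the test sequence,
    which can therefore be paired with a derivative known only uniformly in the frequency. *)
Lemma mid_test_l1 s (J : seq int) : uniq J -> 0 <= s <= T -> \sum_(k <- J) cmod (mid_test k s) <= 2^-1 * (kap L * P).
Proof.
move=> uJ sT; apply: le_trans (sum_mid_coef sT).
apply: (@le_trans _ _ (\sum_(k <- J) \sum_(x <- r | x.1.1 + x.1.2 == k) cmod (mid_coef x s * mid_phase x s))).
  by apply: ler_sum => k _; exact: cmod_sum.
rewrite (exchange_big_dep predT)//=; apply: ler_sum => x _.
rewrite big_const_seq iter_addr_0.
have : (count (eq_op (x.1.1 + x.1.2)%R) J <= 1)%N.
  rewrite (eq_count (a2 := pred1 (x.1.1 + x.1.2))); last by move=> k; rewrite /= eq_sym.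
  by rewrite count_uniq_mem//; case: (_ \in _).
by case: (count _ _) => [|[|]]//; rewrite mulr0n cmod_ge0.
Qed.

Let P0 : 0 <= 2^-1 * (kap L * P).
Proof. by rewrite mulr_ge0 ?mulr_ge0 ?kap_ge0. Qed.

Lemma mid_test_l2 s : 0 <= s <= T -> l2b (fun k => cmod (mid_test k s)) (2^-1 * (kap L * P)).
Proof.
move=> sT J uJ; apply: (@le_trans _ _ ((\sum_(k <- J) cmod (mid_test k s)) ^+ 2)).
  elim: {uJ} J => [|k J IH]; first by rewrite !big_nil expr0n.
  rewrite !big_cons sqrrD -addrA lerD2l; apply: (le_trans IH); rewrite lerDr mulrn_wge0// mulr_ge0 ?cmod_ge0//.
  by apply: sumr_ge0 => *; exact: cmod_ge0.
by rewrite lerXn2r ?nnegrE//; [apply: sumr_ge0 => *; exact: cmod_ge0|exact: mid_test_l1].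
Qed.

(** Counting terms is good enough here: this bound is used only inside a far error at the scale N',
    which is chosen after the number of terms is known. *)
Lemma mid_dtest_bound k s : 0 <= s <= T ->
  cmod (mid_dtest k s) <= (count (fun x : int * int * int => x.1.1 + x.1.2 == k) r)%:R * (h s * Dd + P).
Proof.
move=> sT; have hs := h0 s.
have D0 : 0 <= Dd by rewrite !addr_ge0// !mulr_ge0.
have PP : 0 <= P by rewrite !mulr_ge0.
have A1 j : cmod (A j s) <= MA by have := l2b_le j (lA sT) MA0; rewrite ger0_norm ?cmod_ge0.
have B1 j : cmod (B j s) <= MB by have := l2b_le j (lB sT) MB0; rewrite ger0_norm ?cmod_ge0.
have C1 j : cmod (C j s) <= MC by have := l2b_le j (lC sT) MC0; rewrite ger0_norm ?cmod_ge0.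
apply: (le_trans (cmod_sum _ _ _)).
apply: (@le_trans _ _ (\sum_(x <- r | x.1.1 + x.1.2 == k) (h s * Dd + P))); last first.
  by rewrite big_const_seq iter_addr_0 [leRHS]mulr_natl.
rewrite big_seq_cond [leRHS]big_seq_cond; apply: ler_sum => x /andP[xr _].
apply: (le_trans (cmodD _ _)); apply: lerD; last first.
  by rewrite cmodM cmod_cis mulr1 /mid_coef cmodM cmodM ler_pM ?mulr_ge0 ?cmod_ge0// ler_pM ?cmod_ge0.
rewrite cmodM cmod_mid_phase//; apply: (@le_trans _ _ (cmod (mid_dcoef x s) * 1)).
  rewrite ler_wpM2l ?cmod_ge0//; have := inv_lm_le1 xr; have := inv_lm_ge0 (R := R) x; lra.
rewrite mulr1; apply: (le_trans (cmod_mid_dcoef x sT)); rewrite ler_wpM2l//.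
rewrite -!mulrA; repeat apply: lerD; rewrite ler_wpM2l// ler_pM ?cmod_ge0//.
Qed.

Variable t : R.
Hypothesis tT : 0 <= t <= T.

Lemma cint_seq (F : int * int * int -> R -> R[i]) : (forall x, x \in r -> cintegrable mu `[0, T] (F x)) ->
  cintegrable mu `[0, t] (fun s => \sum_(x <- r) F x s).
Proof.
move=> H; apply: (cint_itvS tT).
have := @cint_sum _ _ R mu _ (mseg 0 T) _ r (fun x s => if x \in r then F x s else 0).
rewrite (_ : (fun s => \sum_(x <- r) _) = (fun s => \sum_(x <- r) F x s)); last first.
  by apply/funext => s; rewrite big_seq [RHS]big_seq; apply: eq_bigr => x ->.
by apply => x; case: (boolP (x \in r)) => [/H//|_]; exact: cint0.
Qed.

Lemma cint_mid_dcoef : cintegrable mu `[0, t] (fun s => \sum_(x <- r) mid_dcoef x s * mid_phase x s * Z (x.1.1 + x.1.2) s).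
Proof.
apply: cint_seq => x xr.
rewrite (_ : (fun s => _) = (fun s => (mid_phase x s * Z (x.1.1 + x.1.2) s) * mid_dcoef x s)); last first.
  by apply/funext => s; ring.
apply: (cAC_intM T0); last exact: cAC_cint (mid_coef_AC x).
exact: (cAC_mul T0 (mid_phase_AC xr) (aZ _)).
Qed.

Lemma mid_parts : tint t (fun s => \sum_(x <- r) mid_coef x s * Z (x.1.1 + x.1.2) s * cis (freq sg x * s)) =
  \sum_(x <- r) mid_coef x t * mid_phase x t * Z (x.1.1 + x.1.2) t - \sum_(x <- r) mid_coef x 0 * mid_phase x 0 * Z (x.1.1 + x.1.2) 0
  - tint t (fun s => \sum_(x <- r) mid_dcoef x s * mid_phase x s * Z (x.1.1 + x.1.2) s)
  - tint t (fun s => \sum_(k <- mid_freqs) mid_test k s * dZ k s).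
Proof.
pose S1 s := \sum_(x <- r) mid_coef x s * Z (x.1.1 + x.1.2) s * cis (freq sg x * s).
pose S2 s := \sum_(x <- r) mid_dcoef x s * mid_phase x s * Z (x.1.1 + x.1.2) s.
pose S3 s := \sum_(k <- mid_freqs) mid_test k s * dZ k s.
have i1 : cintegrable mu `[0, t] S1.
  apply: cint_seq => x xr; apply: (cAC_int T0 (df := _)).
  apply: (cAC_mul T0); first (apply: (cAC_mul T0); [exact: mid_coef_AC|exact: aZ]).
  exact: cAC_cis.
have i2 : cintegrable mu `[0, t] S2 by exact: cint_mid_dcoef.
have i3 : cintegrable mu `[0, t] S3.
  apply: (cint_itvS tT); apply: (cint_sum (mseg 0 T)) => k.
  exact: (cAC_intM T0 (mid_test_AC k) (cAC_cint (aZ k))).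
have H x : cAC T (fun s => if x \in r then mid_coef x s * mid_phase x s * Z (x.1.1 + x.1.2) s else 0)
   (fun s => if x \in r then (mid_dcoef x s * mid_phase x s + mid_coef x s * cis (freq sg x * s)) * Z (x.1.1 + x.1.2) s +
      mid_coef x s * mid_phase x s * dZ (x.1.1 + x.1.2) s else 0).
  case: (boolP (x \in r)) => [xr|_]; last exact: cAC_cst.
  by apply: cAC_mul => //; apply: cAC_mul => //; [exact: mid_coef_AC|exact: mid_phase_AC].
have := cAC_eq (cAC_sum r H) tT.
rewrite -!big_mkcond -!big_seq => E.
rewrite -/S1 -/S2 -/S3.
have S3E s : S3 s = \sum_(x <- r) mid_coef x s * mid_phase x s * dZ (x.1.1 + x.1.2) s.
  rewrite /S3 /mid_freqs /mid_test; under eq_bigr do rewrite mulr_suml.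
  rewrite (exchange_big_dep predT)//= big_seq [RHS]big_seq; apply: eq_bigr => x xr.
  rewrite big_mkcond (bigD1_seq (x.1.1 + x.1.2)) ?undup_uniq ?mem_undup//=; last by apply/mapP; exists x.
  by rewrite eqxx big1 ?addr0// => k; rewrite eq_sym => /negPf ->.
have ES : tint t (fun s => \sum_(x <- r) (if x \in r then (mid_dcoef x s * mid_phase x s + mid_coef x s * cis (freq sg x * s)) * Z (x.1.1 + x.1.2) s +
      mid_coef x s * mid_phase x s * dZ (x.1.1 + x.1.2) s else 0)) = tint t S2 + tint t S1 + tint t S3.
  rewrite /tint -(CintD (mseg 0 t) i2 i1) -(CintD (mseg 0 t)) //; last exact: (cintD (mseg 0 t)).
  apply: eq_Cint => s _; rewrite S3E /S1 /S2 -!big_split/= big_seq [RHS]big_seq; apply: eq_bigr => x ->; ring.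
rewrite ES in E; rewrite E; ring.
Qed.

(** All terms but the last contain the size [y] of [Z] and the factor [kap L], which suits a
    Gronwall inequality. The last one keeps the derivative of [Z], to be replaced by its
    equation. *)
Lemma mid_bound : cmod (tint t (fun s => \sum_(x <- r) mid_coef x s * Z (x.1.1 + x.1.2) s * cis (freq sg x * s))) <=
  2^-1 * (kap L * (P * y t)) + 2^-1 * (kap L * (P * y 0)) +
  2^-1 * (kap L * (Dd * \int[mu]_(s in `[0, t]) (h s * y s))) +
  cmod (tint t (fun s => \sum_(k <- mid_freqs) mid_test k s * dZ k s)).
Proof.
rewrite mid_parts; apply: (le_trans (cmodB _ _)); apply: lerD; last by [].
apply: (le_trans (cmodB _ _)); apply: lerD.
  apply: (le_trans (cmodB _ _)); apply: lerD; apply: (le_trans (cmod_sum _ _ _)); apply: sum_mid_coefZ => //.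
  by rewrite lexx.
have i1 : rintegrable mu `[0, t] (fun s => h s * y s) by exact: (rint_itvS tT).
rewrite [leRHS](_ : _ = 2^-1 * (kap L * Dd) * \int[mu]_(s in `[0, t]) (h s * y s)); last by ring.
rewrite -RintegralZl//; apply: (cmod_Cint_le_bound (mseg 0 t)); first exact: cint_mid_dcoef.
  exact: (rintZ (mseg 0 t)).
move=> s; rewrite /= in_itv /= => /andP[s0 st]; apply: (le_trans (cmod_sum _ _ _)).
apply: le_trans (sum_mid_dcoefZ _) _; first by case/andP: tT => _ tT'; rewrite s0 (le_trans st).
by rewrite le_eqVlt; apply/orP; left; apply/eqP; ring.
Qed.

End Mid.

(** * The equation of the difference of two solutions *)

Section Difference.
Context {R : realType}.
Notation mu := (@lebesgue_measure R).
Notation fc := (@fourier_coef R).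
#[local] Hint Resolve mseg mtorus : core.

Lemma Rint_ae_le (t : R) (F B : R -> R) : rintegrable mu `[0, t] F -> rintegrable mu `[0, t] B ->
  (forall s, 0 <= F s) -> (forall s, 0 <= B s) ->
  {ae mu, forall s, 0 <= s <= t -> F s <= B s} ->
  \int[mu]_(s in `[0, t]) F s <= \int[mu]_(s in `[0, t]) B s.
Proof.
move=> iF iB F0 B0 FB; rewrite /Rintegral fine_le//; try exact: integrable_fin_num.
apply: ae_ge0_le_integral => //.
- by move=> s _; rewrite lee_fin.
- exact: (measurable_int _ iF).
- by move=> s _; rewrite lee_fin.
- exact: (measurable_int _ iB).
Qed.

Lemma cmod_tint_ae (t : R) (F : R -> R[i]) (B : R -> R) : cintegrable mu `[0, t] F -> rintegrable mu `[0, t] B ->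
  (forall s, 0 <= B s) -> {ae mu, forall s, 0 <= s <= t -> cmod (F s) <= B s} ->
  cmod (tint t F) <= \int[mu]_(s in `[0, t]) B s.
Proof.
move=> iF iB B0 FB; apply: (le_trans (cmod_Cint_le (mseg 0 t) iF)).
by apply: Rint_ae_le => //; [exact: (cint_cmod (mseg 0 t))|move=> s; exact: cmod_ge0].
Qed.

Lemma cmod_tint_sum3 (t e : R) (F1 F2 F3 : R -> R[i]) : cintegrable mu `[0, t] F1 -> cintegrable mu `[0, t] F2 ->
  cintegrable mu `[0, t] F3 -> cmod (tint t F1) <= e -> cmod (tint t F2) <= e -> cmod (tint t F3) <= e ->
  cintegrable mu `[0, t] (fun s => F1 s + F2 s + F3 s) /\ cmod (tint t (fun s => F1 s + F2 s + F3 s)) <= 3 * e.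
Proof.
move=> i1 i2 i3 e1 e2 e3.
have i12 : cintegrable mu `[0, t] (fun s => F1 s + F2 s) by exact: (cintD (mseg 0 t)).
split; first exact: (cintD (mseg 0 t)).
have -> : 3 * e = e + e + e by ring.
rewrite /tint (CintD (mseg 0 t) i12 i3) (CintD (mseg 0 t) i1 i2).
by apply: (le_trans (cmodD _ _)); apply: lerD e3; apply: (le_trans (cmodD _ _)); exact: lerD e1 e2.
Qed.

Variables (gamma T sg M : R) (h y : R -> R) (U b : R -> R -> R[i]) (a da bb db : int -> R -> R[i]) (Q : nat).
Definition state_diff s x := U s x - b s x.
Definition profile_diff k s := a k s - bb k s.
Definition dprofile_diff k s := da k s - db k s.
Definition nls_rhs (f : R -> R -> R[i]) k s := 'i%C * gamma%:C * sg%:C * (cis (sg * k%:~R ^+ 2 * s) *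
  (NR (f s) (f s) (f s) k - fc (f s) k * fc (f s) k * conjc (fc (f s) k))).
Hypotheses (T0 : 0 <= T) (sg1 : `|sg| = 1) (M0 : 0 <= M).
Hypotheses (FU : flow T sg M h U a da) (Fb : flow T sg M h b bb db) (Fz : flow T sg M h state_diff profile_diff dprofile_diff).
Hypotheses (daE : forall k s, da k s = nls_rhs U k s) (dbE : forall k s, db k s = nls_rhs b k s).
Hypotheses (hUU : forall s, nrm (fun x => U s x * conjc (U s x)) <= h s)
  (hbU : forall s, nrm (fun x => b s x * conjc (U s x)) <= h s)
  (hbb : forall s, nrm (fun x => b s x * b s x) <= h s).
Hypotheses (y0 : forall s, 0 <= y s) (iy : rintegrable mu `[0, T] y) (ihy : rintegrable mu `[0, T] (fun s => h s * y s)).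
Hypothesis ly : forall s, 0 <= s <= T -> l2b (fun k => lam Q k * cmod (profile_diff k s)) (y s).

Let c0 : R[i] := 'i%C * gamma%:C * sg%:C.

Lemma cmod_coupling : cmod c0 = `|gamma|.
Proof. by rewrite /c0 cmodM cmodM cmod_i mul1r !cmod_real sg1 mulr1. Qed.

Definition resonant_diff k s := fc (U s) k * fc (U s) k * conjc (fc (U s) k) - fc (b s) k * fc (b s) k * conjc (fc (b s) k).

Lemma dprofile_diffE k s : dprofile_diff k s = c0 * (cis (sg * k%:~R ^+ 2 * s) *
  (NR (state_diff s) (U s) (U s) k + NR (state_diff s) (b s) (U s) k + NR (b s) (b s) (state_diff s) k - resonant_diff k s)).
Proof.
rewrite /dprofile_diff daE dbE /nls_rhs -/c0 -(NR_diff k (flow_qi FU s) (flow_qi Fb s)) /resonant_diff; ring.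
Qed.

Lemma h_ge0 s : 0 <= h s. Proof. by apply: le_trans (hUU s); exact: nrm_ge0. Qed.

Lemma profile_diff_ae : {ae mu, forall s, 0 <= s <= T -> forall k, cmod (fc (state_diff s) k) = cmod (profile_diff k s)}.
Proof.
apply: filterS (flow_ae Fz); first exact: (ae_filter_ringOfSetsType mu).
by move=> s H sT k; rewrite (H sT) cmodM cmod_cis mul1r.
Qed.

Lemma cmod_resonant_diff k s : cmod (resonant_diff k s) <= 3 * M ^+ 2 * cmod (fc (state_diff s) k).
Proof.
have qs := qi_sqi (flow_qi FU s); have qb := qi_sqi (flow_qi Fb s).
rewrite /state_diff fc_sub//; apply: cub_diff.
  exact: (cmod_fc_le_l2 M0 k (flow_fc FU s)).
exact: (cmod_fc_le_l2 M0 k (flow_fc Fb s)).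
Qed.

Variable t : R.
Hypothesis tT : 0 <= t <= T.

Section TestBound.
Variables (N : nat) (X1 : R) (gx : R -> R) (X dX : int -> R -> R[i]) (J : seq int).
Hypotheses (N0 : (0 < N)%N) (X0 : 0 <= X1) (uJ : uniq J).
Hypotheses (aX : forall k, cAC T (X k) (dX k)) (lX : forall s, 0 <= s <= T -> l2b (fun k => cmod (X k s)) X1)
  (sX : forall s, 0 <= s <= T -> \sum_(k <- J) cmod (X k s) <= X1)
  (bX : forall k s, 0 <= s <= T -> cmod (dX k s) <= gx s) (igx : rintegrable mu `[0, T] gx).

Let x k s := (lam Q k)%:C * X k s.
Let dx k s := (lam Q k)%:C * dX k s.
Let ax k : cAC T (x k) (dx k). Proof. exact: cAC_scale. Qed.
Let lam_cmod (k : int) (u : R[i]) : cmod ((lam Q k)%:C * u) = lam Q k * cmod u.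
Proof. by rewrite cmodM cmod_real ger0_norm ?lam_ge0. Qed.
Let lx s : 0 <= s <= T -> l2b (fun k => cmod (x k s)) X1.
Proof.
move=> sT; apply: (l2b_mono _ X0 (lexx _) (lX sT)) => k; rewrite cmod_ge0/= lam_cmod.
by rewrite ler_piMl ?cmod_ge0 ?lam_le1.
Qed.
Let bx k s : 0 <= s <= T -> cmod (dx k s) <= gx s.
Proof.
move=> sT; apply: le_trans (bX k sT); rewrite lam_cmod.
by rewrite ler_piMl ?cmod_ge0 ?lam_le1.
Qed.

Let E1 (f g w : R -> R -> R[i]) j s := NR (f s) (g s) (w s) j - NRp (zwin N) (f s) (g s) (w s) j.
Let E3 (f g w : R -> R -> R[i]) j s := NR (f s) (g s) (w s) j - NR3p (win3 N j) (f s) (g s) (w s) j.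
Let S (E : int -> R -> R[i]) s := \sum_(j <- J) x j s * cis (sg * j%:~R ^+ 2 * s) * E j s.
Let near j s := NRp (zwin N) (state_diff s) (U s) (U s) j + NRp (zwin N) (state_diff s) (b s) (U s) j + NR3p (win3 N j) (b s) (b s) (state_diff s) j.
Let err := far_err X1 M N gx h t.
Let d : R := N.*2%:R / Q%:R.

Let near_bound s k : l2b (fun k => lam Q k * cmod (fc (state_diff s) k)) (y s) ->
  lam Q k * cmod (near k s - resonant_diff k s) <= (y s + d * M) * (3 * h s + 4 * M ^+ 2) + 3 * M ^+ 2 * y s.
Proof.
move=> L.
have qU := flow_qi FU s; have qb := flow_qi Fb s; have qz := flow_qi Fz s.
have lU := flow_fc FU s; have lb := flow_fc Fb s; have lz := flow_fc Fz s.
have b1 := NRp_weighted N M0 (y0 s) qU qU lz lU lU L k.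
have b2 := NRp_weighted N M0 (y0 s) qb qU lz lb lU L k.
have b3 := NR3p_weighted N k M0 (y0 s) qb qb qz lb lb lz L.
have dd : N%:R / Q%:R <= d :> R by rewrite ler_wpM2r ?invr_ge0// ler_nat -addnn leq_addr.
have H1 (v : R) : v <= h s -> (y s + N%:R / Q%:R * M) * (v + M ^+ 2) <= (y s + d * M) * (h s + M ^+ 2).
  move=> vh; have hs := h_ge0 s; have ys := y0 s.
  apply: (@le_trans _ _ ((y s + N%:R / Q%:R * M) * (h s + M ^+ 2))).
    by rewrite ler_wpM2l ?lerD2r// addr_ge0// mulr_ge0// divr_ge0.
  by rewrite ler_wpM2r ?addr_ge0 ?exprn_ge0// lerD2l ler_wpM2r.
have {}b1 := le_trans b1 (H1 _ (hUU s)).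
have {}b2 := le_trans b2 (H1 _ (hbU s)).
have {}b3 : lam Q k * cmod (NR3p (win3 N k) (b s) (b s) (state_diff s) k) <= (y s + d * M) * (h s + 2 * M ^+ 2).
  apply: (le_trans b3); rewrite ler_wpM2l ?lerD2r// addr_ge0// mulr_ge0// divr_ge0//.
have b4 : lam Q k * cmod (resonant_diff k s) <= 3 * M ^+ 2 * y s.
  apply: (@le_trans _ _ (lam Q k * (3 * M ^+ 2 * cmod (fc (state_diff s) k)))).
    by rewrite ler_wpM2l ?lam_ge0// cmod_resonant_diff.
  rewrite mulrCA ler_wpM2l ?mulr_ge0 ?exprn_ge0//.
  have := l2b_le k L (y0 s); rewrite ger0_norm// mulr_ge0 ?lam_ge0 ?cmod_ge0//.
apply: (@le_trans _ _ (lam Q k * (cmod (NRp (zwin N) (state_diff s) (U s) (U s) k) + cmod (NRp (zwin N) (state_diff s) (b s) (U s) k) +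
   cmod (NR3p (win3 N k) (b s) (b s) (state_diff s) k) + cmod (resonant_diff k s)))).
  rewrite ler_wpM2l ?lam_ge0//; apply: (le_trans (cmodB _ _)); rewrite lerD2r.
  apply: (le_trans (cmodD _ _)); rewrite lerD2r; exact: cmodD.
rewrite !mulrDr in b1 b2 b3 *.
apply: le_trans (lerD (lerD (lerD b1 b2) b3) b4) _.
by rewrite le_eqVlt; apply/orP; left; apply/eqP; ring.
Qed.

(** Near interactions are bounded uniformly in k by y and h y, up to N / Q, and paired with a test
    sequence in l^1; far ones only give [err], without a factor y but with the small factor
    [kap N]. *)
Lemma test_bound : cmod (tint t (fun s => \sum_(k <- J) X k s * ((lam Q k)%:C * dprofile_diff k s))) <=
  `|gamma| * (3 * err + X1 * \int[mu]_(s in `[0, t]) ((y s + d * M) * (3 * h s + 4 * M ^+ 2) + 3 * M ^+ 2 * y s)).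
Proof.
have [i1 e1] : cintegrable mu `[0, t] (S (E1 state_diff U U)) /\ cmod (tint t (S (E1 state_diff U U))) <= err := far1 T0 sg1 X0 M0 N0 Fz FU FU ax lx bx igx uJ tT.
have [i2 e2] : cintegrable mu `[0, t] (S (E1 state_diff b U)) /\ cmod (tint t (S (E1 state_diff b U))) <= err := far1 T0 sg1 X0 M0 N0 Fz Fb FU ax lx bx igx uJ tT.
have [i3 e3] : cintegrable mu `[0, t] (S (E3 b b state_diff)) /\ cmod (tint t (S (E3 b b state_diff))) <= err := far3 T0 sg1 X0 M0 N0 Fb Fb Fz ax lx bx igx uJ tT.
pose F s := \sum_(k <- J) X k s * ((lam Q k)%:C * dprofile_diff k s).
have iF : cintegrable mu `[0, t] F.
  apply: (cint_itvS tT); apply: (cint_sum (mseg 0 T)) => k; apply: (cAC_intM T0 (aX k)).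
  by apply: (cintZ (mseg 0 T)); exact: (cAC_cint (flow_ac Fz k)).
pose FF s := S (E1 state_diff U U) s + S (E1 state_diff b U) s + S (E3 b b state_diff) s.
pose G s := F s - c0 * FF s.
have [iFF eFF] : cintegrable mu `[0, t] FF /\ cmod (tint t FF) <= 3 * err := cmod_tint_sum3 i1 i2 i3 e1 e2 e3.
have iG : cintegrable mu `[0, t] G by apply: (cintB (mseg 0 t)) => //; exact: (cintZ (mseg 0 t)).
have GE s : G s = c0 * S (fun k s => near k s - resonant_diff k s) s.
  rewrite /G /F /FF /S -!big_split/= !mulr_sumr -sumrB; apply: eq_bigr => k _.
  rewrite dprofile_diffE /E1 /E3 /near /x; ring.
have eF : tint t F = tint t G + c0 * tint t FF.
  rewrite /tint -(CintZ (mseg 0 t) c0 iFF) -(CintD (mseg 0 t)) //; last exact: (cintZ (mseg 0 t)).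
  by apply: eq_Cint => s _; rewrite /G; ring.
pose B s := (y s + d * M) * (3 * h s + 4 * M ^+ 2) + 3 * M ^+ 2 * y s.
have B0 s : 0 <= B s.
  have := h_ge0 s; have := y0 s => ys hs.
  by rewrite addr_ge0 ?mulr_ge0 ?addr_ge0 ?mulr_ge0 ?exprn_ge0 ?divr_ge0.
have iB : rintegrable mu `[0, t] B.
  apply: (rint_itvS tT).
  rewrite (_ : B = fun s => (3 * (h s * y s) + 7 * M ^+ 2 * y s) + (3 * d * M * h s + d * M * (4 * M ^+ 2))).
    apply: (rintD (mseg 0 T)); apply: (rintD (mseg 0 T)); try exact: (rintZ (mseg 0 T)).
      by apply: (rintZ (mseg 0 T)); exact: flow_h FU.
    exact: rint_cst_seg.
  by apply/funext => s; rewrite /B; ring.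
rewrite -/F eF; apply: (le_trans (cmodD _ _)); rewrite mulrDr addrC; apply: lerD.
  by rewrite cmodM cmod_coupling ler_wpM2l.
rewrite mulrA -RintegralZl//.
apply: (cmod_tint_ae iG).
- exact: (rintZ (mseg 0 t)).
- by move=> s; apply: mulr_ge0; [exact: mulr_ge0|exact: (B0 s)].
apply: filterS profile_diff_ae; first exact: (ae_filter_ringOfSetsType mu).
move=> s zs /andP[s0 st].
have sT : 0 <= s <= T by rewrite s0 (le_trans st)//; case/andP: tT.
rewrite GE [cmod (c0 * _)]cmodM cmod_coupling -[leRHS]mulrA; apply: ler_wpM2l; first by [].
apply: (le_trans (cmod_sum _ _ _)).
apply: (@le_trans _ _ (\sum_(k <- J) cmod (X k s) * B s)); last first.
  by rewrite -mulr_suml ler_wpM2r// sX.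
apply: ler_sum => k _; rewrite cmodM cmodM cmod_cis mulr1 /x lam_cmod.
rewrite [lam Q k * _]mulrC -mulrA ler_wpM2l ?cmod_ge0//.
apply: near_bound => I uI; rewrite (eq_bigr (fun k => (lam Q k * cmod (profile_diff k s)) ^+ 2)); last by move=> j _; rewrite zs.
exact: ly.
Qed.

End TestBound.

End Difference.

(** * Interactions with the difference in one slot *)

Section SlotBound.
Context {R : realType}.
Notation mu := (@lebesgue_measure R).
Notation fc := (@fourier_coef R).
#[local] Hint Resolve mseg mtorus : core.

Lemma count_mid (N : nat) (r : seq (int * int * int)) (k : int) : uniq r ->
  (forall x, x \in r -> (`|x.1.2| <= N)%N && (`|x.2| <= N)%N) ->
  (count (fun x : int * int * int => (x.1.1 + x.1.2 == k)%R) r <= size (zwin N) * size (zwin N))%N.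
Proof.
move=> ur rN; have := mem_zwin N; move: (zwin N) => w wP; rewrite -size_filter -(size_allpairs pair) -(size_map (fun x : int * int * int => (x.1.2, x.2))).
apply: uniq_leq_size.
  rewrite map_inj_in_uniq ?filter_uniq// => [[[p l] m]] [[p' l'] m'].
  rewrite !mem_filter /= => /andP[/eqP e _] /andP[/eqP e' _] [el em]; move: e; rewrite -e' el em => /addIr ->//.
move=> [l m] /mapP[[[p l'] m']]; rewrite mem_filter /= => /andP[_ /rN /= /andP[h1 h2]] [-> ->].
by apply: allpairs_f; rewrite wP.
Qed.

(** For fixed l and m two factors are taken in l^inf and two in l^2; the number of pairs (l, m) is
    the price. *)
Lemma sum_square_le (L : nat) (r : seq (int * int * int)) (A B C Z : int -> R) (a b c z : R) : uniq r ->
  (forall x, x \in r -> (`|x.1.2| <= L)%N && (`|x.2| <= L)%N) ->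
  (forall p, 0 <= A p) -> (forall p, 0 <= B p) -> (forall p, 0 <= C p) -> (forall p, 0 <= Z p) ->
  0 <= a -> 0 <= b -> 0 <= c -> 0 <= z -> l2b A a -> l2b B b -> l2b C c -> l2b Z z ->
  \sum_(x <- r) A x.1.1 * B (x.1.1 + x.2) * C (x.1.1 + x.1.2 + x.2) * Z (x.1.1 + x.1.2)
    <= (size (zwin L) * size (zwin L))%:R * (a * b * c * z).
Proof.
move=> ur rL A0 B0 C0 Z0 a0 b0 c0 z0 lA lB lC lZ.
pose I := undup [seq x.1.1 | x <- r].
pose G (q : int * int) := \sum_(p <- I) A p * B (p + q.2) * C (p + q.1 + q.2) * Z (p + q.1).
have G0 p l m : 0 <= A p * B (p + m) * C (p + l + m) * Z (p + l) by rewrite !mulr_ge0.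
have A1 p : A p <= a by have := l2b_le p lA a0; rewrite ger0_norm.
have B1 p : B p <= b by have := l2b_le p lB b0; rewrite ger0_norm.
have GB q : G q <= a * b * c * z.
  apply: (@le_trans _ _ (\sum_(p <- I) a * b * (C (p + (q.1 + q.2)) * Z (p + q.1)))).
    apply: ler_sum => p _; rewrite -[leLHS]mulrA addrA ler_pM ?mulr_ge0// ler_pM//.
  rewrite -mulr_sumr -[leRHS]mulrA; apply: ler_wpM2l; first exact: mulr_ge0.
  apply: l2_CS => //; try exact: addIr.
  exact: undup_uniq.
apply: (@le_trans _ _ (\sum_(q <- [seq (l, m) | l <- zwin L, m <- zwin L]) G q)); last first.
  apply: (@le_trans _ _ (\sum_(q <- [seq (l, m) | l <- zwin L, m <- zwin L]) (a * b * c * z))).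
    by apply: ler_sum.
  by rewrite big_const_seq count_predT size_allpairs iter_addr_0 [leRHS]mulr_natl.
rewrite /G exchange_big/=.
rewrite (_ : \sum_(p <- I) _ = \sum_(w <- [seq (p, q) | p <- I, q <- [seq (l, m) | l <- zwin L, m <- zwin L]])
   A w.1 * B (w.1 + w.2.2) * C (w.1 + w.2.1 + w.2.2) * Z (w.1 + w.2.1)); last first.
  by rewrite big_allpairs_dep.
rewrite (_ : \sum_(x <- r) _ = \sum_(w <- [seq (x.1.1, (x.1.2, x.2)) | x <- r])
   A w.1 * B (w.1 + w.2.2) * C (w.1 + w.2.1 + w.2.2) * Z (w.1 + w.2.1)); last by rewrite big_map.
apply: ler_sum_sub.
- by rewrite map_inj_uniq// => [[[p l] m]] [[p' l'] m'] [-> -> ->].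
- move=> w /mapP[x xr ->]; have /andP[h1 h2] := rL x xr; apply: allpairs_f; first by rewrite mem_undup; exact: (map_f (fun x => x.1.1) xr).
  by apply: allpairs_f; rewrite mem_zwin.
- by move=> w; exact: G0.
Qed.

Variables (gamma T sg M : R) (h y : R -> R) (U b : R -> R -> R[i]) (a da bb db : int -> R -> R[i]) (Q : nat).
Notation profile_diff := (profile_diff a bb).
Notation dprofile_diff := (dprofile_diff da db).
Notation state_diff := (state_diff U b).
Hypotheses (T0 : 0 <= T) (sg1 : `|sg| = 1) (M0 : 0 <= M).
Hypotheses (FU : flow T sg M h U a da) (Fb : flow T sg M h b bb db) (Fz : flow T sg M h state_diff profile_diff dprofile_diff).
Hypotheses (daE : forall k s, da k s = nls_rhs gamma sg U k s) (dbE : forall k s, db k s = nls_rhs gamma sg b k s).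
Hypotheses (hUU : forall s, nrm (fun x => U s x * conjc (U s x)) <= h s)
  (hbU : forall s, nrm (fun x => b s x * conjc (U s x)) <= h s)
  (hbb : forall s, nrm (fun x => b s x * b s x) <= h s).
Hypotheses (y0 : forall s, 0 <= y s) (iy : rintegrable mu `[0, T] y) (ihy : rintegrable mu `[0, T] (fun s => h s * y s)).
Hypothesis ly : forall s, 0 <= s <= T -> l2b (fun k => lam Q k * cmod (profile_diff k s)) (y s).
Variable t : R.
Hypothesis tT : 0 <= t <= T.
Variables (L N N' : nat).
Hypotheses (L0 : (0 < L)%N) (N0' : (0 < N')%N).

Let h0 s : 0 <= h s. Proof. by apply: le_trans (hUU s); exact: nrm_ge0. Qed.

Definition weighted_diff k s := (lam Q k)%:C * profile_diff k s.

Notation W N := (size (zwin N) * size (zwin N))%N.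
Let X1 := 2^-1 * (kap L * M ^+ 2).
Let gx s := (W N)%:R * (h s * (2 * M) + M ^+ 2).
(** The first term counts the gaps up to L. For the larger ones follow the boundary terms, the
    derivative of the known factors, and the equation of the difference tested against [mid_test]
    and truncated at N'. *)
Definition slot_err := (W L)%:R * M ^+ 2 * \int[mu]_(s in `[0, t]) y s +
  (2^-1 * (kap L * (M ^+ 2 * y t)) + 2^-1 * (kap L * (M ^+ 2 * y 0)) +
   2^-1 * (kap L * (2 * M * \int[mu]_(s in `[0, t]) (h s * y s))) +
   `|gamma| * (3 * far_err X1 M N' gx h t + X1 * \int[mu]_(s in `[0, t])
      ((y s + N'.*2%:R / Q%:R * M) * (3 * h s + 4 * M ^+ 2) + 3 * M ^+ 2 * y s))).

Variables (r : seq (int * int * int)) (A dA B dB C dC : int -> R -> R[i]) (MA MB MC cA cB cC : R).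
Hypotheses (MA0 : 0 <= MA) (MB0 : 0 <= MB) (MC0 : 0 <= MC) (cA0 : 0 <= cA) (cB0 : 0 <= cB) (cC0 : 0 <= cC).
Hypotheses (aA : forall k, cAC T (A k) (dA k)) (aB : forall k, cAC T (B k) (dB k))
  (aC : forall k, cAC T (C k) (dC k)).
Hypotheses (lA : forall s, 0 <= s <= T -> l2b (fun k => cmod (A k s)) MA)
  (lB : forall s, 0 <= s <= T -> l2b (fun k => cmod (B k s)) MB)
  (lC : forall s, 0 <= s <= T -> l2b (fun k => cmod (C k s)) MC).
Hypotheses (bA : forall k s, 0 <= s <= T -> cmod (dA k s) <= cA * h s)
  (bB : forall k s, 0 <= s <= T -> cmod (dB k s) <= cB * h s)
  (bC : forall k s, 0 <= s <= T -> cmod (dC k s) <= cC * h s).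
Hypotheses (PE : MA * MB * MC = M ^+ 2) (DE : cA * MB * MC + cB * MA * MC + cC * MA * MB = 2 * M).
Hypotheses (ur : uniq r) (rN : forall x, x \in r -> (`|x.1.2| <= N)%N && (`|x.2| <= N)%N).
Hypothesis r0 : forall x, x \in r -> (x.1.2 != 0) && (x.2 != 0).

Let summand x s := mid_coef A B C x s * weighted_diff (x.1.1 + x.1.2) s * cis (freq sg x * s).

Let aZ k : cAC T (weighted_diff k) (fun s => (lam Q k)%:C * dprofile_diff k s).
Proof. by apply: cAC_scale => //; exact: flow_ac Fz k. Qed.

Let cmod_weighted_diff k s : cmod (weighted_diff k s) = lam Q k * cmod (profile_diff k s).
Proof. by rewrite /weighted_diff cmodM cmod_real ger0_norm ?lam_ge0. Qed.

Let lZ s : 0 <= s <= T -> l2b (fun k => cmod (weighted_diff k s)) (y s).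
Proof. by move=> sT I uI; rewrite (eq_bigr _ (fun k _ => congr1 (fun v => v ^+ 2) (cmod_weighted_diff k s))); exact: ly. Qed.

Lemma slot_int x : cintegrable mu `[0, t] (summand x).
Proof.
apply: (cint_itvS tT); apply: (cAC_int T0 (df := _)).
apply: (cAC_mul T0); last exact: cAC_cis.
by apply: (cAC_mul T0) => //; exact: mid_coef_AC.
Qed.

(** The hypotheses on the products of constants describe the intended use: of [A], [B], [C], two are
    solutions, of norm M and with derivative bounded by h, and one is a test sequence of norm 1,
    constant in time. *)
Lemma slot_bound : cmod (tint t (fun s => \sum_(x <- r) summand x s)) <= slot_err.
Proof.
pose r1 := [seq x <- r | ~~ offaxis L x]; pose r2 := [seq x <- r | offaxis L x].
have u1 : uniq r1 by rewrite filter_uniq.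
have u2 : uniq r2 by rewrite filter_uniq.
have r1P x : x \in r1 -> (`|x.1.2| <= L)%N && (`|x.2| <= L)%N.
  rewrite mem_filter /offaxis => /andP[H /r0 /andP[l0 m0]]; move: H; rewrite l0 m0 /= negb_or -!ltnNge.
  by move=> /andP[/ltnW -> /ltnW ->].
have r2P x : x \in r2 -> offaxis L x by rewrite mem_filter => /andP[].
have i1 : cintegrable mu `[0, t] (fun s => \sum_(x <- r1) summand x s) by apply: (cint_sum (mseg 0 t)); exact: slot_int.
have i2 : cintegrable mu `[0, t] (fun s => \sum_(x <- r2) summand x s) by apply: (cint_sum (mseg 0 t)); exact: slot_int.
have -> : tint t (fun s => \sum_(x <- r) summand x s) = tint t (fun s => \sum_(x <- r1) summand x s) + tint t (fun s => \sum_(x <- r2) summand x s).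
  rewrite /tint -(CintD (mseg 0 t) i1 i2); apply: eq_Cint => s _.
  by rewrite (bigID (offaxis L))/= addrC !big_filter.
apply: (le_trans (cmodD _ _)); apply: lerD.
  rewrite -RintegralZl//; last exact: (rint_itvS tT).
  apply: (cmod_Cint_le_bound (mseg 0 t)) => //; first by apply: (rintZ (mseg 0 t)); exact: (rint_itvS tT).
  move=> s sI; have /andP[s0 st] : 0 <= s <= t by move: sI; rewrite /= in_itv.
  have sT : 0 <= s <= T by rewrite s0 (le_trans st)//; case/andP: tT.
  apply: (le_trans (cmod_sum _ _ _)).
  have Hs := @sum_square_le L r1 (fun k => cmod (A k s)) (fun k => cmod (B k s)) (fun k => cmod (C k s)) (fun k => cmod (weighted_diff k s))
    MA MB MC (y s) u1 r1P (fun _ => cmod_ge0 _) (fun _ => cmod_ge0 _) (fun _ => cmod_ge0 _) (fun _ => cmod_ge0 _)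
    MA0 MB0 MC0 (y0 s) (lA sT) (lB sT) (lC sT) (lZ sT).
  rewrite -mulrA -PE; apply: le_trans Hs.
  by apply: ler_sum => x _; rewrite /summand /mid_coef !cmodM cmod_cis mulr1.
have := mid_bound T0 sg1 L0 MA0 MB0 MC0 cA0 cB0 cC0 aA aB aC aZ lA lB lC lZ y0 h0 bA bB bC ihy u2 r2P tT.
rewrite PE DE => H; apply: (le_trans H); rewrite lerD2l.
have X0 : 0 <= X1 by rewrite mulr_ge0 ?mulr_ge0 ?kap_ge0 ?exprn_ge0.
apply: (test_bound T0 sg1 M0 FU Fb Fz daE dbE hUU hbU hbb y0 iy ihy ly tT N0' X0 (J := mid_freqs r2) (gx := gx)
  (X := mid_test sg r2 A B C) (dX := mid_dtest sg r2 A dA B dB C dC)).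
- exact: undup_uniq.
- exact: (mid_test_AC T0 sg1 aA aB aC r2P).
- move=> s sT; rewrite /X1 -PE; apply: (mid_test_l2 sg1 L0 MA0 MB0 MC0 lA lB lC u2 r2P sT).
- move=> s sT; rewrite /X1 -PE; exact: (mid_test_l1 sg1 L0 MA0 MB0 MC0 lA lB lC u2 r2P (undup_uniq _) sT).
- move=> k s sT.
  apply: (le_trans (mid_dtest_bound sg1 MA0 MB0 MC0 cA0 cB0 cC0 lA lB lC h0 bA bB bC r2P k sT)).
  rewrite PE DE /gx; apply: ler_wpM2r; first by rewrite addr_ge0 ?mulr_ge0 ?exprn_ge0.
  rewrite ler_nat; apply: count_mid => // x; rewrite mem_filter => /andP[_ /rN] //.
- apply: (rintZ (mseg 0 T)); apply: (rintD (mseg 0 T)); last exact: rint_cst_seg.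
  rewrite (_ : (fun s => _) = fun s => (2 * M) * h s); last by apply/funext => s; rewrite mulrC.
  by apply: (rintZ (mseg 0 T)); exact: flow_h FU.
Qed.

End SlotBound.

(** * The weighted difference by duality *)

Section DiffBound.
Context {R : realType}.
Notation mu := (@lebesgue_measure R).
Notation fc := (@fourier_coef R).
#[local] Hint Resolve mseg mtorus : core.

Definition sqtri (N : nat) (J : seq int) : seq (int * int * int) :=
  [seq (p, l) | p <- [seq (j, m) | j <- J, m <- [seq m <- zwin N | m != 0]], l <- [seq l <- zwin N | l != 0]].

Lemma sqtri_uniq N J : uniq J -> uniq (sqtri N J).
Proof.
move=> uJ; have uz : uniq [seq m <- zwin N | m != 0] by rewrite filter_uniq ?uniq_zwin.
by apply: allpairs_uniq => //; [apply: allpairs_uniq => // [[? ?]] [? ?] _ _ [-> ->]|move=> [? ?] [? ?] _ _ [-> ->]].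
Qed.

Lemma mem_sqtri N J q : q \in sqtri N J ->
  [&& q.1.2 != 0, q.2 != 0, (`|q.1.2| <= N)%N & (`|q.2| <= N)%N].
Proof.
move=> /allpairsP[[p l] [pP lz ->]].
move: pP => /allpairsP[[j m] [_ mz ->]].
move: mz lz; rewrite !mem_filter !mem_zwin => /andP[H1 H2] /andP[H3 H4]; apply/and4P; split; [exact: H1|exact: H3|exact: H2|exact: H4].
Qed.

Lemma sum_sqtri N J (F : int -> int -> int -> R[i]) : \sum_(q <- sqtri N J) F q.1.1 q.1.2 q.2 =
  \sum_(j <- J) \sum_(m <- zwin N | m != 0) \sum_(l <- zwin N | l != 0) F j m l.
Proof.
rewrite /sqtri big_allpairs_dep big_allpairs_dep; apply: eq_bigr => j _; rewrite big_filter; apply: eq_bigr => m _.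
by rewrite big_filter.
Qed.

Variables (gamma T sg M : R) (h y : R -> R) (U b : R -> R -> R[i]) (a da bb db : int -> R -> R[i]) (Q : nat).
Notation profile_diff := (profile_diff a bb).
Notation dprofile_diff := (dprofile_diff da db).
Notation state_diff := (state_diff U b).
Hypotheses (T0 : 0 <= T) (sg1 : `|sg| = 1) (M0 : 0 <= M) (Q0 : (0 < Q)%N).
Hypotheses (FU : flow T sg M h U a da) (Fb : flow T sg M h b bb db) (Fz : flow T sg M h state_diff profile_diff dprofile_diff).
Hypotheses (daE : forall k s, da k s = nls_rhs gamma sg U k s) (dbE : forall k s, db k s = nls_rhs gamma sg b k s).
Hypotheses (hUU : forall s, nrm (fun x => U s x * conjc (U s x)) <= h s)
  (hbU : forall s, nrm (fun x => b s x * conjc (U s x)) <= h s)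
  (hbb : forall s, nrm (fun x => b s x * b s x) <= h s).
Hypotheses (y0 : forall s, 0 <= y s) (iy : rintegrable mu `[0, T] y) (ihy : rintegrable mu `[0, T] (fun s => h s * y s)).
Hypothesis ly : forall s, 0 <= s <= T -> l2b (fun k => lam Q k * cmod (profile_diff k s)) (y s).
Variable t : R.
Hypothesis tT : 0 <= t <= T.
Variables (L N N' : nat).
Hypotheses (L0 : (0 < L)%N) (N0 : (0 < N)%N) (N0' : (0 < N')%N).
Variable c : int -> R[i].
Hypothesis lc : l2b (fun k => cmod (c k)) 1.

Notation W := (size (zwin N) * size (zwin N))%N.
Let h0 s : 0 <= h s. Proof. by apply: le_trans (hUU s); exact: nrm_ge0. Qed.
Let c0 : R[i] := 'i%C * gamma%:C * sg%:C.
Let d : R := N.*2%:R / Q%:R.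
Let J := zwin Q.
Let x (j : int) : R[i] := (lam Q j)%:C * c j.
Let ph (q : int * int * int) s : R[i] := cis (freq sg (q.1.1 - q.1.2 - q.2, q.2, q.1.2) * s).
Let t1 (q : int * int * int) s := profile_diff (q.1.1 - q.1.2) s * a (q.1.1 - q.2) s * conjc (a (q.1.1 - q.1.2 - q.2) s).
Let t2 (q : int * int * int) s := bb (q.1.1 - q.1.2) s * profile_diff (q.1.1 - q.2) s * conjc (a (q.1.1 - q.1.2 - q.2) s).
Let t3 (q : int * int * int) s := bb (q.1.1 - q.1.2) s * bb (q.1.1 - q.2) s * conjc (profile_diff (q.1.1 - q.1.2 - q.2) s).
Let w1 (q : int * int * int) : R := lam Q (q.1.1 - q.1.2).
Let w2 (q : int * int * int) : R := lam Q (q.1.1 - q.2).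
Let w3 (q : int * int * int) : R := lam Q (q.1.1 - q.1.2 - q.2).
Let main (w : int * int * int -> R) (tt : int * int * int -> R -> R[i]) (q : int * int * int) s : R[i] :=
  (w q)%:C * (c q.1.1 * tt q s * ph q s).
Let tri := sqtri N J.
Let cst (z : int -> R[i]) (k : int) (s : R) := z k.

(** The phases are attached by [vert_phase]; the product of three modes is then telescoped, passing
    from [a] to [bb] one slot at a time. *)
Lemma sq_profile s : (forall k, a k s = cis (sg * k%:~R ^+ 2 * s) * fc (U s) k) ->
  (forall k, bb k s = cis (sg * k%:~R ^+ 2 * s) * fc (b s) k) ->
  \sum_(j <- J) x j * cis (sg * j%:~R ^+ 2 * s) * (NRsq N (U s) (U s) (U s) j - NRsq N (b s) (b s) (b s) j) =
  \sum_(q <- tri) x q.1.1 * (t1 q s + t2 q s + t3 q s) * ph q s.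
Proof.
move=> aE bE.
rewrite (@sum_sqtri N J (fun j m l => x j * (t1 (j, m, l) s + t2 (j, m, l) s + t3 (j, m, l) s) * ph (j, m, l) s)).
apply: eq_bigr => j _; rewrite /NRsq -sumrB mulr_sumr; apply: eq_bigr => m _.
rewrite -sumrB mulr_sumr; apply: eq_bigr => l _.
have P1 := @vert_phase R sg (cst x) U U U a a a (j - m - l, l, m) s (aE _) (aE _) (aE _).
have P2 := @vert_phase R sg (cst x) b b b bb bb bb (j - m - l, l, m) s (bE _) (bE _) (bE _).
have e1 : j - m - l + l = j - m by ring.
have e2 : j - m - l + m = j - l by ring.
have e3 : j - m - l + l + m = j by ring.
rewrite /quartic /vert /cst /= e3 e1 e2 in P1 P2.
rewrite mulrBr -P1 -P2 /t1 /t2 /t3 /ph /profile_diff /= !cJB; ring.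
Qed.

(** Three labellings of the same parallelogram, which bring the frequency of the difference, j - m,
    j - l or j - m - l, to the position p + l reserved for it. *)
Let r1 := [seq (q.1.1 - q.1.2 - q.2, q.2, q.1.2) | q <- tri].
Let r2 := [seq (q.1.1 - q.1.2 - q.2, q.1.2, q.2) | q <- tri].
Let r3 := [seq (q.1.1 - q.1.2, - q.2, q.1.2) | q <- tri].
Let cj (A : int -> R -> R[i]) k s := conjc (A k s).

Let main1E s : \sum_(q <- tri) main w1 t1 q s = \sum_(v <- r1) mid_coef (cj a) a (cst c) v s * weighted_diff a bb Q (v.1.1 + v.1.2) s * cis (freq sg v * s).
Proof.
rewrite big_map; apply: eq_bigr => [[[j m] l]] _; rewrite /main /mid_coef /t1 /w1 /weighted_diff /ph /cst /cj /=.
rewrite (_ : j - m - l + l + m = j); last by ring.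
rewrite (_ : j - m - l + l = j - m); last by ring.
rewrite (_ : j - m - l + m = j - l); last by ring.
ring.
Qed.

Let main2E s : \sum_(q <- tri) main w2 t2 q s = \sum_(v <- r2) mid_coef (cj a) bb (cst c) v s * weighted_diff a bb Q (v.1.1 + v.1.2) s * cis (freq sg v * s).
Proof.
rewrite big_map; apply: eq_bigr => [[[j m] l]] _; rewrite /main /mid_coef /t2 /w2 /weighted_diff /ph /cst /cj /freq /=.
rewrite (_ : j - m - l + m + l = j); last by ring.
rewrite (_ : j - m - l + l = j - m); last by ring.
rewrite (_ : j - m - l + m = j - l); last by ring.
rewrite [m%:~R * l%:~R]mulrC; ring.
Qed.

(** In the third slot the difference is conjugated. Conjugating the whole sum restores it, and the
    sign of l in [r3] compensates the reversal of the phase. *)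
Let main3E s : \sum_(q <- tri) main w3 t3 q s =
  conjc (\sum_(v <- r3) mid_coef (cj bb) (cst (fun k => conjc (c k))) (cj bb) v s * weighted_diff a bb Q (v.1.1 + v.1.2) s * cis (freq sg v * s)).
Proof.
rewrite cJ_sum big_map; apply: eq_bigr => [[[j m] l]] _; rewrite /main /mid_coef /t3 /w3 /weighted_diff /ph /cst /cj /freq /=.
rewrite (_ : j - m - l + m = j - l); last by ring.
rewrite (_ : j - m + m = j); last by ring.
rewrite !cJM -cisN !conjcK.
rewrite (_ : - (2 * sg * ((- l)%:~R * m%:~R) * s) = 2 * sg * (l%:~R * m%:~R) * s); last by rewrite intrN; ring.
rewrite (_ : conjc ((lam Q (j - m - l))%:C) = (lam Q (j - m - l))%:C :> R[i]); last by rewrite /= /conjc/= oppr0.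
ring.
Qed.

Let lU s : 0 <= s <= T -> l2b (fun k => cmod (a k s)) M := @flow_l2 _ _ _ _ _ _ _ _ FU s.
Let lb s : 0 <= s <= T -> l2b (fun k => cmod (bb k s)) M := @flow_l2 _ _ _ _ _ _ _ _ Fb s.
Let lz s : 0 <= s <= T -> l2b (fun k => cmod (profile_diff k s)) M := @flow_l2 _ _ _ _ _ _ _ _ Fz s.

Let r1_uniq : uniq r1.
Proof.
rewrite map_inj_uniq ?sqtri_uniq ?uniq_zwin// => [[[j m] l]] [[j' m'] l'] /= [e e1 e2]; congr (_, _, _); lia.
Qed.
Let r2_uniq : uniq r2.
Proof.
rewrite map_inj_uniq ?sqtri_uniq ?uniq_zwin// => [[[j m] l]] [[j' m'] l'] /= [e e1 e2]; congr (_, _, _); lia.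
Qed.
Let r3_uniq : uniq r3.
Proof.
rewrite map_inj_uniq ?sqtri_uniq ?uniq_zwin// => [[[j m] l]] [[j' m'] l'] /= [e e1 e2]; congr (_, _, _); lia.
Qed.

Let triple_sum (A B C : int -> R) : (forall k, 0 <= A k) -> (forall k, 0 <= B k) -> (forall k, 0 <= C k) ->
  l2b A M -> l2b B M -> l2b C M ->
  \sum_(q <- tri) cmod (c q.1.1) * (A (q.1.1 - q.1.2) * B (q.1.1 - q.2) * C (q.1.1 - q.1.2 - q.2)) <= W%:R * M ^+ 3.
Proof.
move=> A0 B0 C0 lA lB lC.
have rN v : v \in r1 -> (`|v.1.2| <= N)%N && (`|v.2| <= N)%N.
  by case/mapP => q /mem_sqtri /and4P[_ _ h1 h2] -> /=; rewrite h1 h2.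
have := @sum_square_le _ N r1 C B (fun k => cmod (c k)) A M M 1 M r1_uniq rN C0 B0 (fun=> cmod_ge0 _) A0 M0 M0 ler01 M0 lC lB lc lA.
rewrite (_ : M * M * 1 * M = M ^+ 3); last by ring.
apply: le_trans; rewrite big_map; apply: ler_sum => [[[j m] l]] _ /=.
rewrite (_ : j - m - l + l + m = j); last by ring.
rewrite (_ : j - m - l + l = j - m); last by ring.
rewrite (_ : j - m - l + m = j - l); last by ring.
by rewrite le_eqVlt; apply/orP; left; apply/eqP; ring.
Qed.

(** Moving the weight from the output frequency to that of the difference changes it by at most d,
    all gaps being bounded by N. *)
Let comm_bound (w : int * int * int -> R) (tt : int * int * int -> R -> R[i]) s :
  (forall q, q \in tri -> `|lam Q q.1.1 - w q| <= d) ->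
  \sum_(q <- tri) cmod (c q.1.1) * cmod (tt q s) <= W%:R * M ^+ 3 ->
  cmod (\sum_(q <- tri) (x q.1.1 * tt q s * ph q s - main w tt q s)) <= d * (W%:R * M ^+ 3).
Proof.
move=> wd H; have d0 : 0 <= d by rewrite divr_ge0.
apply: (le_trans (cmod_sum _ _ _)); apply: le_trans (ler_wpM2l d0 H).
rewrite mulr_sumr big_seq [leRHS]big_seq; apply: ler_sum => q qt.
rewrite (_ : _ - _ = (lam Q q.1.1 - w q)%:C * (c q.1.1 * tt q s * ph q s)); last first.
  by rewrite RtoCB /x /main; ring.
rewrite cmodM cmod_real cmodM cmod_cis mulr1 cmodM; apply: ler_wpM2r; first by rewrite mulr_ge0 ?cmod_ge0.
exact: wd.
Qed.

Let lam_d j k : (`|j - k| <= N.*2)%N -> `|lam Q j - lam Q k| <= d.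
Proof. by move=> H; apply: (le_trans (lam_lip _ _ _)); rewrite ler_wpM2r ?invr_ge0// ler_nat. Qed.

Lemma comm_total s : 0 <= s <= T -> cmod (\sum_(q <- tri) x q.1.1 * (t1 q s + t2 q s + t3 q s) * ph q s -
   (\sum_(q <- tri) main w1 t1 q s + \sum_(q <- tri) main w2 t2 q s + \sum_(q <- tri) main w3 t3 q s)) <=
  3 * (d * (W%:R * M ^+ 3)).
Proof.
move=> sT.
rewrite (_ : _ - _ = \sum_(q <- tri) (x q.1.1 * t1 q s * ph q s - main w1 t1 q s) +
   \sum_(q <- tri) (x q.1.1 * t2 q s * ph q s - main w2 t2 q s) +
   \sum_(q <- tri) (x q.1.1 * t3 q s * ph q s - main w3 t3 q s)); last first.
  by rewrite -!big_split/= -sumrB; apply: eq_bigr => q _; ring.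
have b1 : cmod (\sum_(q <- tri) (x q.1.1 * t1 q s * ph q s - main w1 t1 q s)) <= d * (W%:R * M ^+ 3).
  apply: comm_bound.
    by move=> [[j m] l] /mem_sqtri /and4P /= [_ _ h1 h2]; rewrite /w1 /=; apply: lam_d; rewrite (_ : j - (j - m) = m); [clear -h1 h2; lia|ring].
  apply: le_trans (triple_sum (fun=> cmod_ge0 _) (fun=> cmod_ge0 _) (fun=> cmod_ge0 _) (lz sT) (lU sT) (lU sT)).
  by apply: ler_sum => q _; rewrite /t1 !cmodM cmod_conj.
have b2 : cmod (\sum_(q <- tri) (x q.1.1 * t2 q s * ph q s - main w2 t2 q s)) <= d * (W%:R * M ^+ 3).
  apply: comm_bound.
    by move=> [[j m] l] /mem_sqtri /and4P /= [_ _ h1 h2]; rewrite /w2 /=; apply: lam_d; rewrite (_ : j - (j - l) = l); [clear -h1 h2; lia|ring].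
  apply: le_trans (triple_sum (fun=> cmod_ge0 _) (fun=> cmod_ge0 _) (fun=> cmod_ge0 _) (lb sT) (lz sT) (lU sT)).
  by apply: ler_sum => q _; rewrite /t2 !cmodM cmod_conj.
have b3 : cmod (\sum_(q <- tri) (x q.1.1 * t3 q s * ph q s - main w3 t3 q s)) <= d * (W%:R * M ^+ 3).
  apply: comm_bound.
    by move=> [[j m] l] /mem_sqtri /and4P /= [_ _ h1 h2]; rewrite /w3 /=; apply: lam_d; rewrite (_ : j - (j - m - l) = m + l); [clear -h1 h2; lia|ring].
  apply: le_trans (triple_sum (fun=> cmod_ge0 _) (fun=> cmod_ge0 _) (fun=> cmod_ge0 _) (lb sT) (lb sT) (lz sT)).
  by apply: ler_sum => q _; rewrite /t3 !cmodM cmod_conj.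
have -> : 3 * (d * (W%:R * M ^+ 3)) = d * (W%:R * M ^+ 3) + d * (W%:R * M ^+ 3) + d * (W%:R * M ^+ 3) by ring.
by apply: (le_trans (cmodD _ _)); apply: lerD b3; apply: (le_trans (cmodD _ _)); exact: lerD b1 b2.
Qed.

Lemma cub_total s : 0 <= s <= T -> (forall k, cmod (fc (state_diff s) k) = cmod (profile_diff k s)) ->
  cmod (\sum_(j <- J) x j * cis (sg * j%:~R ^+ 2 * s) * resonant_diff U b j s) <= 3 * M ^+ 2 * y s.
Proof.
move=> sT zE; apply: (le_trans (cmod_sum _ _ _)).
have cs := @l2_CS R (fun k => cmod (c k)) (fun k => lam Q k * cmod (profile_diff k s)) 1 (y s) J id id (fun=> cmod_ge0 _)
  (fun k => mulr_ge0 (lam_ge0 _ _) (cmod_ge0 _)) ler01 (y0 s) lc (ly sT) (fun _ _ => id) (fun _ _ => id) (uniq_zwin _).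
rewrite mul1r in cs.
have m3 : 0 <= 3 * M ^+ 2 by rewrite mulr_ge0 ?exprn_ge0.
apply: le_trans (ler_wpM2l m3 cs).
rewrite mulr_sumr; apply: ler_sum => k _.
have cb : cmod (resonant_diff U b k s) <= 3 * M ^+ 2 * cmod (profile_diff k s) by rewrite -zE; exact: (cmod_resonant_diff M0 FU Fb).
rewrite cmodM cmodM cmod_cis mulr1 /x cmodM cmod_real ger0_norm ?lam_ge0//.
apply: (le_trans (ler_wpM2l _ cb)); first by rewrite mulr_ge0 ?lam_ge0 ?cmod_ge0.
by rewrite le_eqVlt; apply/orP; left; apply/eqP; ring.
Qed.

Notation X1 := (2^-1 * (kap L * M ^+ 2)).
Notation serr := (slot_err gamma M h y Q t L N N').

Let acst (z : int -> R[i]) k : cAC T (cst z k) (fun=> 0). Proof. exact: cAC_cst. Qed.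
Let bcst s : cmod (0 : R[i]) <= 0 * h s. Proof. by rewrite cmod0 mul0r. Qed.
Let lconj (A : int -> R -> R[i]) K s : l2b (fun k => cmod (A k s)) K -> l2b (fun k => cmod (cj A k s)) K.
Proof. by move=> H I uI; rewrite (eq_bigr (fun k => cmod (A k s) ^+ 2)) ?H// => k _; rewrite /cj cmod_conj. Qed.
Let lcj : l2b (fun k => cmod (conjc (c k))) 1.
Proof. by move=> I uI; rewrite (eq_bigr (fun k => cmod (c k) ^+ 2)) ?lc// => k _; rewrite cmod_conj. Qed.
Let bnd (A dA : int -> R -> R[i]) f : flow T sg M h f A dA -> forall k s, 0 <= s <= T -> cmod (dA k s) <= 1 * h s.
Proof. by move=> F k s sT; rewrite mul1r; exact: (flow_da F). Qed.
Let bndj (A dA : int -> R -> R[i]) f : flow T sg M h f A dA -> forall k s, 0 <= s <= T -> cmod (cj dA k s) <= 1 * h s.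
Proof. by move=> F k s sT; rewrite mul1r /cj cmod_conj; exact: (flow_da F). Qed.

Let main1_bound : cintegrable mu `[0, t] (fun s => \sum_(q <- tri) main w1 t1 q s) /\
  cmod (tint t (fun s => \sum_(q <- tri) main w1 t1 q s)) <= serr.
Proof.
rewrite (funext main1E); split.
  apply: (cint_sum (mseg 0 t)) => v.
  exact: (slot_int Q T0 Fz tT (fun k => cAC_conj (flow_ac FU k)) (flow_ac FU) (acst c)).
apply: (slot_bound T0 sg1 M0 FU Fb Fz daE dbE hUU hbU hbb y0 iy ihy ly tT L0 N0' (r := r1)
  (A := cj a) (dA := cj da) (B := a) (dB := da) (C := cst c) (dC := fun _ => fun=> 0)
  (MA := M) (MB := M) (MC := 1) (cA := 1) (cB := 1) (cC := 0)) => //.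
- by move=> k; apply: cAC_conj; exact: (flow_ac FU).
- exact: (flow_ac FU).
- by move=> s sT; apply: lconj; exact: lU.
- exact: (bndj FU).
- exact: (bnd FU).
- by ring.
- by ring.
- by move=> v /mapP[q /mem_sqtri /and4P[_ _ h1 h2] ->] /=; rewrite h1 h2.
- by move=> v /mapP[q /mem_sqtri /and4P[h1 h2 _ _] ->] /=; rewrite h1 h2.
Qed.

Let main2_bound : cintegrable mu `[0, t] (fun s => \sum_(q <- tri) main w2 t2 q s) /\
  cmod (tint t (fun s => \sum_(q <- tri) main w2 t2 q s)) <= serr.
Proof.
rewrite (funext main2E); split.
  apply: (cint_sum (mseg 0 t)) => v.
  exact: (slot_int Q T0 Fz tT (fun k => cAC_conj (flow_ac FU k)) (flow_ac Fb) (acst c)).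
apply: (slot_bound T0 sg1 M0 FU Fb Fz daE dbE hUU hbU hbb y0 iy ihy ly tT L0 N0' (r := r2)
  (A := cj a) (dA := cj da) (B := bb) (dB := db) (C := cst c) (dC := fun _ => fun=> 0)
  (MA := M) (MB := M) (MC := 1) (cA := 1) (cB := 1) (cC := 0)) => //.
- by move=> k; apply: cAC_conj; exact: (flow_ac FU).
- exact: (flow_ac Fb).
- by move=> s sT; apply: lconj; exact: lU.
- exact: (bndj FU).
- exact: (bnd Fb).
- by ring.
- by ring.
- by move=> v /mapP[q /mem_sqtri /and4P[_ _ h1 h2] ->] /=; rewrite h1 h2.
- by move=> v /mapP[q /mem_sqtri /and4P[h1 h2 _ _] ->] /=; rewrite h1 h2.
Qed.

Let main3_bound : cintegrable mu `[0, t] (fun s => \sum_(q <- tri) main w3 t3 q s) /\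
  cmod (tint t (fun s => \sum_(q <- tri) main w3 t3 q s)) <= serr.
Proof.
rewrite (funext main3E).
have i : cintegrable mu `[0, t] (fun s => \sum_(v <- r3) mid_coef (cj bb) (cst (fun k => conjc (c k))) (cj bb) v s * weighted_diff a bb Q (v.1.1 + v.1.2) s * cis (freq sg v * s)).
  apply: (cint_sum (mseg 0 t)) => v.
  exact: (slot_int Q T0 Fz tT (fun k => cAC_conj (flow_ac Fb k)) (acst _) (fun k => cAC_conj (flow_ac Fb k))).
split; first exact: (cintJ (mseg 0 t)).
rewrite /tint (CintJ (mseg 0 t))// cmod_conj.
apply: (slot_bound T0 sg1 M0 FU Fb Fz daE dbE hUU hbU hbb y0 iy ihy ly tT L0 N0' (r := r3)
  (A := cj bb) (dA := cj db) (B := cst (fun k => conjc (c k))) (dB := fun _ => fun=> 0) (C := cj bb) (dC := cj db)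
  (MA := M) (MB := 1) (MC := M) (cA := 1) (cB := 0) (cC := 1)) => //.
- by move=> k; apply: cAC_conj; exact: (flow_ac Fb).
- by move=> k; apply: cAC_conj; exact: (flow_ac Fb).
- by move=> s sT; apply: lconj; exact: lb.
- by move=> s sT; apply: lconj; exact: lb.
- exact: (bndj Fb).
- exact: (bndj Fb).
- by ring.
- by ring.
- by move=> v /mapP[q /mem_sqtri /and4P[_ _ h1 h2] ->] /=; rewrite abszN h1 h2.
- by move=> v /mapP[q /mem_sqtri /and4P[h1 h2 _ _] ->] /=; rewrite oppr_eq0 h1 h2.
Qed.

Let Jx (E : int -> R -> R[i]) s := \sum_(j <- J) cst x j s * cis (sg * j%:~R ^+ 2 * s) * E j s.
Let far_half (f : R -> R -> R[i]) (A dA : int -> R -> R[i]) : flow T sg M h f A dA ->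
  let E j s := NR (f s) (f s) (f s) j - NRsq N (f s) (f s) (f s) j in
  cintegrable mu `[0, t] (Jx E) /\ cmod (tint t (Jx E)) <= far_err 1 M N (fun=> 0) h t.
Proof.
move=> F; apply: (farsq T0 sg1 ler01 M0 N0 F F F (x := cst x) (dx := fun _ => fun=> 0) (gx := fun=> 0) _ _ _ _ (uniq_zwin Q) tT).
- exact: acst.
- move=> s sT; apply: (l2b_mono _ ler01 (lexx _) lc) => k; rewrite cmod_ge0 /cst /x cmodM cmod_real ger0_norm ?lam_ge0//=.
  by rewrite ler_piMl ?cmod_ge0 ?lam_le1.
- by move=> k s _; rewrite cmod0.
- exact: rint_cst_seg.
Qed.

(** The test sequence is constant in time and in the unit ball of l^2. Each solution is first
    truncated separately to gaps at most N, an error without y; then the weight is moved to the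
    difference, and [slot_bound] is applied in each of the three slots. *)
Lemma diff_bound : cmod (\sum_(j <- J) x j * profile_diff j t) <= cmod (\sum_(j <- J) x j * profile_diff j 0) +
  `|gamma| * (2 * far_err 1 M N (fun=> 0) h t +
    \int[mu]_(s in `[0, t]) (3 * (d * (W%:R * M ^+ 3)) + 3 * M ^+ 2 * y s) + 3 * serr).
Proof.
have AC : cAC T (fun s => \sum_(j <- J) x j * profile_diff j s) (fun s => \sum_(j <- J) x j * dprofile_diff j s).
  by apply: cAC_sum => j; apply: cAC_scale => //; exact: flow_ac Fz j.
rewrite (cAC_eq AC tT); apply: (le_trans (cmodD _ _)); rewrite lerD2l.
pose F s := \sum_(j <- J) x j * dprofile_diff j s; rewrite -/F.
have iF : cintegrable mu `[0, t] F := cint_itvS tT (cAC_cint AC).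
pose EU j s := NR (U s) (U s) (U s) j - NRsq N (U s) (U s) (U s) j.
pose Eb j s := NR (b s) (b s) (b s) j - NRsq N (b s) (b s) (b s) j.
have [iU eU] : cintegrable mu `[0, t] (Jx EU) /\ cmod (tint t (Jx EU)) <= far_err 1 M N (fun=> 0) h t := far_half FU.
have [ib eb] : cintegrable mu `[0, t] (Jx Eb) /\ cmod (tint t (Jx Eb)) <= far_err 1 M N (fun=> 0) h t := far_half Fb.
pose F1 s := \sum_(q <- tri) main w1 t1 q s; pose F2 s := \sum_(q <- tri) main w2 t2 q s; pose F3 s := \sum_(q <- tri) main w3 t3 q s.
have [i1 e1] : cintegrable mu `[0, t] F1 /\ cmod (tint t F1) <= serr := main1_bound.
have [i2 e2] : cintegrable mu `[0, t] F2 /\ cmod (tint t F2) <= serr := main2_bound.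
have [i3 e3] : cintegrable mu `[0, t] F3 /\ cmod (tint t F3) <= serr := main3_bound.
have [iM eM] := cmod_tint_sum3 i1 i2 i3 e1 e2 e3.
pose FM s := F1 s + F2 s + F3 s; rewrite -/FM in iM eM.
pose FE s := Jx EU s - Jx Eb s.
have iE : cintegrable mu `[0, t] FE := cintB (mseg 0 t) iU ib.
have eE : cmod (tint t FE) <= 2 * far_err 1 M N (fun=> 0) h t.
  rewrite /tint (CintB (mseg 0 t) iU ib) (_ : 2 * _ = far_err 1 M N (fun=> 0) h t + far_err 1 M N (fun=> 0) h t); last by ring.
  by apply: (le_trans (cmodB _ _)); exact: lerD eU eb.
pose FS s := FE s + FM s.
have iS : cintegrable mu `[0, t] FS := cintD (mseg 0 t) iE iM.
have icS : cintegrable mu `[0, t] (fun s => c0 * FS s) := cintZ (mseg 0 t) c0 iS.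
pose G s := F s - c0 * FS s.
have iG : cintegrable mu `[0, t] G := cintB (mseg 0 t) iF icS.
have eF : tint t F = tint t G + c0 * (tint t FE + tint t FM).
  rewrite /tint -(CintD (mseg 0 t) iE iM) -(CintZ (mseg 0 t) c0 iS) -(CintD (mseg 0 t) iG icS).
  by apply: eq_Cint => s _; rewrite /G subrK.
have cc : cmod c0 = `|gamma| by rewrite /c0 cmodM cmodM cmod_i mul1r !cmod_real sg1 mulr1.
have GE s : G s = c0 * (\sum_(j <- J) x j * cis (sg * j%:~R ^+ 2 * s) * (NRsq N (U s) (U s) (U s) j - NRsq N (b s) (b s) (b s) j)
    - FM s - \sum_(j <- J) x j * cis (sg * j%:~R ^+ 2 * s) * resonant_diff U b j s).
  rewrite /G (_ : F s = c0 * (Jx EU s - Jx Eb s + \sum_(j <- J) x j * cis (sg * j%:~R ^+ 2 * s) * (NRsq N (U s) (U s) (U s) j - NRsq N (b s) (b s) (b s) j)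
     - \sum_(j <- J) x j * cis (sg * j%:~R ^+ 2 * s) * resonant_diff U b j s)); first by rewrite /FS /FE; ring.
  rewrite /F /Jx -sumrB -big_split/= -sumrB mulr_sumr; apply: eq_bigr => j _.
  rewrite (dprofile_diffE FU Fb daE dbE) -/c0 -(NR_diff j (flow_qi FU s) (flow_qi Fb s)) /EU /Eb /cst; ring.
pose B s := 3 * (d * (W%:R * M ^+ 3)) + 3 * M ^+ 2 * y s.
have iB : rintegrable mu `[0, t] B.
  apply: (rint_itvS tT); apply: (rintD (mseg 0 T)); first exact: rint_cst_seg.
  exact: (rintZ (mseg 0 T)).
have B0 s : 0 <= B s by rewrite addr_ge0 ?mulr_ge0 ?exprn_ge0 ?divr_ge0.
rewrite eF; apply: (le_trans (cmodD _ _)).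
rewrite (_ : `|gamma| * _ = `|gamma| * (\int[mu]_(s in `[0, t]) B s) + `|gamma| * (2 * far_err 1 M N (fun=> 0) h t + 3 * serr)); last by rewrite /B; ring.
apply: lerD; last first.
  by rewrite cmodM cc; apply: ler_wpM2l => //; apply: (le_trans (cmodD _ _)); exact: lerD eE eM.
rewrite -RintegralZl//; apply: (cmod_tint_ae iG).
- exact: (rintZ (mseg 0 t)).
- by move=> s; apply: mulr_ge0.
apply: filterS3 (flow_ae FU) (flow_ae Fb) (profile_diff_ae Fz); first exact: (ae_filter_ringOfSetsType mu).
move=> s HU Hb Hz /andP[s0 st].
have sT : 0 <= s <= T by rewrite s0 (le_trans st)//; case/andP: tT.
rewrite GE cmodM cc; apply: ler_wpM2l => //.
rewrite (sq_profile (HU sT) (Hb sT)); apply: (le_trans (cmodB _ _)); apply: lerD; first exact: comm_total sT.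
exact: cub_total sT (Hz sT).
Qed.

End DiffBound.

(** * Stability of the Fourier coefficients *)

Section Gronwall.
Context {R : realType}.
Notation mu := (@lebesgue_measure R).
#[local] Hint Resolve mseg mtorus : core.

Lemma expR_int (k t : R) : 0 < k -> 0 <= t ->
  rintegrable mu `[0, t] (fun s => expR (k * s)) /\ \int[mu]_(s in `[0, t]) expR (k * s) <= k^-1 * expR (k * t).
Proof.
move=> k0 t0.
have D (s : R) : is_derive s 1 (fun s => k^-1 * expR (k * s)) (expR (k * s)).
  have H : is_derive s 1 (fun s => expR (k * s)) (k * expR (k * s)).
    have := @is_derive1_comp _ expR (fun s => k * s) s _ _ (is_derive_expR _) (is_derive_mulr k s).
    by rewrite mulrC.
  have := is_deriveZ (k^-1) H; rewrite /GRing.scale /= mulrA mulVf ?gt_eqF// mul1r.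
  by [].
have C : continuous (fun s : R => expR (k * s)).
  by move=> s; apply: continuous_comp; [exact: mulrl_continuous|exact: continuous_expR].
have [ie E] := rAC_C1 t0 D C; split; first exact: ie.
have := E t; rewrite lexx t0 => /(_ isT); rewrite mulr0 expR0 mulr1 => ->.
by rewrite lerDr invr_ge0 ltW.
Qed.

(** A version for h with a bounded square integral, by an exponentially weighted supremum:
    Cauchy-Schwarz bounds the integral of h e^(k s) by sqrt (H / (2 k)) e^(k t), and k = 2 H + 1
    makes the square root at most 1/2. *)
Lemma gronwall (T A H Y : R) (h y : R -> R) : 0 <= T -> 0 <= A -> 0 <= H ->
  (forall s, 0 <= h s) -> (forall s, 0 <= y s) -> measurable_fun `[0, T] h -> measurable_fun `[0, T] y ->
  (forall s, 0 <= s <= T -> y s <= Y) ->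
  rintegrable mu `[0, T] (fun s => h s ^+ 2) -> \int[mu]_(s in `[0, T]) h s ^+ 2 <= H ->
  (forall t, 0 <= t <= T -> y t <= A + \int[mu]_(s in `[0, t]) (h s * y s)) ->
  forall t, 0 <= t <= T -> y t <= 2 * A * expR ((2 * H + 1) * T).
Proof.
move=> T0 A0 H0 h0 y0 mh my yY ih hH ineq; pose k := 2 * H + 1.
have k0 : 0 < k by rewrite /k; lra.
have step K : 0 <= K -> (forall s, 0 <= s <= T -> y s <= K * expR (k * s)) ->
    forall t, 0 <= t <= T -> y t <= (A + K / 2) * expR (k * t).
  move=> K0 yK t tT; have /andP[t0 tT'] := tT; apply: (le_trans (ineq t tT)).
  have E1 : 1 <= expR (k * t) by rewrite -expR0 ler_expR mulr_ge0// ltW.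
  rewrite mulrDl; apply: lerD; first by rewrite ler_peMr.
  have k2 : 0 < 2 * k by lra.
  have [ie eb] := expR_int k2 t0.
  have e2 s : expR (k * s) ^+ 2 = expR (2 * k * s) by rewrite -expRM_natl; congr expR; ring.
  have sub : `[0, t]%classic `<=` `[0, T]%classic by exact: itv0S.
  have mh' : measurable_fun `[0, t] h by exact: (measurable_funS (mseg 0 T) sub).
  have my' : measurable_fun `[0, t] y by exact: (measurable_funS (mseg 0 T) sub).
  have me : measurable_fun `[0, t] (fun s => expR (k * s)).
    by apply: measurableT_comp => //; apply: measurable_funTS; exact: mulrl_measurable.
  have ih' : rintegrable mu `[0, t] (fun s => h s ^+ 2) by exact: (rint_itvS tT).
  have ie' : rintegrable mu `[0, t] (fun s => expR (k * s) ^+ 2) by rewrite (funext e2).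
  have [ihe cs] := Rint_CS (mseg 0 t) mh' me h0 (fun=> expR_ge0 _) ih' ie'.
  have itv s : `[0, t]%classic s -> 0 <= s <= T by move=> /sub; rewrite /= in_itv.
  have ihK : rintegrable mu `[0, t] (fun s => K * (h s * expR (k * s))) by exact: (rintZ (mseg 0 t)).
  have le1 s : `[0, t]%classic s -> h s * y s <= K * (h s * expR (k * s)).
    by move=> /itv sT; rewrite mulrCA ler_wpM2l// yK.
  have ihy : rintegrable mu `[0, t] (fun s => h s * y s).
    apply: (@rint_le _ _ R mu _ (mseg 0 t) _ (fun s => K * (h s * expR (k * s)))) => //.
      exact: measurable_funM.
    by move=> s sI; rewrite ger0_norm ?mulr_ge0// le1.
  apply: (@le_trans _ _ (\int[mu]_(s in `[0, t]) (K * (h s * expR (k * s))))); first exact: le_Rintegral.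
  rewrite RintegralZl// -mulrA; apply: ler_wpM2l => //.
  have hH' : \int[mu]_(s in `[0, t]) h s ^+ 2 <= H.
    apply: le_trans hH; rewrite /Rintegral fine_le//; try exact: integrable_fin_num.
    apply: ge0_subset_integral => //; first exact: (measurable_int _ ih).
    by move=> s _; rewrite lee_fin sqr_ge0.
  set I := \int[mu]_(s in `[0, t]) (h s * expR (k * s)) in cs *.
  have I0 : 0 <= I by apply: Rintegral_ge0 => s _; rewrite mulr_ge0 ?expR_ge0.
  have h20 : 0 <= \int[mu]_(s in `[0, t]) h s ^+ 2 by apply: Rintegral_ge0 => s _; exact: sqr_ge0.
  rewrite -(ler_pXn2r (ltn0Sn 1)) ?nnegrE ?mulr_ge0 ?expR_ge0//; apply: (le_trans cs).
  apply: (@le_trans _ _ (H * ((2 * k)^-1 * expR (2 * k * t)))).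
    by apply: ler_pM => //; [apply: Rintegral_ge0 => s _; exact: sqr_ge0|by under eq_Rintegral do rewrite e2].
  rewrite exprMn e2 mulrA; apply: ler_wpM2r; first exact: expR_ge0.
  by rewrite ler_pdivrMr// /k; lra.
(* The supremum of y e^(-k s) is finite because of Y; [step] improves a constant K to A + K / 2, so
   it is at most 2 A. *)
pose S : set R := [set y s / expR (k * s) | s in `[0, T]%classic].
have Sin s : 0 <= s <= T -> S (y s / expR (k * s)) by move=> sT; exists s => //; rewrite /= in_itv.
have T00 : 0 <= (0 : R) <= T by rewrite lexx.
have Y0 : 0 <= Y by apply: le_trans (yY 0 T00).
have supS : has_sup S.
  split; first by exists (y 0 / expR (k * 0)); exact: Sin.
  exists Y => v [s]; rewrite /= in_itv /= => sT <-; rewrite ler_pdivrMr ?expR_gt0//.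
  apply: (le_trans (yY s sT)); rewrite ler_peMr// -expR0 ler_expR mulr_ge0//; first exact: ltW.
  by case/andP: sT.
have S0 : 0 <= sup S.
  by apply: le_trans (ub_le_sup supS.2 (Sin 0 T00)); rewrite divr_ge0 ?expR_ge0.
have yS s : 0 <= s <= T -> y s <= sup S * expR (k * s).
  by move=> sT; rewrite -ler_pdivrMr ?expR_gt0//; apply: ub_le_sup; [exact: supS.2|exact: Sin].
have S2 : sup S <= A + sup S / 2.
  apply: ge_sup; first exact: supS.1.
  move=> v [s]; rewrite /= in_itv /= => sT <-; rewrite ler_pdivrMr ?expR_gt0//; exact: step.
move=> t tT; apply: (le_trans (yS t tT)).
apply: ler_pM => //; first lra.
rewrite ler_expR; apply: ler_wpM2l; [exact: ltW|by case/andP: tT].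
Qed.

End Gronwall.

(** * The integral inequality for the weighted distance *)

Section PairSetup.
Context {R : realType}.
Notation mu := (@lebesgue_measure R).
#[local] Hint Resolve mseg mtorus : core.

Lemma Rint_lin (t a b c e : R) (f g k : R -> R) : 0 <= t -> rintegrable mu `[0, t] f -> rintegrable mu `[0, t] g ->
  rintegrable mu `[0, t] k -> \int[mu]_(s in `[0, t]) (a * f s + b * g s + c * k s + e) =
  a * \int[mu]_(s in `[0, t]) f s + b * \int[mu]_(s in `[0, t]) g s + c * \int[mu]_(s in `[0, t]) k s + e * t.
Proof.
move=> t0 i_f ig ik.
have h1 := rintZ (mseg 0 t) a i_f; have h2 := rintZ (mseg 0 t) b ig; have h3 := rintZ (mseg 0 t) c ik.
have h12 := rintD (mseg 0 t) h1 h2; have h123 := rintD (mseg 0 t) h12 h3; have h4 := rint_cst_seg t e.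
rewrite (RintegralD (mseg 0 t) h123 h4) (RintegralD (mseg 0 t) h12 h3) (RintegralD (mseg 0 t) h1 h2) !RintegralZl//.
by rewrite Rint_cst_seg// [e * t]mulrC.
Qed.

(** [gron_coef] sees only the scale L. The four errors multiply [kap N], [kap N'], 2 N / Q and 2 N'
    / Q; the number W of pairs of gaps in the second and third belongs to N. *)
Definition gron_coef (g M kL WL : R) : R :=
  g * (3 * M ^+ 2 + 3 * (WL * M ^+ 2 + kL * M + g * (2^-1 * (kL * M ^+ 2)) * (3 + 7 * M ^+ 2))).

Definition gron_err1 (g M H : R) : R := g * (2 * (2 * M ^+ 3 + 3 * M ^+ 2 * H)).
Definition gron_err2 (g M kL W H T : R) : R := 9 * g ^+ 2 *
  (2 * (2^-1 * (kL * M ^+ 2)) * M ^+ 3 + (2 * W * M ^+ 4 + 3 * (2^-1 * (kL * M ^+ 2)) * M ^+ 2) * H + W * M ^+ 5 * T).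
Definition gron_err3 (g M W T : R) : R := 3 * g * W * M ^+ 3 * T.
Definition gron_err4 (g M kL H T : R) : R := 3 * g ^+ 2 * (2^-1 * (kL * M ^+ 2)) * (3 * M * H + 4 * M ^+ 3 * T).

(** The boundary terms contain y t and y 0 with coefficient 3 g X1 <= 1/2; moving the former to the
    left gives the factors 3 and 2 of the conclusion. *)
Lemma absorb (g M kL kN kN' WL W d d' Iy Ihy Ih H t T yt y0 : R) (X1 := 2^-1 * (kL * M ^+ 2)) :
  0 <= g -> 0 <= M -> 0 <= kL -> 0 <= kN -> 0 <= kN' -> 0 <= WL -> 0 <= W -> 0 <= d -> 0 <= d' -> 0 <= Iy -> 0 <= Ihy ->
  Ih <= H -> t <= T -> 0 <= y0 -> 0 <= yt ->
  g * (3 * X1) <= 2^-1 ->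
  yt <= y0 + g * (2 * (kN * (2 * M ^+ 3 + 3 * M ^+ 2 * Ih)) + (3 * (d * (W * M ^+ 3)) * t + 3 * M ^+ 2 * Iy) +
    3 * (WL * M ^+ 2 * Iy + (2^-1 * (kL * (M ^+ 2 * yt)) + 2^-1 * (kL * (M ^+ 2 * y0)) + 2^-1 * (kL * (2 * M * Ihy)) +
      g * (3 * (kN' * (2 * X1 * M ^+ 3 + (2 * W * M ^+ 4 + 3 * X1 * M ^+ 2) * Ih + W * M ^+ 5 * t)) +
       X1 * (3 * Ihy + 7 * M ^+ 2 * Iy + 3 * d' * M * Ih + 4 * d' * M ^+ 3 * t))))) ->
  yt <= 3 * y0 + 2 * (kN * gron_err1 g M H + kN' * gron_err2 g M kL W H T + d * gron_err3 g M W T + d' * gron_err4 g M kL H T) +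
    2 * gron_coef g M kL WL * (Iy + Ihy).
Proof.
move=> g0 M0 kL0 kN0 kN'0 WL0 W0 d0 d'0 Iy0 Ihy0 IhH tT y00 yt0 small ineq.
pose B := kN * gron_err1 g M H + kN' * gron_err2 g M kL W H T + d * gron_err3 g M W T + d' * gron_err4 g M kL H T +
  gron_coef g M kL WL * (Iy + Ihy).
have X10 : 0 <= X1 by rewrite !mulr_ge0// exprn_ge0.
have HI : 0 <= H - Ih by rewrite subr_ge0.
have TI : 0 <= T - t by rewrite subr_ge0.
suff key : yt <= y0 + g * (3 * X1) * (yt + y0) + B.
  have : g * (3 * X1) * (yt + y0) <= 2^-1 * (yt + y0) by rewrite ler_wpM2r// addr_ge0.
  rewrite /B in key; move: key; set e := _ * gron_err1 _ _ _ + _ + _ + _; set q := gron_coef _ _ _ _ * _ => k1 k2.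
  by rewrite -mulrA -/q; lra.
apply: (le_trans ineq); rewrite -subr_ge0.
(* The slack is displayed as a sum of visibly nonnegative terms. *)
rewrite (_ : _ - _ = kN * g * 2 * (3 * M ^+ 2) * (H - Ih) + 3 * g * d * W * M ^+ 3 * (T - t) +
   9 * g ^+ 2 * kN' * ((2 * W * M ^+ 4 + 3 * X1 * M ^+ 2) * (H - Ih) + W * M ^+ 5 * (T - t)) +
   3 * g ^+ 2 * X1 * d' * (3 * M * (H - Ih) + 4 * M ^+ 3 * (T - t)) +
   g * (3 * M ^+ 2 * Ihy + 3 * WL * M ^+ 2 * Ihy + 3 * kL * M * Iy + 3 * g * X1 * (7 * M ^+ 2 * Ihy + 3 * Iy))); last first.
  by rewrite /B /gron_err1 /gron_err2 /gron_err3 /gron_err4 /gron_coef /X1; field.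
clearbody X1; by repeat (first [exact: exprn_ge0 | assumption | exact: ler0n | apply: addr_ge0 | apply: mulr_ge0]).
Qed.

(* [h] serves at once as a bound for the time derivatives and for the L^2 norms of the quadratic expressions; only
   its square integral is controlled. *)
Record flow_pair (gamma T sg M H : R) (h : R -> R) (U b : R -> R -> R[i]) (a da bb db : int -> R -> R[i]) : Prop := FlowPair {
  pair_flow1 : flow T sg M h U a da ;
  pair_flow2 : flow T sg M h b bb db ;
  pair_flow3 : flow T sg M h (state_diff U b) (profile_diff a bb) (dprofile_diff da db) ;
  pair_rhs1 : forall k s, da k s = nls_rhs gamma sg U k s ;
  pair_rhs2 : forall k s, db k s = nls_rhs gamma sg b k s ;
  pair_h1 : forall s, nrm (fun x => U s x * conjc (U s x)) <= h s ;
  pair_h2 : forall s, nrm (fun x => b s x * conjc (U s x)) <= h s ;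
  pair_h3 : forall s, nrm (fun x => b s x * b s x) <= h s ;
  pair_hsq : rintegrable mu `[0, T] (fun s => h s ^+ 2) ;
  pair_hsq_le : \int[mu]_(s in `[0, T]) h s ^+ 2 <= H
}.

Definition wdist (Q : nat) (z : int -> R -> R[i]) s := Num.sqrt (\sum_(k <- zwin Q) (lam Q k * cmod (z k s)) ^+ 2).

Section MainInequality.
Variables (gamma T sg M H : R) (h : R -> R) (U b : R -> R -> R[i]) (a da bb db : int -> R -> R[i]) (Q : nat).
Hypotheses (T0 : 0 <= T) (sg1 : `|sg| = 1) (M0 : 0 <= M) (Q0 : (0 < Q)%N).
Hypothesis P : flow_pair gamma T sg M H h U b a da bb db.
Notation z := (profile_diff a bb).
Let y := wdist Q z.

Let S s := \sum_(k <- zwin Q) (lam Q k * cmod (z k s)) ^+ 2.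
Let S0 s : 0 <= S s. Proof. by apply: sumr_ge0 => k _; exact: sqr_ge0. Qed.

Lemma wdist_ge0 s : 0 <= y s. Proof. exact: sqrtr_ge0. Qed.

Let ysq s : y s ^+ 2 = S s. Proof. by rewrite /y /wdist -/(S s) sqr_sqrtr. Qed.

Lemma wdist_l2b s : l2b (fun k => lam Q k * cmod (z k s)) (y s).
Proof.
move=> I uI; rewrite ysq.
apply: (@le_trans _ _ (\sum_(k <- [seq k <- I | k \in zwin Q]) (lam Q k * cmod (z k s)) ^+ 2)).
  rewrite big_filter [leRHS]big_mkcond/= le_eqVlt; apply/orP; left; apply/eqP; apply: eq_bigr => k _.
  case: (boolP (k \in zwin Q)) => //; rewrite mem_zwin -ltnNge => /ltnW kQ.
  by rewrite lam_supp// mul0r expr0n.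
apply: ler_sum_sub; first by rewrite filter_uniq.
  by move=> k; rewrite mem_filter => /andP[].
by move=> k; exact: sqr_ge0.
Qed.

Lemma wdist_leM s : 0 <= s <= T -> y s <= M.
Proof.
move=> sT; rewrite -(ler_pXn2r (ltn0Sn 1)) ?nnegrE ?wdist_ge0// ysq.
apply: le_trans (flow_l2 (pair_flow3 P) sT (uniq_zwin Q)); apply: ler_sum => k _.
by rewrite ler_pXn2r ?nnegrE ?mulr_ge0 ?lam_ge0 ?cmod_ge0// ler_piMl ?cmod_ge0 ?lam_le1.
Qed.

Lemma wdist_meas : measurable_fun `[0, T] y.
Proof.
apply: (@measurableT_comp _ _ _ _ _ _ (@Num.sqrt R)).
  by apply: continuous_measurable_fun; exact: sqrt_continuous.
apply: measurable_sum => k; apply: measurable_funX; apply: measurable_funM; first exact: measurable_cst.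
exact: meas_cmod (cAC_meas T0 (flow_ac (pair_flow3 P) k)).
Qed.

Let h0 s : 0 <= h s. Proof. by apply: le_trans (pair_h1 P s); exact: nrm_ge0. Qed.
Let ih : rintegrable mu `[0, T] h := flow_h (pair_flow1 P).

Lemma wdist_int : rintegrable mu `[0, T] y.
Proof.
apply: (@rint_le _ _ R mu _ (mseg 0 T) _ (fun=> M)); [exact: wdist_meas| |exact: rint_cst_seg].
by move=> s; rewrite /= in_itv /= => sT; rewrite ger0_norm ?wdist_ge0// wdist_leM.
Qed.

Lemma wdist_hint : rintegrable mu `[0, T] (fun s => h s * y s).
Proof.
apply: (@rint_le _ _ R mu _ (mseg 0 T) _ (fun s => M * h s)).
- by apply: measurable_funM; [exact: rint_meas ih|exact: wdist_meas].
- move=> s; rewrite /= in_itv /= => sT; rewrite ger0_norm ?mulr_ge0 ?wdist_ge0// mulrC.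
  by rewrite ler_wpM2r// wdist_leM.
- exact: (rintZ (mseg 0 T)).
Qed.

Lemma pair_h_int t : 0 <= t <= T -> \int[mu]_(s in `[0, t]) h s <= T + H.
Proof.
move=> tT; have := pair_hsq P => i2.
apply: (@le_trans _ _ (\int[mu]_(s in `[0, T]) h s)).
  rewrite /Rintegral fine_le//; try exact: integrable_fin_num; first exact: integrable_fin_num (rint_itvS tT ih).
  have /andP[_ tT'] := tT; apply: ge0_subset_integral => //; [exact: (measurable_int _ ih)|by move=> s _; rewrite lee_fin|exact: itv0S].
apply: (@le_trans _ _ (\int[mu]_(s in `[0, T]) (1 + h s ^+ 2))).
  apply: le_Rintegral => //; first by apply: (rintD (mseg 0 T)) => //; exact: rint_cst_seg.
  by move=> s _; have := sqr_ge0 (h s - 1); have := h0 s; nra.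
rewrite (RintegralD (mseg 0 T) (rint_cst_seg T 1) i2) Rint_cst_seg// mul1r lerD2l; exact: pair_hsq_le P.
Qed.

Notation W n := ((size (zwin n) * size (zwin n))%:R : R).

Lemma main_ineq t L N N' : 0 <= t <= T -> (0 < L)%N -> (0 < N)%N -> (0 < N')%N ->
  `|gamma| * (3 * (2^-1 * (kap L * M ^+ 2))) <= 2^-1 ->
  y t <= 3 * y 0 + 2 * (kap N * gron_err1 `|gamma| M (T + H) + kap N' * gron_err2 `|gamma| M (kap L) (W N) (T + H) T +
    N.*2%:R / Q%:R * gron_err3 `|gamma| M (W N) T + N'.*2%:R / Q%:R * gron_err4 `|gamma| M (kap L) (T + H) T) +
    \int[mu]_(s in `[0, t]) (2 * gron_coef `|gamma| M (kap L) (W L) * (1 + h s) * y s).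
Proof.
move=> tT L0 N0 N0' small; have /andP[t0 tT'] := tT.
(* The extremal sequence of the duality, normalized by y t; if y t = 0 it is zero, by the convention
   on inverses. *)
pose c j : R[i] := (lam Q j * (y t)^-1)%:C * conjc (z j t).
have cc j : cmod (c j) = (y t)^-1 * (lam Q j * cmod (z j t)).
  by rewrite /c cmodM cmod_conj cmod_real ger0_norm ?mulr_ge0 ?lam_ge0 ?invr_ge0 ?wdist_ge0//; ring.
have yV1 : (y t)^-1 * y t <= 1.
  by have [->|y1] := eqVneq (y t) 0; [rewrite mulr0|rewrite mulVf].
have lc : l2b (fun k => cmod (c k)) 1.
  apply: (l2b_mono _ _ yV1 (l2b_scale (y t)^-1 (wdist_l2b t))); last by rewrite mulr_ge0 ?invr_ge0 ?wdist_ge0.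
  by move=> k; rewrite cmod_ge0/= cc.
have D := diff_bound T0 sg1 M0 Q0 (pair_flow1 P) (pair_flow2 P) (pair_flow3 P) (pair_rhs1 P) (pair_rhs2 P)
  (pair_h1 P) (pair_h2 P) (pair_h3 P) wdist_ge0 wdist_int wdist_hint (fun s _ => wdist_l2b s) tT L0 N0 N0' lc.
have E1 : \sum_(j <- zwin Q) ((lam Q j)%:C * c j) * z j t = (y t)%:C.
  transitivity ((y t)^-1 * y t ^+ 2)%:C; last first.
    congr (_%:C); have [->|y1] := eqVneq (y t) 0; first by rewrite expr0n mulr0.
    by rewrite expr2 mulKf.
  rewrite ysq /S mulr_sumr RtoC_sum; apply: eq_bigr => j _.
  have e : (lam Q j)%:C * c j * z j t = (lam Q j * (lam Q j * (y t)^-1))%:C * (z j t * conjc (z j t)).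
    rewrite /c RtoCM; ring.
  by rewrite e mul_conj -RtoCM; congr (_%:C); ring.
have E2 : cmod (\sum_(j <- zwin Q) ((lam Q j)%:C * c j) * z j 0) <= y 0.
  apply: (le_trans (cmod_sum _ _ _)).
  have cs := @l2_CS R (fun k => cmod (c k)) (fun k => lam Q k * cmod (z k 0)) 1 (y 0) (zwin Q) id id (fun=> cmod_ge0 _)
    (fun k => mulr_ge0 (lam_ge0 _ _) (cmod_ge0 _)) ler01 (wdist_ge0 0) lc (wdist_l2b 0) (fun _ _ => id) (fun _ _ => id) (uniq_zwin _).
  rewrite mul1r in cs; apply: le_trans cs; apply: ler_sum => j _.
  by rewrite cmodM cmodM cmod_real ger0_norm ?lam_ge0// le_eqVlt; apply/orP; left; apply/eqP; ring.
rewrite E1 cmod_real ger0_norm ?wdist_ge0// in D.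
have iy := rint_itvS tT wdist_int; have ihy := rint_itvS tT wdist_hint; have ih' := rint_itvS tT ih.
pose Iy := \int[mu]_(s in `[0, t]) y s; pose Ihy := \int[mu]_(s in `[0, t]) (h s * y s); pose Ih := \int[mu]_(s in `[0, t]) h s.
have lin := @Rint_lin t _ _ _ _ (fun s => y s) (fun s => h s * y s) (fun s => h s) t0 iy ihy ih'.
rewrite (_ : \int[mu]_(s in `[0, t]) (2 * _ * (1 + h s) * y s) = 2 * gron_coef `|gamma| M (kap L) (W L) * (Iy + Ihy)); last first.
  set K := 2 * _; rewrite (_ : (fun s => _) = (fun s => K * y s + K * (h s * y s) + 0 * h s + 0)); last by apply/funext => s; ring.
  by rewrite lin /Iy /Ihy; ring.
have f1 : far_err 1 M N (fun=> 0) h t = kap N * (2 * M ^+ 3 + 3 * M ^+ 2 * Ih).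
  rewrite (far_errE 1 M N tT (rint_cst_seg T 0) ih) /far_const mul1r.
  rewrite (_ : (fun s => _) = (fun s => 0 * y s + 0 * (h s * y s) + (3 * M ^+ 2) * h s + 0)); last by apply/funext => s; ring.
  by rewrite lin -/Ih; ring.
apply: (@absorb `|gamma| M (kap L) (kap N) (kap N') (W L) (W N) (N.*2%:R / Q%:R) (N'.*2%:R / Q%:R) Iy Ihy Ih (T + H) t T (y t) (y 0)) => //;
  try exact: kap_ge0; try exact: wdist_ge0; try by rewrite divr_ge0.
- by apply: Rintegral_ge0 => s _; exact: wdist_ge0.
- by apply: Rintegral_ge0 => s _; rewrite mulr_ge0 ?wdist_ge0.
- exact: pair_h_int.
apply: (le_trans D); apply: lerD E2 _; rewrite le_eqVlt; apply/orP; left; apply/eqP; congr (_ * _).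
rewrite f1; congr (_ + _ + _ * _).
  rewrite (_ : (fun s => _) = (fun s => (3 * M ^+ 2) * y s + 0 * (h s * y s) + 0 * h s + 3 * (N.*2%:R / Q%:R * (W N * M ^+ 3)))); last first.
    by apply/funext => s; ring.
  by rewrite lin -/Iy; ring.
rewrite /slot_err -/Iy -/Ihy; congr (_ + (_ + _ * (_ + _ * _))).
  congr (_ * _); set X1 := 2^-1 * (kap L * M ^+ 2).
  have ig : rintegrable mu `[0, T] (fun s => W N * (h s * (2 * M) + M ^+ 2)).
    apply: (rintZ (mseg 0 T)); apply: (rintD (mseg 0 T)); last exact: rint_cst_seg.
    rewrite (_ : (fun s => _) = fun s => (2 * M) * h s); last by apply/funext => s; rewrite mulrC.
    exact: (rintZ (mseg 0 T)).
  rewrite (far_errE X1 M N' tT ig ih) /far_const; congr (_ * _).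
  rewrite (_ : (fun s => _) = (fun s => 0 * y s + 0 * (h s * y s) + (2 * W N * M ^+ 4 + 3 * X1 * M ^+ 2) * h s + W N * M ^+ 5)); last first.
    by apply/funext => s; ring.
  by rewrite lin -/Ih; ring.
rewrite (_ : (fun s => _) = (fun s => (7 * M ^+ 2) * y s + 3 * (h s * y s) + (3 * (N'.*2%:R / Q%:R) * M) * h s + 4 * (N'.*2%:R / Q%:R) * M ^+ 3)); last first.
  by apply/funext => s; ring.
by rewrite lin -/Iy -/Ihy -/Ih; ring.
Qed.

End MainInequality.

End PairSetup.

(** * Choice of the scales *)

Section Stability.
Context {R : realType}.
Notation mu := (@lebesgue_measure R).
#[local] Hint Resolve mseg mtorus : core.
Notation W n := ((size (zwin n) * size (zwin n))%:R : R).

Lemma kap_small_mul (c e : R) : 0 <= c -> 0 < e -> exists2 N, (0 < N)%N & kap N * c <= e.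
Proof.
move=> c0 e0; have [|N N0 H] := @kap_small R (e / (1 + c)); first by rewrite divr_gt0// ltr_wpDr.
exists N => //; apply: (le_trans (ler_wpM2r c0 (H N (leqnn N)))).
have c1 : 0 < 1 + c by rewrite ltr_wpDr.
by rewrite -mulrA [_^-1 * _]mulrC ler_piMr ?(ltW e0)// ler_pdivrMr// mul1r lerDr.
Qed.

Lemma wdist_le_const Q (z : int -> R -> R[i]) s (d : R) : 0 <= d -> (forall k, (`|k| <= Q)%N -> cmod (z k s) <= d) ->
  wdist Q z s <= (size (zwin Q))%:R * d.
Proof.
move=> d0 zd; rewrite /wdist -(ler_pXn2r (ltn0Sn 1)) ?nnegrE ?sqrtr_ge0 ?mulr_ge0// sqr_sqrtr; last first.
  by apply: sumr_ge0 => k _; exact: sqr_ge0.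
apply: (@le_trans _ _ (\sum_(k <- zwin Q) d ^+ 2)).
  rewrite big_seq [leRHS]big_seq; apply: ler_sum => k; rewrite mem_zwin => kQ.
  rewrite ler_pXn2r ?nnegrE ?mulr_ge0 ?lam_ge0 ?cmod_ge0//; apply: le_trans (zd k kQ).
  by rewrite ler_piMl ?cmod_ge0 ?lam_le1.
rewrite big_const_seq count_predT iter_addr_0 exprMn -[_ *+ size _]mulr_natl ler_wpM2r ?sqr_ge0//.
by rewrite -natrX ler_nat; move: (size _) => [|n]//; rewrite expnS expn1 leq_pmulr.
Qed.

Lemma gron_err_ge0 (g M kL W H T : R) : 0 <= g -> 0 <= M -> 0 <= kL -> 0 <= W -> 0 <= H -> 0 <= T ->
  [/\ 0 <= gron_err1 g M H, 0 <= gron_err2 g M kL W H T, 0 <= gron_err3 g M W T & 0 <= gron_err4 g M kL H T].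
Proof.
move=> *; split; by repeat (first [exact: exprn_ge0 | assumption | exact: ler0n | apply: addr_ge0 | apply: mulr_ge0 | rewrite invr_ge0]).
Qed.

Lemma gron_coef_ge0 (g M kL WL : R) : 0 <= g -> 0 <= M -> 0 <= kL -> 0 <= WL -> 0 <= gron_coef g M kL WL.
Proof.
move=> *; by repeat (first [exact: exprn_ge0 | assumption | exact: ler0n | apply: addr_ge0 | apply: mulr_ge0 | rewrite invr_ge0]).
Qed.

Lemma sqr_affine_le (K x : R) : (K * (1 + x)) ^+ 2 <= 2 * K ^+ 2 * (1 + x ^+ 2).
Proof.
by rewrite -subr_ge0 (_ : _ - _ = (K * (x - 1)) ^+ 2); [exact: sqr_ge0|ring].
Qed.

(** The order of the choices avoids circularity: L allows the absorption and fixes the Gronwall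
    factor [E]; N makes the first error small; N' the second, which contains the number of pairs of
    gaps up to N; Q comes last, against N / Q and N' / Q, and then d. *)
Lemma flow_pair_small (gamma T sg M H e : R) (J : nat) : 0 <= T -> `|sg| = 1 -> 0 <= M -> 0 <= H -> 0 < e ->
  exists Q : nat, exists2 d : R, 0 < d & forall h U b a da bb db, flow_pair gamma T sg M H h U b a da bb db ->
    (forall k, (`|k| <= Q)%N -> cmod (profile_diff a bb k 0) <= d) ->
    forall j t, (`|j| <= J)%N -> 0 <= t <= T -> cmod (profile_diff a bb j t) <= e.
Proof.
move=> T0 sg1 M0 H0 e0; pose g := `|gamma|; have g0 : 0 <= g by exact: normr_ge0.
have TH : 0 <= T + H by rewrite addr_ge0.
have [L L0 small] : exists2 L, (0 < L)%N & g * (3 * (2^-1 * (kap L * M ^+ 2))) <= 2^-1.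
  have [||L L0 HL] := @kap_small_mul (g * (3 * (2^-1 * M ^+ 2))) 2^-1; [by rewrite !mulr_ge0// exprn_ge0|by []|].
  by exists L => //; apply: le_trans HL; rewrite le_eqVlt; apply/orP; left; apply/eqP; ring.
pose K := 2 * gron_coef g M (kap L) (W L).
have K0 : 0 <= K by rewrite mulr_ge0// gron_coef_ge0// kap_ge0.
pose HH := 2 * K ^+ 2 * (T + H); have HH0 : 0 <= HH by apply: mulr_ge0 => //; apply: mulr_ge0 => //; exact: exprn_ge0.
pose E := expR ((2 * HH + 1) * T); have E0 : 0 < E by exact: expR_gt0.
(* Each of the four errors, and the initial distance, is made at most [n1]. Then A <= 3 n1 + 8 n1 <=
   16 n1, and the final bound 4 A E is at most e. *)
pose n1 := e / (64 * E); have n10 : 0 < n1 by rewrite divr_gt0// mulr_gt0.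
have [p1 _ _ _] := gron_err_ge0 g0 M0 (kap_ge0 0%N) (ler0n R 0) TH T0.
have [N N0 HN] := kap_small_mul p1 n10.
have [_ p2 p3 p4] := gron_err_ge0 g0 M0 (kap_ge0 L) (ler0n R (size (zwin N) * size (zwin N))) TH T0.
have [N' N'0 HN'] := kap_small_mul p2 n10.
pose x3 := N.*2%:R * gron_err3 g M (W N) T / n1; have x30 : 0 <= x3 by apply: divr_ge0; [exact: mulr_ge0|exact: ltW].
pose x4 := N'.*2%:R * gron_err4 g M (kap L) (T + H) T / n1; have x40 : 0 <= x4 by apply: divr_ge0; [exact: mulr_ge0|exact: ltW].
(* The first summand gives [lam Q j] >= 1/2 for |j| <= J, the two others make the errors in 1 / Q
   small. *)
pose Q := (J.*2 + Num.bound x3 + Num.bound x4).+1.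
have Q0 : (0 < Q)%N by [].
have Q00 : 0 < Q%:R :> R by rewrite ltr0n.
have HQ (x c : R) : 0 <= x -> (Num.bound x <= Q)%N -> x = c / n1 -> c / Q%:R <= n1.
  move=> x0 xQ xc; rewrite ler_pdivrMr// mulrC -ler_pdivrMr// -xc; apply: (le_trans (ltW (archi_boundP x0))).
  by rewrite ler_nat.
have b3 : (Num.bound x3 <= Q)%N by rewrite /Q; apply: leqW; apply: leq_trans (leq_addr _ _); exact: leq_addl.
have b4 : (Num.bound x4 <= Q)%N by rewrite /Q; apply: leqW; exact: leq_addl.
have bJ : (J.*2 <= Q)%N by rewrite /Q; apply: leqW; rewrite -addnA; exact: leq_addr.
have KE : 2 * gron_coef g M (kap L) (W L) = K by [].
clearbody Q; clearbody K.
have H3 : N.*2%:R / Q%:R * gron_err3 g M (W N) T <= n1.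
  by rewrite mulrAC; exact: (HQ x3 _ x30 b3 erefl).
have H4 : N'.*2%:R / Q%:R * gron_err4 g M (kap L) (T + H) T <= n1.
  by rewrite mulrAC; exact: (HQ x4 _ x40 b4 erefl).
pose d := n1 / (size (zwin Q)).+1%:R.
exists Q, d; first by rewrite divr_gt0.
move=> h U b a da bb db P za0 j t jJ tT.
have y00 : wdist Q (profile_diff a bb) 0 <= n1.
  apply: (le_trans (wdist_le_const _ za0)); first by rewrite divr_ge0// ltW.
  rewrite /d mulrCA ler_piMr ?(ltW n10)// ler_pdivrMr ?ltr0n// mul1r ler_nat; exact: leqnSn.
have h0 s : 0 <= h s by apply: le_trans (pair_h1 P s); exact: nrm_ge0.
have ih := flow_h (pair_flow1 P).
have ih2 := pair_hsq P.
pose h' s := K * (1 + h s).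
have mh' : measurable_fun `[0, T] h'.
  by apply: (rint_meas (mu := mu)); apply: (rintZ (mseg 0 T)); apply: (rintD (mseg 0 T)) => //; exact: rint_cst_seg.
have ib : rintegrable mu `[0, T] (fun s => 2 * K ^+ 2 * (1 + h s ^+ 2)).
  by apply: (rintZ (mseg 0 T)); apply: (rintD (mseg 0 T)) => //; exact: rint_cst_seg.
have hb s : h' s ^+ 2 <= 2 * K ^+ 2 * (1 + h s ^+ 2).
  exact: sqr_affine_le.
have ih'2 : rintegrable mu `[0, T] (fun s => h' s ^+ 2).
  apply: (@rint_le _ _ R mu _ (mseg 0 T) _ (fun s => 2 * K ^+ 2 * (1 + h s ^+ 2))) => //; first exact: measurable_funX.
  by move=> s _; rewrite ger0_norm ?sqr_ge0.
have hHH : \int[mu]_(s in `[0, T]) h' s ^+ 2 <= HH.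
  apply: (le_trans (le_Rintegral (mseg 0 T) ih'2 ib (fun s _ => hb s))).
  have i1 : rintegrable mu `[0, T] (fun s => 1 + h s ^+ 2) by apply: (rintD (mseg 0 T)) => //; exact: rint_cst_seg.
  rewrite RintegralZl// (RintegralD (mseg 0 T) (rint_cst_seg T 1) ih2) Rint_cst_seg// mul1r.
  by rewrite /HH ler_wpM2l ?mulr_ge0 ?exprn_ge0// lerD2l; exact: pair_hsq_le P.
pose A := 3 * wdist Q (profile_diff a bb) 0 + 2 * (kap N * gron_err1 g M (T + H) + kap N' * gron_err2 g M (kap L) (W N) (T + H) T +
    N.*2%:R / Q%:R * gron_err3 g M (W N) T + N'.*2%:R / Q%:R * gron_err4 g M (kap L) (T + H) T).
have A0 : 0 <= A.
  rewrite /A; repeat (first [exact: sqrtr_ge0 | assumption | exact: ler0n | exact: kap_ge0| rewrite invr_ge0 | apply: addr_ge0 | apply: mulr_ge0 ]).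
have G : wdist Q (profile_diff a bb) t <= 2 * A * E.
  apply: (gronwall (h := h') (Y := M) T0 A0 HH0) => //.
  - by move=> s; rewrite mulr_ge0// addr_ge0.
  - by move=> s; exact: wdist_ge0.
  - exact: wdist_meas T0 P.
  - by move=> s sT; exact: (wdist_leM Q M0 P sT).
  - move=> r rT; have := main_ineq T0 sg1 M0 Q0 P rT L0 N0 N'0 small; rewrite -/g KE; exact.
have half : 2^-1 <= lam Q j :> R.
  apply: le_trans (lam_ge Q j); rewrite -[2^-1]/(2^-1) lerBrDr -lerBrDl (_ : 1 - 2^-1 = 2^-1 :> R); last by field.
  by rewrite ler_pdivrMr// -ler_pdivrMl ?invr_gt0// invrK -natrM ler_nat; clear -bJ jJ; lia.
have zj : lam Q j * cmod (profile_diff a bb j t) <= wdist Q (profile_diff a bb) t.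
  have := l2b_le j (wdist_l2b a bb Q0 t) (wdist_ge0 _ _ _ t).
  by rewrite ger0_norm// mulr_ge0 ?lam_ge0 ?cmod_ge0.
have z2 : 2^-1 * cmod (profile_diff a bb j t) <= 2 * A * E.
  by apply: le_trans G; apply: le_trans zj; rewrite ler_wpM2r ?cmod_ge0.
have A1 : A <= 16 * n1 by rewrite /A; lra.
have n1E : n1 * E = e / 64 by rewrite /n1; field; rewrite gt_eqF.
have : A * E <= 16 * (e / 64) by rewrite -n1E mulrA ler_wpM2r// ltW.
by move: z2; rewrite -mulrA; lra.
Qed.

End Stability.

(** * Pairs of gauged solutions *)

Section SolutionPairs.
Context {R : realType}.
Notation mu := (@lebesgue_measure R).
Notation fc := (@fourier_coef R).
#[local] Hint Resolve mseg mtorus : core.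

Definition quartic_const (gamma T M : R) : R := 4 * pi * (2 * kap 1 * M ^+ 4 +
  pi * (4 * kap 1 * M ^+ 3 * (`|gamma| * ((2 * pi)^-1 * Num.sqrt (2 * pi * M ^+ 2)))) ^+ 2 * T + 2 * T * M ^+ 4).

Definition drive_coef (gamma M : R) : R := `|gamma| * ((2 * pi)^-1 * Num.sqrt (2 * pi * M ^+ 2)).

(** It bounds the time integral of h^2 and depends on gamma, T and M only: the stability estimate is
    thus uniform over all pairs of solutions of mass at most 2 pi M^2, in particular along a
    sequence. *)
Definition pair_const (gamma T M : R) : R :=
  (16 * drive_coef gamma M ^+ 2 + 4) * (quartic_const gamma T M + quartic_const gamma T M) +
  64 * (`|gamma| * (2 * M ^+ 3)) ^+ 2 * T.

Lemma nrm_le_sqrt (f g : R -> R[i]) (c : R) : qi f -> qi g -> 2^-1 * (qmass f + qmass g) <= c ->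
  nrm (fun x => f x * g x) <= Num.sqrt c.
Proof. by move=> qf qg H; have [_ m] := qi_mul qf qg; rewrite /nrm ler_wsqrtr// (le_trans m). Qed.

Variables (gamma T sg M : R) (phi psi : R -> R[i]) (u v : R -> R -> R[i]) (m n : R).
Hypotheses (T0 : 0 <= T) (sg1 : `|sg| = 1) (M0 : 0 <= M).
Hypotheses (solu : nls_solution gamma phi u) (solv : nls_solution gamma psi v).
Hypotheses (um : forall t, mass (u t) = m) (vn : forall t, mass (v t) = n).
Hypotheses (mM : m <= 2 * pi * M ^+ 2) (nM : n <= 2 * pi * M ^+ 2).

Notation U := (gauged gamma T sg m u).
Notation V := (gauged gamma T sg n v).
Notation A := (drive_coef gamma M).
Notation B := (`|gamma| * (2 * M ^+ 3)).
Let q s : R := qmass (U s) + qmass (V s).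
Let h1 s : R := gauged_bound gamma T sg M m u s + gauged_bound gamma T sg M n v s.
(** 2 h1 bounds the derivative of the difference, and sqrt q the L^2 norms of the products of two
    solutions. *)
Let h s : R := (h1 s + h1 s) + Num.sqrt (q s).
Let F1 := gauge_flow T0 sg1 M0 solu um mM.
Let F2 := gauge_flow T0 sg1 M0 solv vn nM.

Let gauged_boundE k w s : gauged_bound gamma T sg M k w s = A * Num.sqrt (qmass (gauged gamma T sg k w s)) + B.
Proof. by rewrite /gauged_bound /drive_coef; ring. Qed.

Let A0 : 0 <= A. Proof. by rewrite !mulr_ge0 ?invr_ge0 ?mulr_ge0 ?pi_ge0 ?sqrtr_ge0. Qed.
Let B0 : 0 <= B. Proof. by rewrite !mulr_ge0 ?exprn_ge0. Qed.
Let gh0 k w s : 0 <= gauged_bound gamma T sg M k w s.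
Proof. by rewrite gauged_boundE addr_ge0// mulr_ge0 ?sqrtr_ge0. Qed.
Let q0 s : 0 <= q s. Proof. by rewrite addr_ge0 ?qmass_ge0. Qed.
Let h10 s : 0 <= h1 s. Proof. by rewrite addr_ge0. Qed.
Let iq : rintegrable mu `[0, T] q. Proof. exact: (rintD (mseg 0 T) (flow_q F1) (flow_q F2)). Qed.
Let ih1 : rintegrable mu `[0, T] h1. Proof. exact: (rintD (mseg 0 T) (flow_h F1) (flow_h F2)). Qed.
Let msq : measurable_fun `[0, T] (fun s => Num.sqrt (q s)).
Proof.
apply: (@measurableT_comp _ _ _ _ _ _ (@Num.sqrt R)); last exact: rint_meas iq.
by apply: continuous_measurable_fun; exact: sqrt_continuous.
Qed.
Let isq : rintegrable mu `[0, T] (fun s => Num.sqrt (q s)).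
Proof.
apply: (@rint_le _ _ R mu _ (mseg 0 T) _ (fun s => 1 + q s)) => //.
  move=> s _; rewrite ger0_norm ?sqrtr_ge0//.
  have := sqr_sqrtr (q0 s); have := sqrtr_ge0 (q s); have := sqr_ge0 (Num.sqrt (q s) - 1); nra.
by apply: (rintD (mseg 0 T)) => //; exact: rint_cst_seg.
Qed.
Let ih : rintegrable mu `[0, T] h.
Proof. by apply: (rintD (mseg 0 T)) => //; exact: (rintD (mseg 0 T)). Qed.

Let F1' : flow T sg M h1 U (gauged_profile gamma sg m u) (gauged_dprofile gamma T sg m u).
Proof. by apply: (flow_weaken M0 (lexx _) _ ih1 F1) => s; rewrite lerDl. Qed.
Let F2' : flow T sg M h1 V (gauged_profile gamma sg n v) (gauged_dprofile gamma T sg n v).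
Proof. by apply: (flow_weaken M0 (lexx _) _ ih1 F2) => s; rewrite lerDr. Qed.
Let MM : M <= M + M. Proof. by rewrite lerDl. Qed.
Let h1h s : h1 s <= h s.
Proof. by rewrite /h -addrA lerDl addr_ge0// sqrtr_ge0. Qed.

Let nrm_h (f g : R -> R[i]) s : qi f -> qi g -> 2^-1 * (qmass f + qmass g) <= q s -> nrm (fun x => f x * g x) <= h s.
Proof.
move=> qf qg H; apply: (le_trans (nrm_le_sqrt qf qg H)); by rewrite /h lerDr addr_ge0.
Qed.

Lemma sqr_sum4_le (a b c d : R) : (a + b + c + d) ^+ 2 <= 4 * (a ^+ 2 + b ^+ 2 + c ^+ 2 + d ^+ 2).
Proof.
have := sqr_ge0 (a - b); have := sqr_ge0 (a - c); have := sqr_ge0 (a - d).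
have := sqr_ge0 (b - c); have := sqr_ge0 (b - d); have := sqr_ge0 (c - d); nra.
Qed.

Let hsq s : h s ^+ 2 <= (16 * A ^+ 2 + 4) * q s + 64 * B ^+ 2.
Proof.
have q1 := sqr_sqrtr (qmass_ge0 (U s)); have q2 := sqr_sqrtr (qmass_ge0 (V s)); have q3 := sqr_sqrtr (q0 s).
have := sqr_sum4_le (2 * A * Num.sqrt (qmass (U s))) (2 * A * Num.sqrt (qmass (V s))) (4 * B) (Num.sqrt (q s)).
rewrite (_ : 2 * A * Num.sqrt (qmass (U s)) + 2 * A * Num.sqrt (qmass (V s)) + 4 * B + Num.sqrt (q s) = h s); last first.
  by rewrite /h /h1 !gauged_boundE; ring.
move=> H; apply: (le_trans H); rewrite q3 !exprMn q1 q2 /q le_eqVlt; apply/orP; left; apply/eqP; ring.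
Qed.

Let ihB : rintegrable mu `[0, T] (fun s => (16 * A ^+ 2 + 4) * q s + 64 * B ^+ 2).
Proof. by apply: (rintD (mseg 0 T)); [exact: (rintZ (mseg 0 T))|exact: rint_cst_seg]. Qed.
Let ih2 : rintegrable mu `[0, T] (fun s => h s ^+ 2).
Proof.
apply: (@rint_le _ _ R mu _ (mseg 0 T) _ (fun s => (16 * A ^+ 2 + 4) * q s + 64 * B ^+ 2)) => //.
  by apply: measurable_funX; exact: rint_meas ih.
by move=> s _; rewrite ger0_norm ?sqr_ge0.
Qed.

Let q_le w k (chi : R -> R[i]) : nls_solution gamma chi w -> (forall t, mass (w t) = k) -> k <= 2 * pi * M ^+ 2 ->
  \int[mu]_(s in `[0, T]) qmass (gauged gamma T sg k w s) <= quartic_const gamma T M.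
Proof.
move=> sol wk kM; under eq_Rintegral do rewrite gauged_qmass.
by apply: (apriori_bound T0 sg1 M0 sol) => s _; rewrite wk.
Qed.

Lemma solution_pair : exists h, flow_pair gamma T sg (M + M) (pair_const gamma T M) h U V
  (gauged_profile gamma sg m u) (gauged_dprofile gamma T sg m u) (gauged_profile gamma sg n v) (gauged_dprofile gamma T sg n v).
Proof.
have qU s : qi (U s) := flow_qi F1 s.
have qV s : qi (V s) := flow_qi F2 s.
have p1 s := qmass_ge0 (U s); have p2 s := qmass_ge0 (V s).
exists h; split.
- exact: (flow_weaken M0 MM h1h ih F1').
- exact: (flow_weaken M0 MM h1h ih F2').
- apply: (flow_weaken _ (lexx _) _ ih (flow_sub T0 M0 F1' F2')); first by rewrite addr_ge0.
  by move=> s; rewrite /h lerDl sqrtr_ge0.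
- by [].
- by [].
- move=> s; apply: nrm_h => //; [exact: qi_conj|rewrite qmass_conj /q]; have := p1 s; have := p2 s; lra.
- move=> s; apply: nrm_h => //; [exact: qi_conj|rewrite qmass_conj /q]; have := p1 s; have := p2 s; lra.
- move=> s; apply: nrm_h => //; rewrite /q; have := p1 s; have := p2 s; lra.
- exact: ih2.
apply: (le_trans (le_Rintegral (mseg 0 T) ih2 ihB (fun s _ => hsq s))).
have i1 : rintegrable mu `[0, T] (fun s => (16 * A ^+ 2 + 4) * q s) by exact: (rintZ (mseg 0 T)).
rewrite (RintegralD (mseg 0 T) i1 (rint_cst_seg T _)) RintegralZl// Rint_cst_seg// /pair_const; apply: lerD => //.
apply: ler_wpM2l; first by apply: addr_ge0 => //; apply: mulr_ge0 => //; exact: sqr_ge0.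
rewrite (RintegralD (mseg 0 T) (flow_q F1) (flow_q F2)).
by apply: lerD; [exact: q_le solu um mM|exact: q_le solv vn nM].
Qed.

End SolutionPairs.

Section CoefficientStability.
Context {R : realType}.
Notation mu := (@lebesgue_measure R).
Notation fc := (@fourier_coef R).

(** Continuity adapted to weak convergence: finitely many coefficients of the data control finitely
    many coefficients at later times. The masses m and n may be far apart, as each solution is
    unwound at its own speed. *)
Lemma coef_stability (gamma T sg M e : R) (J : nat) : 0 <= T -> `|sg| = 1 -> 0 <= M -> 0 < e ->
  exists Q : nat, exists2 d : R, 0 < d & forall phi psi u v m n,
    nls_solution gamma phi u -> nls_solution gamma psi v ->
    (forall t, mass (u t) = m) -> (forall t, mass (v t) = n) -> m <= 2 * pi * M ^+ 2 -> n <= 2 * pi * M ^+ 2 ->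
    (forall k, (`|k| <= Q)%N -> cmod (fc (u 0) k - fc (v 0) k) <= d) ->
    forall j t, (`|j| <= J)%N -> 0 <= t <= T ->
      cmod (cis (gauge_speed gamma sg m * t) * fc (u (sg * t)) j - cis (gauge_speed gamma sg n * t) * fc (v (sg * t)) j) <= e.
Proof.
move=> T0 sg1 M0 e0.
have H0 : 0 <= pair_const gamma T M.
  rewrite /pair_const /quartic_const /drive_coef.
  by repeat (first [exact: kap_ge0 | exact: exprn_ge0 | exact: pi_ge0 | exact: normr_ge0 | exact: sqrtr_ge0 | assumption | exact: ler0n | exact: sqr_ge0 | rewrite invr_ge0 | apply: addr_ge0 | apply: mulr_ge0]).
have [Q [d d0 H]] := @flow_pair_small R gamma T sg (M + M) (pair_const gamma T M) e J T0 sg1 (addr_ge0 M0 M0) H0 e0.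
exists Q, d => // phi psi u v m n solu solv um vn mM nM start j t jJ tT.
have [h P] := solution_pair T0 sg1 M0 solu solv um vn mM nM.
have profile_diffE k s : cmod (profile_diff (gauged_profile gamma sg m u) (gauged_profile gamma sg n v) k s) =
    cmod (cis (gauge_speed gamma sg m * s) * fc (u (sg * s)) k - cis (gauge_speed gamma sg n * s) * fc (v (sg * s)) k).
  rewrite /profile_diff /gauged_profile /profile (_ : _ - _ = cis (sg * k%:~R ^+ 2 * s) * (cis (gauge_speed gamma sg m * s) * fc (u (sg * s)) k - cis (gauge_speed gamma sg n * s) * fc (v (sg * s)) k)); last by ring.
  by rewrite cmodM cmod_cis mul1r.
rewrite -profile_diffE; apply: (H _ _ _ _ _ _ _ P) => // k kQ.
by rewrite profile_diffE !mulr0 cis0 !mul1r; exact: start.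
Qed.

End CoefficientStability.

(** * Weak convergence *)

Section WeakConvergence.
Context {R : realType}.
Notation mu := (@lebesgue_measure R).
Notation D := (torus R).
Notation fc := (@fourier_coef R).
#[local] Hint Resolve mseg mtorus : core.

Lemma normc_cmod (z : R[i]) : `|z| = (cmod z)%:C.
Proof. by []. Qed.

Lemma cmod_lt_complex (z e : R[i]) : 0 < e -> (`|z| < e) = (cmod z < Re e).
Proof. by rewrite normc_cmod !ltcE /= => /andP[-> _]. Qed.

Lemma cvgC_cvg (u : nat -> R[i]) (z : R[i]) : cvgC u z -> (u : nat -> R[i]^o) @ \oo --> (z : R[i]^o).
Proof.
move=> uz; apply/cvgrPdist_lt => e e0.
have e1 : 0 < Re e by move: e0; rewrite ltcE => /andP[].
move/cvgrPdist_lt: uz => /(_ _ e1); apply: filterS => n.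
by rewrite sub0r normrN ger0_norm ?cmod_ge0// cmod_lt_complex// -cmodN opprB.
Qed.

Lemma cvg_cvgC (u : nat -> R[i]) (z : R[i]) : (u : nat -> R[i]^o) @ \oo --> (z : R[i]^o) -> cvgC u z.
Proof.
move=> uz; apply/cvgrPdist_lt => e e0.
have e1 : 0 < e%:C :> R[i] by rewrite ltcR.
move/cvgrPdist_lt: uz => /(_ _ e1); apply: filterS => n.
by rewrite cmod_lt_complex// sub0r normrN ger0_norm ?cmod_ge0// -cmodN opprB.
Qed.

Lemma L2inner_fc (f g : R -> R[i]) : L2inner f g = (2 * pi)%:C * fc (fun x => f x * conjc (g x)) 0.
Proof.
rewrite fc0E mulrA -RtoCM mulfV ?mul1r//; have := pi_gt0 R; lra.
Qed.

(** The mass bound makes the pairing with the Fourier tail of g small uniformly in n, which leaves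
    finitely many coefficients. *)
Lemma weak_of_coef (f_ : nat -> R -> R[i]) (f g : R -> R[i]) (C : R) : (forall n, sqi (f_ n)) -> sqi f -> sqi g ->
  (forall n, mass (f_ n) <= C ^+ 2) -> mass f <= C ^+ 2 -> 0 <= C -> (forall k, cvgC (fun n => fc (f_ n) k) (fc f k)) ->
  cvgC (fun n => L2inner (f_ n) g) (L2inner f g).
Proof.
move=> sf_ sf sg mC fC C0 H.
have nC v : mass v <= C ^+ 2 -> nrm v <= C.
  by move=> vC; rewrite -(ler_pXn2r (ltn0Sn 1)) ?nnegrE ?nrm_ge0// nrm_sqr.
rewrite L2inner_fc (_ : (fun n => L2inner _ _) = (fun n => (2 * pi)%:C * fc (fun x => f_ n x * conjc (g x)) 0)); last first.
  by apply/funext => n; rewrite L2inner_fc.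
apply: cvgCZ; apply/cvgrPdist_lt => e e0.
have p0 : 0 < (2 * pi)^-1 :> R by rewrite invr_gt0 mulr_gt0// pi_gt0.
pose c := (2 * pi)^-1 * C; have c0 : 0 <= c by rewrite mulr_ge0// ltW.
have T := tailn_cvg sg uniq_zwin zwin_incl.
have [N HN] : exists N, c * tailn g (zwin N) <= e / 4.
  move/cvgrPdist_le: (cvg0Z c T) => /(_ (e / 4)) [|N _ HN]; first by rewrite divr_gt0.
  exists N; have := HN N (leqnn N); rewrite sub0r normrN; apply: le_trans; exact: ler_norm.
have S : cvgC (fun n => \sum_(p <- zwin N) conjc (fc g p) * fc (f_ n) (p + 0)) (\sum_(p <- zwin N) conjc (fc g p) * fc f (p + 0)).
  by apply: cvgC_sum => k _; apply: cvgCZ; exact: H.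
move/cvgrPdist_lt: S => /(_ (e / 4)) S; have {}S := S ltac:(by rewrite divr_gt0).
apply: filterS S => n; rewrite !sub0r !normrN !ger0_norm ?cmod_ge0// => S.
have b v : sqi v -> mass v <= C ^+ 2 -> cmod (\sum_(p <- zwin N) conjc (fc g p) * fc v (p + 0) - fc (fun x => v x * conjc (g x)) 0) <= e / 4.
  move=> sv vC; apply: (le_trans (fc_mul_conj_tailn 0 (zwin N) sv sg)); apply: le_trans HN.
  by rewrite /c mulrA; apply: ler_wpM2r; [exact: nrm_ge0|rewrite ler_wpM2l ?(ltW p0)// nC].
have b1 := b _ (sf_ n) (mC n); have b2 := b _ sf fC.
set s1 := \sum_(p <- _) _ in S b1; set s2 := \sum_(p <- _) _ in S b2.
set x1 := fc _ 0 in b1 *; set x2 := fc _ 0 in b2 *.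
rewrite (_ : x1 - x2 = (s1 - s2) - (s1 - x1) + (s2 - x2)); last by ring.
apply: (le_lt_trans (cmodD _ _)); have := cmodB (s1 - s2) (s1 - x1); lra.
Qed.

Lemma L2torus_e (k : int) : L2torus (fun x : R => cis (k%:~R * x)).
Proof.
split.
- by move=> x; rewrite mulrDr cisD cis_int2pi mulr1.
- by apply: cmeas_cis; exact: meas_mulr.
have [_ i] := sqi_cis (k%:~R : R); have /integrableP[_] := i.
apply: le_lt_trans; rewrite le_eqVlt; apply/orP; left; apply/eqP; apply: eq_integral => x _.
by rewrite /= ger0_norm// exprn_ge0// cmod_ge0.
Qed.

Lemma weak_fc (f_ : nat -> R -> R[i]) (f : R -> R[i]) k : weak_cvg_L2 f_ f -> cvgC (fun n => fc (f_ n) k) (fc f k).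
Proof.
case=> s_ s /(_ _ (L2torus_e k)) /cvg_cvgC H.
have E (g : R -> R[i]) : fc g k = ((2 * pi)^-1)%:C * L2inner g (fun x => cis (k%:~R * x)).
  rewrite L2inner_fc mulrA -RtoCM mulVf ?mul1r; last by have := pi_gt0 R; lra.
  under [in RHS]eq_fun do rewrite -cisN -mulNr -intrN.
  by rewrite fc_mul_cis opprK add0r.
rewrite E (_ : (fun n => _) = (fun n => ((2 * pi)^-1)%:C * L2inner (f_ n) (fun x => cis (k%:~R * x)))); first exact: cvgCZ.
by apply/funext => n; exact: E.
Qed.

Lemma L2torus_mulc (c : R[i]) (f : R -> R[i]) : L2torus f -> L2torus (fun x => c * f x).
Proof.
move=> Lf; have [pf mf _] := Lf; have sf := sqiZ c (L2_sqi Lf); split.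
- by move=> x; rewrite pf.
- by apply: cmeasM => //; exact: cmeas_cst.
have [_ i] := sf; have /integrableP[_] := i.
apply: le_lt_trans; rewrite le_eqVlt; apply/orP; left; apply/eqP; apply: eq_integral => x _.
by rewrite /= ger0_norm// exprn_ge0// cmod_ge0.
Qed.

Lemma fc_eq_of_mass0 (f g : R -> R[i]) k : sqi f -> sqi g -> mass (fun x => f x - g x) = 0 -> fc f k = fc g k.
Proof.
move=> sf sg m0; apply/eqP; rewrite -subr_eq0; apply/eqP; apply: cmod0_eq0; rewrite -fcB//.
have s1 : sqi (fun=> 1 : R[i]) by apply: (@sqi_bdd _ _ 1) => [|x _]; [exact: cmeas_cst|rewrite -[1]/(1%:C) cmod_real normr1].
have := cmod_fc_le k (sqiB sf sg) s1; rewrite /nrm m0 sqrtr0 mul0r mulr0.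
under [fun x => _ * 1]eq_fun do rewrite mulr1.
by move=> H; apply/eqP; rewrite eq_le H cmod_ge0.
Qed.

Lemma weak_propagation (gamma alpha t : R) (f_ : nat -> R -> R[i]) (f : R -> R[i]) (un : nat -> R -> R -> R[i]) (u : R -> R -> R[i]) :
  weak_cvg_L2 f_ f -> (forall n, nls_solution gamma (f_ n) (un n)) -> nls_solution gamma f u ->
  (fun n => mass (f_ n)) @ \oo --> alpha ^+ 2 ->
  weak_cvg_L2 (fun n => un n t) (v_limit gamma alpha f u t).
Proof.
move=> W soln sol ma.
have [Lf_ Lf _] := W.
have Lun n s : L2torus (un n s) by have [_ [+ _] _ _ _] := soln n; exact.
have Lu s : L2torus (u s) by have [_ [+ _] _ _ _] := sol; exact.
have Lv : L2torus (v_limit gamma alpha f u t) by exact: L2torus_mulc.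
split=> // g Lg; apply: cvgC_cvg.
have mun n s : mass (un n s) = mass (f_ n) by exact: mass_conserved (L2_sqi (Lf_ n)) (soln n).
have mu_ s : mass (u s) = mass f by exact: mass_conserved (L2_sqi Lf) sol.
have mv : mass (v_limit gamma alpha f u t) = mass f.
  rewrite -(mu_ t) -!nrm_sqr; congr (_ ^+ 2).
  by rewrite (nrmZ _ (L2_sqi (Lu t))) cmod_cis mul1r.
have [C C0 [mC fC]] : exists2 C : R, 0 <= C & (forall n, mass (f_ n) <= C ^+ 2) /\ mass f <= C ^+ 2.
  have /cvg_seq_bounded/bounded_fun_has_ubound [B HB] : cvgn (fun n => mass (f_ n)) by apply/cvg_ex; exists (alpha ^+ 2).
  have B1 n : mass (f_ n) <= B by apply: HB; exists n.
  (* The summand 1 makes C <= C^2, so that C^2 dominates both bounds. *)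
  exists (1 + `|B| + mass f); first by rewrite addr_ge0 ?mass_ge0// addr_ge0.
  have := mass_ge0 f; have := normr_ge0 B; have := ler_norm B => b1 b2 b3.
  by split=> [n|]; [apply: (le_trans (B1 n))|]; nra.
apply: (weak_of_coef (C := C)) => //; try by [move=> n; exact: L2_sqi|exact: L2_sqi].
- by move=> n; rewrite mun.
- by rewrite mv.
move=> j.
pose sg : R := if 0 <= t then 1 else -1.
have sg1 : `|sg| = 1 by rewrite /sg; case: ifP => _; rewrite ?normrN normr1.
have sgt : sg * `|t| = t by rewrite /sg; case: ifP => [t0|/negbT]; [rewrite mul1r ger0_norm|rewrite -ltNge => t0; rewrite ltr0_norm// mulN1r opprK].
have C1 : C ^+ 2 <= 2 * pi * C ^+ 2.
  by rewrite ler_peMl ?sqr_ge0//; have := pi_ge2 R; lra.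
have fc0n n k : fc (un n 0) k = fc (f_ n) k.
  by apply: fc_eq_of_mass0; [exact: L2_sqi|exact: L2_sqi|have [_ _ _ + _] := soln n].
have fc0 k : fc (u 0) k = fc f k.
  by apply: fc_eq_of_mass0; [exact: L2_sqi|exact: L2_sqi|have [_ _ _ + _] := sol].
pose G n := gauge_speed gamma sg (mass (f_ n)) * `|t|; pose G0 := gauge_speed gamma sg (mass f) * `|t|.
have S : cvgC (fun n => cis (G n) * fc (un n t) j) (cis G0 * fc (u t) j).
  apply/cvgrPdist_le => e e0.
  (* [Q] and [d] do not depend on n; weak convergence makes the finitely many coefficients with |k|
     <= Q of the data [d]-close for large n. *)
  have [Q [d d0 HQ]] := @coef_stability R gamma `|t| sg C e `|j| (normr_ge0 t) sg1 C0 e0.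
  have near : \forall n \near \oo, forall k, k \in zwin Q -> cmod (fc (f_ n) k - fc f k) <= d.
    elim: (zwin Q) => [|k s IH]; first by near=> n.
    have /cvgrPdist_le/(_ _ d0) Hk := weak_fc k W.
    move: Hk IH; apply: filterS2 => n; rewrite sub0r normrN ger0_norm ?cmod_ge0// => Hk IH l.
    by rewrite inE => /orP[/eqP->|/IH].
  apply: filterS near => n Hn; rewrite sub0r normrN ger0_norm ?cmod_ge0//.
  have := HQ _ _ _ _ _ _ (soln n) sol (mun n) mu_ (le_trans (mC n) C1) (le_trans fC C1) _ j `|t| (leqnn _).
  rewrite sgt; apply; last by rewrite normr_ge0 lexx.
  by move=> k kQ; rewrite fc0n fc0; apply: Hn; rewrite mem_zwin.
(* Undoing the gauge: the rotation of [un n] tends to that of mass alpha^2, while [G0] is the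
   rotation for the mass of f; the discrepancy is the phase of [v_limit]. *)
have E : (fun n => - G n) @ \oo --> gamma / pi * alpha ^+ 2 * t.
  rewrite (_ : (fun n => - G n) = (fun n => gamma / pi * t * mass (f_ n))); last first.
    apply/funext => n; rewrite /G /gauge_speed -{2}sgt; ring.
  rewrite (_ : gamma / pi * alpha ^+ 2 * t = gamma / pi * t * alpha ^+ 2); last by ring.
  exact: cvgMr.
have cisG : cvgC (fun n => cis (- G n)) (cis (gamma / pi * alpha ^+ 2 * t)).
  set w := gamma / pi * alpha ^+ 2 * t.
  have c1 : (fun n => cos (- G n)) @ \oo --> cos w.
    by apply: continuous_cvg => //; exact: continuous_cos.
  have c2 : (fun n => sin (- G n)) @ \oo --> sin w.
    by apply: continuous_cvg => //; exact: continuous_sin.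
  apply: (cvgC_le (e := fun n => `|cos (- G n) - cos w| + `|sin (- G n) - sin w|)).
    by move=> n; rewrite (le_trans (cmod_le_ReIm _)).
  by apply: cvg0D; [move/cvgrPdist_le: c1|move/cvgrPdist_le: c2] => H; apply/cvgrPdist_le => e e0;
    move: (H e e0); apply: filterS => n; rewrite sub0r normrN normr_id distrC.
have cmul (a b : nat -> R[i]) (x y : R[i]) (K : R) : (forall n, cmod (b n) <= K) -> cvgC a x -> cvgC b y -> cvgC (fun n => a n * b n) (x * y).
  move=> bK ax bY; have K0 : 0 <= K := le_trans (cmod_ge0 _) (bK 0%N).
  apply: (cvgC_le (e := fun n => K * cmod (a n - x) + cmod x * cmod (b n - y))).
    move=> n; rewrite (_ : _ - _ = (a n - x) * b n + x * (b n - y)); last by ring.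
    apply: (le_trans (cmodD _ _)); rewrite !cmodM lerD2r mulrC ler_wpM2r ?cmod_ge0//.
  by apply: cvg0D; exact: cvg0Z.
have bK n : cmod (cis (G n) * fc (un n t) j) <= C.
  rewrite cmodM cmod_cis mul1r; apply: (cmod_fc_le_l2 C0).
  by apply: (l2b_fc (L2_sqi (Lun n t))); rewrite mun (le_trans (mC n)).
have := cmul _ _ _ _ _ bK cisG S.
rewrite (_ : (fun n => _) = (fun n => fc (un n t) j)); last first.
  by apply/funext => n; rewrite mulrA -cisD addNr cis0 mul1r.
rewrite [cis _ * (cis _ * _)]mulrA -cisD /v_limit (fcZ _ _ (L2_sqi (Lu t))).
rewrite (_ : G0 = - (gamma / pi * mass f * (sg * `|t|))); last by rewrite /G0 /gauge_speed; ring.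
by rewrite sgt (_ : gamma / pi * (alpha ^+ 2 - mass f) * t = gamma / pi * alpha ^+ 2 * t - gamma / pi * mass f * t); last by ring.
Unshelve. all: by end_near.
Qed.

End WeakConvergence.

(** * Boundedness of weakly convergent sequences *)

Section Hump.
Context {R : realType}.
Notation mu := (@lebesgue_measure R).
Notation D := (torus R).
#[local] Hint Resolve mseg mtorus : core.

(** With ratio 1/3 all the weights after the j-th add up to half of the j-th, so later humps cannot
    undo what the j-th has achieved. *)
Definition third (j : nat) : R := 3^-1 ^+ j.

Lemma third_gt0 j : 0 < third j. Proof. by rewrite /third exprn_gt0// invr_gt0. Qed.

Variable F : nat -> R -> R[i].
Hypothesis LF : forall j, L2torus (F j).
Hypothesis N0 : forall j, 0 < nrm (F j).

Let per j x : F j (x + 2 * pi) = F j x. Proof. by have [+ _ _] := LF j; exact. Qed.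
Let cmF j : cmeasurable (F j). Proof. by have [] := LF j. Qed.
Let sF j : sqi (F j). Proof. exact: L2_sqi. Qed.

Definition hump0 j (x : R) : R[i] := ((nrm (F j))^-1)%:C * F j x.
Definition majpart J (x : R) : R := \sum_(0 <= j < J) third j * cmod (hump0 j x).
(** The square of the majorant of the series of humps, as in the proof of the Riesz-Fischer theorem:
    its integrability yields both pointwise convergence and domination. *)
Definition majsq (x : R) : \bar R := ereal_sup (range (fun J => ((majpart J x) ^+ 2)%:E)).
Definition majset : set R := [set x | (majsq x < +oo)%E].
(* Equal to [hump0] almost everywhere on the torus, and such that the weighted sum of the humps converges everywhere. *)
Definition hump j (x : R) : R[i] := (\1_majset x)%:C * hump0 j x.
Definition maj (x : R) : R := Num.sqrt (fine (majsq x)).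

Let s0 j : sqi (hump0 j). Proof. exact: sqiZ. Qed.
Let n0 j : nrm (hump0 j) = 1.
Proof.
rewrite /hump0 (nrmZ _ (sF j)) cmod_real ger0_norm ?invr_ge0 ?nrm_ge0// mulVf//.
by rewrite gt_eqF// N0.
Qed.
Let cm0 j : cmeasurable (hump0 j). Proof.
change (cmeas_on setT (fun x => ((nrm (F j))^-1)%:C * F j x)).
by apply: cmeasM; [exact: cmeas_cst|exact: cmF].
Qed.
Let per0 j x : hump0 j (x + 2 * pi) = hump0 j x. Proof. by rewrite /hump0 per. Qed.

Lemma majpart_ge0 J x : 0 <= majpart J x.
Proof. by apply: sumr_ge0 => j _; rewrite mulr_ge0 ?cmod_ge0// ltW// third_gt0. Qed.

Lemma majpart_nd x : {homo majpart^~ x : n m / (n <= m)%N >-> n <= m}.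
Proof.
apply/nondecreasing_seqP => n.
by rewrite /majpart big_nat_recr//= lerDl mulr_ge0 ?cmod_ge0// ltW// third_gt0.
Qed.

Let sq_nd x : {homo (fun J => ((majpart J x) ^+ 2)%:E) : n m / (n <= m)%N >-> (n <= m)%E}.
Proof. by move=> n m nm; rewrite lee_fin ler_pXn2r ?nnegrE ?majpart_ge0// majpart_nd. Qed.

Lemma majsq_cvg x : (fun J => ((majpart J x) ^+ 2)%:E) @ \oo --> majsq x.
Proof. by apply: ereal_nondecreasing_cvgn; exact: sq_nd. Qed.

Lemma majsq_ge J x : (((majpart J x) ^+ 2)%:E <= majsq x)%E.
Proof. by apply: ereal_sup_ubound; exists J. Qed.

Lemma majsq_ge0 x : (0 <= majsq x)%E.
Proof. by apply: le_trans (majsq_ge 0 x); rewrite lee_fin sqr_ge0. Qed.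

Lemma majpart_meas J : measurable_fun setT (majpart J).
Proof.
rewrite /majpart; under eq_fun do rewrite big_mkord.
apply: measurable_sum => j; apply: measurable_funM; first exact: measurable_cst.
exact: meas_cmod (cm0 j).
Qed.

Lemma majsq_meas : measurable_fun setT majsq.
Proof.
apply: (@emeasurable_fun_cvg _ _ _ _ (fun J x => ((majpart J x) ^+ 2)%:E) majsq); last by move=> x _; exact: majsq_cvg.
by move=> J; apply/measurable_EFinP; apply: measurable_funX; exact: majpart_meas.
Qed.

Lemma majset_meas : measurable majset.
Proof.
by have := emeasurable_fun_infty_o measurableT majsq_meas +oo%E; rewrite setTI.
Qed.

Lemma maj_meas : measurable_fun setT maj.
Proof.
apply: (@measurableT_comp _ _ _ _ _ _ (@Num.sqrt R)).
  by apply: continuous_measurable_fun; exact: sqrt_continuous.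
by apply: measurableT_comp => //; exact: majsq_meas.
Qed.

Lemma majsq_per x : majsq (x + 2 * pi) = majsq x.
Proof.
have E J : majpart J (x + 2 * pi) = majpart J x by apply: eq_bigr => j _; rewrite per0.
by rewrite /majsq; under eq_fun do rewrite E.
Qed.

Lemma hump_per j x : hump j (x + 2 * pi) = hump j x.
Proof.
have E : (x + 2 * pi \in majset) = (x \in majset) by apply/idP/idP; rewrite !inE /majset /= majsq_per.
by rewrite /hump per0 !indicE E.
Qed.

Lemma hump_meas j : cmeasurable (hump j).
Proof.
change (cmeas_on setT (fun x => (\1_majset x)%:C * hump0 j x)).
by apply: cmeasM; [apply: cmeas_real; exact: measurable_indic majset_meas|exact: cm0].
Qed.

Lemma cmod_hump j x : cmod (hump j x) <= cmod (hump0 j x).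
Proof.
rewrite /hump cmodM cmod_real ger0_norm; last by rewrite indicE ler0n.
by rewrite ler_piMl ?cmod_ge0// indicE lern1 leq_b1.
Qed.

Lemma hump_sqi j : sqi (hump j).
Proof.
split; first exact: cmeas_onS (hump_meas j).
have [_ i] := s0 j; apply: (@rint_le _ _ R mu _ mtorus _ (fun x => cmod (hump0 j x) ^+ 2)) => //.
  by apply: meas_cmodX; exact: cmeas_onS (hump_meas j).
move=> x _; rewrite ger0_norm ?sqr_ge0// lerXn2r ?nnegrE ?cmod_ge0//; exact: cmod_hump.
Qed.

Lemma hump_nrm j : nrm (hump j) <= 1.
Proof.
rewrite -(n0 j) /nrm ler_wsqrtr// /mass; have [_ i] := s0 j; have [_ i'] := hump_sqi j.
by apply: le_Rintegral => // x _; rewrite lerXn2r ?nnegrE ?cmod_ge0//; exact: cmod_hump.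
Qed.

Lemma hump_sum_le J x : \sum_(0 <= j < J) third j * cmod (hump j x) <= maj x.
Proof.
have [xS|xS] := boolP (x \in majset); last first.
  rewrite big1 ?sqrtr_ge0// => j _; rewrite /hump indicE (negbTE xS).
  by rewrite cmodM cmod_real normr0 mul0r mulr0.
have f : majsq x \is a fin_num by rewrite ge0_fin_numE ?majsq_ge0//; move: xS; rewrite inE.
apply: (@le_trans _ _ (majpart J x)).
  by apply: ler_sum => j _; rewrite ler_wpM2l ?cmod_hump// ltW// third_gt0.
rewrite -(ler_pXn2r (ltn0Sn 1)) ?nnegrE ?majpart_ge0 ?sqrtr_ge0// sqr_sqrtr; last exact: fine_ge0 (majsq_ge0 x).
by rewrite -lee_fin fineK// majsq_ge.
Qed.

Let majC J x : R[i] := (majpart J x)%:C.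
Let majC_sqi J : sqi (majC J) /\ nrm (majC J) <= 3 / 2 * (1 - third J).
Proof.
elim: J => [|J [sI nI]].
  have E : majC 0 = (fun=> (0 : R)%:C) by apply/funext => x; rewrite /majC /majpart big_nil.
  have sE : sqi (majC 0) by rewrite E; apply: (@sqi_bdd _ _ 0) => [|x _]; [exact: cmeas_cst|rewrite cmod_real normr0].
  split=> //; rewrite E /third expr0 subrr mulr0 /nrm /mass.
  under eq_Rintegral do rewrite cmod_real normr0 expr0n.
  by rewrite Rintegral_cst// mul0r sqrtr0.
pose w x : R[i] := (third J)%:C * (cmod (hump0 J x))%:C.
have sc : sqi (fun x => (cmod (hump0 J x))%:C).
  have [m i] := s0 J; split; first by apply: cmeas_real; exact: meas_cmod.
  rewrite /rintegrable (_ : (fun x => _) = (fun x => cmod (hump0 J x) ^+ 2))//.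
  by apply/funext => x; rewrite cmod_real ger0_norm// cmod_ge0.
have nc : nrm (fun x => (cmod (hump0 J x))%:C : R[i]) = 1.
  rewrite -(n0 J) /nrm /mass; under eq_Rintegral do rewrite cmod_real ger0_norm ?cmod_ge0//.
  by [].
have E : majC J.+1 = (fun x => majC J x + w x).
  by apply/funext => x; rewrite /majC /majpart big_nat_recr//= RtoCD RtoCM.
have sw : sqi w by exact: sqiZ.
rewrite E; split; first exact: sqiD.
apply: (le_trans (nrmD sI sw)).
rewrite (nrmZ _ sc) nc mulr1 cmod_real ger0_norm ?(ltW (third_gt0 J))//.
apply: (le_trans (lerD nI (lexx _))); rewrite /third exprS le_eqVlt; by apply/orP; left; apply/eqP; field.
Qed.

(** Normalized humps with weights of sum 3/2 have partial sums of norm at most 3/2; monotone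
    convergence passes this to the limit. *)
Lemma majsq_int_le : (\int[mu]_(x in D) majsq x <= (9 / 4)%:E)%E.
Proof.
have mg J : measurable_fun D (fun x => ((majpart J x) ^+ 2)%:E).
  by apply/measurable_EFinP; apply: measurable_funX; apply: measurable_funTS; exact: majpart_meas.
have g0 J x : D x -> (0 <= ((majpart J x) ^+ 2)%:E)%E by move=> _; rewrite lee_fin sqr_ge0.
have nd x : D x -> {homo (fun J => ((majpart J x) ^+ 2)%:E) : n m / (n <= m)%N >-> (n <= m)%E} by move=> _; exact: sq_nd.
have C := cvg_monotone_convergence (mu := mu) mtorus mg g0 nd.
have E : (\int[mu]_(x in D) limn (fun J => ((majpart J x) ^+ 2)%:E) = \int[mu]_(x in D) majsq x)%E.
  by apply: eq_integral => x _; apply: cvg_lim => //; exact: majsq_cvg.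
rewrite E in C; rewrite -(cvg_lim _ C)//; apply: lime_le; first by apply/cvg_ex; eexists; exact: C.
apply: nearW => J; have [[m i] nC] := majC_sqi J.
have fi : (\int[mu]_(x in D) ((majpart J x) ^+ 2)%:E)%E = (mass (majC J))%:E.
  rewrite /mass /Rintegral fineK; last exact: integrable_fin_num i.
  by apply: eq_integral => x _; rewrite /majC cmod_real real_normK// num_real.
rewrite fi lee_fin -nrm_sqr (_ : 9 / 4 = (3 / 2) ^+ 2); last by field.
rewrite ler_pXn2r ?nnegrE ?nrm_ge0//; apply: (le_trans nC).
by have := third_gt0 J; lra.
Qed.

Lemma majsq_int : mu.-integrable D majsq.
Proof.
apply/integrableP; split; first by apply: measurable_funTS; exact: majsq_meas.
under eq_integral do rewrite gee0_abs ?majsq_ge0//.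
by apply: (le_lt_trans majsq_int_le); rewrite ltry.
Qed.

Lemma maj_int : rintegrable mu D (fun x => maj x ^+ 2).
Proof.
apply: (le_integrable _ _ _ majsq_int) => //.
  by apply/measurable_EFinP; apply: measurable_funX; apply: measurable_funTS; exact: maj_meas.
move=> x _ /=; rewrite /maj sqr_sqrtr ?fine_ge0 ?majsq_ge0// gee0_abs ?majsq_ge0//.
rewrite ger0_norm ?fine_ge0 ?majsq_ge0//; case: (majsq x) (majsq_ge0 x) => [a| |] //=.
Qed.

Lemma hump_ae j : {ae mu, forall x, 0 <= x <= 2 * pi -> hump j x = hump0 j x}.
Proof.
have := integrable_ae mtorus majsq_int; apply: filterS => x H Dx; rewrite /hump indicE (_ : x \in majset) ?mul1r//.
by rewrite inE /majset /= -ge0_fin_numE ?majsq_ge0//; apply: H; rewrite /torus /= in_itv.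
Qed.

Lemma L2inner_hump j : L2inner (F j) (hump j) = (nrm (F j))%:C.
Proof.
have E : L2inner (F j) (hump j) = L2inner (F j) (hump0 j).
  have m1 := cmeasM (sF j).1 (cmeasJ (hump_sqi j).1); have m2 := cmeasM (sF j).1 (cmeasJ (s0 j).1).
  apply: (@eq_ae_tint R (2 * pi)); [exact: m1|exact: m2|].
  apply: filterS (hump_ae j); first exact: (ae_filter_ringOfSetsType mu).
  by move=> x H xD; rewrite H.
rewrite E /L2inner /hump0.
under [X in Cintegral _ _ X]eq_fun do rewrite cJM.
rewrite (_ : (fun x => _) = (fun x => ((nrm (F j))^-1)%:C * (F j x * conjc (F j x)))); last first.
  by apply/funext => x; rewrite (_ : conjc ((nrm (F j))^-1)%:C = ((nrm (F j))^-1)%:C :> R[i]); [ring|rewrite /conjc/= oppr0].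
rewrite (CintZ mtorus); last exact: (sqi_int (sF j) (sqi_conj (sF j))).
rewrite mass_Cint// -RtoCM -nrm_sqr; congr (_%:C).
by rewrite expr2 mulKf// gt_eqF// N0.
Qed.

End Hump.

(** * The gliding hump *)

Section Gliding.
Context {R : realType}.
Notation mu := (@lebesgue_measure R).
Notation D := (torus R).
#[local] Hint Resolve mseg mtorus : core.

Lemma L2innerD (f g w : R -> R[i]) : sqi f -> sqi g -> sqi w ->
  L2inner f (fun x => g x + w x) = L2inner f g + L2inner f w.
Proof.
move=> sf sg sw; rewrite /L2inner -(CintD mtorus (sqi_int sf (sqi_conj sg)) (sqi_int sf (sqi_conj sw))).
by apply: eq_Cint => x _; rewrite cJD mulrDr.
Qed.

Lemma L2innerZ (c : R[i]) (f g : R -> R[i]) : sqi f -> sqi g ->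
  L2inner f (fun x => c * g x) = conjc c * L2inner f g.
Proof.
move=> sf sg; rewrite /L2inner -(CintZ mtorus _ (sqi_int sf (sqi_conj sg))).
by apply: eq_Cint => x _; rewrite cJM mulrCA.
Qed.

Lemma cmod_L2inner (f g : R -> R[i]) : sqi f -> sqi g -> cmod (L2inner f g) <= nrm f * nrm g.
Proof. by move=> sf sg; rewrite -(nrm_conj g); exact: (cmod_int_CS sf (sqi_conj sg)). Qed.

Variable F : nat -> R -> R[i].
Hypothesis LF : forall j, L2torus (F j).
Hypothesis N0 : forall j, 0 < nrm (F j).

Let sF j : sqi (F j). Proof. exact: L2_sqi. Qed.
Let sh j : sqi (hump F j). Proof. exact: hump_sqi. Qed.

(* Of the two signs for the next hump, at least one gives a pairing with [F K] as large as that of the hump alone. *)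
Fixpoint glide (J : nat) : R -> R[i] := if J is K.+1 then
    if third K * nrm (F K) <= cmod (L2inner (F K) (fun x => glide K x + (third K)%:C * hump F K x))
    then fun x => glide K x + (third K)%:C * hump F K x else fun x => glide K x + (- third K)%:C * hump F K x
  else fun=> 0.

Lemma glide_step J : exists2 e : R, `|e| = 1 & forall x, glide J.+1 x = glide J x + (e * third J)%:C * hump F J x.
Proof.
rewrite /=; case: ifP => _; first by exists 1; rewrite ?normr1// => x; rewrite mul1r.
by exists (-1); rewrite ?normrN ?normr1// => x; rewrite mulN1r.
Qed.

Lemma glide_sqi J : sqi (glide J).
Proof.
elim: J => [|J IH]; first by apply: (@sqi_bdd _ _ 0) => [|x _]; [exact: cmeas_cst|rewrite cmod0].
by have [e _ E] := glide_step J; rewrite (funext E); apply: sqiD => //; exact: sqiZ.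
Qed.

Lemma glide_meas J : cmeasurable (glide J).
Proof.
elim: J => [|J IH]; first exact: (cmeas_cst setT).
have [e _ E] := glide_step J; rewrite (funext E).
change (cmeas_on setT (fun x => glide J x + (e * third J)%:C * hump F J x)).
by apply: cmeasD; [exact: IH|apply: cmeasM; [exact: cmeas_cst|exact: hump_meas]].
Qed.

Lemma glide_per J x : glide J (x + 2 * pi) = glide J x.
Proof.
elim: J => [//|J IH]; have [e _ E] := glide_step J.
by rewrite !E IH hump_per.
Qed.

Lemma glide_diff J x : cmod (glide J.+1 x - glide J x) = third J * cmod (hump F J x).
Proof.
have [e e1 E] := glide_step J; rewrite E addrC addKr cmodM cmod_real normrM e1 mul1r.
by rewrite ger0_norm// ltW// third_gt0.
Qed.

Lemma glide_hump J : third J * nrm (F J) <= cmod (L2inner (F J) (glide J.+1)).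
Proof.
rewrite /=; case: ifP => [//|/negbT]; rewrite -ltNge.
have r0 := third_gt0 (R := R) J.
rewrite !L2innerD//; try exact: glide_sqi; try exact: sqiZ.
rewrite !L2innerZ// L2inner_hump//.
rewrite (_ : conjc ((- third J)%:C : R[i]) = - (third J)%:C); last by rewrite /conjc/= oppr0 -rmorphN.
rewrite (_ : conjc ((third J)%:C : R[i]) = (third J)%:C); last by rewrite /conjc/= oppr0.
set A := L2inner _ _; set B := (third J)%:C * _.
have BE : B = (third J * nrm (F J))%:C by rewrite /B -RtoCM.
have b0 : 0 <= third J * nrm (F J) by rewrite mulr_ge0 ?nrm_ge0// ltW.
have cB : cmod B = third J * nrm (F J) by rewrite BE cmod_real ger0_norm.
rewrite -cB mulNr -/B => lt.
(* Here A + B and A - B are the pairings for the two signs; they cannot both be smaller than B in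
   modulus. *)
have : cmod (B + B) <= cmod (A + B) + cmod (A - B).
  by rewrite (_ : B + B = (A + B) - (A - B)); [exact: cmodB|ring].
rewrite [B + B](_ : _ = (third J * nrm (F J) + third J * nrm (F J))%:C); last by rewrite BE -RtoCD.
by rewrite cmod_real ger0_norm ?addr_ge0// -cB; lra.
Qed.

Lemma glide_tail (f : R -> R[i]) J n : sqi f ->
  cmod (L2inner f (glide (J + n)) - L2inner f (glide J)) <= nrm f * (3 / 2 * (third J - third (J + n))).
Proof.
move=> sf; elim: n => [|n IH]; first by rewrite addn0 !subrr cmod0 mulr0 mulr0.
rewrite addnS; set K := (J + n)%N in IH *.
have [e e1 E] := glide_step K.
have r0 := third_gt0 (R := R) K.
rewrite (funext E) L2innerD//; [|exact: glide_sqi|exact: sqiZ].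
rewrite addrAC; apply: (le_trans (cmodD _ _)); apply: (le_trans (lerD IH (lexx _))).
have : cmod (L2inner f (fun x => (e * third K)%:C * hump F K x)) <= nrm f * third K.
  apply: (le_trans (cmod_L2inner sf (sqiZ _ (sh K)))); rewrite ler_wpM2l ?nrm_ge0// (nrmZ _ (sh K)) cmod_real normrM e1 mul1r.
  by rewrite ger0_norm ?(ltW r0)// ler_piMr ?(ltW r0)// hump_nrm.
move=> H; apply: (le_trans (lerD (lexx _) H)).
by rewrite -mulrDr ler_wpM2l ?nrm_ge0// /third exprS; lra.
Qed.

Lemma glide_le_maj J x : cmod (glide J x) <= maj F x.
Proof.
apply: le_trans (hump_sum_le F J x).
elim: J => [|J IH]; first by rewrite big_nil cmod0.
rewrite big_nat_recr//= -/(glide J.+1) -(subrK (glide J x) (glide J.+1 x)) addrC.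
by apply: (le_trans (cmodD _ _)); apply: lerD => //; rewrite glide_diff.
Qed.

Let part_cvg (p : R[i] -> R) x : (forall z w, p (z - w) = p z - p w) -> (forall z, `|p z| <= cmod z) ->
  cvgn (fun J => p (glide J x)).
Proof.
move=> pB pc; pose u k := p (glide k.+1 x) - p (glide k x).
have E J : p (glide J x) = series u J + p (glide 0 x).
  elim: J => [|J IH]; first by rewrite /series /= big_nil add0r.
  by rewrite seriesS /u [_ + series _ _]addrC addrAC -IH; ring.
rewrite (funext E); apply: is_cvgD; last exact: is_cvg_cst.
apply: normed_cvg.
apply: (@series_le_cvg _ _ (fun k => third k * cmod (hump F k x))).
- by move=> n; exact: normr_ge0.
- by move=> n; rewrite mulr_ge0 ?cmod_ge0// ltW// third_gt0.
- move=> n; change (`|p (glide n.+1 x) - p (glide n x)| <= third n * cmod (hump F n x)).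
  by rewrite -pB -glide_diff; exact: pc.
apply: nondecreasing_is_cvgn.
  by apply: nondecreasing_series => n _ _; rewrite mulr_ge0 ?cmod_ge0// ltW// third_gt0.
exists (maj F x) => _ [J _ <-]; exact: hump_sum_le.
Qed.

(** The limit exists at every x, since the humps are cut off where the majorant is infinite; exact
    periodicity and measurability are inherited from the partial sums. *)
Definition glide_lim (x : R) : R[i] := limn (fun J => Re (glide J x)) +i* limn (fun J => Im (glide J x)).

Let cRe x : (fun J => Re (glide J x)) @ \oo --> Re (glide_lim x).
Proof. by apply: part_cvg => [z w|z]; [rewrite cReD cReN|exact: Re_le_cmod]. Qed.
Let cIm x : (fun J => Im (glide J x)) @ \oo --> Im (glide_lim x).
Proof. by apply: part_cvg => [z w|z]; [rewrite cImD cImN|exact: Im_le_cmod]. Qed.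

Lemma glide_cvg x : cvgC (fun J => glide J x) (glide_lim x).
Proof.
apply: (cvgC_le (e := fun n => `|Re (glide n x) - Re (glide_lim x)| + `|Im (glide n x) - Im (glide_lim x)|)).
  by move=> n; rewrite (le_trans (cmod_le_ReIm _))// cReD cReN cImD cImN.
by apply: cvg0D; [have := @cRe x|have := @cIm x] => /cvgrPdist_le H; apply/cvgrPdist_le => e e0;
  move: (H e e0); apply: filterS => n; rewrite sub0r normrN normr_id distrC.
Qed.

Lemma glide_lim_le x : cmod (glide_lim x) <= maj F x.
Proof. by apply: (cvgC_bound (glide_cvg x)) => n; exact: glide_le_maj. Qed.

Lemma glide_lim_meas : cmeasurable glide_lim.
Proof.
split.
  by apply: (@measurable_fun_cvg _ _ _ _ (fun J x => Re (glide J x))) => [m|x _]; [have [] := glide_meas m|exact: cRe].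
by apply: (@measurable_fun_cvg _ _ _ _ (fun J x => Im (glide J x))) => [m|x _]; [have [] := glide_meas m|exact: cIm].
Qed.

Lemma glide_lim_sqi : sqi glide_lim.
Proof.
split; first exact: cmeas_onS glide_lim_meas.
apply: (@rint_le _ _ R mu _ mtorus _ (fun x => maj F x ^+ 2)); last exact: maj_int.
  by apply: meas_cmodX; exact: cmeas_onS glide_lim_meas.
move=> x _; rewrite ger0_norm ?sqr_ge0// lerXn2r ?nnegrE ?cmod_ge0 ?sqrtr_ge0//; exact: glide_lim_le.
Qed.

Lemma glide_lim_L2 : L2torus glide_lim.
Proof.
split; [|exact: glide_lim_meas|].
  by move=> x; rewrite /glide_lim; under eq_fun do rewrite glide_per; under [in X in _ +i* X]eq_fun do rewrite glide_per.
have [_ i] := glide_lim_sqi; have /integrableP[_] := i.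
apply: le_lt_trans; rewrite le_eqVlt; apply/orP; left; apply/eqP; apply: eq_integral => x _.
by rewrite /= ger0_norm// exprn_ge0// cmod_ge0.
Qed.

(** Dominated convergence with majorant 2 |f| [maj F], a product of two square integrable
    functions. *)
Lemma glide_inner_cvg (f : R -> R[i]) : sqi f -> cvgC (fun J => L2inner f (glide J)) (L2inner f glide_lim).
Proof.
move=> sf; have sg := glide_lim_sqi.
apply: (cvgC_le (e := fun J => \int[mu]_(x in `[0, 2 * pi]) (cmod (f x) * cmod (glide J x - glide_lim x)))).
  move=> J; have sd := sqiB (glide_sqi J) sg.
  rewrite /L2inner -(CintB mtorus (sqi_int sf (sqi_conj (glide_sqi J))) (sqi_int sf (sqi_conj sg))).
  rewrite (_ : (fun x => _) = (fun x => f x * conjc (glide J x - glide_lim x))); last first.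
    by apply/funext => x; rewrite cJB mulrBr.
  apply: (le_trans (cmod_Cint_le mtorus (sqi_int sf (sqi_conj sd)))).
  by under eq_Rintegral do rewrite cmodM cmod_conj.
have mm : measurable_fun D (maj F) by apply: measurable_funTS; exact: maj_meas.
have [i _] := Rint_CS mtorus (meas_cmod sf.1) mm (fun=> cmod_ge0 _) (fun=> sqrtr_ge0 _) sf.2 (maj_int LF N0).
apply: (@Rint_dct R 0 (2 * pi) _ (fun x => 2 * (cmod (f x) * maj F x))).
- by move=> J; apply: measurable_funM; [exact: meas_cmod sf.1|exact: meas_cmod (sqiB (glide_sqi J) sg).1].
- exact: (rintZ mtorus).
- move=> J x _; rewrite ger0_norm ?mulr_ge0 ?cmod_ge0// mulrCA ler_wpM2l ?cmod_ge0//.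
  apply: (le_trans (cmodB _ _)); rewrite (_ : 2 * maj F x = maj F x + maj F x); last by ring.
  by apply: lerD; [exact: glide_le_maj|exact: glide_lim_le].
- by apply: aeW => x _; apply: cvg0Z; exact: glide_cvg.
Qed.

(** After step j the pairing is at least [third j] times the norm of [F j]; the later humps change
    it by at most half of that. *)
Lemma glide_lim_big j : 2^-1 * (third j * nrm (F j)) <= cmod (L2inner (F j) glide_lim).
Proof.
have n0 := nrm_ge0 (F j); have r0 := third_gt0 (R := R) j.
have C := cvgC_shift j.+1 (glide_inner_cvg (sF j)).
have S := cvgCB (cvgC_cst (L2inner (F j) (glide j.+1))) C.
have : cmod (L2inner (F j) (glide j.+1) - L2inner (F j) glide_lim) <= 2^-1 * (third j * nrm (F j)).
  apply: (cvgC_bound S) => n; rewrite -cmodN opprB; apply: (le_trans (glide_tail _ _ (sF j))).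
  have t0 := third_gt0 (R := R) (j.+1 + n).
  rewrite (_ : third j = 3 * third j.+1); last by rewrite /third exprS mulrA mulfV ?mul1r.
  apply: (@le_trans _ _ (nrm (F j) * (3 / 2 * third j.+1))); first by rewrite ler_wpM2l//; lra.
  by rewrite le_eqVlt; apply/orP; left; apply/eqP; field.
have := glide_hump j.
have := cmodD (L2inner (F j) (glide j.+1) - L2inner (F j) glide_lim) (L2inner (F j) glide_lim).
rewrite subrK; lra.
Qed.

End Gliding.

Section UniformBoundedness.
Context {R : realType}.

Lemma weak_cvg_bounded (f_ : nat -> R -> R[i]) (f : R -> R[i]) : weak_cvg_L2 f_ f -> exists C : R, forall n, mass (f_ n) <= C.
Proof.
move=> [L_ L W]; apply: contrapT => /forallNP H.
(* Norms growing like 9^j against the weights 3^(-j) leave pairings of size at least 3^j / 2 with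
   the single function [glide_lim], whereas weak convergence keeps all pairings with it bounded. *)
have big j : exists n, 9 ^+ j <= nrm (f_ n).
  have /existsNP[n Hn] := H ((9 ^+ j) ^+ 2); exists n.
  rewrite -(ler_pXn2r (ltn0Sn 1)) ?nnegrE ?nrm_ge0 ?exprn_ge0// nrm_sqr ltW//.
  by rewrite ltNge; apply/negP.
have [s Hs] := choice big.
pose F j := f_ (s j).
have N0 j : 0 < nrm (F j) by apply: lt_le_trans (Hs j); rewrite exprn_gt0.
have LF j : L2torus (F j) := L_ (s j).
have /cvg_cvgC C := W _ (glide_lim_L2 LF N0).
have /cvg_seq_bounded/bounded_fun_has_ubound [B HB] : cvgn (fun n => cmod (L2inner (f_ n) (glide_lim F) - L2inner f (glide_lim F))).
  by apply/cvg_ex; exists 0.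
pose B1 := B + cmod (L2inner f (glide_lim F)).
have key j : 2^-1 * 3 ^+ j <= B1.
  have b1 : cmod (L2inner (F j) (glide_lim F)) <= B1.
    rewrite -(subrK (L2inner f (glide_lim F)) (L2inner (F j) _)); apply: (le_trans (cmodD _ _)); rewrite lerD2r.
    by apply: HB; exists (s j).
  apply: le_trans b1; apply: le_trans (glide_lim_big LF N0 j); rewrite ler_wpM2l//.
  apply: le_trans (ler_wpM2l (ltW (third_gt0 j)) (Hs j)).
  by rewrite /third -exprMn (_ : 3^-1 * 9 = 3 :> R)//; field.
clearbody B1; have B0 : 0 <= 2 * B1 by have := key 0%N; rewrite expr0; lra.
have := key (Num.bound (2 * B1)); have := archi_boundP B0.
have : forall n, n%:R <= 3 ^+ n :> R.
  elim=> [|n IH]; first by rewrite expr0.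
  rewrite exprS -natr1; have : 1 <= 3 ^+ n :> R by rewrite exprn_ege1// ler1n.
  lra.
move=> /(_ (Num.bound (2 * B1))); move: (Num.bound _)%:R (3 ^+ Num.bound _) => p q h1 h2 h3.
by clear -h1 h2 h3; lra.
Qed.

End UniformBoundedness.

(** * Adherence values *)

Section Adherence.
Context {R : realType}.
Notation mu := (@lebesgue_measure R).
Notation D := (torus R).
#[local] Hint Resolve mseg mtorus : core.

Lemma adherence_of_frequent (a : nat -> R) (l : R) :
  (forall e, 0 < e -> forall N, exists2 n, (N <= n)%N & `|a n - l| < e) -> adherence_value a l.
Proof.
move=> H; have H' (p : nat * nat) : exists n, (p.1 < n)%N /\ `|a n - l| < (p.2.+1%:R)^-1.
  have [|n Nn an] := H (p.2.+1%:R)^-1 _ p.1.+1; first by rewrite invr_gt0.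
  by exists n.
have [f fP] := choice H'.
pose nk := fix nk k := if k is k'.+1 then f (nk k', k) else f (0%N, 0%N).
have nkP k : `|a (nk k) - l| < (k.+1%:R)^-1 by case: k => [|k]; [exact: (fP (0, 0)%N).2|exact: (fP (nk k, k.+1)).2].
exists nk; split.
  by apply/increasing_seqP => k; exact: (fP (nk k, k.+1)).1.
apply/cvgrPdist_lt => e e0.
have e1 : 0 <= e^-1 by rewrite invr_ge0 ltW.
exists (Num.bound e^-1) => // k /= Hk; rewrite distrC; apply: (lt_le_trans (nkP k)).
rewrite -[leRHS]invrK lef_pV2 ?posrE ?invr_gt0// ltW//; apply: (lt_le_trans (archi_boundP e1)).
by rewrite ler_nat ltnW.
Qed.

Lemma adherence_opp (a : nat -> R) (l : R) : adherence_value (fun n => - a n) l -> adherence_value a (- l).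
Proof. by move=> [nk [ink H]]; exists nk; split=> //; rewrite (_ : (fun k => a (nk k)) = (fun k => - (- a (nk k)))); [exact: cvgN|apply/funext => k; rewrite opprK]. Qed.

(** The value found is the upper limit, realized as the supremum of the numbers that the sequence
    reaches or exceeds infinitely often. *)
Lemma adherence_above (a : nat -> R) (C m e : R) : (forall n, a n <= C) -> 0 < e ->
  (forall N, exists2 n, (N <= n)%N & m + e <= a n) -> exists2 l, adherence_value a l & m < l.
Proof.
move=> aC e0 H.
pose S : set R := [set x | forall N, exists2 n, (N <= n)%N & x <= a n].
have Se : S (m + e) by [].
have hS : has_sup S.
  split; first by exists (m + e).
  by exists C => x /(_ 0%N) [n _ xa]; exact: le_trans xa (aC n).
exists (sup S); last by apply: (lt_le_trans (y := m + e)); [rewrite ltrDl|exact: (ub_le_sup hS.2 Se)].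
apply: adherence_of_frequent => d d0 N.
have [x Sx xd] := sup_adherent d0 hS.
have nS : ~ S (sup S + d / 2).
  move=> /(ub_le_sup hS.2); rewrite leNgt ltrDl divr_gt0//.
have /existsNP[N1 H1] := nS.
have [n Hn xn] := Sx (maxn N N1).
exists n; first by apply: leq_trans Hn; exact: leq_maxl.
have N1n : (N1 <= n)%N by apply: leq_trans Hn; exact: leq_maxr.
have an : a n < sup S + d / 2.
  by rewrite ltNge; apply/negP => an; apply: H1; exists n.
by rewrite ltr_norml; apply/andP; split; lra.
Qed.

(** The sequence stays e away from m infinitely often; if this does not happen infinitely often
    above m, it does below, and the opposite sequence is used. *)
Lemma adherence_ne (a : nat -> R) (C m : R) : (forall n, `|a n| <= C) -> ~ (a @ \oo --> m) ->
  exists l, adherence_value a l /\ l <> m.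
Proof.
move=> aC nc.
have [e e0 He] : exists2 e : R, 0 < e & forall N, exists2 n, (N <= n)%N & e <= `|a n - m|.
  apply: contrapT => H; apply: nc; apply/cvgrPdist_lt => e e0.
  apply: contrapT => H'; apply: H; exists e => // N; apply: contrapT => H2; apply: H'.
  exists N => // n /= Nn; rewrite distrC ltNge; apply/negP => ean; apply: H2; by exists n.
have [Hp|Hn] := pselect (forall N, exists2 n, (N <= n)%N & m + e <= a n).
  have [|l al ml] := adherence_above (C := C) _ e0 Hp; first by move=> n; apply: le_trans (aC n); exact: ler_norm.
  by exists l; split=> //; apply/eqP; rewrite gt_eqF.
have [||l al ml] := @adherence_above (fun n => - a n) C (- m) e _ e0.
- by move=> n; apply: le_trans (aC n); rewrite -normrN; exact: ler_norm.
- move/existsNP : Hn => [N1 H1] N; have [n Hn He'] := He (maxn N N1).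
  exists n; first by apply: leq_trans Hn; exact: leq_maxl.
  have nl : ~~ (m + e <= a n).
    by apply/negP => H; apply: H1; exists n => //; apply: leq_trans Hn; exact: leq_maxr.
  move: nl; rewrite -ltNge => nl; move: He'; rewrite ler_normr => /orP[]; lra.
exists (- l); split; first exact: adherence_opp.
by apply/eqP; rewrite lt_eqF// ltrNl.
Qed.

Lemma mass_sub (f g : R -> R[i]) : sqi f -> sqi g ->
  mass (fun x => f x - g x) = mass f + mass g - 2 * Re (L2inner f g).
Proof.
move=> sf sg; have sd := sqiB sf sg.
have iff := sqi_int sf (sqi_conj sf); have igg := sqi_int sg (sqi_conj sg).
have ifg := sqi_int sf (sqi_conj sg); have igf := cintJ mtorus ifg.
have E : (mass (fun x => f x - g x))%:C = (mass f)%:C + (mass g)%:C - (L2inner f g + conjc (L2inner f g)).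
  rewrite -(mass_Cint sd) -(mass_Cint sf) -(mass_Cint sg) /L2inner -(CintJ mtorus ifg).
  rewrite -(CintD mtorus ifg igf) -(CintD mtorus iff igg) -(CintB mtorus (cintD mtorus iff igg) (cintD mtorus ifg igf)).
  by apply: eq_Cint => x _; rewrite cJM cJB conjcK; ring.
move: E; case: (L2inner f g) => p q /(congr1 (@complex.Re R)) /= ->; ring.
Qed.

(** The Radon-Riesz property: in the expanded square of the distance, the cross term converges by
    weak convergence tested against the limit itself. *)
Lemma strong_of_weak_mass (f_ : nat -> R -> R[i]) (f : R -> R[i]) : weak_cvg_L2 f_ f ->
  (fun n => mass (f_ n)) @ \oo --> mass f -> strong_cvg_L2 f_ f.
Proof.
move=> [L_ L W] H; split=> //.
have C := cvg_cvgC (W f L).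
have RC : (fun n => Re (L2inner (f_ n) f)) @ \oo --> mass f.
  have := cvgC_Re C; rewrite (_ : Re (L2inner f f) = mass f)//.
  by rewrite /L2inner (mass_Cint (L2_sqi L)).
rewrite (_ : (fun n => _) = (fun n => mass (f_ n) + mass f - 2 * Re (L2inner (f_ n) f))); last first.
  by apply/funext => n; rewrite mass_sub//; exact: L2_sqi.
rewrite (_ : 0 = mass f + mass f - 2 * mass f); last by ring.
apply: cvgB; last exact: cvgMr.
by apply: cvgD => //; exact: cvg_cst.
Qed.

End Adherence.

Theorem theorem1p1 (R : realType) (gamma : R) (gamma_neq0 : gamma <> 0)
    (u0n : nat -> R -> R[i]) (u0 : R -> R[i])
    (u0n_L2 : forall n, L2torus (u0n n)) (u0_L2 : L2torus u0)
    (u0n_weak : weak_cvg_L2 u0n u0) (u0n_not_strong : ~ strong_cvg_L2 u0n u0)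
    (un : nat -> R -> R -> R[i]) (u : R -> R -> R[i])
    (un_sol : forall n, nls_solution gamma (u0n n) (un n))
    (u_sol : nls_solution gamma u0 u) :
  (exists l : R,
     adherence_value (fun n => mass (u0n n)) l /\ l <> mass u0) /\
  (forall alpha : R,
     adherence_value (fun n => mass (u0n n)) (alpha ^+ 2) ->
     forall nk : nat -> nat, increasing_seq nk ->
       (fun k => mass (u0n (nk k))) @ \oo --> alpha ^+ 2 ->
       forall t : R,
         weak_cvg_L2 (fun k => un (nk k) t) (v_limit gamma alpha u0 u t)).
Proof.
split.
  have [C HC] := weak_cvg_bounded u0n_weak.
  apply: (@adherence_ne _ _ C) => [n|H]; first by rewrite ger0_norm ?mass_ge0.
  by apply: u0n_not_strong; exact: strong_of_weak_mass.
move=> alpha _ nk ink ma t.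
have [L_ L W] := u0n_weak.
have nkoo : nk @ \oo --> \oo.
  apply/cvgnyPge => N; exists N => // k /= Nk; apply: (leq_trans Nk).
  elim: {Nk} k => [//|k IH]; apply: (leq_ltn_trans IH).
  by move/increasing_seqP : ink => /(_ k); rewrite ltEnat.
have Wn : weak_cvg_L2 (fun k => u0n (nk k)) u0.
  by split=> // g Lg; exact: (cvg_comp _ _ nkoo (W g Lg)).
exact: (weak_propagation t Wn (fun n => un_sol (nk n)) u_sol ma).
Qed.
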